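(* Let $n\ge 3$ be odd, with prime factorization $n=\prod_{j=1}^r p_j^{e_j}$, $q_j=p_j^{e_j}$. Then a basis of $\mathbf{Was}^{+}(\mathbb{Q}(\zeta_n))$ is given by: (i) the elements $|\xi_{q_j,a}|$ with $j\in\{1,\dots,r\}$ and $1\le a<\varphi(q_j)/2$; (ii) the elements $|1-\zeta_n^{\sigma_1}|\,|x|$, where $\Omega\subset\{1,\dots,r\}$ with $|\Omega|\ge2$ and $x\in B_\Omega$.
   Context: For $m\ge1$, $\zeta_m=\exp(2i\pi/m)$; $|\cdot|$ is the complex absolute value; $\varphi$ is Euler's function. For an abelian number field $\mathbb{L}$ of conductor $m$ (least $m$ with $\mathbb{L}\subset\mathbb{Q}(\zeta_m)$): $\mathbf{E}(\mathbb{L})$ is its unit group, $\mathbf{Z}(\mathbb{L})$ its roots of unity, $\mathcal{C}_m$ the subgroup of $\mathbb{Q}(\zeta_m)^\times$ generated by the roots of unity of $\mathbb{Q}(\zeta_m)$ and all Galois conjugates of $1-\zeta_d$ ($d\mid m$, $d>1$), and $\mathbf{Was}(\mathbb{L})=\mathbf{E}(\mathbb{L})\cap\mathcal{C}_m$; $\mathbf{Was}^{+}(\mathbb{L})$ is the subgroup of $\mathbf{Was}(\mathbb{L})$ fixed by complex conjugation. A ''basis'' of a group $W$ of units containing roots of unity $Z$ means a family whose images in $W/Z$ (here $Z=\mathbf{Z}^{+}=\{\pm1\}$) form a $\mathbb{Z}$-basis of this free abelian group. Galois conventions: $\sigma_j$ is a fixed generator of the cyclic group $\mathrm{Gal}(\mathbb{Q}(\zeta_{q_j})/\mathbb{Q})$,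 viewed in $\mathrm{Gal}(\mathbb{Q}(\zeta_n)/\mathbb{Q})$ as acting trivially on $\mathbb{Q}(\zeta_{n/q_j})$; Galois elements act on units multiplicatively, and $\zeta^{\sigma}$ means $\sigma(\zeta)$. For $a\in\mathbb{Z}$, let $c$ be an integer with $\sigma_j^a(\zeta_{q_j})=\zeta_{q_j}^c$ and $\xi_{q_j,a}=\zeta_{q_j}^{(1-c)/2}\frac{1-\zeta_{q_j}^{c}}{1-\zeta_{q_j}}$, the exponent $(1-c)/2$ being taken modulo $q_j$ ($2$ invertible mod $q_j$); this is a real unit of $\mathbb{Q}(\zeta_{q_j})$. Gold–Kim sets $B_\Omega$: for $\Omega\subset\{1,\dots,r\}$ put $n_\Omega=\prod_{j\in\Omega}q_j$, $\zeta_\Omega=\zeta_{n_\Omega}$. For $\Omega=\{j\}$, $B_\Omega=\{\xi_{q_j,a}:1\le a<\varphi(q_j)/2\}$. For $\Omega=\{i_1<\dots<i_s\}$ with $s\ge2$ and $1\le k\le s$, let $X_\Omega^k$ be the set of $(a_1,\dots,a_s)\in\mathbb{N}^s$ with $1\le a_j<\varphi(q_{i_j})$ for $j<k$, $1\le a_k<\varphi(q_{i_k})/2$, and $a_j=0$ for $j>k$; let $X_\Omega^0=\{(0,\dots,0)\}$. Put $B_\Omega^k=\{(\prod_{j=1}^s\sigma_{i_j}^{a_j})(1-\zeta_\Omega):(a_1,\dots,a_s)\in X_\Omega^k\}$ and $B_\Omega=\bigcup_{k=0}^sB_\Omega^k$ if $|\Omega|$ is even, $B_\Omega=\bigcup_{k=1}^sB_\Omega^k$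 if $|\Omega|$ is odd. (The union of all $B_\Omega$ is Gold and Kim's basis of $\mathbf{Was}(\mathbb{Q}(\zeta_n))$.) Here $1-\zeta_n^{\sigma_1}$ means $\sigma_1(1-\zeta_n)$.
   Formalization: When n has at least two prime factors the primes are labelled so that q_1 ≠ 3; with q_1 = 3 the claim fails, e.g. for n = 15, q_1 = 3, q_2 = 5, where |1-ζ_15^{σ_1}||1-ζ_15| lies in the group generated by -1 and |ξ_{5,1}|. *)

(* Defs.v *)
From mathcomp Require Import all_boot all_order all_algebra.
From mathcomp Require Import complex.
From mathcomp Require Import all_classical all_reals all_analysis.

Set Implicit Arguments.
Unset Strict Implicit.
Unset Printing Implicit Defensive.

Import Order.TTheory GRing.Theory Num.Theory.
Local Open Scope classical_set_scope.
Local Open Scope ring_scope.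

(* Number fields are subsets of the complex numbers R[i], and `|x| is the
   complex absolute value seen inside R[i]. *)

(* exp(2 i pi / m) *)
Definition zeta (R : realType) (m : nat) : R[i] :=
  (cos (2 * pi / m%:R) +i* sin (2 * pi / m%:R))%C.

(* Q(zeta_m), the smallest subfield of R[i] containing zeta_m. *)
Definition cyclotomic_field (R : realType) (m : nat) : set R[i] :=
  [set x | forall K : {pred R[i]},
     GRing.divring_closed K -> zeta R m \in K -> x \in K].
Arguments cyclotomic_field : clear implicits.

(* s restricts to an element of Gal(K / Q); its values outside K are
   irrelevant. *)
Definition is_field_aut (R : realType) (K : set R[i]) (s : R[i] -> R[i]) :=
  [/\ set_bij K K s,
      s 1 = 1,
      (forall x y, K x -> K y -> s (x + y) = s x + s y)
    & (forall x y, K x -> K y -> s (x * y) = s x * s y)].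

(* s restricts to a generator of Gal(K / Q), a finite group: powers with
   exponents in nat suffice. *)
Definition generates_gal (R : realType) (K : set R[i]) (s : R[i] -> R[i]) :=
  is_field_aut K s /\
  forall t, is_field_aut K t ->
    exists k, forall x, K x -> t x = iter k s x.

Definition is_conductor (R : realType) (L : set R[i]) (m : nat) :=
  [/\ (0 < m)%N, L `<=` cyclotomic_field R m
    & forall k, (0 < k)%N -> L `<=` cyclotomic_field R k -> (m <= k)%N].

(* Since 0^-1 = 0, the condition x != 0 is not redundant. *)
Definition unit_group (R : realType) (L : set R[i]) : set R[i] :=
  [set x | [/\ L x, x != 0, integralOver (intr : int -> R[i]) x
             & integralOver (intr : int -> R[i]) x^-1]].

Definition roots_of_unity (R : realType) (L : set R[i]) : set R[i] :=
  [set x | L x /\ exists2 k, (0 < k)%N & x ^+ k = 1].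

Definition gen_mulgroup (R : realType) (S : set R[i]) : set R[i] :=
  [set x | forall H : {pred R[i]},
     GRing.divr_closed H -> (forall y, S y -> y \in H) -> x \in H].

Definition circular_numbers (R : realType) (m : nat) : set R[i] :=
  gen_mulgroup (roots_of_unity (cyclotomic_field R m) `|`
    [set x | exists d s, [/\ (d %| m)%N, (1 < d)%N,
               is_field_aut (cyclotomic_field R m) s
             & x = s (1 - zeta R d)]]).
Arguments circular_numbers : clear implicits.

Definition Was (R : realType) (L : set R[i]) : set R[i] :=
  [set x | unit_group L x /\
           exists2 m, is_conductor L m & circular_numbers R m x].

Definition Was_plus (R : realType) (L : set R[i]) : set R[i] :=
  [set x | Was L x /\ x^*%C = x].

(* The images in W / Z of the b i, for i in D, form a Z-basis of W / Z. *)
Definition is_basis_mod (R : realType) (W Z : set R[i]) (I : choiceType)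
    (D : set I) (b : I -> R[i]) :=
  [/\ (forall i, D i -> W (b i)),
      (forall w, W w -> exists (s : seq I) (k : I -> int) (z : R[i]),
         [/\ uniq s, (forall i, i \in s -> D i), Z z
           & w = z * \prod_(i <- s) b i ^ k i])
    & (forall (s : seq I) (k : I -> int),
         uniq s -> (forall i, i \in s -> D i) ->
         Z (\prod_(i <- s) b i ^ k i) -> forall i, i \in s -> k i = 0)].

(* xi_(q, a), where c is an integer such that sigma^a maps zeta_q to zeta_q^c;
   for odd q, (q + 1) / 2 is the inverse of 2 modulo q. *)
Definition xi (R : realType) (q : nat) (c : int) : R[i] :=
  zeta R q ^ ((1 - c) * (q.+1)./2%:Z) * ((1 - zeta R q ^ c) / (1 - zeta R q)).

Section GoldKim.
Variables (R : realType) (r : nat) (q : 'I_r -> nat).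
Variable sigma : 'I_r -> R[i] -> R[i].
Implicit Type Omega : {set 'I_r}.

Definition n_of Omega : nat := (\prod_(j in Omega) q j)%N.

(* Writing Omega = {i_1 < ... < i_s}, the index i_(j+1) is @enum_val _ Omega j
   for j : 'I_s (positions are numbered from 0). *)
Definition X_Omega Omega (k : nat) : set {ffun 'I_#|Omega| -> nat} :=
  [set a | forall j : 'I_#|Omega|,
     [/\ (j.+1 < k)%N -> (1 <= a j < totient (q (enum_val j)))%N,
         j.+1 = k -> (1 <= a j < (totient (q (enum_val j)))./2)%N
       & (k < j.+1)%N -> a j = 0%N]].

Definition gal_word Omega (a : {ffun 'I_#|Omega| -> nat}) : R[i] -> R[i] :=
  \big[(fun f g => f \o g)/id]_(j < #|Omega|)
     iter (a j) (sigma (enum_val j)).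

(* The Gold-Kim set B_Omega, for #|Omega| >= 2. *)
Definition B_Omega Omega : set R[i] :=
  [set x | exists k (a : {ffun 'I_#|Omega| -> nat}),
     [/\ (k <= #|Omega|)%N, odd #|Omega| -> (0 < k)%N, X_Omega k a
       & x = gal_word a (1 - zeta R (n_of Omega))]].

End GoldKim.

(* Indices (j, a) of the family (i) and (Omega, x) of the family (ii). *)
Definition basis_index (R : realType) (r : nat) : Type :=
  ('I_r * nat + {set 'I_r} * R[i])%type.

Definition basis_dom (R : realType) (r : nat) (q : 'I_r -> nat)
    (sigma : 'I_r -> R[i] -> R[i]) : set (basis_index R r) :=
  [set i : basis_index R r | match i with
           | inl (j, a) => (1 <= a < (totient (q j))./2)%N : Prop
           | inr (Omega, x) => (2 <= #|Omega|)%N /\ B_Omega q sigma Omega x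
           end].
Arguments basis_dom : clear implicits.

(* Main.v *)
(* The map x |-> ln |x| embeds Was+ modulo {1, -1} into the real numbers, so it
   suffices to study the numbers g(a) = ln |1 - zeta_n^a|, for a in Z/n.  They
   are even in a and satisfy the norm relations.

   Generation.  Modulo the span of the Gold-Kim words, the norm relations move
   every exponent vector into the required range when |Omega| is even.  When
   |Omega| is odd one needs in addition an Ennola relation, which is half of a
   consequence of the norm relations: restrict a cycle of the Koszul complex of
   the norm relations to a half system modulo {1, -1}.  A parity count shows that
   its coefficients do not vanish.

   Independence.  There are at most phi(n)/2 - 1 words, so the matrix
   (g(u w) - g(w)), indexed by words w and by units u <> 1 modulo {1, -1}, is
   injective as soon as it has no kernel on the side of the units.  By generation,
   a kernel vector gives a combination of the translates of g vanishing on all of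
   Z/n - {0}; decomposing it under the group of units produces an even nontrivial
   Dirichlet character chi with L(1, chi) = 0.

   Absolute values.  |1 - zeta_n^a| is i times an element of Q(zeta_n), up to
   sign, and i is not in Q(zeta_n), so a real unit involves an even number of the
   words of (ii).  Since q_1 <> 3, sigma_1(1 - zeta_n) is itself one of these
   words, and multiplying all of them by its absolute value spans exactly the
   products with an even number of factors. *)
Require Import Defs.
From mathcomp Require Import all_boot all_order all_algebra.
From mathcomp Require Import cyclic cyclotomic algC algnum.
From mathcomp Require Import complex ring lra zify.
From mathcomp Require Import all_classical all_reals all_analysis.
Set Implicit Arguments.
Unset Strict Implicit.
Unset Printing Implicit Defensive.
Import Order.TTheory GRing.Theory Num.Theory.
Local Open Scope classical_set_scope.
Local Open Scope ring_scope.

(** The combinatorial part is proved for an arbitrary even function [g] on Z/n that satisfies the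
    distribution relations, with values in a group without 2-torsion and modulo a subgroup [L]. It
    is used twice: for g = [lz] and L the span of the words it is the generation; for g a
    combination of the unit translates of [lz] and L = 0 it carries the vanishing on the words over
    to all of Z/n. Two obstacles shape the rest. The numbers 1 - zeta_(q_j) are not units, only the
    quotients of their conjugates are; a unit involves them trivially because the logarithms of the
    p_j are independent modulo logarithms of units. And a relation between real absolute values is
    not visibly stable under Galois; squaring repairs this, since |1 - zeta_n^a|^2 lies in
    Q(zeta_n). The analysis uses finite sums with explicit errors: L(1, chi) = 0 is expressed by a
    bound C / K on the K-th partial sum of chi k / k, and no L-function is formed as a limit. *)

Section ComplexModulus.
Variable R : realType.
Implicit Types x y : R[i].

(** The modulus [|x|] is an element of [R[i]]; [modc x] is the same number in [R], where the order
    is total and [ln] is available. *)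
Definition modc x : R := complex.Re `|x|.

Lemma modcE x : `|x| = ((modc x)%:C)%C.
Proof. by rewrite /modc normc_def. Qed.

Lemma modcM x y : modc (x * y) = modc x * modc y.
Proof. by apply: complexI; rewrite rmorphM /= -!modcE normrM. Qed.

Lemma modc_ge0 x : 0 <= modc x.
Proof. by rewrite -lecR -modcE normr_ge0. Qed.

Lemma modcN x : modc (- x) = modc x.
Proof. by rewrite /modc normrN. Qed.

Lemma modcD x y : modc (x + y) <= modc x + modc y.
Proof. by rewrite -lecR rmorphD /= -!modcE ler_normD. Qed.

Lemma modcBD x y : modc (x - y) <= modc x + modc y.
Proof. by rewrite -[modc y]modcN modcD. Qed.

Lemma modc_sum (I : Type) (r : seq I) (P : pred I) (F : I -> R[i]) :
  modc (\sum_(i <- r | P i) F i) <= \sum_(i <- r | P i) modc (F i).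
Proof.
rewrite -lecR rmorph_sum /= -modcE.
by apply: (le_trans (ler_norm_sum _ _ _)); apply: ler_sum => i _; rewrite modcE.
Qed.

Lemma modc_prod (I : Type) (r : seq I) (P : pred I) (F : I -> R[i]) :
  modc (\prod_(i <- r | P i) F i) = \prod_(i <- r | P i) modc (F i).
Proof.
apply: complexI; rewrite rmorph_prod /= -modcE normr_prod.
by apply: eq_bigr => i _; rewrite modcE.
Qed.

Lemma modcX x k : modc (x ^+ k) = modc x ^+ k.
Proof. by apply: complexI; rewrite rmorphXn /= -!modcE normrX. Qed.

Lemma modcV x : modc x^-1 = (modc x)^-1.
Proof. by apply: complexI; rewrite fmorphV /= -!modcE normfV. Qed.

Lemma modcXz x (k : int) : modc (x ^ k) = modc x ^ k.
Proof. by case: k => k; rewrite ?NegzE -?exprnN -?exprnP ?modcV ?modcX. Qed.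

Lemma modc0 : modc 0 = 0 :> R.
Proof. by rewrite /modc normr0. Qed.

Lemma modc1 : modc 1 = 1 :> R.
Proof. by rewrite /modc normr1. Qed.

Lemma modc_eq0 x : (modc x == 0) = (x == 0).
Proof.
by rewrite -[LHS](inj_eq (@complexI R)) /= -modcE normr_eq0.
Qed.

Lemma modc_gt0 x : (0 < modc x) = (x != 0).
Proof. by rewrite lt_def modc_ge0 andbT modc_eq0. Qed.

Lemma modc_real (r : R) : modc (r%:C)%C = `|r|.
Proof.
by rewrite /modc normc_def /= expr0n /= addr0 sqrtr_sqr.
Qed.

Lemma modcJ x : modc (x^*)%C = modc x.
Proof. by rewrite /modc normcJ. Qed.

Lemma modc_sqr x : modc x ^+ 2 = complex.Re x ^+ 2 + complex.Im x ^+ 2.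
Proof. by rewrite /modc normc_def /= sqr_sqrtr // addr_ge0 ?sqr_ge0. Qed.

Lemma mulcJ x : x * (x^*)%C = ((modc x ^+ 2)%:C)%C.
Proof. by rewrite rmorphXn /= -modcE sqr_normc. Qed.

Lemma abel_bound (c : nat -> R[i]) (b : nat -> R) (M : R) (m K : nat) :
  (forall k, modc (\sum_(0 <= i < k) c i) <= M) ->
  (forall k, (m <= k)%N -> b k.+1 <= b k) -> (forall k, 0 <= b k) ->
  modc (\sum_(m <= k < K) c k * ((b k)%:C)%C) <= 2 * M * b m.
Proof.
move=> hM hb hb0; have M0 : 0 <= M by apply: le_trans (hM 0%N); apply: modc_ge0.
pose C k := \sum_(0 <= i < k) c i.
have [Km|mK] := leqP K m.
  by rewrite big_geq // modc0 !mulr_ge0.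
have abel j : \sum_(m <= k < m + j) c k * ((b k)%:C)%C =
  C (m + j)%N * ((b (m + j)%N)%:C)%C - C m * ((b m)%:C)%C
   + \sum_(m <= k < m + j) C k.+1 * ((b k - b k.+1)%:C)%C.
  elim: j => [|j IH]; first by rewrite addn0 !big_geq // addr0 subrr.
  rewrite addnS !big_nat_recr ?leq_addr //= IH /C big_nat_recr //= rmorphB /=.
  by ring.
have -> : K = (m + (K - m))%N by rewrite subnKC // ltnW.
set j := (K - m)%N; rewrite abel.
apply: le_trans (modcD _ _) _.
have sumb : \sum_(m <= k < m + j) (b k - b k.+1) = b m - b (m + j)%N.
  rewrite -[RHS]opprB -telescope_sumr ?leq_addr // -sumrN.
  by apply: eq_bigr => i _; rewrite opprB.
have h1 : modc (\sum_(m <= k < m + j) C k.+1 * ((b k - b k.+1)%:C)%C)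
   <= M * (b m - b (m + j)%N).
  apply: (le_trans (modc_sum _ _ _)); rewrite -sumb mulr_sumr.
  apply: ler_sum_nat => i /andP[mi _]; rewrite modcM modc_real.
  rewrite ger0_norm ?subr_ge0 ?hb //; apply: ler_wpM2r; first by rewrite subr_ge0 hb.
  exact: hM.
have h2 : modc (C (m + j)%N * ((b (m + j)%N)%:C)%C - C m * ((b m)%:C)%C)
   <= M * b (m + j)%N + M * b m.
  apply: (le_trans (modcBD _ _)); rewrite !modcM !modc_real !ger0_norm //.
  by apply: lerD; apply: ler_wpM2r => //; exact: hM.
by apply: le_trans (lerD h2 h1) _; lra.
Qed.

End ComplexModulus.

Lemma sum_residues_mul (V : nmodType) (n b : nat) (F : nat -> V) :
  (0 < n)%N -> coprime b n -> (forall a, F (a %% n)%N = F a) ->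
  \sum_(0 <= k < n) F (b * k)%N = \sum_(0 <= k < n) F k.
Proof.
move=> n0 co Fmod; rewrite !big_mkord.
have f_lt (k : 'I_n) : (b * k %% n < n)%N by rewrite ltn_mod.
pose f k : 'I_n := Ordinal (f_lt k).
rewrite [RHS](reindex_inj (h := f)) /=.
  by apply: eq_bigr => k _; rewrite Fmod.
move=> k l /(congr1 val) /= /eqP.
have [lekl|/ltnW lekl] := leqP l k.
  rewrite eqn_mod_dvd ?leq_mul2l ?lekl ?orbT // -mulnBr Gauss_dvdr 1?coprime_sym //.
  move=> d; apply/val_inj/eqP => /=; rewrite eqn_leq lekl andbT -subn_eq0.
  rewrite -leqn0 leqNgt; apply/negP => h; have := dvdn_leq h d.
  by rewrite leqNgt (leq_ltn_trans (leq_subr _ _)).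
rewrite eq_sym eqn_mod_dvd ?leq_mul2l ?lekl ?orbT // -mulnBr Gauss_dvdr 1?coprime_sym //.
move=> d; apply/val_inj/eqP => /=; rewrite eqn_leq lekl /= -subn_eq0.
rewrite -leqn0 leqNgt; apply/negP => h; have := dvdn_leq h d.
by rewrite leqNgt (leq_ltn_trans (leq_subr _ _)).
Qed.

(** * Non-vanishing of L(1, chi) *)

Record dirichlet (R : realType) (n : nat) (chi : nat -> R[i]) : Prop := Dirichlet {
  dir_n : (0 < n)%N;
  dir1 : chi 1%N = 1;
  dirM : forall a b, chi (a * b)%N = chi a * chi b;
  dirP : forall a, chi (a + n)%N = chi a;
  dir0 : forall a, ~~ coprime a n -> chi a = 0 }.

Section Characters.
Variables (R : realType) (n : nat) (chi : nat -> R[i]).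
Hypothesis Dchi : dirichlet n chi.
Let n0 := dir_n Dchi.

Lemma dirMn a k : chi (a + k * n)%N = chi a.
Proof.
elim: k => [|k IH]; first by rewrite addn0.
by rewrite mulSnr addnA (dirP Dchi) IH.
Qed.

Lemma dir_mod a : chi (a %% n)%N = chi a.
Proof. by rewrite {2}(divn_eq a n) addnC dirMn. Qed.

Lemma dirX a k : chi (a ^ k)%N = chi a ^+ k.
Proof.
elim: k => [|k IH]; first exact: (dir1 Dchi).
by rewrite expnS (dirM Dchi) IH exprS.
Qed.

Lemma dir_totient a : coprime a n -> chi a ^+ totient n = 1.
Proof.
move=> co; rewrite -dirX -dir_mod (Euler_exp_totient co) dir_mod.
exact: (dir1 Dchi).
Qed.

Lemma dir_modc a : coprime a n -> modc (chi a) = 1.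
Proof.
move=> co; have h := dir_totient co.
have t0 : (0 < totient n)%N by rewrite totient_gt0.
by apply/eqP; rewrite -(pexpr_eq1 t0) ?modc_ge0 // -modcX h modc1.
Qed.

Lemma dir_modc_le1 a : modc (chi a) <= 1.
Proof.
case: (boolP (coprime a n)) => co; first by rewrite dir_modc.
by rewrite (dir0 Dchi co) modc0.
Qed.

Hypothesis nontriv : exists2 b, coprime b n & chi b != 1.

Lemma dir_sum0 : \sum_(0 <= k < n) chi k = 0.
Proof.
have [b cob chib] := nontriv.
have := sum_residues_mul n0 cob dir_mod; under eq_bigr do rewrite (dirM Dchi).
rewrite -mulr_sumr => /eqP; rewrite -subr_eq0 -{2}[\sum_(_ <= _ < _) _]mul1r -mulrBl.
by rewrite mulf_eq0 subr_eq0 (negPf chib) => /eqP.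
Qed.

Lemma dir_partial_sum K : modc (\sum_(0 <= k < K) chi k) <= n%:R.
Proof.
rewrite (divn_eq K n); elim: (K %/ n)%N => [|j IH].
  rewrite mul0n add0n; apply: le_trans (modc_sum _ _ _) _.
  apply: (@le_trans _ _ (\sum_(0 <= i < K %% n) 1)).
    by apply: ler_sum => i _; apply: dir_modc_le1.
  by rewrite sumr_const_nat subn0 ler_nat ltnW // ltn_mod.
apply: le_trans IH; rewrite mulSn -addnA (big_cat_nat (leq0n n)) ?leq_addr //=.
rewrite dir_sum0 add0r -{1}[n]add0n big_addn addKn.
by under eq_bigr do rewrite (dirP Dchi).
Qed.

Lemma dir_abel (b : nat -> R) m K :
  (forall k, (m <= k)%N -> b k.+1 <= b k) -> (forall k, 0 <= b k) ->
  modc (\sum_(m <= k < K) chi k * ((b k)%:C)%C) <= 2 * n%:R * b m.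
Proof. by move=> h1 h2; apply: abel_bound => // k; exact: dir_partial_sum. Qed.

End Characters.

(** * The weights of a Dirichlet series at 1 + eps *)

Section Weights.
Variables (R : realType) (eps : R).
Hypothesis eps0 : 0 < eps.

(** [pe k] is k^(-eps) and [wt k] is k^(-(1 + eps)) for k > 0; at 0 the conventions for [ln] and
    inverses give [pe 0 = 1] and [wt 0 = 0]. *)
Definition pe (k : nat) : R := expR (- (eps * ln k%:R)).
Definition wt (k : nat) : R := pe k / k%:R.

Lemma pe_gt0 k : 0 < pe k. Proof. exact: expR_gt0. Qed.

Lemma pe1 : pe 1 = 1. Proof. by rewrite /pe ln1 mulr0 oppr0 expR0. Qed.

Lemma peM a b : (0 < a)%N -> (0 < b)%N -> pe (a * b) = pe a * pe b.
Proof.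
move=> a0 b0; rewrite /pe natrM lnM ?posrE ?ltr0n //.
by rewrite mulrDr opprD expRD.
Qed.

Lemma pe_le1 k : pe k <= 1.
Proof.
rewrite /pe -[leRHS]expR0 ler_expR oppr_le0 mulr_ge0 ?(ltW eps0) //.
case: k => [|k]; first by rewrite ln0.
by apply: ln_ge0; rewrite ler1n.
Qed.

Lemma wt_ge0 k : 0 <= wt k.
Proof. by rewrite mulr_ge0 ?invr_ge0 // ltW ?pe_gt0. Qed.

Lemma wt1 : wt 1 = 1. Proof. by rewrite /wt pe1 divr1. Qed.

Lemma wtM a b : (0 < a)%N -> (0 < b)%N -> wt (a * b) = wt a * wt b.
Proof. by move=> a0 b0; rewrite /wt peM // natrM invfM mulrACA. Qed.

Lemma wt_le k : wt k <= (k%:R)^-1.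
Proof. by rewrite /wt ler_piMl ?invr_ge0 ?pe_le1. Qed.

Lemma pe_decr k : (0 < k)%N -> pe k.+1 <= pe k.
Proof.
move=> k0; rewrite /pe ler_expR lerN2 ler_wpM2l ?(ltW eps0) //.
rewrite ler_ln ?posrE ?ltr0n //.
by rewrite ler_nat.
Qed.

Lemma wt_decr k : (0 < k)%N -> wt k.+1 <= wt k.
Proof.
move=> k0; rewrite /wt; apply: ler_pM; rewrite ?invr_ge0 ?pe_decr ?(ltW (pe_gt0 _)) //.
by rewrite lef_pV2 ?posrE ?ltr0n // ler_nat.
Qed.

(** This replaces the comparison of the sum of k^(-1-eps) with an integral: it follows from ln (1 +
    1/k) >= 1/(k+1) and from exp x >= 1 + x. *)
Lemma wt_telescope k : (0 < k)%N -> eps * wt k.+1 <= pe k - pe k.+1.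
Proof.
move=> k0; have k1 : (0 : R) < k.+1%:R by rewrite ltr0n.
have kR : (0 : R) < k%:R by rewrite ltr0n.
have -> : pe k = pe k.+1 * expR (eps * (ln k.+1%:R - ln k%:R)).
  by rewrite /pe -expRD; congr expR; ring.
have h : (k.+1%:R)^-1 <= ln k.+1%:R - ln k%:R :> R.
  rewrite -opprB -ln_div ?posrE // lerNr.
  have -> : k%:R / k.+1%:R = 1 + - (k.+1%:R)^-1 :> R.
    by rewrite -natr1; field; rewrite natr1 pnatr_eq0.
  apply: le_ln1Dx; rewrite ltrN2 invf_lt1 // ltr1n.
  by rewrite ltnS.
have := expR_ge1Dx (eps * (ln k.+1%:R - ln k%:R)) => h2.
rewrite -[X in _ <= _ - X]mulr1 -mulrBr /wt mulrCA.
apply: ler_wpM2l; first by rewrite ltW ?pe_gt0.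
have h3 := ler_wpM2l (ltW eps0) h.
set x := expR _ in h2 *; set y := eps * (_ - _) in h2 h3.
set u := eps / _ in h3 *; clearbody x y u; lra.
Qed.

Lemma pe_diff k : (0 < k)%N -> pe k - pe k.+1 <= eps / k%:R.
Proof.
move=> k0; have k1 : (0 : R) < k.+1%:R by rewrite ltr0n.
have kR : (0 : R) < k%:R by rewrite ltr0n.
have -> : pe k.+1 = pe k * expR (- (eps * (ln k.+1%:R - ln k%:R))).
  by rewrite /pe -expRD; congr expR; ring.
have h : ln k.+1%:R - ln k%:R <= (k%:R)^-1 :> R.
  rewrite -ln_div ?posrE //.
  have -> : k.+1%:R / k%:R = 1 + (k%:R)^-1 :> R.
    by rewrite -natr1; field; rewrite gt_eqF.
  by apply: le_ln1Dx; rewrite (@lt_trans _ _ 0) ?ltrN10 ?invr_gt0.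
have := expR_ge1Dx (- (eps * (ln k.+1%:R - ln k%:R))) => h2.
rewrite -[X in X - _]mulr1 -mulrBr.
have h3 : 1 - expR (- (eps * (ln k.+1%:R - ln k%:R))) <= eps / k%:R.
  have h3 := ler_wpM2l (ltW eps0) h.
  set x := expR _ in h2 *; set y := eps * (_ - _) in h2 h3.
  set u := eps / _ in h3 *; clearbody x y u; lra.
have [h4|h4] := leP 0 (1 - expR (- (eps * (ln k.+1%:R - ln k%:R)))).
  by apply: le_trans h3; rewrite ler_piMl ?pe_le1.
apply: (@le_trans _ _ 0); first by rewrite nmulr_lle0 // ltW ?pe_gt0.
by rewrite divr_ge0 ?ltW.
Qed.

Lemma wt_tail a b : (0 < a)%N -> \sum_(a.+1 <= k < b) wt k <= pe a / eps.
Proof.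
move=> a0; rewrite ler_pdivlMr // mulrC mulr_sumr.
have [ba|ab] := leqP b a.+1; first by rewrite big_geq // ltW ?pe_gt0.
apply: (@le_trans _ _ (\sum_(a.+1 <= k < b) (pe k.-1 - pe k))).
  apply: ler_sum_nat => -[|k] /andP[ak _] //.
  by apply: wt_telescope; rewrite (leq_trans a0).
have -> : \sum_(a.+1 <= k < b) (pe k.-1 - pe k) = pe a - pe b.-1.
  have [m bm] : exists m, b = m.+1 by exists b.-1; rewrite prednK // (leq_trans _ ab).
  rewrite bm big_add1 /= -[RHS]opprB -telescope_sumr; last by rewrite -ltnS -bm ltnW.
  by rewrite -sumrN; apply: eq_bigr => i _; rewrite opprB.
by rewrite gerBl ltW ?pe_gt0.
Qed.

Lemma wt_sum K : \sum_(1 <= k < K) wt k <= 1 + eps^-1.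
Proof.
have e0 : 0 <= eps^-1 by rewrite invr_ge0 ltW.
case: K => [|[|K]]; first by rewrite big_geq ?addr_ge0.
  by rewrite big_geq ?addr_ge0.
rewrite big_ltn // wt1 lerD2l; apply: le_trans (wt_tail _ _) _ => //.
by rewrite pe1 div1r.
Qed.

Lemma wt_tail_small (d : R) : 0 < d -> exists2 M, (0 < M)%N &
  forall a b, (M <= a)%N -> \sum_(a.+1 <= k < b) wt k <= d.
Proof.
(* [L] is the value of [ln a] at which the tail bound [pe a / eps] equals [d]. *)
move=> d0; pose L := - ln (d * eps) / eps; pose M := (Num.bound (expR L)).
have HM : expR L < M%:R by apply: archi_boundP; rewrite expR_ge0.
have M0 : (0 < M)%N by rewrite -(ltr0n R) (lt_trans _ HM) ?expR_gt0.
exists M => // a b Ma; have a0 : (0 < a)%N by rewrite (leq_trans M0).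
apply: le_trans (wt_tail _ a0) _; rewrite ler_pdivrMr //.
have de0 : 0 < d * eps by rewrite mulr_gt0.
rewrite -[leRHS]lnK ?posrE // /pe ler_expR.
have : L <= ln a%:R.
  rewrite -[L]expRK ler_ln ?posrE ?expR_gt0 ?ltr0n //.
  by apply: ltW; apply: lt_le_trans HM _; rewrite ler_nat.
rewrite /L ler_pdivrMr // mulrC; lra.
Qed.

End Weights.

(** * Removing Euler factors from a truncated series *)

Lemma big_dvdn_reindex (V : nmodType) (p K : nat) (Q : pred nat) (F : nat -> V) :
  (0 < p)%N ->
  \sum_(1 <= j < (p * K).+1 | (p %| j)%N && Q j) F j
  = \sum_(1 <= k < K.+1 | Q (p * k)%N) F (p * k)%N.
Proof.
move=> p0; rewrite -big_filter_cond.
rewrite -[RHS](big_map (muln p) Q F); apply: perm_big; apply: uniq_perm.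
- by rewrite filter_uniq // iota_uniq.
- rewrite map_inj_uniq ?iota_uniq // => x y /eqP.
  by rewrite eqn_pmul2l // => /eqP.
move=> j; rewrite mem_filter mem_index_iota; apply/idP/mapP.
  move=> /andP[/dvdnP[k ->] /andP[h1 h2]]; exists k; last by rewrite mulnC.
  rewrite mem_index_iota; move: h1 h2; rewrite muln_gt0 => /andP[-> _] /=.
  by rewrite !ltnS mulnC leq_pmul2l.
move=> [k]; rewrite mem_index_iota ltnS => /andP[k0 kK] ->.
by rewrite dvdn_mulr //= muln_gt0 p0 k0 /= ltnS leq_pmul2l.
Qed.

Definition rough (ps : seq nat) (k : nat) := all (fun p => ~~ (p %| k)%N) ps.

Section Sieve.
Variables (R : realType) (f : nat -> R[i]) (w : nat -> R).
Hypothesis fM : forall a b, (0 < a)%N -> (0 < b)%N -> f (a * b)%N = f a * f b.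
Hypothesis fw : forall a, (0 < a)%N -> modc (f a) <= w a.
Hypothesis w0 : forall a, 0 <= w a.
Hypothesis tail : forall d, 0 < d -> exists2 M, (0 < M)%N &
  forall a b, (M <= a)%N -> \sum_(a.+1 <= k < b) w k <= d.

(** The factor [1 - f p] cancels the terms whose index is divisible by p, except that the product
    reaches up to [p * K]: the surplus terms have index between K and [p * K] and form a piece of
    the tail. Primes are removed one at a time, each with its share of the error. *)
Lemma sieve ps : uniq ps -> all prime ps -> forall d, 0 < d ->
  exists K0, forall K, (K0 <= K)%N ->
  modc (\prod_(p <- ps) (1 - f p) * (\sum_(1 <= k < K.+1) f k)
        - \sum_(1 <= k < K.+1 | rough ps k) f k) <= d.
Proof.
elim: ps => [|p ps IH] /=.
  move=> _ _ d d0; exists 0%N => K _.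
  by rewrite big_nil mul1r (eq_bigl predT) // subrr modc0 ltW.
move=> /andP[pps ups] /andP[pp aps] d d0.
have p0 := prime_gt0 pp.
set B := modc (1 - f p).
have B0 : 0 <= B by apply: modc_ge0.
(* Dividing by [B + 1] keeps the inherited error below [d / 2] after multiplication by [1 - f p],
   whose modulus is [B]. *)
have [K1 HK1] := IH ups aps (d / 2 / (B + 1)) ltac:(rewrite !divr_gt0 // ltr_wpDl //).
have [K2 _ HK2] := tail (d := d / 2) ltac:(by rewrite divr_gt0).
exists (maxn K1 K2) => K; rewrite geq_max => /andP[KK1 KK2].
have {}HK1 := HK1 _ KK1.
rewrite big_cons.
set S := \sum_(1 <= k < K.+1) f k in HK1 *.
set P := \prod_(j <- ps) _ in HK1 *.
set S1 := \sum_(1 <= k < K.+1 | rough ps k) f k in HK1 *.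
set S2 := \sum_(1 <= k < K.+1 | rough (p :: ps) k) f k.
have roughM k : rough ps (p * k) = rough ps k.
  apply: eq_in_all => q qps; have pq := allP aps _ qps.
  rewrite Euclid_dvdM //.
  have -> // : (q %| p)%N = false.
  rewrite dvdn_prime2 //; apply/negbTE.
  by apply: contraNneq pps => <-.
have KpK : (K.+1 <= (p * K).+1)%N by rewrite ltnS leq_pmull.
have E : (1 - f p) * S1 - S2 =
   - \sum_(K.+1 <= j < (p * K).+1 | (p %| j)%N && rough ps j) f j.
  have -> : S2 = S1 - \sum_(1 <= k < K.+1 | (p %| k)%N && rough ps k) f k.
    apply/eqP; rewrite eq_sym subr_eq /S1 (bigID (fun k => p %| k)%N) /= addrC.
    rewrite /S2 /=; apply/eqP; congr (_ + _); apply: eq_bigl => k /=; by rewrite andbC.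
  have -> : (1 - f p) * S1 = S1 - \sum_(1 <= k < K.+1 | rough ps (p * k)) f (p * k)%N.
    rewrite mulrBl mul1r /S1 mulr_sumr; congr (_ - _).
    rewrite big_nat_cond [RHS]big_nat_cond; apply: eq_big => k.
      by rewrite roughM.
    by move=> /andP[/andP[k0 _] _]; rewrite fM.
  rewrite -(big_dvdn_reindex _ _ _ p0) (big_cat_nat (n := K.+1)) //=.
  by ring.
have -> : (1 - f p) * P * S - S2 = (1 - f p) * (P * S - S1) + ((1 - f p) * S1 - S2).
  by ring.
rewrite E; apply: le_trans (modcD _ _) _.
have -> : d = d / 2 + d / 2 by lra.
apply: lerD.
  rewrite modcM -/B; apply: le_trans (ler_wpM2l B0 HK1) _.
  rewrite mulrCA ler_piMr ?divr_ge0 ?ltW //.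
  by rewrite ltr_pdivrMr ?ltr_wpDl // mul1r ltrDl.
rewrite modcN; apply: le_trans (modc_sum _ _ _) _.
apply: le_trans (HK2 K (p * K).+1 KK2).
rewrite big_mkcond /=; apply: ler_sum_nat => k /andP[Kk _].
by case: ifP => // _; apply: fw; apply: leq_trans Kk.
Qed.

End Sieve.

Lemma sum_inv_sqr_le (R : realType) K : \sum_(1 <= k < K.+1) (k%:R ^- 2 : R) <= 2.
Proof.
have h j : \sum_(1 <= k < j.+2) (k%:R ^- 2 : R) <= 2 - (j.+1%:R)^-1.
  elim: j => [|j IH]; first by rewrite big_nat1 expr1n invr1; lra.
  rewrite big_nat_recr //=; apply: le_trans (lerD IH (lexx _)) _.
  have k1 : (0 : R) < j.+1%:R by rewrite ltr0n.
  have e2 : j.+2%:R = j.+1%:R + 1 :> R by rewrite natr1.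
  rewrite e2; set x := (j.+1%:R : R) in k1 *.
  rewrite -subr_ge0.
  have -> : 2 - (x + 1)^-1 - (2 - x^-1 + (x + 1) ^- 2) = (x * (x + 1) ^+ 2)^-1.
    by field; rewrite !gt_eqF // addr_gt0.
  by rewrite invr_ge0 mulr_ge0 ?ltW // exprn_gt0 // addr_gt0.
case: K => [|K]; first by rewrite big_geq.
by apply: le_trans (h K) _; rewrite gerBl invr_ge0 ler0n.
Qed.

(** The bound 2 alone would not survive the induction; the sharper 2 - 2/(j + 2) leaves room for the
    next factor. *)
Lemma prod_inv_sqr_le (R : realType) y : \prod_(2 <= k < y) (1 + k%:R ^- 2 : R) <= 2.
Proof.
have h j : \prod_(2 <= k < j.+2) (1 + k%:R ^- 2 : R) <= 2 - 2 * (j.+2%:R)^-1.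
  elim: j => [|j IH]; first by rewrite big_geq //; lra.
  rewrite big_nat_recr //=.
  have k1 : (0 : R) < j.+2%:R by rewrite ltr0n.
  apply: (@le_trans _ _ ((2 - 2 * (j.+2%:R)^-1) * (1 + j.+2%:R ^- 2))).
    by apply: ler_wpM2r => //; rewrite addr_ge0 // invr_ge0 exprn_ge0 // ltW.
  have e2 : j.+3%:R = j.+2%:R + 1 :> R by rewrite natr1.
  rewrite e2; set x := (j.+2%:R : R) in k1 *.
  rewrite -subr_ge0.
  have -> : 2 - 2 * (x + 1)^-1 - (2 - 2 * x^-1) * (1 + x ^- 2) = 2 * (x ^+ 3 * (x + 1))^-1.
    by field; rewrite !gt_eqF // addr_gt0.
  by rewrite mulr_ge0 // invr_ge0 mulr_ge0 ?exprn_ge0 ?ltW // addr_gt0.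
have [y2|y2] := leqP y 2; first by rewrite big_geq //; lra.
case: y y2 => [|[|y]] // _; apply: le_trans (h y) _.
by rewrite gerBl mulr_ge0 // invr_ge0 ler0n.
Qed.

(** * Powers of a character and their truncated L-series *)

Section CharPowers.
Variables (R : realType) (n : nat) (chi : nat -> R[i]).
Hypothesis Dchi : dirichlet n chi.

(** The test matters for i = 0: the power [chi k ^+ 0] is 1 even where [chi k] is 0, while the
    principal character must vanish there. *)
Definition chipow (i k : nat) : R[i] := if coprime k n then chi k ^+ i else 0.

Lemma chipow_dirichlet i : dirichlet n (chipow i).
Proof.
split; rewrite /chipow.
- exact: dir_n Dchi.
- by rewrite coprime1n (dir1 Dchi) expr1n.
- move=> a b; rewrite coprimeMl.
  case: (coprime a n); case: (coprime b n); rewrite ?mul0r ?mulr0 //=.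
  by rewrite (dirM Dchi) exprMn.
- move=> a; rewrite -coprime_modl modnDr coprime_modl.
  by rewrite (dirP Dchi).
- by move=> a /negbTE ->.
Qed.

Lemma chipow1 k : chipow 1 k = chi k.
Proof.
rewrite /chipow; case: (boolP (coprime k n)) => co //.
by rewrite (dir0 Dchi co).
Qed.

(** By orthogonality the sum is N where [chi p = 1] and 0 otherwise; only its sign is used. *)
Lemma chipow_geom N p : (0 < N)%N ->
  (forall k, coprime k n -> chi k ^+ N = 1) ->
  0 <= \sum_(i < N) complex.Re (chipow i p).
Proof.
move=> N0 hN; rewrite /chipow; case: (boolP (coprime p n)) => co; last first.
  by rewrite big1.
rewrite -(raddf_sum (@complex.Re R : Rcomplex R -> R)) /=.
have [->|ne1] := eqVneq (chi p) 1.
  under eq_bigr do rewrite expr1n.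
  rewrite sumr_const card_ord.
  have -> : (1 : R[i]) *+ N = ((N%:R : R)%:C)%C by rewrite rmorph_nat.
  by rewrite /= ler0n.
have : (chi p - 1) * (\sum_(i < N) chi p ^+ i) = 0.
  by rewrite -subrX1 hN // subrr.
move/eqP; rewrite mulf_eq0 subr_eq0 (negPf ne1) /= => /eqP ->.
by [].
Qed.

End CharPowers.

Section LBounds.
Variables (R : realType) (n : nat) (eps : R).
Hypothesis eps0 : 0 < eps.
Variable chi : nat -> R[i].
Hypothesis Dchi : dirichlet n chi.

Definition Lpart (K : nat) : R[i] := \sum_(1 <= k < K.+1) chi k * ((wt eps k)%:C)%C.

Lemma Lpart_triv K : modc (Lpart K) <= 1 + eps^-1.
Proof.
apply: le_trans (modc_sum _ _ _) _; apply: le_trans (wt_sum eps0 K.+1).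
apply: ler_sum => k _; rewrite modcM modc_real ger0_norm ?wt_ge0 //.
by rewrite ler_piMl ?wt_ge0 ?(dir_modc_le1 Dchi).
Qed.

Lemma Lpart_nontriv K : (exists2 b, coprime b n & chi b != 1) ->
  modc (Lpart K) <= 2 * n%:R.
Proof.
move=> nt; pose b k := wt eps k.-1.+1.
have -> : Lpart K = \sum_(1 <= k < K.+1) chi k * ((b k)%:C)%C.
  by apply: eq_big_nat => -[].
apply: le_trans (dir_abel Dchi nt _ _ _) _.
- by move=> [|k] // _; apply: wt_decr.
- by move=> k; apply: wt_ge0.
by rewrite /b wt1 mulr1.
Qed.

(** The hypothesis is the quantitative form of L(1, chi) = 0. Summation by parts against [pe] costs
    C eps at the boundary, because K >= 1/eps, and at most C eps / k^2 for each k; the latter add up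
    to at most 2 C eps. *)
Lemma Lpart_zero (C : R) : 0 < C ->
  (forall K, (0 < K)%N -> modc (\sum_(1 <= k < K.+1) chi k / k%:R) <= C / K%:R) ->
  forall K, eps^-1 <= K%:R -> modc (Lpart K) <= 3 * C * eps.
Proof.
move=> C0 hC K hK.
have K0 : (0 : R) < K%:R by apply: lt_le_trans hK; rewrite invr_gt0.
pose S k := \sum_(1 <= i < k.+1) chi i / i%:R.
have E j : \sum_(1 <= k < j.+1) chi k * ((wt eps k)%:C)%C =
   S j * ((pe eps j.+1)%:C)%C + \sum_(1 <= k < j.+1) S k * ((pe eps k - pe eps k.+1)%:C)%C.
  elim: j => [|j IH]; first by rewrite /S !big_geq // mul0r addr0.
  rewrite big_nat_recr //= IH [in RHS]big_nat_recr //= /S [in RHS]big_nat_recr //=.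
  rewrite /wt !rmorphM rmorphB /= fmorphV rmorph_nat.
  by ring.
rewrite /Lpart E; apply: le_trans (modcD _ _) _.
have -> : 3 * C * eps = C * eps + 2 * C * eps by ring.
apply: lerD.
  rewrite modcM modc_real ger0_norm; last by rewrite ltW ?pe_gt0.
  apply: (@le_trans _ _ (C / K%:R * 1)).
    apply: ler_pM; rewrite ?modc_ge0 ?pe_le1 ?(ltW (pe_gt0 _ _)) //.
    by apply: hC; rewrite -(ltr0n R).
  rewrite mulr1 ler_pM2l // -[leRHS]invrK lef_pV2 ?posrE ?invr_gt0 //.
apply: le_trans (modc_sum _ _ _) _.
apply: (@le_trans _ _ (\sum_(1 <= k < K.+1) (C * eps) * (k%:R ^- 2))).
  apply: ler_sum_nat => k /andP[k0 _]; have kR : (0 : R) < k%:R by rewrite ltr0n.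
  rewrite modcM modc_real ger0_norm ?subr_ge0 ?pe_decr //.
  have -> : C * eps * k%:R ^- 2 = C / k%:R * (eps / k%:R) by field; rewrite gt_eqF.
  by apply: ler_pM; rewrite ?modc_ge0 ?subr_ge0 ?pe_decr ?hC ?pe_diff.
rewrite -mulr_sumr; have Ce : 0 <= C * eps by rewrite mulr_ge0 // ltW.
apply: le_trans (ler_wpM2l Ce (sum_inv_sqr_le R K)) _; lra.
Qed.

(* Multiplying by the Euler factors at the primes up to y leaves 1 plus the
   terms of index > y, a tail of the series. *)
Lemma Lpart_sieved y : (0 < y)%N ->
  (forall a b, (y <= a)%N -> \sum_(a.+1 <= k < b) wt eps k <= 4^-1) ->
  exists K0, forall K, (K0 <= K)%N ->
  2^-1 <= modc (\prod_(2 <= p < y.+1 | prime p) (1 - chi p * ((wt eps p)%:C)%C) * Lpart K).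
Proof.
move=> y0 hy; have q0 : (0 : R) < 4^-1 by rewrite invr_gt0.
pose ps := [seq p <- index_iota 2 y.+1 | prime p].
pose f k := chi k * ((wt eps k)%:C)%C.
have fM a b : (0 < a)%N -> (0 < b)%N -> f (a * b)%N = f a * f b.
  by move=> a0 b0; rewrite /f (dirM Dchi) wtM // rmorphM /=; ring.
have fw a : (0 < a)%N -> modc (f a) <= wt eps a.
  move=> a0; rewrite /f modcM modc_real ger0_norm ?wt_ge0 //.
  by rewrite ler_piMl ?wt_ge0 ?(dir_modc_le1 Dchi).
have [||K0 hK0] := sieve fM fw (wt_ge0 eps) (wt_tail_small eps0) (ps := ps) _ _ q0.
- by rewrite filter_uniq // iota_uniq.
- exact: filter_all.
exists (maxn K0 1) => K; rewrite geq_max => /andP[K0K K1].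
have := hK0 K K0K; rewrite big_filter -/(Lpart K).
set P := _ * Lpart K => hP.
have h1 : modc (\sum_(1 <= k < K.+1 | rough ps k) f k - 1) <= 4^-1.
  rewrite big_mkcond big_ltn // {1}/rough.
  have -> : all (fun p => ~~ (p %| 1)%N) ps.
    by apply/allP => p; rewrite mem_filter => /andP[pp _]; rewrite dvdn1; case: p pp => [|[]].
  rewrite /f (dir1 Dchi) wt1 mulr1 addrAC subrr add0r.
  apply: le_trans (modc_sum _ _ _) _.
  have [Ky|yK] := leqP K y.
    rewrite big_nat_cond big1 ?ltW // => k /andP[/andP[k1 kK] _].
    case: ifP; rewrite ?modc0 // => /allP hr.
    have pk := pdiv_prime k1; have := hr (pdiv k).
    rewrite mem_filter pk mem_index_iota prime_gt1 //= ltnS.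
    rewrite (leq_trans (pdiv_leq _)) ?(ltnW k1) ?(leq_trans _ Ky) // pdiv_dvd.
    by move/(_ isT).
  rewrite (big_cat_nat (n := y.+1)) //=; last by rewrite ltnS ltnW.
  rewrite [X in X + _]big_nat_cond [X in X + _]big1 ?add0r.
    apply: le_trans (hy y K.+1 (leqnn y)); apply: ler_sum_nat => k /andP[ky _].
    case: ifP => _; last by rewrite modc0 wt_ge0.
    by apply: fw; apply: leq_trans ky.
  move=> k /andP[/andP[k1 ky] _].
  case: ifP; rewrite ?modc0 // => /allP hr.
  have pk := pdiv_prime k1; have := hr (pdiv k).
  rewrite mem_filter pk mem_index_iota prime_gt1 //= ltnS.
  rewrite (leq_trans (pdiv_leq _)) ?(ltnW k1) // pdiv_dvd.
  by move/(_ isT).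
set S := (\sum_(1 <= k < K.+1 | rough ps k) f k) in hP h1.
have : modc (1 : R[i]) <= modc P + modc (P - S) + modc (S - 1).
  have {1}-> : 1 = P - (P - S) - (S - 1) :> R[i] by ring.
  by apply: (le_trans (modcBD _ _)); rewrite lerD2r modcBD.
rewrite modc1; lra.
Qed.

End LBounds.

(* Summation by parts: if L(1, chi) = 0 then L(1 + eps, chi) = O(eps), and the
   same holds for the conjugate character; the product of the L-functions of the
   powers of chi, bounded below by AM-GM on the Euler factors, has only one pole. *)
Section ComplexCase.
Variables (R : realType) (n : nat) (chi : nat -> R[i]).
Hypothesis Dchi : dirichlet n chi.

Lemma euler_factor_sqr (w : R) (x : R[i]) : modc x <= 1 ->
  modc (1 - x * (w%:C)%C) ^+ 2 <= 1 + w ^+ 2 - 2 * w * complex.Re x.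
Proof.
move=> x1; have : modc x ^+ 2 <= 1 by rewrite expr_le1 ?modc_ge0.
rewrite !modc_sqr; case: x {x1} => a b /=.
move=> h; rewrite -subr_ge0.
have -> : 1 + w ^+ 2 - 2 * w * a -
  ((1 - (a * w - b * 0)) ^+ 2 + (0 - (a * 0 + b * w)) ^+ 2)
  = w ^+ 2 * (1 - (a ^+ 2 + b ^+ 2)) by ring.
by rewrite mulr_ge0 ?sqr_ge0 // subr_ge0.
Qed.

(** AM-GM bounds the product by a power of the mean of the squared factors, and in this mean the
    real parts of the powers of chi at p have a nonnegative sum, so that they only help. *)
Lemma prod_euler_factors N (w : R) p : (0 < N)%N -> 0 <= w ->
  (forall k, coprime k n -> chi k ^+ N = 1) ->
  \prod_(i < N) modc (1 - chipow n chi i p * (w%:C)%C) ^+ 2 <= (1 + w ^+ 2) ^+ N.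
Proof.
move=> N0 w0 hN.
have NR : (0 : R) < N%:R by rewrite ltr0n.
have AG := (leif_AGM (A := predT)
  (E := fun i : 'I_N => modc (1 - chipow n chi i p * (w%:C)%C) ^+ 2)).
have {AG} := (AG (fun i _ => sqr_ge0 _)).1.
rewrite card_ord => AG; apply: le_trans AG _.
apply: lerXn2r; rewrite ?nnegrE ?divr_ge0 ?sumr_ge0 ?addr_ge0 ?sqr_ge0 ?(ltW NR) //.
  by move=> i _; apply: sqr_ge0.
rewrite ler_pdivrMr //.
apply: (@le_trans _ _ (\sum_(i < N) (1 + w ^+ 2 - 2 * w * complex.Re (chipow n chi i p)))).
  by apply: ler_sum => i _; apply/euler_factor_sqr/dir_modc_le1/chipow_dirichlet.
rewrite sumrB sumr_const card_ord -mulr_sumr -[X in X - _]mulr_natr gerBl.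
by apply: mulr_ge0; [rewrite mulr_ge0|apply: chipow_geom].
Qed.

(** Each sieved series has squared modulus at least 1/4, and the squared Euler factors of all N
    characters multiply to at most the N-th power of the product of 1 + p^(-2), hence to at most
    2^N. This is the origin of 8^N. *)
Lemma prod_Lpart_lower (N : nat) (eps : R) : 0 < eps -> (0 < N)%N ->
  (forall k, coprime k n -> chi k ^+ N = 1) ->
  exists K0, forall K, (K0 <= K)%N ->
    (8 ^+ N)^-1 <= \prod_(i < N) modc (Lpart eps (chipow n chi i) K) ^+ 2.
Proof.
move=> e0 N0 hN; have q0 : (0 : R) < 4^-1 by rewrite invr_gt0.
have [y y0 hy] := wt_tail_small e0 q0.
have hK (i : 'I_N) := Lpart_sieved e0 (chipow_dirichlet Dchi i) y0 hy.
pose K0 (i : 'I_N) := projT1 (cid (hK i)).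
have HK0 i K : (K0 i <= K)%N -> _ := projT2 (cid (hK i)) K.
exists (\max_i K0 i) => K /bigmax_leqP HK.
set L := \prod_(i < N) _.
have L0 : 0 <= L by apply: prodr_ge0 => i _; apply: sqr_ge0.
pose P := \prod_(i < N) \prod_(2 <= p < y.+1 | prime p)
  modc (1 - chipow n chi i p * ((wt eps p)%:C)%C) ^+ 2.
have h1 : 4^-1 ^+ N <= P * L.
  rewrite -big_split /= -[X in _ ^+ X]card_ord -prodr_const.
  apply: ler_prod => i _; rewrite invr_ge0 ler0n /=.
  have := HK0 i K (HK i isT); rewrite modcM modc_prod => h.
  rewrite prodrXl -exprMn; have -> : (4^-1 : R) = 2^-1 ^+ 2 by field.
  by apply: lerXn2r; rewrite ?nnegrE ?invr_ge0 ?mulr_ge0 ?modc_ge0 ?prodr_ge0 // => j _; apply: modc_ge0.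
have h2 : P <= 2 ^+ N.
  rewrite /P exchange_big /=.
  apply: (@le_trans _ _ (\prod_(2 <= p < y.+1) (1 + p%:R ^- 2) ^+ N)).
    rewrite big_mkcond /= big_nat_cond [leRHS]big_nat_cond.
    apply: ler_prod => p /andP[/andP[p2 _] _].
    have pR : (0 : R) < p%:R by rewrite ltr0n (leq_trans _ p2).
    have p1 : 1 <= 1 + p%:R ^- 2 :> R by rewrite lerDl invr_ge0 exprn_ge0 // ltW.
    case: ifP => _; last by rewrite ler01 exprn_ege1.
    apply/andP; split; first by apply: prodr_ge0 => i _; apply: sqr_ge0.
    apply: le_trans (prod_euler_factors p N0 (wt_ge0 eps p) hN) _.
    apply: lerXn2r; rewrite ?nnegrE ?addr_ge0 ?sqr_ge0 ?(le_trans ler01 p1) //.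
    rewrite lerD2l -exprVn; apply: lerXn2r; rewrite ?nnegrE ?wt_ge0 ?wt_le //.
  rewrite prodrXl; apply: lerXn2r; rewrite ?nnegrE ?ler0n ?prod_inv_sqr_le //.
  by apply: prodr_ge0 => i _; rewrite addr_ge0 // invr_ge0 exprn_ge0 // ler0n.
have h3 := le_trans h1 (ler_wpM2r L0 h2).
rewrite -(ler_pM2l (x := 2 ^+ N)) ?exprn_gt0 //; apply: le_trans h3.
by rewrite -exprVn -exprMn; have -> : 2 * 8^-1 = 4^-1 :> R by field.
Qed.

Lemma dir_conj k N : (0 < N)%N -> coprime k n -> chi k ^+ N = 1 ->
  chi k ^+ N.-1 = ((chi k)^*)%C.
Proof.
move=> N0 co h; have m1 := dir_modc Dchi co.
have c0 : chi k != 0 by rewrite -modc_eq0 m1 oner_eq0.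
apply: (mulfI c0); rewrite -exprS prednK // h mulcJ m1 expr1n.
by [].
Qed.

Lemma L1_nonzero_complex (C : R) : 0 < C ->
  (forall K, (0 < K)%N -> modc (\sum_(1 <= k < K.+1) chi k / k%:R) <= C / K%:R) ->
  (exists2 b, coprime b n & chi b ^+ 2 != 1) -> False.
Proof.
move=> C0 hC [b cob chib].
have eqW (x y : R) : x = y -> x <= y by move=> ->.
pose PN N := (0 < N)%N && `[< forall k, coprime k n -> chi k ^+ N = 1 >].
have exN : exists N, PN N.
  exists (totient n); rewrite /PN totient_gt0 (dir_n Dchi); apply/asboolP => k.
  exact: dir_totient.
(* With N the exact order of chi, the powers [chi^i] for 0 < i < N are nontrivial. N > 2 makes chi
   and its conjugate chi^(N-1) two distinct factors, both of size O(eps), against the single pole of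
   order one at i = 0. *)
have [N /andP[N0 /asboolP hN] minN] := ex_minnP exN.
have N3 : (2 < N)%N.
  case: N N0 hN {minN} => [|[|[|N]]] // _ hN.
    by move: chib; rewrite -[chi b]expr1 hN // expr1n eqxx.
  by move: chib; rewrite hN // eqxx.
have nontriv i : (0 < i < N)%N -> exists2 b, coprime b n & chipow n chi i b != 1.
  move=> /andP[i0 iN]; apply/exists2P; apply: contrapT => nex.
  have : PN i.
    rewrite /PN i0; apply/asboolP => k co; apply/eqP; apply/negPn/negP => h.
    by apply: nex; exists k; split => //; rewrite /chipow co.
  by move/minN; rewrite leqNgt iN.
pose B : R := (2 * n%:R) ^+ 2.
have B0 : 0 <= B by apply: sqr_ge0.
(* 81 = 3^4 comes from the two squared small factors and 4 bounds (1 + eps)^2. The lower bound will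
   read 1 <= A eps, which the choice of [eps] contradicts. *)
pose A : R := 324 * C ^+ 4 * B ^+ (N - 3) * 8 ^+ N.
have A0 : 0 <= A.
  apply: mulr_ge0; last by rewrite exprn_ge0.
  apply: mulr_ge0; last by rewrite exprn_ge0.
  by apply: mulr_ge0; [exact: ler0n|rewrite exprn_ge0 // ltW].
pose eps : R := (A + 1)^-1.
have A1 : 0 < A + 1 by rewrite ltr_wpDl.
have e0 : 0 < eps by rewrite invr_gt0.
have e1 : eps <= 1 by rewrite invf_le1 // lerDr.
have [K0 HK0] := prod_Lpart_lower e0 N0 hN.
pose K := maxn K0 (Num.bound eps^-1).
have KK0 : (K0 <= K)%N by rewrite leq_maxl.
have Ke : eps^-1 <= K%:R.
  apply: le_trans (ltW (archi_boundP _)) _; first by rewrite invr_ge0 ltW.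
  by rewrite ler_nat leq_maxr.
have := HK0 K KK0.
pose L i := modc (Lpart eps (chipow n chi i) K) ^+ 2.
have sq (x y : R) : 0 <= x -> x <= y -> x ^+ 2 <= y ^+ 2.
  by move=> x0 xy; apply: lerXn2r; rewrite ?nnegrE // (le_trans x0).
have L0 : L 0%N <= (1 + eps^-1) ^+ 2.
  apply: sq; first exact: modc_ge0.
  exact: (Lpart_triv e0 (chipow_dirichlet Dchi 0)).
have L1 : L 1%N <= (3 * C * eps) ^+ 2.
  apply: sq; first exact: modc_ge0.
  apply: (Lpart_zero e0 C0) => // K' K'0.
  by under eq_bigr do rewrite (chipow1 Dchi); apply: hC.
have LN : L N.-1 <= (3 * C * eps) ^+ 2.
  apply: sq; first exact: modc_ge0.
  apply: (Lpart_zero e0 C0) => // K' K'0.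
  apply: le_trans (hC K' K'0); rewrite -[leRHS]modcJ rmorph_sum /=.
  apply: eqW; congr modc; apply: eq_bigr => k _.
  rewrite rmorphM /= conjc_inv conjc_nat /chipow.
  case: (boolP (coprime k n)) => co; first by rewrite (dir_conj N0 co) ?hN.
  by rewrite (dir0 Dchi co) conjc0.
have Li i : (0 < i < N)%N -> L i <= B.
  move=> hi; apply: sq; first exact: modc_ge0.
  exact: (Lpart_nontriv e0 (chipow_dirichlet Dchi i) _ (nontriv i hi)).
have Lge0 i : 0 <= L i by apply: sqr_ge0.
have N1 : (1 < N)%N by apply: leq_trans N3.
have NN : (N.-1 < N)%N by rewrite prednK.
have n1N0 : (N.-1 != 0)%N by clear -N3; lia.
have n1N1 : (N.-1 != 1)%N by clear -N3; lia.
rewrite (bigD1 (Ordinal N0)) //= (bigD1 (Ordinal N1)) //= (bigD1 (Ordinal NN)) /=; last first.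
  by rewrite -!val_eqE /= n1N0 n1N1.
rewrite -!/(L _) => H.
have H2 : \prod_(i < N | (i != Ordinal N0) && (i != Ordinal N1) && (i != Ordinal NN)) L i <= B ^+ (N - 3).
  apply: (@le_trans _ _ (\prod_(i < N | (i != Ordinal N0) && (i != Ordinal N1) && (i != Ordinal NN)) B)).
    apply: ler_prod => i /andP[/andP[i0 _] _]; rewrite Lge0 Li //.
    by rewrite ltn_ord andbT lt0n.
  rewrite prodr_const; apply: eqW; congr (_ ^+ _).
  have e3 : #|[set Ordinal N0; Ordinal N1; Ordinal NN]%SET| = 3%N.
    by rewrite finset.setUC !cardsU1 cards1 !inE -!val_eqE /= (negPf n1N0) (negPf n1N1).
  have hc : #|~: [set Ordinal N0; Ordinal N1; Ordinal NN]%SET| = (N - 3)%N.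
    by apply/eqP; rewrite -(eqn_add2l 3) subnKC // -{1}e3 cardsC card_ord.
  rewrite -hc; apply: eq_card => i; by rewrite !inE -!topredE /= !negb_or.
have H3 : (8 ^+ N)^-1 <= (1 + eps^-1) ^+ 2 * ((3 * C * eps) ^+ 2 * ((3 * C * eps) ^+ 2 * B ^+ (N - 3))).
  have pm (a b' c d : R) : 0 <= a <= b' -> 0 <= c <= d -> 0 <= a * c <= b' * d.
    by move=> /andP[a0 ab] /andP[c0 cd]; rewrite mulr_ge0 //= ler_pM.
  apply: le_trans H _.
  suff /andP[] : 0 <= L 0%N * (L 1%N * (L N.-1 * (\prod_(i < N |
      (i != Ordinal N0) && (i != Ordinal N1) && (i != Ordinal NN)) L i))) <=
      (1 + eps^-1) ^+ 2 * ((3 * C * eps) ^+ 2 * ((3 * C * eps) ^+ 2 * B ^+ (N - 3))).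
    by [].
  apply: (pm); first by rewrite Lge0.
  apply: (pm); first by rewrite Lge0.
  apply: (pm); first by rewrite Lge0.
  by rewrite H2 andbT prodr_ge0.
have E : (1 + eps^-1) ^+ 2 * ((3 * C * eps) ^+ 2 * ((3 * C * eps) ^+ 2 * B ^+ (N - 3)))
   = (eps + 1) ^+ 2 * (81 * C ^+ 4 * B ^+ (N - 3)) * eps ^+ 2.
  by field; rewrite gt_eqF.
have e4 : (eps + 1) ^+ 2 <= 4.
  by apply: (@le_trans _ _ (2 ^+ 2)); [apply: sq; lra|lra].
have H4 : (8 ^+ N)^-1 <= 324 * C ^+ 4 * B ^+ (N - 3) * eps.
  apply: le_trans H3 _; rewrite E.
  have X0 : 0 <= 81 * C ^+ 4 * B ^+ (N - 3).
    apply: mulr_ge0; last by rewrite exprn_ge0.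
    by apply: mulr_ge0; [exact: ler0n|rewrite exprn_ge0 // ltW].
  apply: (@le_trans _ _ (4 * (81 * C ^+ 4 * B ^+ (N - 3)) * eps)); last by lra.
  apply: ler_pM.
  - by apply: mulr_ge0 => //; exact: sqr_ge0.
  - exact: sqr_ge0.
  - exact: ler_wpM2r.
  - by rewrite expr2 ler_piMl // ltW.
have E8 : (0 : R) < 8 ^+ N by rewrite exprn_gt0.
move: H4; rewrite -[X in X <= _]mul1r ler_pdivrMr // => H4.
have : 1 <= A * eps by rewrite /A; apply: le_trans H4 _; apply: eqW; ring.
by rewrite /eps ler_pdivlMr // mul1r gerDl ler10.
Qed.

End ComplexCase.

(** * Divisor sums of a real character *)

Section DivisorSums.
Variables (R : realType) (x : nat -> R).
Hypothesis x1 : x 1%N = 1.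
Hypothesis xM : forall a b, x (a * b)%N = x a * x b.
Hypothesis xv : forall a, [\/ x a = 0, x a = 1 | x a = -1].

Definition divsum (m : nat) : R := \sum_(d <- divisors m) x d.

Let xX a k : x (a ^ k)%N = x a ^+ k.
Proof. by elim: k => [|k IH]; rewrite ?expn0 // expnS xM IH exprS. Qed.

Lemma divsum_prime_power p e m : prime p -> ~~ (p %| m)%N -> (0 < m)%N ->
  divsum (p ^ e * m) = (\sum_(0 <= i < e.+1) x p ^+ i) * divsum m.
Proof.
move=> pp pm m0; have p0 := prime_gt0 pp.
have pe0 : (0 < p ^ e * m)%N by rewrite muln_gt0 expn_gt0 p0.
have lognpm : logn p m = 0%N by rewrite lognE (negPf pm) !andbF.
have lognd d : d \in divisors m -> logn p d = 0%N.
  rewrite -dvdn_divisors // => dm; rewrite lognE.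
  have -> : (p %| d)%N = false by apply: contraNF pm => pd; apply: dvdn_trans dm.
  by rewrite !andbF.
have dgt d : d \in divisors m -> (0 < d)%N.
  by rewrite -dvdn_divisors // => dm; apply: dvdn_gt0 dm.
have logM i d : d \in divisors m -> logn p (p ^ i * d)%N = i.
  move=> dm; rewrite lognM ?expn_gt0 ?p0 ?dgt // (lognd _ dm) addn0.
  exact: pfactorK.
have -> : divsum (p ^ e * m) =
    \sum_(z <- [seq (p ^ i * d)%N | i <- index_iota 0 e.+1, d <- divisors m]) x z.
  apply: perm_big; apply: uniq_perm; first exact: divisors_uniq.
    apply: allpairs_uniq; rewrite ?iota_uniq ?divisors_uniq //.
    move=> [i d] [j d'] hi hj /= E.
    have [[i1 d1] /= [_ h1 [ei ed]]] := allpairsP hi.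
    have [[i2 d2] /= [_ h2 [ej ed']]] := allpairsP hj.
    move: E; rewrite ei ed ej ed' => E {i d j d' hi hj ei ed ej ed'}.
    have ij : i1 = i2 by rewrite -(logM i1 d1 h1) E logM.
    move: E => /eqP; rewrite ij eqn_pmul2l ?expn_gt0 ?p0 // => /eqP ->.
    by [].
  move=> z; rewrite -dvdn_divisors //; apply/idP/allpairsP => [zd|[[i d] /=]].
    have z0 : (0 < z)%N by apply: dvdn_gt0 zd.
    exists (logn p z, z`_p^')%N => /=; split.
    - rewrite mem_index_iota /= ltnS -[leqRHS](logM e m) -?dvdn_divisors //.
      exact: dvdn_leq_log.
    - rewrite -dvdn_divisors //; have := partn_dvd (negn p) pe0 zd.
      rewrite partnM ?expn_gt0 ?p0 // partnX.
      have -> : (p`_(negn p))%N = 1%N.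
        by apply/eqP; rewrite partn_eq1 // pnatNK pnat_id.
      have pnm : (negn p).-nat%N m by rewrite p'natE.
      by rewrite ssrnat.exp1n mul1n (part_pnat_id pnm).
    - by rewrite -p_part partnC.
  move=> [hi hd ->]; move: hi; rewrite mem_index_iota ltnS /= => ie.
  by rewrite dvdn_mul ?dvdn_exp2l // dvdn_divisors.
rewrite big_allpairs_dep mulr_suml; apply: eq_bigr => i _.
by rewrite /divsum mulr_sumr; apply: eq_bigr => d _; rewrite xM xX.
Qed.

Lemma geom_sign_ge0 (u : R) e : [\/ u = 0, u = 1 | u = -1] ->
  0 <= \sum_(0 <= i < e) u ^+ i.
Proof.
case=> ->.
- by apply: sumr_ge0 => i _; apply: exprn_ge0.
- by apply: sumr_ge0 => i _; apply: exprn_ge0.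
have : \sum_(0 <= i < e) (-1 : R) ^+ i = (odd e)%:R.
  elim: e => [|e IH]; first by rewrite big_geq.
  rewrite big_nat_recr //= IH -signr_odd; case: (odd e) => /=; rewrite ?expr1 ?expr0; lra.
by move=> ->; rewrite ler0n.
Qed.

Lemma geom_sign_ge1 (u : R) e : [\/ u = 0, u = 1 | u = -1] -> ~~ odd e ->
  1 <= \sum_(0 <= i < e.+1) u ^+ i.
Proof.
move=> hu ev; case: (hu) => ->.
- by rewrite big_ltn // expr0 lerDl; apply: sumr_ge0 => i _; apply: exprn_ge0.
- by rewrite big_ltn // expr0 lerDl; apply: sumr_ge0 => i _; apply: exprn_ge0.
have : \sum_(0 <= i < e.+1) (-1 : R) ^+ i = (odd e.+1)%:R.
  elim: e.+1 => [|f IH]; first by rewrite big_geq.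
  rewrite big_nat_recr //= IH -signr_odd; case: (odd f) => /=; rewrite ?expr1 ?expr0; lra.
by move=> ->; rewrite /= ev.
Qed.

(** Splitting off one prime power multiplies the divisor sum by a geometric sum in 0, 1 or -1. It is
    never negative, and at least 1 when the exponent is even, that is when the number of terms is
    odd. *)
Lemma divsum_ge m : (0 < m)%N ->
  0 <= divsum m /\ ((forall p, ~~ odd (logn p m)) -> 1 <= divsum m).
Proof.
elim/ltn_ind: m => m IH m0.
have [m1|m1] := leqP m 1.
  have -> : m = 1%N by apply/eqP; rewrite eqn_leq m1.
  have -> : divsum 1 = 1 by rewrite /divsum (_ : divisors 1 = [:: 1%N]) // big_seq1.
  by split.
have pp := pdiv_prime m1; set p := pdiv m in pp.
have [m'] := pfactor_coprime pp m0; rewrite coprime_sym => cop Em.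
set e := logn p m in Em.
have m'0 : (0 < m')%N by move: m0; rewrite Em; case: (m').
have pm' : ~~ (p %| m')%N by rewrite -prime_coprime // coprime_sym.
have e0 : (0 < e)%N by rewrite logn_gt0 mem_primes pp m0 pdiv_dvd.
have m'm : (m' < m)%N.
  by rewrite [X in (_ < X)%N]Em ltn_Pmulr // -(expn0 p) ltn_exp2l // prime_gt1.
have [h1 h2] := IH m' m'm m'0.
have Ed : divsum m = (\sum_(0 <= i < e.+1) x p ^+ i) * divsum m'.
  by rewrite -divsum_prime_power // mulnC -Em.
split; first by rewrite Ed mulr_ge0 // geom_sign_ge0.
move=> hodd; rewrite Ed.
have g1 := geom_sign_ge1 (xv p) (hodd p).
have : 1 <= divsum m'.
  apply: h2 => q; have [->|qp] := eqVneq q p.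
    by rewrite lognE (negPf pm') !andbF.
  have := hodd q.
  have -> : logn q m = (logn q m' + e * logn q p)%N.
    by rewrite {1}Em lognM ?expn_gt0 ?(prime_gt0 pp) // lognX.
  by rewrite (logn_prime _ pp) (negPf qp) muln0 addn0.
move=> g2; apply: le_trans g1 _.
by rewrite ler_peMr // geom_sign_ge0.
Qed.

Lemma divsum_sqr k : (0 < k)%N -> 1 <= divsum (k ^ 2).
Proof.
move=> k0; apply: (divsum_ge _).2; first by rewrite expn_gt0 k0.
by move=> p; rewrite lognX oddM.
Qed.

Lemma divsum_squares (y : R) K D : 0 <= y -> (K ^ 2 <= D)%N ->
  \sum_(1 <= k < K.+1) y ^+ (k ^ 2) <= \sum_(1 <= m < D.+1) divsum m * y ^+ m.
Proof.
move=> y0 KD.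
have ge0 a b : (0 < a)%N -> 0 <= \sum_(a <= m < b) divsum m * y ^+ m.
  move=> a0; rewrite big_nat_cond; apply: sumr_ge0 => m /andP[/andP[am _] _].
  by rewrite mulr_ge0 ?exprn_ge0 // (divsum_ge _).1 // (leq_trans a0).
rewrite [leRHS](big_cat_nat (n := (K ^ 2).+1)) //=.
apply: (@le_trans _ _ (\sum_(1 <= m < (K ^ 2).+1) divsum m * y ^+ m)); last first.
  by rewrite lerDl ge0.
elim: K {KD} => [|K IH]; first by rewrite !big_geq.
rewrite big_nat_recr //=.
have KK : (K ^ 2 < K.+1 ^ 2)%N by rewrite ltn_exp2r.
rewrite [leRHS](big_cat_nat (n := (K ^ 2).+1)) //=; last by rewrite ltnS ltnW.
apply: lerD => //; rewrite big_nat_recr //=.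
rewrite -[leLHS]add0r; apply: lerD; first exact: ge0.
by rewrite ler_peMl ?exprn_ge0 // divsum_sqr.
Qed.

(** The Lambert series, cut off by d e <= D and rearranged according to m = d e. *)
Lemma divsum_exchange (y : R) D :
  \sum_(1 <= d < D.+1) x d * (\sum_(1 <= e < D.+1 | (d * e <= D)%N) y ^+ (d * e))
  = \sum_(1 <= m < D.+1) divsum m * y ^+ m.
Proof.
transitivity (\sum_(1 <= d < D.+1) \sum_(1 <= m < D.+1 | (d %| m)%N) x d * y ^+ m).
  apply: eq_big_nat => d /andP[d0 dD]; rewrite -mulr_sumr; congr (_ * _).
  rewrite -(big_dvdn_reindex D (fun j => (j <= D)%N) (fun j => y ^+ j) d0).
  have DdD : (D.+1 <= (d * D).+1)%N by rewrite ltnS leq_pmull.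
  rewrite (big_cat_nat (n := D.+1)) //= [X in _ + X]big1_seq ?addr0; last first.
    move=> j; rewrite mem_index_iota => /and3P[/andP[_ jD] Dj _].
    by move: Dj; rewrite ltnNge jD.
  rewrite big_nat_cond [RHS]big_nat_cond; apply: eq_bigl => j.
  by rewrite ltnS; case: (j <= D)%N; rewrite ?andbT ?andbF.
rewrite (exchange_big_dep predT) //=; apply: eq_big_nat => m /andP[m0 mD].
rewrite -mulr_suml; congr (_ * _); rewrite /divsum -big_filter.
apply: perm_big; apply: uniq_perm; rewrite ?filter_uniq ?iota_uniq ?divisors_uniq //.
move=> d; rewrite mem_filter mem_index_iota -dvdn_divisors //.
case: (boolP (d %| m)%N) => //= dm; rewrite (dvdn_gt0 m0 dm) /=.
by apply: leq_ltn_trans mD; apply: dvdn_leq.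
Qed.

End DivisorSums.

(* Monsky: if chi is real, the Lambert series of chi has coefficients
   sum_(d | m) chi d, which are nonnegative and at least 1 on squares, so it is
   unbounded near 1, while L(1, chi) = 0 bounds it.  Taking y = w ^+ 2 keeps the
   AM-GM comparison free of square roots. *)
Section Lambert.
Variables (R : realType) (w : R).
Hypothesis w01 : 0 < w < 1.
Let w0 : 0 < w. Proof. by case/andP: w01. Qed.
Let w1 : w < 1. Proof. by case/andP: w01. Qed.
Let y : R := w ^+ 2.
Let y0 : 0 < y. Proof. by rewrite exprn_gt0. Qed.
Let y1 : y < 1. Proof. by rewrite expr_lt1 // ltW. Qed.

(** Adding the sum to its reversal pairs the powers of y with exponents adding up to d - 1; the two
    numbers of a pair have geometric mean w^(d-1) because y = w^2. *)
Lemma geom_AGM d : d%:R * w ^+ d.-1 <= \sum_(i < d) y ^+ i.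
Proof.
case: d => [|d] /=; first by rewrite mul0r big_ord0.
have E : \sum_(i < d.+1) y ^+ i = \sum_(i < d.+1) y ^+ (d - i).
  rewrite (reindex_inj rev_ord_inj) /=; apply: eq_bigr => i _.
  by rewrite subSS.
suff : (d.+1%:R * w ^+ d) *+ 2 <= (\sum_(i < d.+1) y ^+ i) *+ 2 by rewrite lerMn2r.
rewrite [leRHS]mulr2n {2}E -big_split /=.
apply: (@le_trans _ _ (\sum_(i < d.+1) (w ^+ d *+ 2))).
  by rewrite sumr_const card_ord -mulrnA mulnC mulrnA mulr_natl.
apply: ler_sum => i _.
have di : (i <= d)%N by rewrite -ltnS.
rewrite -{1}(subnKC di) exprD /y -!exprM ![(2 * _)%N]mulnC !exprM.
set a := w ^+ i; set b := w ^+ (d - i).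
have := sqr_ge0 (a - b); lra.
Qed.

(** The coefficient of chi d in L(1, chi) / (1 - y) minus the Lambert series. These weights are
    nonnegative and decreasing, so that Abel summation bounds the difference uniformly in y. *)
Definition lam (d : nat) : R := (d%:R * (1 - y))^-1 - y ^+ d / (1 - y ^+ d).

Let y1' : 0 < 1 - y. Proof. by rewrite subr_gt0. Qed.

Lemma lamE d : (0 < d)%N ->
  lam d = (1 - y)^-1 * (d%:R^-1 - y ^+ d / (\sum_(i < d) y ^+ i)).
Proof.
move=> d0; rewrite /lam.
have -> : 1 - y ^+ d = (1 - y) * (\sum_(i < d) y ^+ i).
  by rewrite -opprB subrX1 -mulNr opprB.
have s0 : 0 < \sum_(i < d) y ^+ i.
  apply: lt_le_trans (geom_AGM d); rewrite mulr_gt0 ?exprn_gt0 ?ltr0n //.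
by field; rewrite !gt_eqF // ltr0n.
Qed.

Lemma lam_ge0 d : (0 < d)%N -> 0 <= lam d.
Proof.
move=> d0; rewrite lamE // mulr_ge0 ?invr_ge0 ?(ltW y1') // subr_ge0.
have s0 := geom_AGM d; have dR : (0 : R) < d%:R by rewrite ltr0n.
have s1 : 0 < \sum_(i < d) y ^+ i.
  by apply: lt_le_trans s0; rewrite mulr_gt0 ?exprn_gt0.
rewrite ler_pdivrMr // mulrC ler_pdivlMr // mulrC.
apply: le_trans s0; apply: ler_wpM2l; first exact: ltW.
rewrite /y -exprM.
by apply: ler_wiXn2l; rewrite ?(ltW w0) ?(ltW w1) //; lia.
Qed.

Lemma lam_decr d : (0 < d)%N -> lam d.+1 <= lam d.
Proof.
move=> d0; rewrite !lamE // ler_wpM2l ?invr_ge0 ?(ltW y1') //.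
have s0 := geom_AGM d; have dR : (0 : R) < d%:R by rewrite ltr0n.
have t0 := geom_AGM d.+1; have d1R : (0 : R) < d.+1%:R by rewrite ltr0n.
rewrite big_ord_recr /= in t0 *.
have yd : 1 - y ^+ d = (1 - y) * (\sum_(i < d) y ^+ i).
  by rewrite -opprB subrX1 -mulNr opprB.
have s1 : 0 < \sum_(i < d) y ^+ i.
  by apply: lt_le_trans s0; rewrite mulr_gt0 ?exprn_gt0.
set s := \sum_(i < d) y ^+ i in s0 t0 yd s1 *.
have yd0 : 0 < y ^+ d by rewrite exprn_gt0.
have t1 : 0 < s + y ^+ d by rewrite addr_gt0.
(* The difference of consecutive weights is, up to the factor 1/(1 - y), equal to 1/(d (d+1)) - y^d
   / (s s'), with s and s' the geometric sums of lengths d and d + 1. AM-GM applied to each of them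
   gives the inequality that is needed. *)
have prod : d%:R * d.+1%:R * y ^+ d <= s * (s + y ^+ d).
  apply: (@le_trans _ _ ((d%:R * w ^+ d.-1) * (d.+1%:R * w ^+ d))); last first.
    have h0 k : 0 <= w ^+ k by apply: exprn_ge0; exact: ltW.
    by apply: ler_pM => //; apply: mulr_ge0 => //; exact: ler0n.
  rewrite [leRHS]mulrACA; apply: ler_wpM2l; first by rewrite mulr_ge0 ?ler0n.
  rewrite -exprD /y -exprM; apply: ler_wiXn2l; rewrite ?(ltW w0) ?(ltW w1) //.
  clear -d0; lia.
rewrite -subr_ge0.
have -> : d%:R^-1 - y ^+ d / s - (d.+1%:R^-1 - y ^+ d.+1 / (s + y ^+ d))
  = (d%:R * d.+1%:R)^-1 - y ^+ d / (s * (s + y ^+ d)).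
  have e1 : d.+1%:R = d%:R + 1 :> R by rewrite natr1.
  have : y ^+ d.+1 = y * y ^+ d by rewrite exprS.
  rewrite e1 in d1R *; move=> ->; move: yd; set z := y ^+ d in yd0 t1 *.
  move=> yd; have ys : y * s = s - 1 + z by move: yd; rewrite mulrBl mul1r; lra.
  apply/eqP; rewrite -subr_eq0.
  have -> : d%:R^-1 - z / s - ((d%:R + 1)^-1 - y * z / (s + z)) -
    ((d%:R * (d%:R + 1))^-1 - z / (s * (s + z))) =
    z / (s * (s + z)) * (y * s - (s - 1 + z)).
    by field; rewrite !gt_eqF.
  by rewrite ys subrr mulr0.
rewrite subr_ge0 ler_pdivrMr ?mulr_gt0 // mulrC ler_pdivlMr ?mulr_gt0 //.
by rewrite mulrC.
Qed.

Lemma lam1 : lam 1 = 1.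
Proof. by rewrite /lam mul1r expr1; field; rewrite gt_eqF. Qed.

End Lambert.

Lemma bernoulli_le (R : realFieldType) (t : R) m : 0 <= t <= 1 ->
  1 - m%:R * t <= (1 - t) ^+ m.
Proof.
move=> /andP[t0 t1]; elim: m => [|m IH]; first by rewrite mul0r subr0.
rewrite exprS; have h : 0 <= 1 - t by rewrite subr_ge0.
apply: le_trans (ler_wpM2l h IH).
have mt : 0 <= m%:R * t ^+ 2 by rewrite mulr_ge0 ?sqr_ge0 ?ler0n.
rewrite -natr1 -subr_ge0.
have -> : (1 - t) * (1 - m%:R * t) - (1 - (m%:R + 1) * t) = m%:R * t ^+ 2 by ring.
by [].
Qed.

Lemma bernoulli_ge (R : realFieldType) (h : R) m : 0 <= h ->
  m%:R * h <= (1 + h) ^+ m.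
Proof.
move=> h0; suff : 1 + m%:R * h <= (1 + h) ^+ m by apply: le_trans; rewrite lerDr.
elim: m => [|m IH]; first by rewrite mul0r addr0.
have h1 : 0 <= 1 + h by rewrite addr_ge0.
rewrite exprS; apply: le_trans (ler_wpM2l h1 IH).
have mt : 0 <= m%:R * h ^+ 2 by rewrite mulr_ge0 ?sqr_ge0 ?ler0n.
rewrite -natr1 -subr_ge0.
have -> : (1 + h) * (1 + m%:R * h) - (1 + (m%:R + 1) * h) = m%:R * h ^+ 2 by ring.
by [].
Qed.

Section RealCase.
Variables (R : realType) (n : nat) (chi : nat -> R[i]).
Hypothesis Dchi : dirichlet n chi.
Hypothesis nontriv : exists2 b, coprime b n & chi b != 1.
Hypothesis chi2 : forall k, coprime k n -> chi k ^+ 2 = 1.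

Let x k : R := complex.Re (chi k).

Lemma realchar_values k : [\/ chi k = 0, chi k = 1 | chi k = -1].
Proof.
case: (boolP (coprime k n)) => co; last by constructor 1; apply: (dir0 Dchi).
have /eqP := chi2 co; rewrite sqrf_eq1 => /orP[] /eqP ->.
  by constructor 2.
by constructor 3.
Qed.

Lemma realcharE k : chi k = ((x k)%:C)%C.
Proof.
rewrite /x; case: (realchar_values k) => -> //=.
by rewrite rmorphN rmorph1.
Qed.

Let x1 : x 1%N = 1.
Proof. by rewrite /x (dir1 Dchi). Qed.

Let xM a b : x (a * b)%N = x a * x b.
Proof. by apply: complexI; rewrite rmorphM /= -!realcharE (dirM Dchi). Qed.

Let xv a : [\/ x a = 0, x a = 1 | x a = -1].
Proof.
rewrite /x; case: (realchar_values a) => ->; first by constructor 1.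
  by constructor 2.
by constructor 3.
Qed.

Lemma realchar_le1 a : `|x a| <= 1.
Proof. by case: (xv a) => ->; rewrite ?normrN ?normr1 ?normr0. Qed.

Lemma lambert_bound (C w : R) (D K : nat) : 0 < w < 1 -> (0 < D)%N -> (K ^ 2 <= D)%N ->
  modc (\sum_(1 <= k < D.+1) chi k / k%:R) <= C / D%:R ->
  forall y, y = w ^+ 2 ->
  \sum_(1 <= k < K.+1) y ^+ (k ^ 2) <=
    2 * n%:R + C / D%:R / (1 - y) + D%:R * y ^+ D / (1 - y) + D%:R ^+ 2 * y ^+ D.
Proof.
move=> w01 D0 KD hC y Ey.
have [w0 w1] := andP w01.
have y0 : 0 < y by rewrite Ey exprn_gt0.
have y1 : y < 1 by rewrite Ey expr_lt1 // ltW.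
have y1' : 0 < 1 - y by rewrite subr_gt0.
have yD k : 0 <= y ^+ k by rewrite exprn_ge0 // ltW.
apply: le_trans (divsum_squares x1 xM xv (ltW y0) KD) _.
rewrite -divsum_exchange.
set T := \sum_(1 <= d < D.+1) _.
pose S := \sum_(1 <= k < D.+1) x k / k%:R.
pose L := \sum_(1 <= k < D.+1) x k * lam w k.
pose E1 := \sum_(1 <= d < D.+1) x d * (y ^+ (d * D.+1) / (1 - y ^+ d)).
pose E2 := \sum_(1 <= d < D.+1) x d *
   (\sum_(1 <= e < D.+1 | (D < d * e)%N) y ^+ (d * e)).
have Ed d : (0 < d)%N -> y ^+ d / (1 - y ^+ d) =
   \sum_(1 <= e < D.+1 | (d * e <= D)%N) y ^+ (d * e)
   + \sum_(1 <= e < D.+1 | (D < d * e)%N) y ^+ (d * e)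
   + y ^+ (d * D.+1) / (1 - y ^+ d).
  move=> d0; have z1 : 1 - y ^+ d != 0.
    by rewrite subr_eq0 eq_sym lt_eqF // expr_lt1 // ltW.
  have -> : \sum_(1 <= e < D.+1 | (d * e <= D)%N) y ^+ (d * e)
   + \sum_(1 <= e < D.+1 | (D < d * e)%N) y ^+ (d * e) =
     \sum_(1 <= e < D.+1) (y ^+ d) ^+ e.
    rewrite [RHS](bigID (fun e => (d * e <= D)%N)) /=; congr (_ + _).
      by apply: eq_bigr => e _; rewrite exprM.
    by apply: eq_big => e; rewrite ?ltnNge // exprM.
  have G m : (1 - y ^+ d) * \sum_(1 <= e < m.+1) (y ^+ d) ^+ e = y ^+ d - (y ^+ d) ^+ m.+1.
    elim: m => [|m IH]; first by rewrite big_geq // mulr0 expr1 subrr.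
    by rewrite big_nat_recr //= mulrDr IH !exprS; ring.
  apply: (mulfI z1); rewrite mulrDr G exprM.
  by field.
(* Expanding y^d / (1 - y^d) geometrically in e, the pairs with d e <= D give [T], the terms with e
   > D give [E1], and the pairs with e <= D < d e give [E2]. *)
have ET : T = S / (1 - y) - L - E1 - E2.
  rewrite /T /S /L /E1 /E2 mulr_suml -!sumrB.
  apply: eq_big_nat => d /andP[d0 _].
  have dR : (0 : R) < d%:R by rewrite ltr0n.
  rewrite /lam -Ey (Ed d d0) invfM; ring.
have hL : - L <= 2 * n%:R.
  have [h1 h2] : L <= `|L| /\ - L <= `|L| by split; [exact: ler_norm|rewrite -normrN ler_norm].
  apply: le_trans h2 _; rewrite -modc_real.
  have -> : (L%:C)%C = \sum_(1 <= k < D.+1) chi k * ((lam w k.-1.+1)%:C)%C.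
    rewrite /L rmorph_sum /=; apply: eq_big_nat => -[|k] // _.
    by rewrite rmorphM /= -realcharE.
  apply: le_trans (dir_abel Dchi nontriv (b := fun k => lam w k.-1.+1) _ _ _) _.
  - by move=> [|k] // _; apply: lam_decr.
  - by move=> k; apply: lam_ge0.
  by rewrite lam1 // mulr1.
have hS : S / (1 - y) <= C / D%:R / (1 - y).
  apply: ler_wpM2r; first by rewrite invr_ge0 ltW.
  apply: le_trans (ler_norm _) _; rewrite -modc_real; apply: le_trans hC.
  rewrite /S rmorph_sum /= le_eqVlt; apply/orP; left; apply/eqP; congr modc.
  by apply: eq_bigr => k _; rewrite rmorphM /= fmorphV rmorph_nat -realcharE.
have hE1 : - E1 <= D%:R * y ^+ D / (1 - y).
  rewrite /E1 -sumrN; apply: (@le_trans _ _ (\sum_(1 <= d < D.+1) y ^+ D / (1 - y))).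
    apply: ler_sum_nat => d /andP[d0 _].
    have h : 0 < 1 - y ^+ d by rewrite subr_gt0 expr_lt1 // ltW.
    apply: le_trans (ler_norm _) _; rewrite normrN normrM.
    apply: (@le_trans _ _ `|y ^+ (d * D.+1) / (1 - y ^+ d)|).
      by rewrite ler_piMl // realchar_le1.
    rewrite ger0_norm ?divr_ge0 ?(ltW h) //.
    apply: ler_pM; rewrite ?invr_ge0 ?(ltW h) //.
      apply: ler_wiXn2l; rewrite ?(ltW y0) ?(ltW y1) //.
      by rewrite (leq_trans (leqnSn D)) // leq_pmull.
    rewrite lef_pV2 ?posrE // lerD2l lerN2 -[leRHS]expr1.
    by apply: ler_wiXn2l; rewrite ?(ltW y0) ?(ltW y1).
  by rewrite sumr_const_nat subn1 /= -mulrA mulr_natl.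
have hE2 : - E2 <= D%:R ^+ 2 * y ^+ D.
  rewrite /E2 -sumrN; apply: (@le_trans _ _ (\sum_(1 <= d < D.+1) D%:R * y ^+ D)).
    apply: ler_sum_nat => d /andP[d0 _].
    apply: le_trans (ler_norm _) _; rewrite normrN normrM.
    set Z := \sum_(_ <= _ < _ | _) _.
    have Z0 : 0 <= Z by apply: sumr_ge0.
    apply: (@le_trans _ _ `|Z|); first by rewrite ler_piMl // realchar_le1.
    rewrite ger0_norm // /Z; apply: (@le_trans _ _ (\sum_(1 <= e < D.+1) y ^+ D)).
      rewrite big_mkcond /=; apply: ler_sum => e _; case: ifP => // h.
      by apply: ler_wiXn2l; rewrite ?(ltW y0) ?(ltW y1) // ltnW.
    by rewrite sumr_const_nat subn1 /= mulr_natl.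
  by rewrite sumr_const_nat subn1 /= expr2 -mulrA [leRHS]mulr_natl.
rewrite ET; lra.
Qed.

Lemma L1_nonzero_real (C : R) : 0 < C ->
  (forall K, (0 < K)%N -> modc (\sum_(1 <= k < K.+1) chi k / k%:R) <= C / K%:R) -> False.
Proof.
move=> C0 hC.
(* The squares will contribute at least K/2 = 2 n + 5, while the upper bound will be 2 n + 1. *)
pose K := (4 * n + 10)%N; have K0 : (0 < K)%N by rewrite addn_gt0 orbT.
have KR : (0 : R) < K%:R by rewrite ltr0n.
pose t : R := (8 * K%:R ^+ 2)^-1.
have t8 : 0 < 8 * K%:R ^+ 2 :> R by rewrite mulr_gt0 // exprn_gt0.
have t0 : 0 < t by rewrite invr_gt0.
have t1 : t < 1.
  rewrite invf_lt1 // -natrX -natrM ltr1n (@leq_trans 8) //.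
  by rewrite leq_pmulr // expn_gt0 K0.
(* By Bernoulli y^(K^2) = (1 - t)^(4 K^2) is at least 1 - 4 K^2 t = 1/2. The fourth power serves
   once more below: Bernoulli for 1/v gives y^D = O(D^(-4)), which absorbs the factor D^2 in the
   error terms. *)
pose v : R := 1 - t; pose w := v ^+ 2; pose y := w ^+ 2.
have v0 : 0 < v by rewrite subr_gt0.
have v1 : v < 1 by rewrite gtrBl.
have w01 : 0 < w < 1 by rewrite exprn_gt0 //= expr_lt1 // ltW.
have [w0 w1] := andP w01.
have y0 : 0 < y by rewrite exprn_gt0.
have y1 : y < 1 by rewrite expr_lt1 // ltW.
have y1' : 0 < 1 - y by rewrite subr_gt0.
have low : K%:R / 2 <= \sum_(1 <= k < K.+1) y ^+ (k ^ 2).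
  apply: (@le_trans _ _ (\sum_(1 <= k < K.+1) 2^-1)).
    by rewrite sumr_const_nat subn1 /= mulr_natl.
  apply: ler_sum_nat => k /andP[k0 kK].
  apply: (@le_trans _ _ (y ^+ (K ^ 2))); last first.
    apply: ler_wiXn2l; rewrite ?(ltW y0) ?(ltW y1) //.
    by rewrite leq_exp2r.
  rewrite /y /w -!exprM; apply: le_trans (bernoulli_le _ _); last first.
    by rewrite (ltW t0) (ltW t1).
  rewrite natrM natrM natrX /t.
  have -> : 1 - 2 * (2 * K%:R ^+ 2) * (8 * K%:R ^+ 2)^-1 = 2^-1 :> R.
    by field; rewrite gt_eqF.
  by [].
pose h : R := v^-1 - 1.
have h0 : 0 < h by rewrite subr_gt0 invf_gt1.
have hv : 1 + h = v^-1 by rewrite /h addrC subrK.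
pose Q : R := C / (1 - y) + (h ^+ 4)^-1 / (1 - y) + (h ^+ 4)^-1.
have i1 : 0 <= (1 - y)^-1 by rewrite invr_ge0 ltW.
have i4 : 0 <= (h ^+ 4)^-1 by rewrite invr_ge0 exprn_ge0 // ltW.
have Q0 : 0 <= Q by rewrite !addr_ge0 ?mulr_ge0 ?(ltW C0).
pose D := maxn (K ^ 2) (Num.bound Q).
have D0 : (0 < D)%N by rewrite leq_max expn_gt0 K0.
have DR : (0 : R) < D%:R by rewrite ltr0n.
have D1 : 1 <= D%:R :> R by rewrite ler1n.
have QD : Q <= D%:R.
  apply: le_trans (ltW (archi_boundP Q0)) _; by rewrite ler_nat leq_maxr.
have KD : (K ^ 2 <= D)%N by rewrite leq_maxl.
have := lambert_bound w01 D0 KD (hC D D0) (erefl y).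
have yDle : y ^+ D <= (h ^+ 4)^-1 / D%:R ^+ 4.
  have -> : y ^+ D = (v ^+ D) ^+ 4.
    by rewrite -exprM (mulnC D 4) /y /w exprM; congr (_ ^+ D); ring.
  have -> : (h ^+ 4)^-1 / D%:R ^+ 4 = ((D%:R * h)^-1) ^+ 4.
    by field; rewrite !gt_eqF.
  apply: lerXn2r; rewrite ?nnegrE ?invr_ge0 ?mulr_ge0 ?exprn_ge0 ?(ltW v0) ?(ltW h0) ?(ltW DR) //.
  have := bernoulli_ge D (ltW h0); rewrite hv exprVn => hb.
  have vD : 0 < v ^+ D by rewrite exprn_gt0.
  by rewrite -[leLHS]invrK lef_pV2 ?posrE ?invr_gt0 ?mulr_gt0.
have hD1 : D%:R * y ^+ D / (1 - y) <= (h ^+ 4)^-1 / (1 - y) / D%:R.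
  rewrite -[leRHS]mulrAC; apply: ler_wpM2r => //.
  apply: le_trans (ler_wpM2l (ltW DR) yDle) _.
  have -> : D%:R * ((h ^+ 4)^-1 / D%:R ^+ 4) = (h ^+ 4)^-1 * (D%:R * (D%:R * D%:R))^-1.
    by field; rewrite !gt_eqF.
  apply: ler_wpM2l => //; rewrite lef_pV2 ?posrE ?mulr_gt0 // ler_peMr ?(ltW DR) //.
  by rewrite -[leLHS]mulr1; apply: ler_pM.
have hD2 : D%:R ^+ 2 * y ^+ D <= (h ^+ 4)^-1 / D%:R.
  apply: le_trans (ler_wpM2l (exprn_ge0 2 (ltW DR)) yDle) _.
  rewrite mulrCA ler_wpM2l //.
  have -> : D%:R ^+ 2 / D%:R ^+ 4 = (D%:R * D%:R)^-1 :> R by field; rewrite gt_eqF.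
  by rewrite lef_pV2 ?posrE ?mulr_gt0 // ler_peMr ?(ltW DR).
have hD3 : C / D%:R / (1 - y) = C / (1 - y) / D%:R by rewrite mulrAC.
have hQ : C / (1 - y) / D%:R + (h ^+ 4)^-1 / (1 - y) / D%:R + (h ^+ 4)^-1 / D%:R <= 1.
  have -> : C / (1 - y) / D%:R + (h ^+ 4)^-1 / (1 - y) / D%:R + (h ^+ 4)^-1 / D%:R = Q / D%:R.
    by rewrite /Q [in RHS]mulrDl [in RHS]mulrDl.
  by rewrite ler_pdivrMr // mul1r.
have : K%:R = 4 * n%:R + 10 :> R by rewrite /K natrD natrM.
move: low; clear -hD1 hD2 hD3 hQ; lra.
Qed.

End RealCase.

Lemma L1_nonzero (R : realType) n (chi : nat -> R[i]) (C : R) :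
  dirichlet n chi -> (exists2 b, coprime b n & chi b != 1) -> 0 < C ->
  (forall K, (0 < K)%N -> modc (\sum_(1 <= k < K.+1) chi k / k%:R) <= C / K%:R) -> False.
Proof.
move=> Dchi nt C0 hC.
have [h2|h2] := pselect (exists2 b, coprime b n & chi b ^+ 2 != 1).
  exact: (L1_nonzero_complex Dchi C0 hC h2).
apply: (L1_nonzero_real Dchi nt _ C0 hC) => k co; apply/eqP; apply: contra_notT h2 => h.
by exists k.
Qed.

(** * Logarithms of |1 - zeta^a| *)

Arguments zeta : simpl never.

Section Zeta.
Variable R : realType.

Lemma zetaX n a : zeta R n ^+ a = (cos (a%:R * (2 * pi / n%:R)) +i* sin (a%:R * (2 * pi / n%:R)))%C.
Proof.
elim: a => [|a IH]; first by rewrite expr0 mul0r cos0 sin0.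
rewrite exprS IH /zeta; set v := 2 * pi / _.
have -> : a.+1%:R * v = v + a%:R * v by rewrite -natr1 mulrDl mul1r addrC.
set u := a%:R * _; rewrite cosD sinD.
apply/eqP; rewrite eq_complex /=; apply/andP; split; apply/eqP; ring.
Qed.

Lemma cos_eq1_small (x : R) : 0 < x < 2 * pi -> cos x != 1.
Proof.
move=> /andP[x0 x2]; have [xp|px] := leP x pi.
  rewrite -[X in _ != X]cos0; apply/negP => /eqP /cos_inj.
  rewrite !in_itv /= lexx pi_ge0 xp (ltW x0) => /(_ isT isT) x00.
  by move: x0; rewrite x00 ltxx.
have -> : cos x = cos (2 * pi - x).
  by rewrite mulr_natl cosB cos2pi sin2pi mul1r mul0r addr0.
rewrite -[X in _ != X]cos0; apply/negP => /eqP /cos_inj; rewrite !in_itv /= lexx pi_ge0.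
by move=> /(_ ltac:(apply/andP; split; lra) isT); lra.
Qed.

Lemma zeta_prim n : (0 < n)%N -> n.-primitive_root (zeta R n).
Proof.
move=> n0; have nR : (0 : R) < n%:R by rewrite ltr0n.
have zn : zeta R n ^+ n = 1.
  rewrite zetaX; have -> : n%:R * (2 * pi / n%:R) = pi *+ 2 :> R.
    by rewrite mulr2n; field; rewrite gt_eqF.
  by rewrite cos2pi sin2pi.
have [k prk kn] := prim_order_exists n0 zn.
have k0 := prim_order_gt0 prk.
have [kE|kn'] := eqVneq k n; first by rewrite -[X in X.-primitive_root _]kE.
have lkn : (k < n)%N by rewrite ltn_neqAle kn' dvdn_leq.
have := prim_expr_order prk; rewrite zetaX => -[] /eqP h _; exfalso.
move: h; apply/negP; apply: cos_eq1_small.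
have kR : (0 : R) < k%:R by rewrite ltr0n.
rewrite !mulr_gt0 ?invr_gt0 ?pi_gt0 //=.
rewrite mulrCA -[ltRHS]mulr1 ltr_pM2l ?mulr_gt0 ?pi_gt0 //.
by rewrite ltr_pdivrMr // mul1r ltr_nat.
Qed.

Lemma modc_zetaX n a : modc (zeta R n ^+ a) = 1.
Proof.
rewrite modcX; have -> : modc (zeta R n) = 1; last by rewrite expr1n.
by apply/eqP; rewrite -(@eqrXn2 _ 2) ?modc_ge0 // modc_sqr /= cos2Dsin2 expr1n.
Qed.

Lemma zeta_neq0 n : zeta R n != 0.
Proof. by rewrite -modc_eq0 -[zeta R n]expr1 modc_zetaX oner_eq0. Qed.

Lemma zetaJ n : ((zeta R n)^*)%C = (zeta R n)^-1.
Proof.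
apply: (mulfI (zeta_neq0 n)).
by rewrite mulcJ -[zeta R n]expr1 modc_zetaX divff ?expr1n // expr1 zeta_neq0.
Qed.

Lemma zeta_mod n a : (0 < n)%N -> zeta R n ^+ (a %% n) = zeta R n ^+ a.
Proof. by move=> n0; apply: prim_expr_mod; apply: zeta_prim. Qed.

Lemma zeta_eq1 n a : (0 < n)%N -> (zeta R n ^+ a == 1) = (n %| a)%N.
Proof. by move=> n0; rewrite (prim_order_dvd (zeta_prim n0)). Qed.

Lemma zeta_expN n a : (0 < n)%N -> zeta R n ^+ (n.-1 * a) = ((zeta R n ^+ a)^*)%C.
Proof.
move=> n0; have -> : ((zeta R n ^+ a)^*)%C = (((zeta R n)^*)%C) ^+ a by rewrite rmorphXn.
rewrite exprM zetaJ; congr (_ ^+ _).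
apply: (mulfI (zeta_neq0 n)); rewrite -exprS prednK // divff ?zeta_neq0 //.
by apply/eqP; rewrite zeta_eq1.
Qed.

Definition lg n (a : nat) : R := ln (modc (1 - zeta R n ^+ a)).

Lemma lg_mod n a : (0 < n)%N -> lg n (a %% n) = lg n a.
Proof. by move=> n0; rewrite /lg zeta_mod. Qed.

Lemma lgN n a : (0 < n)%N -> lg n (n.-1 * a) = lg n a.
Proof.
by move=> n0; rewrite /lg zeta_expN // -modcJ rmorphB rmorph1 /= conjcK.
Qed.

(* The error term is estimated by integrating the derivative of the left-hand
   side in r. *)
Lemma ln_series_bound (th r : R) (K : nat) : 0 <= r < 1 ->
  `| 2^-1 * ln (1 - 2 * r * cos th + r ^+ 2) +
     \sum_(1 <= k < K.+1) r ^+ k * cos (k%:R * th) / k%:R |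
  <= 2 * r ^+ K / (1 - r) ^+ 2.
Proof.
move=> /andP[r0 r1].
have [->|rn0] := eqVneq r 0.
  rewrite mulr0 mul0r subr0 expr0n addr0 ln1 mulr0 add0r big_nat_cond big1.
    by rewrite normr0 !mulr_ge0 // ?exprn_ge0 // invr_ge0 sqr_ge0.
  by move=> k /andP[/andP[k0 _] _]; rewrite expr0n gtn_eqF // !mul0r.
have {}r0 : 0 < r by rewrite lt_def rn0.
set c := cos th.
pose Q (x : R) := 1 - 2 * x * c + x ^+ 2.
pose G j (x : R) := \sum_(1 <= k < j.+1) x ^+ k * cos (k%:R * th) / k%:R.
pose G' j (x : R) := \sum_(1 <= k < j.+1) x ^+ k.-1 * cos (k%:R * th).
have Qge (x : R) : 0 <= x -> (1 - x) ^+ 2 <= Q x.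
  move=> x0; rewrite /Q; have := cos_le1 th; rewrite -/c => c1.
  rewrite -subr_ge0; have -> : 1 - 2 * x * c + x ^+ 2 - (1 - x) ^+ 2 = 2 * x * (1 - c) by ring.
  by rewrite !mulr_ge0 // subr_ge0.
have dG j (x : R) : is_derive x 1 (G j) (G' j x).
  elim: j => [|j IH].
    have -> : G 0%N = cst 0 by apply/funext => y; rewrite /G big_geq.
    by rewrite /G' big_geq //; apply: is_derive_cst.
  have H1 := @is_deriveX R R (@id R) j.+1 x 1 1 (is_derive_id x 1).
  have H2 := is_deriveZ (cos (j.+1%:R * th) / j.+1%:R) H1.
  have H3 := is_deriveD IH H2.
  have -> : G j.+1 = G j + (cos (j.+1%:R * th) / j.+1%:R) \*: (@id R ^+ j.+1).
    apply/funext => y; rewrite /G big_nat_recr //= fctE /=.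
    by rewrite /GRing.scale /= exprfctE; congr (_ + _); ring.
  apply: is_derive_eq H3 _; rewrite /G' [in RHS]big_nat_recr //=; congr (_ + _).
  rewrite /GRing.scale /= mulr1; have : j.+1%:R != 0 :> R by rewrite pnatr_eq0.
  by move: (j.+1%:R : R) => J J0; field.
pose F (x : R) := 2^-1 * ln (Q x) + G K x.
pose F' (x : R) := (x - c) / Q x + G' K x.
have Q0 (x : R) : 0 <= x <= r -> 0 < Q x.
  move=> /andP[x0 xr]; apply: lt_le_trans (Qge x x0).
  by rewrite exprn_gt0 // subr_gt0 (le_lt_trans xr).
have dF (x : R) : 0 <= x <= r -> is_derive x 1 F (F' x).
  move=> hx.
  have dQ : is_derive x 1 Q (2 * (x - c)).
    have H1 := @is_deriveX R R (@id R) 2 x 1 1 (is_derive_id x 1).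
    have H2 := is_deriveZ (- (2 * c)) (is_derive_id x (1 : R)).
    have H3 := is_deriveD (is_deriveD (is_derive_cst (1 : R) x (1 : R)) H2) H1.
    have -> : Q = cst 1 + (- (2 * c)) \*: (@id R) + (@id R ^+ 2).
      apply/funext => y; rewrite /Q !fctE /= /GRing.scale /=; ring.
    by apply: is_derive_eq H3 _; rewrite /GRing.scale /= expr1; ring.
  have dl := is_derive1_comp (is_derive1_ln (Q0 x hx)) dQ.
  have H := is_deriveD (is_deriveZ (2^-1) dl) (dG K x).
  have -> : F = 2^-1 \*: (@ln R \o Q) + G K by apply/funext.
  apply: is_derive_eq H _; rewrite /GRing.scale /F' /=; congr (_ + _).
  by field; rewrite gt_eqF ?Q0.
have Fcont : {within `[0, r], continuous F}.
  apply: derivable_within_continuous => x; rewrite in_itv /= => hx.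
  by have [] := dF x hx.
have hd (x : R) : x \in `]0, r[ -> is_derive x 1 F (F' x).
  by rewrite in_itv /= => /andP[x0 xr]; apply: dF; rewrite !ltW.
have [xi] := MVT r0 hd Fcont.
rewrite in_itv /= => /andP[x0 xr].
have F0 : F 0 = 0.
  rewrite /F /Q /G mulr0 mul0r subr0 expr0n addr0 ln1 mulr0 add0r.
  rewrite big_nat_cond big1 // => k /andP[/andP[k0 _] _].
  by rewrite expr0n gtn_eqF // !mul0r.
rewrite F0 !subr0 => EF.
rewrite -/(F r) EF.
have hxi : 0 <= xi <= r by rewrite !ltW.
have Qx := Q0 xi hxi.
(* Multiplication by Q collapses the cosine sum, by the three-term recurrence of cos (j theta). The
   term c - xi cancels the derivative of the logarithm, so that [F'] is of size xi^K / Q. *)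
have sumE j : Q xi * G' j xi = c - xi - xi ^+ j * cos (j.+1%:R * th) + xi ^+ j.+1 * cos (j%:R * th).
  elim: j => [|j IH].
    by rewrite /G' big_geq // mulr0 expr0 mul0r cos0 mul1r expr1 mul1r /c; ring.
  rewrite /G' big_nat_recr //= mulrDr IH.
  have : cos (j.+2%:R * th) = 2 * c * cos (j.+1%:R * th) - cos (j%:R * th).
    have -> : j.+2%:R * th = j.+1%:R * th + th by rewrite -[j.+2%:R]natr1 mulrDl mul1r.
    have -> : j%:R * th = j.+1%:R * th - th by rewrite -[j.+1%:R]natr1 mulrDl mul1r addrK.
    rewrite cosD cosB /c; ring.
  move=> ->; rewrite /Q !exprS; ring.
have F'E : F' xi = (- xi ^+ K * cos (K.+1%:R * th) + xi ^+ K.+1 * cos (K%:R * th)) / Q xi.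
  rewrite /F'; apply: (mulIf (x := Q xi)); first by rewrite gt_eqF.
  rewrite divfK ?gt_eqF // mulrDl divfK ?gt_eqF // [G' K xi * _]mulrC sumE; ring.
have xk k : 0 <= xi ^+ k by rewrite exprn_ge0 // ltW.
have num : `|- xi ^+ K * cos (K.+1%:R * th) + xi ^+ K.+1 * cos (K%:R * th)| <= 2 * r ^+ K.
  apply: le_trans (ler_normD _ _) _; rewrite !normrM normrN !(ger0_norm (xk _)).
  have -> : 2 * r ^+ K = r ^+ K + r ^+ K by ring.
  have h1 : xi ^+ K <= r ^+ K by apply: lerXn2r; rewrite ?nnegrE ?(ltW x0) ?(ltW r0) ?(ltW xr).
  apply: lerD; first by apply: le_trans h1; rewrite ler_piMr ?cos_max.
  apply: le_trans h1; apply: (@le_trans _ _ (xi ^+ K.+1)); first by rewrite ler_piMr ?cos_max.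
  by rewrite exprS ler_piMl // ltW // (lt_trans xr).
rewrite F'E !normrM normfV (gtr0_norm r0) (gtr0_norm Qx).
have r1' : 0 < (1 - r) ^+ 2 by rewrite exprn_gt0 // subr_gt0.
have Qr : (1 - r) ^+ 2 <= Q xi.
  apply: le_trans (Qge xi (ltW x0)); apply: lerXn2r; rewrite ?nnegrE ?subr_ge0 ?(ltW r1) //.
    by rewrite ltW // (lt_trans xr).
  by rewrite lerD2l lerN2 ltW.
apply: (@le_trans _ _ (2 * r ^+ K / (1 - r) ^+ 2 * 1)); last by rewrite mulr1.
apply: ler_pM; rewrite ?(ltW r0) ?(ltW r1) ?mulr_ge0 ?invr_ge0 ?(ltW Qx) //.
apply: ler_pM; rewrite ?invr_ge0 ?(ltW Qx) //.
by rewrite lef_pV2 ?posrE.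
Qed.

End Zeta.

(** * From relations between logarithms to the vanishing of L(1, chi) *)

Section LogFourier.
Variables (R : realType) (n : nat).
Hypothesis n1 : (1 < n)%N.
Let n0 : (0 < n)%N. Proof. exact: ltnW. Qed.

Definition cosz (k : nat) : R := complex.Re (zeta R n ^+ k).

Lemma coszE k : cosz k = cos (k%:R * (2 * pi / n%:R)).
Proof. by rewrite /cosz zetaX. Qed.

Lemma cosz_sum s : \sum_(0 <= t < n) cosz (t * s) = if (n %| s)%N then n%:R else 0.
Proof.
rewrite big_mkord /cosz -(raddf_sum (@complex.Re R : Rcomplex R -> R)) /=.
under eq_bigr do rewrite mulnC exprM.
case: ifP => [|/negbT]; rewrite -(zeta_eq1 R) // => hs.
  rewrite (eqP hs); under eq_bigr do rewrite expr1n.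
  rewrite sumr_const card_ord.
  by have -> : (1 : R[i]) *+ n = ((n%:R : R)%:C)%C by rewrite rmorph_nat.
have : (zeta R n ^+ s - 1) * (\sum_(i < n) (zeta R n ^+ s) ^+ i) = 0.
  by rewrite -subrX1 -exprM mulnC exprM (prim_expr_order (zeta_prim R n0)) expr1n subrr.
by move/eqP; rewrite mulf_eq0 subr_eq0 (negPf hs) /= => /eqP ->.
Qed.

Lemma cosz_mul t u : cosz t * cosz u = 2^-1 * (cosz (t + u) + cosz (t + n.-1 * u)).
Proof.
rewrite /cosz !exprD zeta_expN //.
case: (zeta R n ^+ t) => a b; case: (zeta R n ^+ u) => c d /=; by field.
Qed.

Lemma cosz_corr j : \sum_(0 <= t < n) cosz t * cosz (t * j) =
  2^-1 * n%:R * ((n %| 1 + j)%N%:R + (n %| 1 + n.-1 * j)%N%:R).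
Proof.
under eq_bigr do rewrite cosz_mul.
rewrite -mulr_sumr big_split /=.
have -> : \sum_(0 <= t < n) cosz (t + t * j) = \sum_(0 <= t < n) cosz (t * (1 + j)).
  by apply: eq_bigr => t _; rewrite mulnDr muln1.
have -> : \sum_(0 <= t < n) cosz (t + n.-1 * (t * j)) = \sum_(0 <= t < n) cosz (t * (1 + n.-1 * j)).
  by apply: eq_bigr => t _; rewrite mulnDr muln1 mulnCA.
rewrite !cosz_sum; case: (n %| 1 + j)%N; case: (n %| 1 + n.-1 * j)%N => /=; ring.
Qed.

(** This is ln |1 - r zeta^b|: for r < 1 the series of [ln_series_bound] converges geometrically,
    and r will tend to 1. *)
Definition lgr (r : R) (b : nat) : R := 2^-1 * ln (1 - 2 * r * cosz b + r ^+ 2).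

Lemma modc_1zeta b : modc (1 - zeta R n ^+ b) ^+ 2 = 2 - 2 * cosz b.
Proof.
rewrite modc_sqr coszE zetaX /=; set x := _ * _.
have := cos2Dsin2 x; lra.
Qed.

Lemma lgr1 b : ~~ (n %| b)%N -> lg R n b = lgr 1 b.
Proof.
rewrite -(zeta_eq1 R) // eq_sym -subr_eq0 -modc_gt0 => h.
rewrite /lgr expr1n mulr1.
have -> : 1 - 2 * cosz b + 1 = modc (1 - zeta R n ^+ b) ^+ 2 by rewrite modc_1zeta; ring.
by rewrite lnXn // -mulr_natr /lg; field.
Qed.

Lemma ln_lip (x y : R) : 0 < x -> 0 < y -> ln x - ln y <= (x - y) / y.
Proof.
move=> x0 y0; rewrite -ln_div ?posrE //.
have -> : x / y = 1 + (x - y) / y by field; rewrite gt_eqF.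
by apply: le_ln1Dx; rewrite mulrBl divff ?gt_eqF // ltrBrDr addNr divr_gt0.
Qed.

Definition lipc (b : nat) : R := (2 - 2 * cosz b)^-1 + 2.

Lemma lipc_ge0 b : 0 <= lipc b.
Proof. by rewrite addr_ge0 // invr_ge0 -modc_1zeta sqr_ge0. Qed.

Lemma lgr_lip r b : 2^-1 <= r < 1 -> ~~ (n %| b)%N ->
  `|lgr r b - lg R n b| <= lipc b * (1 - r).
Proof.
move=> /andP[r2 r1] nb; rewrite (lgr1 nb) /lgr expr1n mulr1 -mulrBr normrM ger0_norm //.
have m2 : 0 < 2 - 2 * cosz b.
  rewrite -modc_1zeta exprn_gt0 // modc_gt0 subr_eq0 eq_sym zeta_eq1 //.
rewrite /lipc; have -> : 1 - 2 * cosz b + 1 = 2 - 2 * cosz b by ring.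
have -> : 1 - 2 * r * cosz b + r ^+ 2 = (1 - r) ^+ 2 + r * (2 - 2 * cosz b) by ring.
set m := 2 - _ in m2 *; set u := _ + r * m.
have r0 : 0 < r by apply: lt_le_trans r2.
have s0 : 0 < 1 - r by rewrite subr_gt0.
have um : m / 2 <= u.
  rewrite /u; have := sqr_ge0 (1 - r); have := ler_wpM2r (ltW m2) r2; lra.
have u0 : 0 < u by apply: lt_le_trans um; rewrite divr_gt0.
have h1 : ln u - ln m <= m^-1 * (1 - r).
  apply: le_trans (ln_lip u0 m2) _; rewrite mulrC ler_pM2l ?invr_gt0 //.
  rewrite /u expr2; have := ler_wpM2l (ltW s0) (ltW r1); have := ler_wpM2r (ltW m2) (ltW r1).
  have := mulr_ge0 (ltW s0) (ltW r0); lra.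
have h2 : ln m - ln u <= 2 * (1 - r).
  apply: le_trans (ln_lip m2 u0) _; rewrite ler_pdivrMr //.
  have : m - u <= m * (1 - r) by rewrite /u; have := sqr_ge0 (1 - r); lra.
  have := ler_wpM2r (ltW s0) um; lra.
have i0 : 0 < m^-1 by rewrite invr_gt0.
have i1 := mulr_gt0 i0 s0.
rewrite mulrDl; apply: (@le_trans _ _ `|ln u - ln m|).
  by rewrite ler_piMl // invf_le1 // ler1n.
by rewrite ler_norml; apply/andP; split; lra.
Qed.

Variable chi : nat -> R[i].
Hypothesis Dchi : dirichlet n chi.
Hypothesis nontriv : exists2 b, coprime b n & chi b != 1.
Hypothesis chi_even : chi n.-1 = 1.

Definition conjchar (k : nat) : R[i] := ((chi k)^*)%C.

Lemma conjchar_dirichlet : dirichlet n conjchar.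
Proof.
split; rewrite /conjchar.
- exact: dir_n Dchi.
- by rewrite (dir1 Dchi) conjc1.
- by move=> a b; rewrite (dirM Dchi) rmorphM.
- by move=> a; rewrite (dirP Dchi).
- by move=> a co; rewrite (dir0 Dchi co) conjc0.
Qed.

Lemma conjchar_nontriv : exists2 b, coprime b n & conjchar b != 1.
Proof.
have [b co h] := nontriv; exists b => //; apply: contra h => /eqP h.
by rewrite -[chi b]conjcK -/(conjchar b) h conjc1.
Qed.

(** The divisibility says that k a is 1 modulo n, so the sum picks the value of chi at the inverse
    of k. *)
Lemma inverse_char_sum k :
  \sum_(0 <= a < n) chi a * (n %| 1 + n.-1 * (k * a))%N%:R = conjchar k.
Proof.
have E j : (n %| 1 + n.-1 * j)%N = (j == 1 %[mod n])%N.
  rewrite -(eqn_modDl (n.-1 * j)%N) -mulSnr prednK // modnMr.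
  by rewrite eq_sym /dvdn addnC.
under eq_bigr do rewrite E.
case: (boolP (coprime k n)) => co; last first.
  rewrite big1_seq /conjchar ?(dir0 Dchi co) ?conjc0 // => a _.
  rewrite [(_ == _)](_ : _ = false) ?mulr0 //; apply: contraNF co => /eqP h.
  have : coprime (k * a) n by rewrite -coprime_modl h coprime_modl coprime1n.
  by rewrite coprimeMl => /andP[].
pose k' := (k ^ (totient n).-1)%N.
have t0 : (0 < totient n)%N by rewrite totient_gt0.
have kk' : (k * k' = 1 %[mod n])%N by rewrite -expnS prednK // Euler_exp_totient.
have cok' : coprime k' n by rewrite coprimeXl.
rewrite -(sum_residues_mul (F := fun a => chi a * (k * a == 1 %[mod n])%N%:R) n0 cok'); last first.
  by move=> a; rewrite (dir_mod Dchi) -[X in (X == _)]modnMmr modn_mod modnMmr.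

rewrite big_mkord (bigD1 (Ordinal n1)) //= big1 ?addr0; last first.
  move=> a; rewrite -val_eqE /= => a1; rewrite mulnA -modnMml kk' modnMml mul1n.
  by rewrite !modn_small // (negPf a1) mulr0.
rewrite muln1 kk' eqxx mulr1 /k' (dirX Dchi).
by apply: (dir_conj Dchi) => //; apply: (dir_totient Dchi).
Qed.

Lemma inverse_char_sum_neg k :
  \sum_(0 <= a < n) chi a * (n %| 1 + k * a)%N%:R = conjchar k.
Proof.
have con : coprime n.-1 n by rewrite coprimePn.
rewrite -(sum_residues_mul (F := fun a => chi a * (n %| 1 + k * a)%N%:R) n0 con).
  rewrite -inverse_char_sum; apply: eq_bigr => a _.
  by rewrite (dirM Dchi) chi_even mul1r mulnCA.
move=> a; rewrite (dir_mod Dchi); congr (_ * _%:R).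
by rewrite /dvdn -modnDmr modnMmr modnDmr.
Qed.

Hypothesis hlog : forall t, ~~ (n %| t)%N ->
  \sum_(0 <= a < n) chi a * ((lg R n (a * t))%:C)%C = 0.

(** Averaging against [cosz t] keeps, in the cosine series of [lgr r (a * t)], the frequencies k for
    which k a is 1 or -1 modulo n, and so produces conj(chi) k r^k / k with the factor -n. It takes
    the place of a Gauss sum, which may vanish when chi is imprimitive; the price is that the
    relations [hlog] are needed at all t. *)
Definition twist (r : R) : R[i] :=
  \sum_(0 <= t < n) ((cosz t)%:C)%C * \sum_(0 <= a < n) chi a * ((lgr r (a * t))%:C)%C.

Lemma cosz_le1 k : `|cosz k| <= 1.
Proof. by rewrite coszE cos_max. Qed.

Lemma twist_small : exists2 M, 0 <= M & forall r, 2^-1 <= r < 1 -> modc (twist r) <= M * (1 - r).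
Proof.
exists (\sum_(0 <= t < n) \sum_(0 <= a < n) lipc (a * t)).
  by apply: sumr_ge0 => t _; apply: sumr_ge0 => a _; apply: lipc_ge0.
move=> r hr; have s0 : 0 <= 1 - r by case/andP: hr => _ ?; rewrite subr_ge0 ltW.
rewrite mulr_suml; apply: le_trans (modc_sum _ _ _) _.
apply: ler_sum_nat => t /andP[_ tn]; rewrite modcM modc_real.
apply: (@le_trans _ _ (modc (\sum_(0 <= a < n) chi a * ((lgr r (a * t))%:C)%C))).
  by rewrite ler_piMl ?modc_ge0 ?cosz_le1.
(* At t = 0 the logarithm does not depend on a, and the vanishing sum of chi replaces [hlog]. *)
have [->|t0] := eqVneq t 0%N.
  under eq_bigr do rewrite muln0.
  rewrite -mulr_suml (dir_sum0 Dchi nontriv) mul0r modc0.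
  by rewrite mulr_ge0 // sumr_ge0 // => a _; apply: lipc_ge0.
have nt : ~~ (n %| t)%N by rewrite gtnNdvd // lt0n.
have -> : \sum_(0 <= a < n) chi a * ((lgr r (a * t))%:C)%C =
    \sum_(0 <= a < n) chi a * ((lgr r (a * t) - lg R n (a * t))%:C)%C.
  under [RHS]eq_bigr do rewrite rmorphB /= mulrBr.
  by rewrite sumrB hlog // subr0.
rewrite mulr_suml; apply: le_trans (modc_sum _ _ _) _.
apply: ler_sum => a _; rewrite modcM modc_real.
case: (boolP (coprime a n)) => co; last first.
  by rewrite (dir0 Dchi co) modc0 mul0r mulr_ge0 ?lipc_ge0.
rewrite (dir_modc Dchi co) mul1r; apply: lgr_lip => //.
by rewrite Gauss_dvdr // coprime_sym.
Qed.

Lemma twist_series r K : 0 <= r < 1 ->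
  modc (twist r + n%:R * \sum_(1 <= k < K.+1) conjchar k * ((r ^+ k / k%:R)%:C)%C)
  <= n%:R ^+ 2 * (2 * r ^+ K / (1 - r) ^+ 2).
Proof.
move=> hr.
have -> : n%:R * \sum_(1 <= k < K.+1) conjchar k * ((r ^+ k / k%:R)%:C)%C =
  \sum_(0 <= t < n) ((cosz t)%:C)%C * \sum_(0 <= a < n) chi a *
     ((\sum_(1 <= k < K.+1) r ^+ k * cosz (k * (a * t)) / k%:R)%:C)%C.
  have E k : n%:R * conjchar k = \sum_(0 <= a < n) chi a *
      ((\sum_(0 <= t < n) cosz t * cosz (t * (k * a)))%:C)%C.
    under eq_bigr do rewrite cosz_corr.
    transitivity ((2^-1 * n%:R) * (\sum_(0 <= a < n) chi a * (n %| 1 + k * a)%N%:R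
        + \sum_(0 <= a < n) chi a * (n %| 1 + n.-1 * (k * a))%N%:R) : R[i]).
      by rewrite inverse_char_sum inverse_char_sum_neg; field.
    rewrite -big_split mulr_sumr /=; apply: eq_bigr => a _.
    by rewrite !rmorphM rmorphD /= fmorphV !rmorph_nat; ring.
  transitivity (\sum_(1 <= k < K.+1) \sum_(0 <= a < n) \sum_(0 <= t < n)
     chi a * ((cosz t * cosz (t * (k * a)))%:C)%C * ((r ^+ k / k%:R)%:C)%C).
    rewrite mulr_sumr; apply: eq_bigr => k _; rewrite mulrA E mulr_suml.
    by apply: eq_bigr => a _; rewrite rmorph_sum /= mulr_sumr mulr_suml.
  under [RHS]eq_bigr do rewrite mulr_sumr.
  rewrite exchange_big /= [RHS]exchange_big /=; apply: eq_bigr => a _.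
  rewrite exchange_big /=; apply: eq_bigr => t _.
  rewrite rmorph_sum /= !mulr_sumr; apply: eq_bigr => k _.
  have -> : (t * (k * a) = k * (a * t))%N by rewrite mulnCA [(t * a)%N]mulnC.
  by rewrite !rmorphM /=; ring.
rewrite /twist -big_split /=.
apply: le_trans (modc_sum _ _ _) _.
set e := 2 * r ^+ K / _.
have e0 : 0 <= e.
  case/andP: hr => r0 r1.
  by rewrite !mulr_ge0 ?exprn_ge0 ?invr_ge0 // sqr_ge0.
apply: (@le_trans _ _ (\sum_(0 <= t < n) n%:R * e)); last first.
  by rewrite sumr_const_nat subn0 -[leLHS]mulr_natl expr2 mulrA.
apply: ler_sum => t _; rewrite -mulrDr modcM modc_real.
set X := (X in _ * modc X).
apply: (@le_trans _ _ (modc X)); first by rewrite ler_piMl ?modc_ge0 ?cosz_le1.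
rewrite /X -big_split /=; apply: le_trans (modc_sum _ _ _) _.
apply: (@le_trans _ _ (\sum_(0 <= a < n) e)); last first.
  by rewrite sumr_const_nat subn0 mulr_natl.
apply: ler_sum => a _; rewrite -mulrDr -rmorphD modcM modc_real.
apply: le_trans (_ : 1 * `|_| <= _).
  by apply: ler_wpM2r => //; apply: dir_modc_le1 Dchi _.
rewrite mul1r; have := ln_series_bound ((a * t)%:R * (2 * pi / n%:R)) K hr.
rewrite -/e -coszE; congr (`|_ + _| <= _); apply: eq_bigr => k _.
by rewrite coszE (natrM _ k) mulrA.
Qed.

(** An Abelian argument with explicit errors: the power series of conj(chi) k / k is O(1 - r) by
    [twist_small] and [twist_series], it differs from its value at r = 1 by O(1 - r), and the tail
    beyond K is at most 2 n / K. This last bound is the constant given to [L1_nonzero]. *)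
Lemma even_char_contra : False.
Proof.
apply: (L1_nonzero conjchar_dirichlet conjchar_nontriv (C := 2 * n%:R)).
  by rewrite mulr_gt0 // ltr0n.
move=> K K0; have KR : (0 : R) < K%:R by rewrite ltr0n.
have nR : (0 : R) < n%:R by rewrite ltr0n.
apply/ler_addgt0Pr => d d0.
have [M M0 hM] := twist_small.
pose S j := \sum_(1 <= k < j.+1) conjchar k / k%:R.
have hS j r : 2^-1 <= r < 1 ->
    modc (S j) <= (M + 2 * n%:R) * (1 - r) + n%:R * (2 * r ^+ j / (1 - r) ^+ 2).
  move=> hr; have [r2 r1] := andP hr.
  have r0 : 0 < r by apply: lt_le_trans r2.
  have hr' : 0 <= r < 1 by rewrite r1 ltW.
  have h1 := twist_series j hr'; have h2 := hM r hr.
  set T := \sum_(1 <= k < j.+1) _ in h1.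
  (* The weights (1 - r^k) / k equal 1 - r times the mean of the first k powers of r, and these
     means decrease, so that Abel summation applies. *)
  have ST : modc (S j - T) <= 2 * n%:R * (1 - r).
    have -> : S j - T = \sum_(1 <= k < j.+1) conjchar k *
         ((((1 - r) * (\sum_(i < k.-1.+1) r ^+ i) / k.-1.+1%:R))%:C)%C.
      rewrite /S /T -sumrB; apply: eq_big_nat => -[|k] // _ /=.
      rewrite -mulrBr; congr (_ * _).
      rewrite -(rmorph_nat (real_complex R)) -fmorphV -rmorphB /=; congr (_ %:C)%C.
      rewrite -[X in X - _]mul1r -mulrBl; congr (_ / _).
      by rewrite -opprB subrX1 -mulNr opprB.
    have -> : 2 * n%:R * (1 - r) = 2 * n%:R * ((1 - r) * (\sum_(i < 1.-1.+1) r ^+ i) / 1.-1.+1%:R).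
      by rewrite /= big_ord1 expr0 mulr1 divr1.
    apply: (dir_abel conjchar_dirichlet conjchar_nontriv (b := fun k =>
       (1 - r) * (\sum_(i < k.-1.+1) r ^+ i) / k.-1.+1%:R)).
      move=> [|k] // _ /=; rewrite -!mulrA; apply: ler_wpM2l; first by rewrite subr_ge0 ltW.
      have k1 : (0 : R) < k.+1%:R by rewrite ltr0n.
      have k2 : (0 : R) < k.+2%:R by rewrite ltr0n.
      rewrite ler_pdivrMr // mulrAC ler_pdivlMr // [X in X * _]big_ord_recr /=.
      rewrite -[k.+2%:R]natr1 mulrDl mulrDr mulr1 lerD2l.
      apply: (@le_trans _ _ (\sum_(i < k.+1) r ^+ k.+1)).
        by rewrite sumr_const card_ord mulr_natr.
      apply: ler_sum => i _; apply: ler_wiXn2l; rewrite ?(ltW r0) ?(ltW r1) //.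
      exact/ltnW/ltn_ord.
    move=> k; rewrite divr_ge0 // mulr_ge0 ?subr_ge0 ?(ltW r1) //.
    by apply: sumr_ge0 => i _; rewrite exprn_ge0 // ltW.
  have nT : n%:R * modc T <= M * (1 - r) + n%:R ^+ 2 * (2 * r ^+ j / (1 - r) ^+ 2).
    have -> : n%:R * modc T = modc (n%:R * T).
      rewrite modcM; congr (_ * _); rewrite -(rmorph_nat (real_complex R)) modc_real.
      by rewrite ger0_norm // ler0n.
    have -> : n%:R * T = (twist r + n%:R * T) - twist r by ring.
    apply: le_trans (modcBD _ _) _; lra.
  have T1 : modc T <= M * (1 - r) + n%:R * (2 * r ^+ j / (1 - r) ^+ 2).
    rewrite -(ler_pM2l nR); apply: le_trans nT _.
    have -> : n%:R * (M * (1 - r) + n%:R * (2 * r ^+ j / (1 - r) ^+ 2)) =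
      n%:R * (M * (1 - r)) + n%:R ^+ 2 * (2 * r ^+ j / (1 - r) ^+ 2) by ring.
    rewrite lerD2r ler_peMl ?ler1n //.
    by rewrite mulr_ge0 // subr_ge0 ltW.
  have -> : S j = (S j - T) + T by ring.
  apply: le_trans (modcD _ _) _; lra.
have Stail j : (K <= j)%N -> modc (S K) <= 2 * n%:R / K%:R + modc (S j).
  move=> Kj; have -> : S K = - (\sum_(K.+1 <= k < j.+1) conjchar k / k%:R) + S j.
    have -> : S j = S K + \sum_(K.+1 <= k < j.+1) conjchar k / k%:R.
      by rewrite /S (big_cat_nat (n := K.+1)).
    by rewrite addrCA addNr addr0.
  apply: le_trans (modcD _ _) _; rewrite lerD2r modcN.
  have -> : \sum_(K.+1 <= k < j.+1) conjchar k / k%:R =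
     \sum_(K.+1 <= k < j.+1) conjchar k * (((k%:R)^-1)%:C)%C.
    by apply: eq_bigr => k _; rewrite fmorphV rmorph_nat.
  apply: le_trans (dir_abel conjchar_dirichlet conjchar_nontriv (b := fun k => (k%:R)^-1) _ _ _) _.
  - move=> k Kk; rewrite lef_pV2 ?posrE ?ltr0n ?ler_nat //.
    by apply: leq_trans Kk.
  - by move=> k; rewrite invr_ge0 ler0n.
  rewrite ler_pM2l ?mulr_gt0 // lef_pV2 ?posrE ?ltr0n ?ler_nat //.
have A0 : 0 < M + 2 * n%:R by rewrite ltr_wpDl // mulr_gt0.
(* [s] is the future 1 - r: at most 1/2, and so small that the error linear in 1 - r is at most d/2.
   Only then is j chosen, large enough for the geometric error. *)
pose s : R := (2 + d^-1 * (2 * (M + 2 * n%:R)))^-1.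
have B0 : 0 < d^-1 * (2 * (M + 2 * n%:R)) by rewrite !mulr_gt0 ?invr_gt0.
have s0 : 0 < s by rewrite invr_gt0 addr_gt0.
have s2 : s <= 2^-1 by rewrite lef_pV2 ?posrE ?addr_gt0 // lerDl ltW.
have sd : (M + 2 * n%:R) * s <= d / 2.
  rewrite /s ler_pdivrMr ?addr_gt0 //.
  have -> : d / 2 * (2 + d^-1 * (2 * (M + 2 * n%:R))) = d + (M + 2 * n%:R).
    by field; rewrite gt_eqF.
  by rewrite lerDr ltW.
pose r := 1 - s; have r0 : 0 < r by rewrite /r; lra.
have hr : 2^-1 <= r < 1 by rewrite /r; apply/andP; split; lra.
have r1 : 1 - r = s by rewrite /r; ring.
pose h : R := r^-1 - 1.
have h0 : 0 < h by rewrite subr_gt0 invf_gt1 //; case/andP: hr.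
pose Z : R := n%:R * (2 * (h^-1 / s ^+ 2)) * 2 / d.
have Z0 : 0 <= Z by rewrite !mulr_ge0 ?invr_ge0 ?exprn_ge0 ?(ltW h0) ?(ltW s0) ?(ltW d0) ?ler0n.
pose j := maxn K (Num.bound Z).
have j0 : (0 < j)%N by rewrite leq_max K0.
have jR : (0 : R) < j%:R by rewrite ltr0n.
have Kj : (K <= j)%N by rewrite leq_maxl.
have Zj : Z <= j%:R.
  by apply: le_trans (ltW (archi_boundP Z0)) _; rewrite ler_nat leq_maxr.
apply: le_trans (Stail j Kj) _; rewrite lerD2l; apply: le_trans (hS j r hr) _.
rewrite r1; have -> : d = d / 2 + d / 2 by field.
apply: lerD => //.
have rj : r ^+ j <= h^-1 / j%:R.
  have := bernoulli_ge j (ltW h0).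
  have -> : 1 + h = r^-1 by rewrite /h addrC subrK.
  rewrite exprVn => hb.
  have rj0 : 0 < r ^+ j by rewrite exprn_gt0.
  rewrite -invfM -[leLHS]invrK lef_pV2 ?posrE ?invr_gt0 ?mulr_gt0 //.
  by rewrite mulrC.
have s20 : 0 <= (s ^+ 2)^-1 by rewrite invr_ge0 sqr_ge0.
apply: (@le_trans _ _ (n%:R * (2 * (h^-1 / j%:R) / s ^+ 2))).
  by apply: ler_wpM2l; [rewrite ler0n|apply: ler_wpM2r => //; apply: ler_wpM2l].
have -> : n%:R * (2 * (h^-1 / j%:R) / s ^+ 2) = Z / j%:R * (d / 2).
  by rewrite /Z; field; rewrite !gt_eqF.
rewrite ler_piMl ?divr_ge0 ?(ltW d0) //.
by rewrite ler_pdivrMr // mul1r.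
Qed.

End LogFourier.

(** * Kernel of the matrix of logarithms, by characters of the units *)

Section LogKernel.
Variables (R : realType) (n : nat).
Hypothesis n1 : (1 < n)%N.
Let n0 : (0 < n)%N. Proof. exact: ltnW. Qed.

Lemma coprime_inverse b : coprime b n ->
  exists2 b', coprime b' n & (b * b' = 1 %[mod n])%N.
Proof.
move=> co; exists (b ^ (totient n).-1)%N; first by rewrite coprimeXl.
by rewrite -expnS prednK ?totient_gt0 // Euler_exp_totient.
Qed.

Definition logker (f : nat -> R[i]) :=
  [/\ forall a, f (a %% n)%N = f a,
      forall a, ~~ coprime a n -> f a = 0,
      forall a, f (n.-1 * a)%N = f a,
      \sum_(0 <= a < n) f a = 0
    & forall t, ~~ (n %| t)%N -> \sum_(0 <= a < n) f a * ((lg R n (a * t))%:C)%C = 0].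

Lemma logker_translates (f : nat -> R[i]) (N m : nat) (w : nat -> R[i]) :
  coprime m n -> logker f ->
  logker (fun k => \sum_(l < N) w l * f (m ^ l * k)%N).
Proof.
move=> com [fmod fcop feven fsum flog].
have com' l : coprime (m ^ l) n by rewrite coprimeXl.
split.
- by move=> a; apply: eq_bigr => l _; rewrite -fmod modnMmr fmod.
- move=> a co; rewrite big1 // => l _; rewrite fcop ?mulr0 //.
  by rewrite coprimeMl com'.
- by move=> a; apply: eq_bigr => l _; rewrite mulnCA feven.
- rewrite exchange_big big1 //= => l _.
  by rewrite -mulr_sumr (sum_residues_mul n0 (com' l) fmod) fsum mulr0.
move=> t nt; under eq_bigr do rewrite mulr_suml.
rewrite exchange_big big1 //= => l _.
have [b' cob' bb'] := coprime_inverse (com' l).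
pose F a := f a * ((lg R n (a * (b' * t)))%:C)%C.
have Fmod a : F (a %% n)%N = F a.
  by rewrite /F fmod -[in LHS]lg_mod // modnMml lg_mod.
have FE a : w l * f (m ^ l * a)%N * ((lg R n (a * t))%:C)%C = w l * F (m ^ l * a)%N.
  rewrite /F -mulrA; congr (_ * (_ * (_ %:C)%C)).
  have -> : (m ^ l * a * (b' * t) = m ^ l * b' * (a * t))%N by rewrite mulnACA.
  by rewrite -[RHS]lg_mod // -modnMml bb' modnMml mul1n lg_mod.
under eq_bigr do rewrite FE.
rewrite -mulr_sumr (sum_residues_mul n0 (com' l) Fmod) /F flog ?mulr0 //.
by rewrite Gauss_dvdr // coprime_sym.
Qed.

(** [F i] projects f, up to a factor, to an eigenspace of the translation by m, whose order divides
    [totient n]. The [F i] add up to a multiple of f, so that one of them is nonzero at [k0];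
    translations commute, which keeps the earlier eigenvalues. *)
Lemma logker_eigen_step (f : nat -> R[i]) m k0 : coprime m n -> logker f -> f k0 != 0 ->
  exists f', [/\ logker f', f' k0 != 0, (exists z, forall k, f' (m * k)%N = z * f' k)
    & forall m2 z, (forall k, f (m2 * k)%N = z * f k) -> forall k, f' (m2 * k)%N = z * f' k].
Proof.
move=> com fK fk.
set N := totient n; have N0 : (0 < N)%N by rewrite totient_gt0.
pose om := zeta R N.
have omN : om ^+ N = 1 by apply/eqP; rewrite zeta_eq1.
pose F i k : R[i] := \sum_(l < N) (om ^+ i) ^+ l * f (m ^ l * k)%N.
have sumF : \sum_(i < N) F i k0 = N%:R * f k0.
  rewrite /F exchange_big /= (bigD1 (Ordinal N0)) //= expn0 mul1n.
  under eq_bigr do rewrite expr0 mul1r.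
  rewrite sumr_const card_ord -[f k0 *+ N]mulr_natl big1 ?addr0 // => l l0.
  rewrite -mulr_suml.
  have h : om ^+ l != 1 by rewrite zeta_eq1 // gtnNdvd // lt0n.
  have : (om ^+ l - 1) * (\sum_(i < N) (om ^+ l) ^+ i) = 0.
    by rewrite -subrX1 -exprM mulnC exprM omN expr1n subrr.
  move/eqP; rewrite mulf_eq0 subr_eq0 (negPf h) /= => /eqP E.
  have -> : \sum_(i < N) (om ^+ i) ^+ l = \sum_(i < N) (om ^+ l) ^+ i.
    by apply: eq_bigr => i _; rewrite -!exprM mulnC.
  by rewrite E mul0r.
have [i Fi] : exists i : 'I_N, F i k0 != 0.
  apply/existsP; apply: contraT => /existsPn h.
  have : N%:R * f k0 = 0.
    by rewrite -sumF big1 // => i _; apply/eqP; have := h i; rewrite negbK.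
  by move/eqP; rewrite mulf_eq0 (negPf fk) pnatr_eq0 orbF => /eqP N00; rewrite N00 in N0.
exists (F i); split => //.
- exact: logker_translates.
- exists (om ^+ i)^-1 => k.
  have z0 : om ^+ i != 0 by rewrite expf_neq0 // zeta_neq0.
  apply: (mulfI z0); rewrite mulVKf // /F mulr_sumr.
  have [fmod _ _ _ _] := fK.
  pose G l : R[i] := (om ^+ i) ^+ l * f (m ^ l * k)%N.
  transitivity (\sum_(l < N) G l.+1).
    by apply: eq_bigr => l _; rewrite /G exprS mulrA expnSr mulnA.
  have GN : G N = G 0%N.
    rewrite /G -exprM mulnC exprM omN expr1n expr0 expn0 mul1n !mul1r.
    by rewrite -fmod -modnMml Euler_exp_totient // modnMml mul1n fmod.
  apply: (addrI (G 0%N)); transitivity (\sum_(l < N.+1) G l).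
    by rewrite big_ord_recl.
  by rewrite big_ord_recr /= GN addrC.
move=> m2 z h k; rewrite /F mulr_sumr; apply: eq_bigr => l _.
by rewrite mulnCA h mulrCA.
Qed.

Lemma logker_eigen (ms : seq nat) (f : nat -> R[i]) k0 :
  all (fun m => coprime m n) ms -> logker f -> f k0 != 0 ->
  exists f', [/\ logker f', f' k0 != 0
    & forall m, m \in ms -> exists z, forall k, f' (m * k)%N = z * f' k].
Proof.
elim: ms f => [|m ms IH] f /=; first by move=> _ fK fk; exists f; split.
move=> /andP[com coms] fK fk.
have [f1 [f1K f1k eig]] := IH f coms fK fk.
have [f2 [f2K f2k eig2 pres]] := logker_eigen_step com f1K f1k.
exists f2; split => // m'; rewrite inE => /orP[/eqP -> //|hm].
by have [z hz] := eig m' hm; exists z; apply: pres.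
Qed.

(** A common eigenvector of all unit translations is a multiple of a Dirichlet character. It is even
    because f is, and nontrivial because a nonzero constant on the units would have a nonzero
    sum. *)
Lemma logker_trivial (f : nat -> R[i]) k : logker f -> f k = 0.
Proof.
move=> fK; apply/eqP/negPn/negP => fk.
have coms : all (fun m => coprime m n) [seq m <- iota 0 n | coprime m n] by apply: filter_all.
have [f' [[fmod fcop feven fsum flog] fk' eig]] := logker_eigen coms fK fk.
have eig' m : coprime m n -> exists z, forall j, f' (m * j)%N = z * f' j.
  move=> co; have [|z hz] := eig (m %% n)%N.
    by rewrite mem_filter coprime_modl co mem_iota ltn_mod.
  by exists z => j; rewrite -hz -[RHS]fmod modnMml fmod.
have f1 : f' 1%N != 0.
  apply: contra fk' => /eqP f10.
  have [co|/fcop -> //] := boolP (coprime k n).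
  have [z hz] := eig' k co; rewrite -[k]muln1 hz f10 mulr0.
  by [].
have fM a b : f' (a * b)%N * f' 1%N = f' a * f' b.
  have [co|nco] := boolP (coprime a n); last first.
    by rewrite (fcop a) // (fcop (a * b)%N) ?mul0r // coprimeMl (negPf nco).
  have [z hz] := eig' a co.
  by rewrite -[a in RHS]muln1 !hz; ring.
pose chi a := f' a / f' 1%N.
have Dchi : dirichlet n chi.
  split=> //.
  - by rewrite /chi divff.
  - by move=> a b; rewrite /chi -[f' (a * b)%N](mulfK f1) fM; field.
  - by move=> a; rewrite /chi -fmod modnDr fmod.
  - by move=> a co; rewrite /chi fcop // mul0r.
have nt : exists2 b, coprime b n & chi b != 1.
  have [//|h] := pselect (exists2 b, coprime b n & chi b != 1).
  have fb b : f' b = (coprime b n)%:R * f' 1%N.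
    have [co|nco] := boolP (coprime b n); last by rewrite fcop // mul0r.
    rewrite mul1r; apply/eqP; rewrite -subr_eq0; apply/negPn/negP => hb; apply: h.
    exists b => //; rewrite /chi -subr_eq0 -(inj_eq (mulIf f1)) mul0r.
    by rewrite mulrBl mul1r divfK.
  move: fsum; under eq_bigr do rewrite fb.
  rewrite -mulr_suml -natr_sum => /eqP; rewrite mulf_eq0 (negPf f1) orbF pnatr_eq0.
  by rewrite big_mkord (bigD1 (Ordinal n1)) //= coprime1n.
apply: (even_char_contra n1 Dchi nt).
  by rewrite /chi -[n.-1]muln1 feven divff.
move=> t tn; rewrite /chi.
have -> : \sum_(0 <= a < n) f' a / f' 1%N * ((lg R n (a * t))%:C)%C =
   (f' 1%N)^-1 * \sum_(0 <= a < n) f' a * ((lg R n (a * t))%:C)%C.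
  by rewrite mulr_sumr; apply: eq_bigr => a _; ring.
by rewrite flog ?mulr0.
Qed.

(* The log vectors (ln |1 - z^(a t)|)_a, for t not divisible by n, have only
   the obvious real relations. *)
Lemma log_relations_even (c : nat -> R) :
  (forall a, c (a %% n)%N = c a) -> (forall a, ~~ coprime a n -> c a = 0) ->
  \sum_(0 <= a < n) c a = 0 ->
  (forall t, ~~ (n %| t)%N -> \sum_(0 <= a < n) c a * lg R n (a * t) = 0) ->
  forall a, c a + c (n.-1 * a)%N = 0.
Proof.
move=> cmod ccop csum clog a.
have con : coprime n.-1 n by rewrite coprimePn.
apply: complexI; rewrite rmorph0.
apply: (logker_trivial (f := fun a => ((c a + c (n.-1 * a)%N)%:C)%C)); split.
- by move=> b; rewrite cmod -[c (_ * (_ %% _))%N]cmod modnMmr cmod.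
- by move=> b nco; rewrite !ccop ?addr0 // coprimeMl con.
- move=> b; rewrite addrC; congr ((_ + _)%:C)%C.
  have nn : (n.-1 * n.-1 = 1 %[mod n])%N.
    have -> : (n.-1 * n.-1 = n.-2 * n + 1)%N.
      by case: n n1 => [|[|m]] // _; rewrite /= mulSn !mulnS; lia.
    by rewrite modnMDl.
  by rewrite mulnA -[LHS]cmod -modnMml nn modnMml mul1n cmod.
- rewrite -rmorph_sum /= big_split /= csum add0r.
  by rewrite (sum_residues_mul n0 con cmod) csum.
move=> t tn; under eq_bigr do rewrite -rmorphM /= mulrDl.
rewrite -rmorph_sum /= big_split /= clog // add0r.
pose F a := c a * lg R n (a * t).
have Fmod b : F (b %% n)%N = F b by rewrite /F cmod -[in LHS]lg_mod // modnMml lg_mod.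
have -> : \sum_(0 <= i < n) c (n.-1 * i)%N * lg R n (i * t) = \sum_(0 <= i < n) F (n.-1 * i)%N.
  by apply: eq_bigr => b _; rewrite /F -mulnA lgN.
by rewrite (sum_residues_mul n0 con Fmod) /F clog.
Qed.

End LogKernel.

(** * The reduction of Gold and Kim *)

(* The Koszul complex of the norm relations.  Formal sums of elements of S are
   encoded as functions S -> int; koszul A is a zigzag from the class of 0. *)
Section Koszul.
Variables (S : finComNzRingType) (r : nat).
Variables (e : 'I_r -> S) (G : 'I_r -> {set S}) (al be : 'I_r -> S) (H : {set S}).
Hypothesis e_idem : forall i, e i * e i = e i.
Hypothesis e_orth : forall i j, i != j -> e i * e j = 0.
Hypothesis GE : forall i x, x \in G i -> x * e i = x.
Hypothesis G0 : forall i, 0 \notin G i.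
Hypothesis GN : forall i x, x \in G i -> - x \in G i.
Definition is_unit (u : S) := exists v, u * v = 1.
Hypothesis Gu : forall i x u, is_unit u -> x \in G i -> u * x \in G i.
Hypothesis al_unit : forall i, is_unit (al i).
Hypothesis be_unit : forall i, is_unit (be i).
Hypothesis H0 : 0 \notin H.
Hypothesis HN : forall x, x != 0 -> (x \in H) (+) (- x \in H).

Implicit Types (psi : S -> int) (A : {set 'I_r}) (t : S).

Let sum_unit (V : nmodType) i u (F : S -> V) : is_unit u ->
  \sum_(x in G i) F (u * x) = \sum_(x in G i) F x.
Proof.
move=> [v uv].
have inj : injective (fun x => u * x).
  by move=> x y /(congr1 (fun z => v * z)); rewrite !mulrA [v * u]mulrC uv !mul1r.
rewrite [RHS](reindex_inj inj) /=; apply: eq_bigl => x.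
apply/idP/idP => [|h]; first by apply: Gu; exists v.
have := Gu (u := v) _ h; rewrite mulrA [v * u]mulrC uv mul1r; apply.
by exists u; rewrite mulrC.
Qed.

(** The transpose of the i-th norm relation: pairing [g] with [rho i psi] is pairing [psi] with the
    function g(t + x) summed over x in G i, minus g(u t), plus g(v t), where u and v are the
    inverses of [al i] and [be i]. *)
Definition rho i psi t : int :=
  \sum_(x in G i) psi (t - x) - psi (al i * t) + psi (be i * t).

Lemma rho_comm i j psi t : rho i (rho j psi) t = rho j (rho i psi) t.
Proof.
rewrite /rho !big_split /= !sumrN.
have E k (u : S) : is_unit u ->
    \sum_(x in G k) psi (u * (t - x)) = \sum_(x in G k) psi (u * t - x).
  move=> hu; rewrite -(sum_unit _ (fun x => psi (u * t - x)) hu).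
  by apply: eq_bigr => x _; rewrite mulrBr.
rewrite !E //.
rewrite exchange_big /=.
have -> : \sum_(i0 in G j) \sum_(i1 in G i) psi (t - i1 - i0) =
  \sum_(i0 in G j) \sum_(i1 in G i) psi (t - i0 - i1).
  by apply: eq_bigr => x _; apply: eq_bigr => y _; rewrite addrAC.
rewrite ![al j * (_ * _)]mulrCA ![be j * (_ * _)]mulrCA; ring.
Qed.

Definition sgnA (i : 'I_r) A : int := (-1) ^+ #|[set k in A | (k < i)%N]|.

Lemma sgnA_swap A i j : i \in A -> j \in A -> i != j ->
  sgnA i A * sgnA j (A :\ i) = - (sgnA j A * sgnA i (A :\ j)).
Proof.
wlog ij : i j / (i < j)%N.
  move=> hw iA jA ne; have [h|h] := ltnP i j; first exact: hw.
  have h' : (j < i)%N by rewrite ltn_neqAle h eq_sym ne.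
  by rewrite (hw j i) // ?opprK // eq_sym.
move=> iA jA ne; rewrite /sgnA.
have -> : [set k in A :\ j | (k < i)%N] = [set k in A | (k < i)%N].
  apply/setP => k; rewrite !inE; case: eqP => //= ->.
  by rewrite ltnNge (ltnW ij) andbF.
have -> : [set k in A | (k < j)%N] = i |: [set k in A :\ i | (k < j)%N].
  by apply/setP => k; rewrite !inE; case: eqP => //= ->; rewrite iA ij.
by rewrite cardsU1 !inE eqxx /= add1n exprS; ring.
Qed.

(** The argument [m] is the cardinality of [A]. Cutting the boundary down to the half system [H]
    makes it, up to sign, a symmetrisation of the result ([koszul_bdry]); this is where the relation
    gets halved. *)
Fixpoint kos (m : nat) A t : int :=
  if m is m'.+1 then
    if A == finset.set0 then (t == 0)%:R
    else if t \in H then \sum_(i in A) sgnA i A * rho i (kos m' (A :\ i)) t else 0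
  else (t == 0)%:R.

Definition koszul A := kos #|A| A.
Definition bdry A t : int := \sum_(i in A) sgnA i A * rho i (koszul (A :\ i)) t.

Lemma koszul0 t : koszul finset.set0 t = (t == 0)%:R.
Proof. by rewrite /koszul cards0. Qed.

Lemma koszulE A t : A != finset.set0 -> koszul A t = if t \in H then bdry A t else 0.
Proof.
move=> A0; rewrite /koszul; case E: #|A| => [|m].
  by move: A0; rewrite -cards_eq0 E.
rewrite /= (negPf A0); case: ifP => // _; apply: eq_bigr => i iA.
by rewrite /koszul; have := cardsD1 i A; rewrite E iA add1n => -[->].
Qed.

Definition good t := forall i, t * e i = 0 \/ t * e i \in G i.

Let unit_cancel u t : is_unit u -> u * t = 0 -> t = 0.
Proof.
by move=> [v uv] h; rewrite -[t]mul1r -uv [u * v]mulrC -mulrA h mulr0.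
Qed.

Let unit_good u t : is_unit u -> good (u * t) -> good t.
Proof.
move=> [v uv] h i; have vu : is_unit v by exists u; rewrite mulrC.
have E : t * e i = v * (u * t * e i) by rewrite -mulrA mulrA [v * u]mulrC uv mul1r.
by case: (h i) => hi; [left; rewrite E hi mulr0|right; rewrite E; apply: Gu].
Qed.

Lemma koszul_supp A t : koszul A t != 0 ->
  good t /\ forall i, i \notin A -> t * e i = 0.
Proof.
have [m] := ubnP #|A|; elim: m A t => // m IH A t Am.
have [->|A0] := eqVneq A finset.set0.
  rewrite koszul0; case: (eqVneq t 0) => // -> _.
  by split=> i; rewrite mul0r; [left|].
rewrite koszulE //; case: ifP => // _ hb.
have [i iA hi] : exists2 i, i \in A & rho i (koszul (A :\ i)) t != 0.
  apply/exists_inP; apply: contraNT hb => /exists_inPn h.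
  by rewrite /bdry big1 // => i iA; move/negPn/eqP: (h i iA) => ->; rewrite mulr0.
have Ai : (#|A :\ i| < m)%N by move: Am; rewrite (cardsD1 i A) iA add1n ltnS.
have iAi : i \notin A :\ i by rewrite !inE eqxx.
have [[x xG hx]|hx] : (exists2 x, x \in G i & koszul (A :\ i) (t - x) != 0)
   \/ (exists2 u, is_unit u & koszul (A :\ i) (u * t) != 0).
- have [z1|n1] := eqVneq (koszul (A :\ i) (al i * t)) 0; last by right; exists (al i).
  have [z2|n2] := eqVneq (koszul (A :\ i) (be i * t)) 0; last by right; exists (be i).
  left; apply/exists_inP; apply: contraNT hi => /exists_inPn h.
  rewrite /rho z1 z2 subr0 addr0 big1 // => x xG.
  by move/negPn/eqP: (h x xG).
- have [gt st] := IH _ _ Ai hx.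
  have xe k : k != i -> x * e k = 0.
    by move=> ki; rewrite -(GE xG) -mulrA e_orth ?mulr0 // eq_sym.
  have te : t * e i = x.
    by have := st i iAi; rewrite mulrBl (GE xG) => /eqP; rewrite subr_eq0 => /eqP.
  have tek k : k != i -> (t - x) * e k = t * e k.
    by move=> ki; rewrite mulrBl xe // subr0.
  split=> k.
    have [->|ki] := eqVneq k i; first by right; rewrite te.
    by have := gt k; rewrite tek.
  move=> kA; have ki : k != i by apply: contraNneq kA => ->.
  by rewrite -tek // st // !inE ki.
case: hx => u uu hx.
have [gt st] := IH _ _ Ai hx.
split; first exact: unit_good gt.
move=> k kA; apply: (unit_cancel uu); rewrite mulrA st // !inE negb_and kA orbT.
by [].
Qed.

Lemma koszul_at0 A : A != finset.set0 -> koszul A 0 = 0.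
Proof. by move=> A0; rewrite koszulE // (negPf H0). Qed.

Lemma rho_at0 A i : i \notin A -> rho i (koszul A) 0 = 0.
Proof.
move=> iA; rewrite /rho !mulr0 subrK big1 // => x xG.
apply/eqP; apply: contraTT xG => h; have [_ st] := koszul_supp h.
have := st i iA; rewrite sub0r mulNr => /eqP; rewrite oppr_eq0 => /eqP xe.
by apply: contra (G0 i) => xG; rewrite -xe GE.
Qed.

Lemma rhoN i psi t : rho i psi (- t) = rho i (fun s => psi (- s)) t.
Proof.
rewrite /rho !mulrN; congr (_ - _ + _).
rewrite (reindex_inj oppr_inj) /=; apply: eq_big => x.
  by apply/idP/idP => /GN; rewrite ?opprK.
by move=> _; congr psi; rewrite opprB opprK addrC.
Qed.

Lemma rhoD i psi psi' (c : int) t :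
  rho i (fun s => psi s + c * psi' s) t = rho i psi t + c * rho i psi' t.
Proof. by rewrite /rho big_split /= -mulr_sumr; ring. Qed.

Lemma rho_sum i (J : finType) (P : pred J) (w : J -> int) (F : J -> S -> int) t :
  rho i (fun s => \sum_(j | P j) w j * F j s) t = \sum_(j | P j) w j * rho i (F j) t.
Proof.
rewrite /rho exchange_big /=.
under eq_bigr do rewrite -mulr_sumr.
rewrite -sumrN -!big_split /=; apply: eq_bigr => j _; ring.
Qed.

(** The boundary of a boundary vanishes since the [rho i] commute and the signs anticommute. Hence
    the boundary is symmetric or antisymmetric under t -> -t, according to the parity of [A], and is
    recovered from its values on [H]. *)
Lemma koszul_bdry A t : bdry A t = koszul A t - (-1) ^+ #|A| * koszul A (- t).
Proof.
have [m] := ubnP #|A|; elim: m A t => // m IH A t Am.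
have [->|A0] := eqVneq A finset.set0.
  by rewrite /bdry big_set0 !koszul0 cards0 oppr_eq0 expr0 mul1r subrr.
have dd s : \sum_(i in A) sgnA i A * rho i (bdry (A :\ i)) s = 0.
  pose X (i j : 'I_r) := if (i \in A) && (j \in A :\ i) then
     sgnA i A * sgnA j (A :\ i) * rho i (rho j (koszul (A :\ i :\ j))) s else 0.
  have -> : \sum_(i in A) sgnA i A * rho i (bdry (A :\ i)) s = \sum_i \sum_j X i j.
    rewrite big_mkcond; apply: eq_bigr => i _; rewrite /X; case: ifP => /= iA; last by rewrite big1.
    rewrite rho_sum mulr_sumr big_mkcond /=.
    by apply: eq_bigr => j _; case: ifP => //; rewrite mulrA.
  have Xanti i j : X i j = - X j i.
    rewrite /X !inE [j == i]eq_sym; case: eqP => /= [_|/eqP ij].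
      by rewrite !andbF oppr0.
    case: (boolP (i \in A)) => iA; case: (boolP (j \in A)) => jA /=; rewrite ?oppr0 //.
    rewrite sgnA_swap // rho_comm mulNr; congr (- (_ * _)).
    by rewrite !finset.setDDl [_ :|: _]finset.setUC.
  have : \sum_i \sum_j X i j = - \sum_i \sum_j X i j.
    rewrite {1}exchange_big /= -sumrN; apply: eq_bigr => i _.
    by rewrite -sumrN; apply: eq_bigr => j _; rewrite Xanti.
  by move/eqP; rewrite -subr_eq0 opprK -mulr2n mulrn_eq0 /= => /eqP.
(* By induction the bracket under [rho i] is the boundary of [A :\ i], because the signs of [A] and
   [A :\ i] are opposite; then [dd] applies. *)
have bN s : bdry A s + (-1) ^+ #|A| * bdry A (- s) = 0.
  rewrite -[RHS](dd s) {1 2}/bdry mulr_sumr -big_split /=; apply: eq_bigr => i iA.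
  rewrite mulrCA -mulrDr rhoN -rhoD; congr (_ * _).
  have Ai : (#|A :\ i| < m)%N by move: Am; rewrite (cardsD1 i A) iA add1n ltnS.
  have -> : bdry (A :\ i) = fun s => koszul (A :\ i) s - (-1) ^+ #|A :\ i| * koszul (A :\ i) (- s).
    by apply/funext => u; apply: IH.
  have -> : (-1) ^+ #|A| = - (-1) ^+ #|A :\ i| :> int.
    by rewrite (cardsD1 i A) iA add1n exprS mulN1r.
  by congr rho; apply/funext => u; rewrite mulNr.
rewrite !koszulE //.
have [->|t0] := eqVneq t 0.
  rewrite oppr0 (negPf H0) mulr0 subr0 /bdry big1 // => i iA.
  by rewrite rho_at0 ?mulr0 // !inE eqxx.
have := HN t0; case: (t \in H); case: (- t \in H) => //= _.
  by rewrite mulr0 subr0.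
by rewrite sub0r; have := bN t => /eqP; rewrite addr_eq0 => /eqP.
Qed.

Section Pairing.
Variables (V : zmodType) (g : S -> V).
Hypothesis V2 : forall v : V, v *+ 2 = 0 -> v = 0.
Hypothesis g_even : forall t, g (- t) = g t.
Hypothesis g_norm : forall i t, t != 0 -> t * e i = 0 ->
  forall u v, u * al i = 1 -> v * be i = 1 ->
  \sum_(x in G i) g (t + x) = g (u * t) - g (v * t).

Lemma koszul_relation A : odd #|A| -> (1 < #|A|)%N ->
  \sum_t g t *~ koszul A t = 0.
Proof.
move=> oA A1.
have rho0 i : i \in A -> \sum_t g t *~ rho i (koszul (A :\ i)) t = 0.
  move=> iA; have [u ua] := al_unit i; have [v vb] := be_unit i.
  set psi := koszul (A :\ i).
  have psi0 : psi 0 = 0.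
    rewrite /psi koszul_at0 // -card_gt0.
    by move: A1; rewrite (cardsD1 i A) iA add1n ltnS.
  have psiE t : psi t != 0 -> t * e i = 0.
    by case/koszul_supp => _; apply; rewrite !inE eqxx.
  have sub_unit (w w' : S) : w * w' = 1 -> \sum_t g t *~ psi (w * t) = \sum_t g (w' * t) *~ psi t.
    move=> ww; have inj : injective (fun t => w * t).
      by move=> x y /(congr1 (fun z => w' * z)); rewrite !mulrA [w' * w]mulrC ww !mul1r.
    rewrite [RHS](reindex_inj inj) /=; apply: eq_bigr => t _.
    by rewrite mulrA [w' * w]mulrC ww mul1r.
  transitivity (\sum_t ((\sum_(x in G i) g (t + x)) - g (u * t) + g (v * t)) *~ psi t).
    have -> : \sum_t g t *~ rho i psi t =
       \sum_t \sum_(x in G i) g t *~ psi (t - x) - \sum_t g t *~ psi (al i * t)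
         + \sum_t g t *~ psi (be i * t).
      rewrite -sumrN -!big_split /=; apply: eq_bigr => t _.
      by rewrite /rho mulrzDr mulrzBr mulrz_sumr.
    rewrite (sub_unit _ _ ua) (sub_unit _ _ vb) exchange_big /=.
    have -> : \sum_(x in G i) \sum_t g t *~ psi (t - x) = \sum_t \sum_(x in G i) g (t + x) *~ psi t.
      rewrite [RHS]exchange_big /=; apply: eq_bigr => x _.
      rewrite (reindex_inj (addIr x)) /=; apply: eq_bigr => t _.
      by rewrite addrK.
    rewrite -sumrN -!big_split /=; apply: eq_bigr => t _.
    by rewrite mulrzDl mulrzBl mulrz_suml.
  apply: big1 => t _.
  have [->|tp] := eqVneq (psi t) 0; first by rewrite mulr0z.
  have t0 : t != 0 by apply: contraNneq tp => ->; rewrite psi0.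
  rewrite (g_norm t0 (psiE t tp) (u := u) (v := v)) 1?mulrC //.
  by rewrite addrAC subrK addrN mul0rz.
have b0 : \sum_t g t *~ bdry A t = 0.
  have -> : \sum_t g t *~ bdry A t =
     \sum_(i in A) (\sum_t g t *~ rho i (koszul (A :\ i)) t) *~ sgnA i A.
    transitivity (\sum_t \sum_(i in A) g t *~ (sgnA i A * rho i (koszul (A :\ i)) t)).
      by apply: eq_bigr => t _; rewrite mulrz_sumr.
    rewrite exchange_big /=; apply: eq_bigr => i _; rewrite mulrz_suml.
    by apply: eq_bigr => t _; rewrite mulrC mulrzA.
  by rewrite big1 // => i iA; rewrite rho0 // mul0rz.
apply: V2; rewrite mulr2n -[RHS]b0.
have -> : \sum_t g t *~ koszul A t = \sum_t g t *~ koszul A (- t).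
  by rewrite (reindex_inj oppr_inj) /=; apply: eq_bigr => t _; rewrite g_even.
rewrite {1}(reindex_inj oppr_inj) /= -big_split /=; apply: eq_bigr => t _.
by rewrite g_even opprK -mulrzDr koszul_bdry -signr_odd oA expr1 mulN1r opprK.
Qed.

End Pairing.

Definition flip (D : {set 'I_r}) : S := \prod_(i in D) (1 - e i *+ 2).

(** Modulo 2, the coefficients at all sign changes of t add up to the same sum for [A] without one
    index, which leads down to the empty set and its single coefficient 1. *)
Lemma koszul_odd A t :
  (forall i, i \in A -> t * e i \in G i) -> t = \sum_(i in A) t * e i ->
  (2 %| \sum_(D in powerset A) koszul A (t * flip D) - 1)%Z.
Proof.
have [m] := ubnP #|A|; elim: m A t => // m IH A t Am tG tA.
have evenP (I : finType) (P : pred I) (F : I -> int) :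
    (forall i, P i -> (2 %| F i)%Z) -> (2 %| \sum_(i | P i) F i)%Z.
  by move=> h; apply: rpred_sum.
have dD (x y : int) : (2 %| x)%Z -> (2 %| y)%Z -> (2 %| x + y)%Z.
  by move=> hx hy; apply: rpredD.
have [A0|A0] := eqVneq A finset.set0.
  rewrite A0 powerset0 big_set1 koszul0 /flip big_set0 mulr1.
  by rewrite tA A0 big_set0 eqxx subrr dvdz0.
have /set0Pn[i0 iA0] := A0.
have flip2 i : (1 - e i *+ 2) * (1 - e i *+ 2) = 1.
  have := e_idem i; rewrite mulr2n => ei.
  have -> : (1 - (e i + e i)) * (1 - (e i + e i)) = 1 - 4 * e i + 4 * (e i * e i) by ring.
  by rewrite ei; ring.
have flip_out i (D : {set 'I_r}) : i \notin D -> flip D * e i = e i.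
  move=> iD; rewrite /flip; elim/big_ind: _ => [|x y hx hy|k kD].
  - by rewrite mul1r.
  - by rewrite -mulrA hy hx.
  - have ki : k != i by apply: contraNneq iD => <-.
    by rewrite mulrBl mul1r mulrnAl e_orth // mul0rn subr0.
have flipU i (D : {set 'I_r}) : i \notin D -> flip (i |: D) = (1 - e i *+ 2) * flip D.
  by move=> iD; rewrite /flip big_setU1.
have flip_in i (D : {set 'I_r}) : i \in D -> flip D * e i = - e i.
  move=> iD; rewrite -(finset.setD1K iD) flipU ?inE ?eqxx // -mulrA flip_out ?inE ?eqxx //.
  by rewrite mulrBl mul1r mulrnAl e_idem mulr2n opprD addrA subrr sub0r.
have flipG i (D : {set 'I_r}) : i \in A -> t * flip D * e i \in G i.
  move=> iA; rewrite -mulrA; case: (boolP (i \in D)) => iD.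
    by rewrite flip_in // mulrN; apply/GN/tG.
  by rewrite flip_out //; apply: tG.
have compl (D : {set 'I_r}) : D \subset A -> t * flip (A :\: D) = - (t * flip D).
  move=> DA; rewrite tA !mulr_suml -sumrN; apply: eq_bigr => i iA.
  rewrite -!mulrA ![e i * _]mulrC; case: (boolP (i \in D)) => iD.
    by rewrite flip_out ?flip_in ?mulrN ?opprK // !inE iD.
  by rewrite flip_in ?flip_out ?mulrN // !inE iD.
have split i (P : pred {set 'I_r}) (F : {set 'I_r} -> int) :
   (forall D, P (i |: D) = P D) ->
   \sum_(D | P D) F D = \sum_(D | P D && (i \notin D)) (F D + F (i |: D)).
  move=> hP; rewrite (bigID (fun D : {set 'I_r} => i \in D)) /= addrC big_split /=; congr (_ + _).
  rewrite (reindex_onto (fun D : {set 'I_r} => i |: D) (fun D => D :\ i)) /=; last first.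
    by move=> D /andP[_ iD]; rewrite finset.setD1K.
  apply: eq_bigl => D; rewrite hP finset.setU11 andbT; congr (_ && _).
  apply/eqP/idP => [<-|iD]; first by rewrite !inE eqxx.
  by rewrite finset.setU1K.
pose Q (D : {set 'I_r}) := (D \subset A) && (i0 \notin D).
(* Complementary sign changes give opposite points, and [Q] selects one set from each complementary
   pair. *)
have N1 : \sum_(D in powerset A) koszul A (t * flip D) =
    \sum_(D | Q D) (koszul A (t * flip D) + koszul A (- (t * flip D))).
  rewrite big_split /= (bigID (fun D : {set 'I_r} => i0 \notin D)) /=; congr (_ + _).
    by apply: eq_bigl => D; rewrite powersetE.
  rewrite (reindex_onto (fun D : {set 'I_r} => A :\: D) (fun D => A :\: D)) /=; last first.
    move=> D; rewrite powersetE => /andP[DA _].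
    by rewrite finset.setDDr finset.setDv finset.set0U; apply/finset.setIidPr.
  apply: eq_big => [D|D].
    rewrite powersetE finset.subsetDl !inE negb_and negbK /= iA0 orbF /Q.
    rewrite finset.setDDr finset.setDv finset.set0U.
    rewrite andbC; congr (_ && _); apply/eqP/idP => [<-|DA]; first exact: finset.subsetIl.
    exact/finset.setIidPr.
  rewrite powersetE => /andP[_ /eqP ED].
  have DA : D \subset A by rewrite -ED finset.subsetDl.
  by rewrite compl.
(* The support of [koszul (A :\ i)] has no i-th coordinate, so only the translation that removes
   this coordinate survives in [rho i]. *)
have rhoE i D : i \in A ->
    rho i (koszul (A :\ i)) (t * flip D) = koszul (A :\ i) (t * flip D * (1 - e i)).
  move=> iA; set t' := t * flip D; have t'G := flipG i D iA; rewrite -/t' in t'G.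
  have z s : s * e i != 0 -> koszul (A :\ i) s = 0.
    move=> h; apply/eqP; apply: contraNT h => /koszul_supp[_] st.
    by rewrite st // !inE eqxx.
  have t'0 : t' * e i != 0 by apply: contraTneq t'G => ->; rewrite G0.
  have zu u : is_unit u -> koszul (A :\ i) (u * t') = 0.
    move=> uu; apply: z; apply: contra t'0 => /eqP h; apply/eqP.
    by apply: (unit_cancel uu); rewrite mulrA.
  rewrite /rho !zu // subr0 addr0 (bigD1 (t' * e i)) //= big1 ?addr0.
    by rewrite mulrBr mulr1.
  move=> x /andP[xG xt]; apply: z; rewrite mulrBl (GE xG) subr_eq0 eq_sym.
  by [].
pose M := \sum_(D | Q D) \sum_(i in A) koszul (A :\ i) (t * flip D * (1 - e i)).
have NM : (2 %| \sum_(D in powerset A) koszul A (t * flip D) - M)%Z.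
  rewrite N1 /M -sumrB; apply: (evenP) => D _.
  have -> : koszul A (t * flip D) + koszul A (- (t * flip D)) =
     bdry A (t * flip D) + (1 + (-1) ^+ #|A|) * koszul A (- (t * flip D)).
    by rewrite koszul_bdry; ring.
  rewrite addrAC; apply: rpredD; last first.
    rewrite -signr_odd; apply: dvdz_mulr; by case: (odd #|A|).
  rewrite /bdry -sumrB; apply: (evenP) => i iA; rewrite rhoE // -{2}[koszul _ _]mul1r -mulrBl.
  apply: dvdz_mulr; rewrite /sgnA -signr_odd; by case: (odd _).
have iA1 : (#|A :\ i0| < m)%N by move: Am; rewrite (cardsD1 i0 A) iA0 add1n ltnS.
have IH0 := IH (A :\ i0) (t * (1 - e i0)) iA1.
have tek k : k != i0 -> t * (1 - e i0) * e k = t * e k.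
  by move=> ki; rewrite -mulrA mulrBl mul1r e_orth ?subr0 // eq_sym.
have {}IH0 : (2 %| \sum_(D in powerset (A :\ i0)) koszul (A :\ i0) (t * (1 - e i0) * flip D) - 1)%Z.
  apply: IH0 => [i|].
    by rewrite !inE => /andP[ii0 iA]; rewrite tek //; apply: tG.
  rewrite {1}tA (big_setD1 i0) //= mulrDl mulrDr !mulr1.
  rewrite mulrN -mulrA e_idem subrr add0r mulr_suml.
  apply: eq_bigr => i; rewrite !inE => /andP[ii0 iA].
  by rewrite tek // -mulrA mulrBr mulr1 e_orth // subr0.
(* For i other than [i0] the summand no longer sees the sign at i, so its terms are equal in pairs;
   only the summand of [i0] remains. *)
have M0 : (2 %| M - \sum_(D in powerset (A :\ i0)) koszul (A :\ i0) (t * (1 - e i0) * flip D))%Z.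
  rewrite /M exchange_big /= (big_setD1 i0) //= addrAC.
  have -> : \sum_(D | Q D) koszul (A :\ i0) (t * flip D * (1 - e i0)) =
     \sum_(D in powerset (A :\ i0)) koszul (A :\ i0) (t * (1 - e i0) * flip D).
    apply: eq_big => [D|D _]; last by rewrite mulrAC.
    rewrite powersetE /Q finset.subsetD1; congr (_ && _).
  rewrite subrr add0r; apply: (evenP) => i; rewrite !inE => /andP[ii0 iA].
  rewrite (split i) => [|D].
    apply: (evenP) => D /andP[_ iD]; rewrite flipU // mulrCA -!mulrA.
    have -> : (1 - e i *+ 2) * (t * (flip D * (1 - e i))) = t * (flip D * (1 - e i)).
      have -> : (1 - e i *+ 2) * (t * (flip D * (1 - e i))) =
         t * (flip D * (1 - e i)) - (t * flip D * (e i - e i * e i)) *+ 2.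
        by rewrite !mulr2n; ring.
      by rewrite e_idem subrr mulr0 mul0rn subr0.
    have h2 (x : int) : (2 %| x + x)%Z.
      by rewrite -mulr2n -[x *+ 2]mulr_natr; apply: dvdz_mull.
    exact: h2.
  rewrite /Q finset.subUset finset.sub1set iA /= !inE negb_or eq_sym ii0.
  by [].
have -> : \sum_(D in powerset A) koszul A (t * flip D) - 1 =
  (\sum_(D in powerset A) koszul A (t * flip D) - M) +
  (M - \sum_(D in powerset (A :\ i0)) koszul (A :\ i0) (t * (1 - e i0) * flip D)) +
  (\sum_(D in powerset (A :\ i0)) koszul (A :\ i0) (t * (1 - e i0) * flip D) - 1) by ring.
exact: (dD _ _ (dD _ _ NM M0) IH0).
Qed.

End Koszul.

(* Exponent vectors: f a stands for the class of the word with exponents a. *)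
Section GoldKimReduction.
Variables (V : zmodType) (r : nat) (Om : {set 'I_r}) (phi h : 'I_r -> nat).
Variables (f : ('I_r -> nat) -> V) (L : {pred V}).
Hypothesis LZ : GRing.zmod_closed L.
Hypothesis phiE : forall i, phi i = (h i).*2.
Hypothesis h0 : forall i, (0 < h i)%N.
Implicit Types (a : 'I_r -> nat) (i j : 'I_r).

Definition upd a i v j : nat := if j == i then v else a j.

Hypothesis fext : forall a a', (forall j, j \in Om -> a j = a' j) -> f a = f a'.
Hypothesis fper : forall a i v, i \in Om -> f (upd a i (v + phi i)) = f (upd a i v).
Hypothesis fsum : forall a i, i \in Om -> \sum_(v < phi i) f (upd a i v) \in L.
Hypothesis fJ : forall a, f (fun j => a j + h j)%N = f a.
Hypothesis fX : forall i a, i \in Om ->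
  (forall j, j \in Om -> [/\ (j < i)%N -> (0 < a j < phi j)%N,
     j = i -> (0 < a j < h j)%N & (i < j)%N -> a j = 0%N]) -> f a \in L.

Let L0 : 0 \in L. Proof. by case: LZ. Qed.
Let LB x y : x \in L -> y \in L -> x - y \in L. Proof. by case: LZ => _; apply. Qed.
Let LN x : x \in L -> - x \in L. Proof. by move=> xL; rewrite -sub0r LB. Qed.
Let LD x y : x \in L -> y \in L -> x + y \in L.
Proof. by move=> xL yL; rewrite -[y]opprK LB // LN. Qed.
Let Lsum (I : finType) (P : pred I) (F : I -> V) :
  (forall x, P x -> F x \in L) -> \sum_(x | P x) F x \in L.
Proof. by move=> hF; elim/big_ind: _ => //; apply: LD. Qed.
Let LDl x y : x \in L -> (x + y \in L) = (y \in L).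
Proof.
by move=> xL; apply/idP/idP => [h'|]; [rewrite -[y](addKr x) LD ?LN|apply: LD].
Qed.

Let phi0 i : (0 < phi i)%N. Proof. by rewrite phiE double_gt0. Qed.
Let hphi i : (h i < phi i)%N. Proof. by rewrite phiE -addnn -addn1 leq_add2l. Qed.

Definition bounded a := forall j, j \in Om -> (a j < phi j)%N.
Definition spec a j := (a j == 0%N) || (a j == h j).

Lemma upd_bounded a i v : bounded a -> (v < phi i)%N -> bounded (upd a i v).
Proof. by move=> ba vi j jO; rewrite /upd; case: eqP => [->|_]; last exact: ba. Qed.

Lemma upd_id a i : f (upd a i (a i)) = f a.
Proof. by apply: fext => j _; rewrite /upd; case: eqP => // ->. Qed.

Definition inL_from k := forall a, bounded a ->
  forall j, j \in Om -> (k <= j)%N -> ~~ spec a j -> f a \in L.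

(** In the norm relation along j, every exponent other than 0 and h j already gives an element of
    L. *)
Lemma flip_spec k j a : inL_from k -> j \in Om -> (k <= j)%N -> bounded a ->
  f (upd a j 0) + f (upd a j (h j)) \in L.
Proof.
move=> Lk jO kj ba; have := fsum a jO.
rewrite (bigD1 (Ordinal (phi0 j))) //= (bigD1 (Ordinal (hphi j))) /=; last first.
  by rewrite -val_eqE /= -lt0n h0.
rewrite addrA addrC LDl //; apply: Lsum => v /andP[v0 vh].
apply: (Lk _ _ j) => //; first exact: upd_bounded.
rewrite /spec /upd eqxx negb_or.
by move: v0 vh; rewrite -!val_eqE /= => -> ->.
Qed.

Definition trunc a (m : nat) j : nat := if (m <= j)%N then 0%N else a j.

Lemma trunc_bounded a m : bounded a -> bounded (trunc a m).
Proof. by move=> ba j jO; rewrite /trunc; case: ifP => // _; apply: ba. Qed.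

Lemma trunc_all a : f (trunc a r) = f a.
Proof. by apply: fext => j _; rewrite /trunc leqNgt ltn_ord. Qed.

Lemma trunc_step k m (mr : (m < r)%N) a : inL_from k -> bounded a -> (k <= m)%N ->
  (Ordinal mr \in Om -> spec a (Ordinal mr)) ->
  f (trunc a m.+1) - f (trunc a m) \in L \/ f (trunc a m.+1) + f (trunc a m) \in L.
Proof.
move=> Lk ba km sp; set i := Ordinal mr.
have Etr : forall v, v = trunc a m.+1 i -> f (upd (trunc a m.+1) i v) = f (trunc a m.+1).
  by move=> v ->; apply: upd_id.
have Etr0 : f (upd (trunc a m.+1) i 0) = f (trunc a m).
  apply: fext => j _; rewrite /upd /trunc; case: eqP => [->|/eqP ji] /=; first by rewrite leqnn.
  have -> // : (m < j)%N = (m <= j)%N.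
  by rewrite [RHS]leq_eqVlt; case: eqP => //= E; case/eqP: ji; apply/val_inj.
have vi : trunc a m.+1 i = a i by rewrite /trunc /= ltnn.
case: (boolP (i \in Om)) => [iO|iO]; last first.
  left; rewrite -Etr0 (fext (a := upd _ _ _) (a' := trunc a m.+1)) ?subrr //.
  by move=> j jO; rewrite /upd; case: eqP => // ji; rewrite -ji jO in iO.
case/orP: (sp iO) => /eqP ai.
  by left; rewrite -Etr0 Etr ?subrr // vi.
right; rewrite addrC -Etr0 -(Etr (h i)) ?vi //.
by apply: (flip_spec Lk) => //; apply: trunc_bounded.
Qed.

(** Replacing a special exponent by 0 changes the value by at most a sign modulo L, which membership
    in L does not see. *)
Lemma trunc_in k m a : inL_from k -> bounded a -> (k <= m <= r)%N ->
  (forall j, j \in Om -> (m <= j)%N -> spec a j) ->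
  (f a \in L) = (f (trunc a m) \in L).
Proof.
move=> Lk ba /andP[km mr] sp; rewrite -(trunc_all a).
rewrite -{1}(subnKC mr); have : (m + (r - m) <= r)%N by rewrite subnKC.
elim: (r - m)%N => [|d IH]; first by rewrite addn0.
rewrite addnS => mdr; rewrite -IH ?(ltnW mdr) //.
have kmd : (k <= m + d)%N by rewrite (leq_trans km) ?leq_addr.
case: (trunc_step (mr := mdr) Lk ba kmd) => [iO|hL|hL].
- by apply: sp => //=; apply: leq_addr.
- by rewrite -[f (trunc a (m + d).+1)](subrK (f (trunc a (m + d)))) LDl.
rewrite -[f (trunc a (m + d).+1)](addrK (f (trunc a (m + d)))) LDl //.
by apply/idP/idP => /LN //; rewrite opprK.
Qed.

(** An exponent 0 below the pivot k is traded, through the norm relation, for minus the sum over the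
    nonzero exponents. In the induction d counts the positions just below k where 0 is still
    allowed. *)
Lemma reduce_low k (kr : (k < r)%N) a : Ordinal kr \in Om -> bounded a ->
  (0 < a (Ordinal kr) < h (Ordinal kr))%N ->
  (forall j, j \in Om -> (k < j)%N -> a j = 0%N) -> f a \in L.
Proof.
move=> kO ba ak ahi.
suff Z d : (d <= k)%N -> forall a, bounded a -> (0 < a (Ordinal kr) < h (Ordinal kr))%N ->
    (forall j, j \in Om -> (k < j)%N -> a j = 0%N) ->
    (forall j, j \in Om -> (j < k - d)%N -> (0 < a j)%N) -> f a \in L.
  by apply: (Z k (leqnn k)) => // j _; rewrite subnn.
elim: d => [_|d IH dk] {ba ak ahi}a ba ak ahi alo.
  apply: (fX kO) => j jO; split=> [jk|->|kj]; [|exact: ak|exact: ahi].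
  by rewrite ba // andbT alo // subn0.
have m_lt : (k - d.+1 < r)%N by rewrite (leq_ltn_trans (leq_subr _ _)).
set i := Ordinal m_lt.
have ik : (i < k)%N by rewrite /= ltn_subrL /= (leq_trans _ dk).
have jcase j : (j < k - d)%N -> j = i \/ (j < k - d.+1)%N.
  have -> : (k - d = (k - d.+1).+1)%N by rewrite subnSK.
  rewrite ltnS leq_eqVlt => /orP[/eqP E|]; [left; exact/val_inj|by right].
case: (boolP (i \in Om)) => iO; last first.
  apply: IH => //; first exact: ltnW.
  by move=> j jO /jcase[ji|]; [rewrite ji (negPf iO) in jO|apply: alo].
have pos v : (0 < v < phi i)%N -> f (upd a i v) \in L.
  move=> /andP[v0 vphi]; apply: IH; first exact: ltnW.
  - exact: upd_bounded.
  - by rewrite /upd ifN // -val_eqE /= gtn_eqF.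
  - move=> j jO kj; rewrite /upd ifN ?ahi //.
    by rewrite -val_eqE /= gtn_eqF // (ltn_trans ik).
  - by move=> j jO /jcase[->|jl]; rewrite /upd ?eqxx //; case: eqP => // _; apply: alo.
have [ai|ai] := posnP (a i); last by rewrite -(upd_id a i) pos // ai ba.
have := fsum a iO; rewrite (bigD1 (Ordinal (phi0 i))) //= addrC LDl.
  by rewrite -{1}ai upd_id.
by apply: Lsum => v v0; apply: pos; rewrite ltn_ord andbT lt0n.
Qed.

(** Descending induction on the position of the last non-special exponent: the special ones behind
    it are set to 0 by [trunc_in], the ones before it are handled by [reduce_low]. *)
Lemma inL_from_all k : inL_from k.
Proof.
suff H d : inL_from (r - d).
  by have [kr|rk] := leqP k r; [rewrite -(subKn kr)|move=> a _ j _ kj; have := leq_trans rk kj; rewrite ltnNge (ltnW (ltn_ord j))].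
elim: d => [|d IH] a ba j jO kj nsp.
  by move: kj; rewrite subn0 leqNgt ltn_ord.
have [dr|rd] := ltnP d r; last first.
  have E : (r - d.+1 = r - d)%N.
    by rewrite (eqP (_ : r - d == 0)%N) ?subn_eq0 //; apply/eqP; rewrite subn_eq0 ltnW.
  by apply: (IH a ba j); rewrite -?E.
have Ek : (r - d = (r - d.+1).+1)%N by rewrite subnSK.
clear k; set k := (r - d.+1)%N in Ek kj *; rewrite Ek in IH.
have [/forallP hall|] := boolP [forall i : 'I_r, (i \in Om) && (k < i)%N ==> spec a i]; last first.
  rewrite negb_forall; move/existsP; case=> i; rewrite negb_imply => /andP[/andP[iO ki] ni]; exact: (IH a ba i).
have sp i : i \in Om -> (k < i)%N -> spec a i by move=> iO ki; have := hall i; rewrite iO ki.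
have jk : val j = k.
  by apply/eqP; move: kj; rewrite leq_eqVlt eq_sym => /orP[//|kj]; rewrite sp in nsp.
have kr : (k < r)%N by rewrite -jk; exact: (ltn_ord j).
have jE : j = Ordinal kr by apply/val_inj.
have km : (k.+1 <= k.+1 <= r)%N by rewrite leqnn.
move: nsp; rewrite /spec negb_or => /andP[aj0 ajh].
have low b : bounded b -> (forall i, i \in Om -> (k < i)%N -> spec b i) ->
   (0 < b j < h j)%N -> f b \in L.
  move=> bb sb bj; rewrite (trunc_in IH bb km sb).
  apply: (reduce_low (kr := kr)); rewrite -?jE //; first exact: trunc_bounded.
    by rewrite /trunc jk ltnn.
  by move=> i _ ki; rewrite /trunc ki.
have [ajl|ajl] := ltnP (a j) (h j); first by apply: low => //; rewrite lt0n aj0.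
have hj : (h j < a j)%N by rewrite ltn_neqAle eq_sym ajh.
(* Complex conjugation adds h to every exponent; b is the result reduced modulo phi. It brings a
   pivot above h j into the lower half and preserves special exponents. *)
pose b i := if (a i < h i)%N then (a i + h i)%N else (a i - h i)%N.
have fb : f b = f a.
  have E (n : nat) : f (fun i => a i + h i)%N =
      f (fun i => if (i < n)%N && (i \in Om) then b i else (a i + h i)%N).
    elim: n => [|n ->]; first by apply: fext.
    have [nr|rn] := ltnP n r; last first.
      by apply: fext => i iO; rewrite !(leq_trans (ltn_ord i)) // leqW.
    set i := Ordinal nr.
    set F := fun i0 : 'I_r => if (i0 < n)%N && (i0 \in Om) then b i0 else (a i0 + h i0)%N.
    have Fi : F i = (a i + h i)%N by rewrite /F ltnn.
    case: (boolP (i \in Om)) => iO; last first.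
      apply: fext => i' iO'; rewrite /F ltnS [(i' <= n)%N]leq_eqVlt.
      by case: (eqVneq (val i') n) => //= E; case/negP: iO; rewrite (_ : i = i') //; apply/val_inj.
    transitivity (f (upd F i (b i))).
      rewrite -(upd_id F i) Fi /b; case: ltnP => // hi.
      have -> : (a i + h i = a i - h i + phi i)%N.
        by rewrite phiE -addnn addnA subnK.
      exact: fper.
    apply: fext => i' iO'; rewrite /upd ltnS [(i' <= n)%N]leq_eqVlt iO' andbT.
    case: (eqVneq i' i) => [->|ne] /=; first by rewrite eqxx.
    have -> : (val i' == n) = false by apply: contraNF ne => /eqP E; apply/eqP/val_inj.
    by rewrite /F iO' andbT.
  rewrite -[RHS]fJ (E r); apply: fext => i iO.
  by rewrite ltn_ord iO.
rewrite -fb; apply: low.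
- move=> i iO; have := ba i iO; rewrite /b phiE -addnn; case: (ltnP (a i) (h i)) => hi h'; first by rewrite ltn_add2r.
  by apply: leq_ltn_trans (leq_subr _ _) _.
- move=> i iO ki; rewrite /spec /b; case/orP: (sp i iO ki) => /eqP ->.
    by rewrite h0 add0n eqxx orbT.
  by rewrite ltnn subnn eqxx.
have -> : b j = (a j - h j)%N by rewrite /b ltnNge ajl.
rewrite subn_gt0 hj /= ltn_subLR //.
by have := ba j jO; rewrite phiE -addnn.
Qed.

(** Passing from exponents 0 to exponents h changes the sign once for each index of Om, an odd
    number of times, whereas complex conjugation identifies both values. The norm relations thus
    give only twice the base value. *)
Lemma special_double : odd #|Om| -> f (fun=> 0%N) *+ 2 \in L.
Proof.
move=> oddO; pose hh (m : nat) := trunc h m.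
have bh : bounded h by move=> j _; apply: hphi.
have key m : (m <= r)%N ->
    f (hh m) - f (fun=> 0%N) *~ (-1) ^+ #|[set j : 'I_r in Om | (j < m)%N]| \in L.
  elim: m => [_|m IH mr].
    have -> : [set j : 'I_r in Om | (j < 0)%N] = finset.set0 by apply/setP => j; rewrite !inE andbF.
    rewrite cards0 expr0 mulr1z (fext (a := hh 0%N) (a' := fun=> 0%N)) ?subrr //.
  have {}IH := IH (ltnW mr); set i := Ordinal mr.
  case: (boolP (i \in Om)) => iO; last first.
    have -> : [set j : 'I_r in Om | (j < m.+1)%N] = [set j : 'I_r in Om | (j < m)%N].
      apply/setP => j; rewrite !inE ltnS leq_eqVlt; case: (eqVneq (val j) m) => //= E.
      by rewrite (_ : j = i) ?(negPf iO) //; apply/val_inj.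
    rewrite (fext (a := hh m.+1) (a' := hh m)) // => j jO.
    rewrite /hh /trunc; have -> // : (m < j)%N = (m <= j)%N.
    rewrite [RHS]leq_eqVlt; case: (eqVneq m j) => //= E.
    by rewrite (_ : j = i) ?(negPf iO) // in jO; apply/val_inj.
  have -> : [set j : 'I_r in Om | (j < m.+1)%N] = i |: [set j : 'I_r in Om | (j < m)%N].
    apply/setP => j; rewrite !inE ltnS leq_eqVlt -val_eqE /=.
    by case: (eqVneq (val j) m) => //= E; rewrite (_ : j = i) ?iO //; apply/val_inj.
  rewrite cardsU1 !inE ltnn andbF /= add1n exprS mulN1r mulrNz opprK.
  have : f (upd (hh m.+1) i 0) + f (upd (hh m.+1) i (h i)) \in L.
    by apply: (flip_spec (@inL_from_all 0)) => //; apply: trunc_bounded.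
  have -> : f (upd (hh m.+1) i (h i)) = f (hh m.+1).
    by rewrite -[RHS](upd_id _ i) /hh {3}/trunc /= ltnn.
  have -> : f (upd (hh m.+1) i 0) = f (hh m).
    apply: fext => j _; rewrite /upd /hh /trunc; case: eqP => [->|/eqP ji] /=; first by rewrite leqnn.
    have -> // : (m < j)%N = (m <= j)%N.
    by rewrite [RHS]leq_eqVlt; case: eqP => //= E; case/eqP: ji; apply/val_inj.
  move=> h1; have := LB h1 IH.
  set y := f (fun=> _) *~ _ in IH *.
  have alg (u v w : V) : u + w = v + u - (v - w).
    by rewrite opprB [v + u]addrC addrACA subrr addr0.
  by have := LB h1 IH; rewrite -(alg (f (hh m.+1)) (f (hh m)) y).
have := key r (leqnn r).
have -> : [set j : 'I_r in Om | (j < r)%N] = Om by apply/setP => j; rewrite !inE ltn_ord andbT.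
rewrite -signr_odd oddO expr1 mulrN1z opprK /hh trunc_all.
have -> : f h = f (fun=> 0%N) by rewrite -[RHS]fJ; apply: fext.
by rewrite mulr2n.
Qed.

Lemma special_in a : f (fun=> 0%N) \in L -> bounded a -> f a \in L.
Proof.
move=> f0 ba.
have [/forallP hall|] := boolP [forall i : 'I_r, (i \in Om) ==> spec a i]; last first.
  rewrite negb_forall; move/existsP; case=> i; rewrite negb_imply => /andP[iO ni]; exact: (@inL_from_all 0 a ba i).
have sp j : j \in Om -> (0 <= j)%N -> spec a j by move=> jO _; have := hall j; rewrite jO.
by rewrite (trunc_in (@inL_from_all 0) ba (m := 0%N)) // (@fext _ (fun=> 0%N)).
Qed.

Lemma special_sub a : f (fun=> 0%N) *+ 2 \in L -> bounded a ->
  (forall j, j \in Om -> spec a j) -> f a - f (fun=> 0%N) \in L.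
Proof.
move=> f2 ba sp.
have key m : (m <= r)%N -> f (trunc a m) - f (fun=> 0%N) \in L.
  elim: m => [_|m IH mr].
    by rewrite (fext (a' := fun=> 0%N)) ?subrr.
  have {}IH := IH (ltnW mr).
  case: (trunc_step (mr := mr) (@inL_from_all 0) ba (leq0n m)) => [iO|hL|hL].
  - exact: sp.
  - by have := LD hL IH; rewrite addrA subrK.
  have := LB hL (LD IH f2); rewrite mulr2n.
  by rewrite addrA subrK opprD addrA addrK.
by have := key r (leqnn r); rewrite trunc_all.
Qed.

End GoldKimReduction.

(** * Spanning by the Gold-Kim words *)

Section GoldKimSpan.
Variables (S : finComNzRingType) (r : nat).
Variables (e : 'I_r -> S) (G : 'I_r -> {set S}) (al be : 'I_r -> S) (H : {set S}).
Hypothesis e_idem : forall i, e i * e i = e i.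
Hypothesis e_orth : forall i j, i != j -> e i * e j = 0.
Hypothesis e_sum : \sum_i e i = 1.
Hypothesis GE : forall i x, x \in G i -> x * e i = x.
Hypothesis G0 : forall i, 0 \notin G i.
Hypothesis GN : forall i x, x \in G i -> - x \in G i.
Hypothesis Gu : forall i x u, is_unit u -> x \in G i -> u * x \in G i.
Hypothesis al_unit : forall i, is_unit (al i).
Hypothesis be_unit : forall i, is_unit (be i).
Hypothesis H0 : 0 \notin H.
Hypothesis HN : forall x, x != 0 -> (x \in H) (+) (- x \in H).

Variables (s : 'I_r -> S) (h : 'I_r -> nat).
Hypothesis h0 : forall i, (0 < h i)%N.
Let phi i := (h i).*2.
Hypothesis s_fix : forall i k, k != i -> s i * e k = e k.
Hypothesis s_half : forall i, s i ^+ h i * e i = - e i.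
Hypothesis G_gen : forall i x y, x \in G i -> y \in G i ->
  exists2 a, (a < phi i)%N & y = x * s i ^+ a.
Hypothesis G_inj : forall i x a c, x \in G i -> (a < phi i)%N -> (c < phi i)%N ->
  x * s i ^+ a = x * s i ^+ c -> a = c.

Definition full (Om : {set 'I_r}) t := forall i,
  if i \in Om then (t * e i \in G i : Prop) else t * e i = 0.

Variable b : {set 'I_r} -> S.
Hypothesis b_full : forall Om, full Om (b Om).

Definition gk_word (Om : {set 'I_r}) (a : 'I_r -> nat) : S :=
  b Om * \prod_(i in Om) s i ^+ a i.

Variables (V : zmodType) (g : S -> V) (L : {pred V}).
Hypothesis LZ : GRing.zmod_closed L.
Hypothesis V2 : forall v : V, v *+ 2 = 0 -> v = 0.
Hypothesis g_even : forall t, g (- t) = g t.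
Hypothesis g_norm : forall i t, t != 0 -> t * e i = 0 ->
  forall u v, u * al i = 1 -> v * be i = 1 ->
  \sum_(x in G i) g (t + x) = g (u * t) - g (v * t).
Hypothesis gX : forall (Om : {set 'I_r}) i a, (1 < #|Om|)%N -> i \in Om ->
  (forall j, j \in Om -> [/\ (j < i)%N -> (0 < a j < phi j)%N,
     j = i -> (0 < a j < h j)%N & (i < j)%N -> a j = 0%N]) -> g (gk_word Om a) \in L.
Hypothesis g_base : forall Om : {set 'I_r}, (1 < #|Om|)%N -> ~~ odd #|Om| -> g (b Om) \in L.
Hypothesis g_single : forall i a, (0 < a < h i)%N ->
  g (b [set i] * s i ^+ a) - g (b [set i]) \in L.

Let L0 : 0 \in L. Proof. by case: LZ. Qed.
Let LB x y : x \in L -> y \in L -> x - y \in L. Proof. by case: LZ => _; apply. Qed.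
Let LN x : x \in L -> - x \in L. Proof. by move=> xL; rewrite -sub0r LB. Qed.
Let LD x y : x \in L -> y \in L -> x + y \in L.
Proof. by move=> xL yL; rewrite -[y]opprK LB // LN. Qed.
Let Lsum (I : finType) (P : pred I) (F : I -> V) :
  (forall x, P x -> F x \in L) -> \sum_(x | P x) F x \in L.
Proof. by move=> hF; elim/big_ind: _ => //; apply: LD. Qed.
Let Lz x (n : int) : x \in L -> x *~ n \in L.
Proof.
move=> xL; have Ln (k : nat) : x *+ k \in L.
  by elim: k => [|k IH]; rewrite ?mulr0n // mulrS LD.
by case: n => k; [exact: Ln|rewrite NegzE mulrNz LN //; exact: Ln].
Qed.

Let ext x y : (forall i, x * e i = y * e i) -> x = y.
Proof.
move=> hxy; rewrite -[x]mulr1 -[y]mulr1 -e_sum !mulr_sumr.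
by apply: eq_bigr => i _.
Qed.

Let fixpow i k m : k != i -> s i ^+ m * e k = e k.
Proof.
by move=> ki; elim: m => [|m IH]; rewrite ?mul1r // exprSr -mulrA s_fix.
Qed.

Let fixprod (D : {set 'I_r}) a i : i \notin D -> (\prod_(k in D) s k ^+ a k) * e i = e i.
Proof.
move=> iD; elim/big_rec: _ => [|k x kD IH]; first by rewrite mul1r.
by rewrite -mulrA IH fixpow //; apply: contraNneq iD => ->.
Qed.

Let wordE Om a i : gk_word Om a * e i =
  if i \in Om then b Om * e i * s i ^+ a i else 0.
Proof.
rewrite /gk_word; case: ifP => iO.
  rewrite (finset.big_setD1 i) //= -!mulrA fixprod ?finset.setD11 //.
  by rewrite [s i ^+ _ * e i]mulrC.
rewrite -mulrA fixprod ?iO //.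
by have := b_full Om i; rewrite iO.
Qed.

Let s_phi i : s i ^+ phi i = 1.
Proof.
apply: ext => k; have [->|ki] := eqVneq k i; last by rewrite fixpow ?mul1r.
by rewrite /phi -addnn exprD -mulrA s_half mulrN s_half opprK mul1r.
Qed.

Let s_half_G i x : x \in G i -> x * s i ^+ h i = - x.
Proof.
by move=> xG; rewrite -(GE xG) -mulrA [e i * _]mulrC s_half mulrN.
Qed.

Let pow_unit i a : is_unit (s i ^+ a).
Proof.
exists (s i ^+ (phi i * a - a)); rewrite -exprD subnKC ?exprM ?s_phi ?ssrnat.expn0 ?expr1n //.
by rewrite leq_pmull // double_gt0.
Qed.

Let b_single i : b [set i] \in G i.
Proof.
suff -> : b [set i] = b [set i] * e i by have := b_full [set i] i; rewrite inE eqxx.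
apply: ext => k; rewrite -mulrA; have [->|ki] := eqVneq k i; first by rewrite e_idem.
by rewrite e_orth 1?eq_sym // mulr0; have := b_full [set i] k; rewrite inE (negPf ki).
Qed.

Lemma gold_kim_single i x y : x \in G i -> y \in G i -> g x - g y \in L.
Proof.
suff Z z : z \in G i -> g z - g (b [set i]) \in L.
  by move=> /Z hx /Z hy; have := LB hx hy; rewrite opprB addrA subrK.
case/(G_gen (b_single i)) => a aphi ->.
have Z c : (c < h i)%N -> g (b [set i] * s i ^+ c) - g (b [set i]) \in L.
  have [->|c0 ch] := posnP c; first by rewrite mulr1 subrr.
  by apply: g_single; rewrite c0.
have [|ha] := ltnP a (h i); first exact: Z.
rewrite -(subnKC ha) exprD mulrA s_half_G // mulNr g_even; apply: Z.
by rewrite ltn_subLR // addnn.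
Qed.

Lemma gk_word_full Om a : full Om (gk_word Om a).
Proof.
move=> i; case: ifP => iO; rewrite wordE iO // mulrC.
by apply: Gu => //; have := b_full Om i; rewrite iO.
Qed.

Let unit_full Om u t : is_unit u -> full Om t -> full Om (u * t).
Proof.
move=> uu ft i; have := ft i; rewrite -mulrA; case: ifP => _; first exact: Gu.
by move=> ->; rewrite mulr0.
Qed.

Let full_word Om t : full Om t ->
  exists2 a, (forall i, i \in Om -> (a i < phi i)%N) & t = gk_word Om a.
Proof.
move=> ft.
have /choice[a ha] i : exists a, i \in Om -> (a < phi i)%N /\ t * e i = b Om * e i * s i ^+ a.
  have := ft i; have := b_full Om i; case: ifP => iO; last by exists 0%N.
  by move=> h1 h2; have [a h3 h4] := G_gen h1 h2; exists a.
exists a; first by move=> i /ha[].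
apply: ext => i; rewrite wordE; have := ft i; case: ifP => // iO _.
by have [] := ha i iO.
Qed.

Let full_nz Om t : full Om t -> (0 < #|Om|)%N -> t != 0.
Proof.
move=> ft /card_gt0P[i iO]; apply: contraL (iO) => /eqP t0.
by have := ft i; rewrite t0 mul0r; case: ifP => // _; rewrite (negPf (G0 i)).
Qed.

Let supp_single (Om : {set 'I_r}) j t : full Om t -> Om = [set j]%SET -> t \in G j.
Proof.
move=> ft OE; suff -> : t = t * e j by have := ft j; rewrite OE inE eqxx.
apply: ext => k; rewrite -mulrA; have [->|kj] := eqVneq k j; first by rewrite e_idem.
by rewrite e_orth 1?eq_sym // mulr0; have := ft k; rewrite OE inE (negPf kj).
Qed.

(** The indicator function of G j satisfies the norm relations itself, so the Ennola relation
    applies to it. The coefficients on G j having sum 0, only differences [g x - g y] of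
    single-prime values enter, and those are the ones that lie in L. *)
Let single_indicator (A : {set 'I_r}) j : odd #|A| -> (1 < #|A|)%N ->
  \sum_(t in G j) koszul G al be H A t = 0.
Proof.
move=> oA A1; pose g' (t : S) : int := (t \in G j)%:R.
have ucan u t : is_unit u -> (u * t \in G j) = (t \in G j).
  move=> [v uv]; apply/idP/idP; last by apply: Gu; exists v.
  by move/(@Gu j (u * t) v); rewrite mulrA [v * u]mulrC uv mul1r; apply; exists u; rewrite mulrC.
have int2 (v : int) : v *+ 2 = 0 -> v = 0 by move/eqP; rewrite mulrn_eq0 /= => /eqP.
have ge t : g' (- t) = g' t.
  by rewrite /g'; have -> // : (- t \in G j) = (t \in G j); apply/idP/idP => /GN; rewrite ?opprK.
have gn i t : t != 0 -> t * e i = 0 -> forall u v, u * al i = 1 -> v * be i = 1 ->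
    \sum_(x in G i) g' (t + x) = g' (u * t) - g' (v * t).
  move=> t0 ti u v ua vb.
  rewrite {2 3}/g' !ucan; [|by exists (be i)|by exists (al i)].
  rewrite subrr; apply: big1 => x xG; rewrite /g'; case: (boolP (_ \in G j)) => // txj.
  have [ij|ij] := eqVneq i j.
    subst j; have := GE txj; rewrite mulrDl ti add0r GE // => /eqP.
    by rewrite -subr_eq0 opprD addrCA subrr addr0 oppr_eq0 (negPf t0).
  have := congr1 (fun z => z * e i) (GE txj).
  rewrite -mulrA (e_orth (i := j)) 1?eq_sym // mulr0 mulrDl ti add0r GE // => x0.
  by have := G0 i; rewrite x0 xG.
have := koszul_relation (al := al) (be := be) e_orth GE G0 GN Gu al_unit be_unit H0 HN int2 ge gn oA A1.
rewrite (bigID (mem (G j))) /= [X in _ + X]big1 ?addr0 => [E|t /negPf tj].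
  rewrite -[RHS]E; apply: eq_bigr => t tj; by rewrite /g' tj -mulrzr mul1r intz.
by rewrite /g' tj mul0rz.
Qed.

(** Induction on the support. When it is odd, the reduction stops at twice the base value; the
    Ennola relation then gives an odd multiple of it, since its terms of smaller support are known
    by induction and the single-prime ones by [single_indicator]. *)
Lemma gold_kim_span (Om : {set 'I_r}) t : (1 < #|Om|)%N -> full Om t -> g t \in L.
Proof.
have [m] := ubnP #|Om|; elim: m => // m IH in Om t *; rewrite ltnS => Om_m O1.
pose f a := g (gk_word Om a).
have fext a a' : (forall j, j \in Om -> a j = a' j) -> f a = f a'.
  by move=> aa; rewrite /f /gk_word; congr (g (_ * _)); apply: eq_bigr => i iO; rewrite aa.
have fper a i v : i \in Om -> f (upd a i (v + phi i)) = f (upd a i v).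
  move=> iO; rewrite /f /gk_word; congr (g (_ * _)); apply: eq_bigr => k kO.
  by rewrite /upd; case: eqP => // ->; rewrite exprD s_phi mulr1.
(* Varying the i-th exponent runs through y + G i, where y is the word without its i-th coordinate,
   so that [g_norm] lands in the support Om :\ i. *)
have fsum a i : i \in Om -> \sum_(v < phi i) f (upd a i v) \in L.
  move=> iO; set w := gk_word Om a; set y := w * (1 - e i).
  have yi : y * e i = 0 by rewrite /y -mulrA mulrBl mul1r e_idem subrr mulr0.
  have yk k : k != i -> y * e k = w * e k.
    by move=> ki; rewrite /y -mulrA mulrBl mul1r e_orth 1?eq_sym // subr0.
  have y_full : full (Om :\ i) y.
    move=> k; rewrite !inE; have [->|ki] := eqVneq k i; first by [].
    by rewrite yk //=; have := gk_word_full Om a k.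
  have bi : b Om * e i \in G i by have := b_full Om i; rewrite iO.
  have cardD : #|Om| = #|Om :\ i|.+1 by rewrite (cardsD1 i Om) iO.
  have -> : \sum_(v < phi i) f (upd a i v) = \sum_(x in G i) g (y + x).
    have inj : injective (fun v : 'I_(phi i) => b Om * e i * s i ^+ v).
      by move=> u v /(G_inj bi (ltn_ord u) (ltn_ord v)) uv; apply/val_inj.
    have -> : G i = finset.imset (fun v : 'I_(phi i) => b Om * e i * s i ^+ v) (mem predT).
      apply/setP => x; apply/idP/imsetP => [xG|[v _ ->]].
        by have [v vphi ->] := G_gen bi xG; exists (Ordinal vphi).
      by rewrite mulrC; apply: Gu.
    rewrite big_imset /=; last by move=> u v _ _ E; apply: inj.
    apply: eq_bigr => v _; congr g; apply: ext => k; rewrite wordE mulrDl.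
    have [->|ki] := eqVneq k i.
      rewrite iO yi add0r /upd eqxx -!mulrA; congr (_ * _).
      by rewrite [s i ^+ v * e i]mulrC mulrA e_idem.
    rewrite yk // /w wordE; have -> : b Om * e i * s i ^+ v * e k = 0.
      by rewrite mulrAC -!mulrA [e i * _]mulrA e_orth 1?eq_sym // mul0r mulr0.
    by rewrite addr0 /upd (negPf ki).
  have [u ua] := al_unit i; have [v vb] := be_unit i.
  have y0 : y != 0 by apply: (full_nz y_full); move: O1; rewrite cardD ltnS.
  rewrite (g_norm y0 yi (etrans (mulrC u _) ua) (etrans (mulrC v _) vb)).
  have fu : full (Om :\ i) (u * y) by apply: unit_full => //; exists (al i); rewrite mulrC.
  have fv : full (Om :\ i) (v * y) by apply: unit_full => //; exists (be i); rewrite mulrC.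
  have [D1|D1] := ltnP 1 #|Om :\ i|.
    by apply: LB; apply: (IH _ _ _ D1) => //; rewrite -cardD.
  have /eqP/cards1P[j jE] : #|Om :\ i| = 1%N.
    by apply/eqP; rewrite eqn_leq D1 -ltnS -cardD.
  exact: (gold_kim_single (supp_single fu jE) (supp_single fv jE)).
have fJ a : f (fun j => a j + h j)%N = f a.
  rewrite /f -g_even; congr g; apply: ext => i; rewrite mulNr !wordE.
  case: ifP => iO; last by rewrite oppr0.
  rewrite addnC exprD mulrA s_half_G ?mulNr ?opprK //.
  by have := b_full Om i; rewrite iO.
have fX i a : i \in Om -> (forall j, j \in Om -> [/\ (j < i)%N -> (0 < a j < phi j)%N,
     j = i -> (0 < a j < h j)%N & (i < j)%N -> a j = 0%N]) -> f a \in L.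
  exact: gX.
have phiE i : phi i = (h i).*2 by [].
have f0 : f (fun=> 0%N) = g (b Om).
  by rewrite /f /gk_word big1 ?mulr1.
suff fb : g (b Om) \in L.
  move=> /full_word[a ab ->]; rewrite -f0 in fb.
  exact: (special_in LZ phiE h0 fext fper fsum fJ fX fb ab).
have [oO|eO] := boolP (odd #|Om|); last exact: g_base.
have f2 : f (fun=> 0%N) *+ 2 \in L := special_double LZ phiE h0 fext fper fsum fJ fX oO.
pose K := koszul G al be H Om.
have rel : \sum_x g x *~ K x = 0.
  exact: (koszul_relation (al := al) (be := be) e_orth GE G0 GN Gu al_unit be_unit H0 HN V2 g_even g_norm).
have Kfull x : K x != 0 -> exists2 D : {set 'I_r}, D \subset Om & full D x.
  move=> /(koszul_supp e_orth GE Gu al_unit be_unit)[gx ox].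
  exists [set i | x * e i != 0]%SET; last first.
    move=> i; rewrite inE; case: eqP => //= xi.
    by case: (gx i).
  by apply/fintype.subsetP => i; rewrite inE; apply: contraR => /ox ->.
have full_uniq D D' x : full D x -> full D' x -> D = D'.
  move=> h1 h2; apply/setP => i; have := h1 i; have := h2 i.
  by case: (i \in D); case: (i \in D') => // h3 h4; [move: h4; rewrite h3|move: h3; rewrite h4]; rewrite (negPf (G0 i)).
pose Fl := [set x | `[< full Om x >]]%SET.
have inFl x : reflect (full Om x) (x \in Fl) by rewrite inE; apply: asboolP.
(* Part of the relation supported off Om. *)
have low : \sum_(x | x \notin Fl) g x *~ K x \in L.
  pose Sg := [set x | (x \notin Fl) && [exists i, x \in G i]]%SET.
  rewrite (bigID (mem Sg)) /=; apply: LD; last first.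
    apply: Lsum => x /andP[/inFl xF xS]; have [->|Kx] := eqVneq (K x) 0; first by rewrite mulr0z.
    apply: Lz; have [D DO fD] := Kfull x Kx.
    have DO' : (#|D| < #|Om|)%N.
      apply: proper_card; rewrite finset.properEneq DO andbT.
      by apply/eqP => DE; apply: xF; rewrite -DE.
    apply: (IH D) => //; first exact: leq_trans DO' Om_m.
    rewrite ltnNge; apply/negP => D1.
    have [D0|D0] := posnP #|D|.
      have x0 : x = 0.
        apply: ext => i; rewrite mul0r; have := fD i.
        by move/eqP: D0; rewrite cards_eq0 => /eqP ->; rewrite inE.
      by move: Kx; rewrite x0 /K koszul_at0 ?eqxx // -card_gt0 ltnW.
    have /eqP/cards1P[j jE] : #|D| = 1%N by apply/eqP; rewrite eqn_leq D1.
    move: xS; rewrite inE negb_and negbK => /orP[/inFl //|].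
    by move/negP; apply; apply/existsP; exists j; apply: (supp_single fD jE).
  have SgE x : ((x \notin Fl) && (x \in Sg)) = [exists i, x \in G i].
    rewrite [x \in Sg]inE; case: (boolP (x \in Fl)) => xF /=; last by [].
    apply/esym/negbTE/negP => a.
    have /inFl fO := xF; case/existsP: a => i xG.
    have [j jO ji] : exists2 j, j \in Om & j != i.
      have : (0 < #|Om :\ i|)%N.
        by move: O1; rewrite (cardsD1 i Om); case: (i \in Om) => //; rewrite add0n => /ltnW.
      by case/card_gt0P => j; rewrite !inE => /andP[ji jO]; exists j.
    have := fO j; rewrite jO -(GE xG) -mulrA e_orth 1?eq_sym // mulr0.
    by rewrite (negPf (G0 j)).
  have -> : \sum_(x | (x \notin Fl) && (x \in Sg)) g x *~ K x =
      \sum_i \sum_(x in G i) g x *~ K x.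
    rewrite (exchange_big_dep (fun x => [exists i, x \in G i])) /=; last first.
      by move=> i x _ xG; apply/existsP; exists i.
    rewrite (eq_bigl _ _ SgE); apply: eq_bigr => x /existsP[i xG].
    rewrite (big_pred1 i) // => j /=; apply/idP/eqP => [xj|-> //].
    apply/eqP; apply: contraT => ji; have := G0 i.
    by have := GE xG; rewrite -(GE xj) -mulrA e_orth // mulr0 => ->; rewrite GE // xG.
  apply: Lsum => i _.
  have -> : \sum_(x in G i) g x *~ K x = \sum_(x in G i) (g x - g (b [set i])) *~ K x.
    rewrite [RHS](eq_bigr (fun x => g x *~ K x - g (b [set i]) *~ K x)) => [|x _]; last by rewrite mulrzBl.
    by rewrite sumrB -mulrz_sumr single_indicator // mulr0z subr0.
  by apply: Lsum => x xG; apply: Lz; exact: (gold_kim_single xG (b_single i)).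
(* The points whose exponents are all special: raising s i to the power h i changes the sign of the
   i-th coordinate. *)
pose Sp := [set b Om * flip e D | D in powerset Om]%SET.
have flipE (D : {set 'I_r}) i : D \subset Om -> b Om * flip e D * e i =
    if i \in D then - (b Om * e i) else b Om * e i.
  move=> DO; rewrite /flip; case: ifP => iD.
    rewrite (finset.big_setD1 i) //= -!mulrA -mulrN; congr (_ * _).
    have -> : (\prod_(k in D :\ i) (1 - e k *+ 2)) * e i = e i.
      elim/big_rec: _ => [|k x]; first by rewrite mul1r.
      rewrite !inE => /andP[ki _] IH'; rewrite -mulrA IH' mulrBl mul1r mulrnAl e_orth //.
      by rewrite mul0rn subr0.
    by rewrite mulrBl mul1r mulrnAl e_idem mulr2n opprD addrA subrr add0r.
  rewrite -!mulrA; congr (_ * _); elim/big_rec: _ => [|k x kD IH']; first by rewrite mul1r.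
  rewrite -mulrA IH' mulrBl mul1r mulrnAl e_orth ?mul0rn ?subr0 //.
  by apply: contraTneq kD => ->; rewrite iD.
have Nz2 i x : x \in G i -> x != - x.
  move=> xG; have x0 : x != 0 by apply: contraTneq xG => ->.
  by apply/eqP => E; have := HN x0; rewrite -E addbb.
have flip_inj : {in powerset Om &, injective (fun D => b Om * flip e D)}.
  move=> D D'; rewrite !powersetE => DO DO' E; apply/setP => i.
  have := congr1 (fun z => z * e i) E; rewrite !flipE //.
  have bi : i \in Om -> b Om * e i \in G i by move=> iO; have := b_full Om i; rewrite iO.
  case: (boolP (i \in D)) => iD; case: (boolP (i \in D')) => iD' // /eqP.
    by rewrite eq_sym (negPf (Nz2 i _ (bi (fintype.subsetP DO _ iD)))).
  by rewrite (negPf (Nz2 i _ (bi (fintype.subsetP DO' _ iD')))).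
have SpF x : x \in Sp -> x \in Fl.
  case/imsetP => D; rewrite powersetE => DO ->; apply/inFl => i; rewrite flipE //.
  case: (boolP (i \in D)) => iD; last exact: b_full.
  have iO := fintype.subsetP DO _ iD.
  by rewrite iO; apply: GN; have := b_full Om i; rewrite iO.
have high : \sum_(x in Fl) g x *~ K x - g (b Om) *~ (\sum_(x in Sp) K x) \in L.
  have -> : \sum_(x in Sp) K x = \sum_(x in Fl) (if x \in Sp then K x else 0).
    rewrite -big_mkcondr /=; apply: eq_bigl => x.
    by apply/idP/andP => [xS|[]//]; split; first exact: SpF.
  rewrite mulrz_sumr -sumrB; apply: Lsum => x /inFl fx.
  have [a ab xE] := full_word fx.
  have [sa|] := boolP [forall j, (j \in Om) ==> spec h a j].
    have sa' j : j \in Om -> spec h a j by move=> jO; have /forallP/(_ j) := sa; rewrite jO.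
    have -> : x \in Sp.
      apply/imsetP; exists [set j in Om | a j == h j]%SET.
        by rewrite powersetE; apply/fintype.subsetP => j; rewrite inE => /andP[].
      rewrite xE; apply: ext => j; rewrite wordE flipE; last first.
        by apply/fintype.subsetP => k; rewrite inE => /andP[].
      rewrite inE; case: ifP => jO /=; last by have := b_full Om j; rewrite jO.
      have bj : b Om * e j \in G j by have := b_full Om j; rewrite jO.
      case: eqP => [->|/eqP aj]; first by rewrite s_half_G.
      by have := sa' j jO; rewrite /spec (negPf aj) orbF => /eqP ->; rewrite mulr1.
    rewrite -mulrzBl; apply: Lz; rewrite xE -f0.
    exact: (special_sub LZ phiE h0 fext fper fsum fJ fX f2 ab sa').
  rewrite negb_forall; move/existsP; case=> j; rewrite negb_imply => /andP[jO nsp].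
  have fa : f a \in L.
    exact: (@inL_from_all _ _ _ _ _ _ _ LZ phiE h0 fext fper fsum fJ fX 0%N a ab j jO (leq0n _) nsp).
  case: ifP => xS; last by rewrite mulr0z subr0 xE; apply: Lz.
  case/imsetP: xS => D; rewrite powersetE => DO xD; case/negP: nsp.
  have := congr1 (fun z => z * e j) xD; rewrite flipE // xE wordE jO.
  have bj : b Om * e j \in G j by have := b_full Om j; rewrite jO.
  rewrite /spec; case: ifP => _ E.
    rewrite (_ : a j = h j) ?eqxx ?orbT //; apply: (G_inj bj) => //; first exact: ab.
      by rewrite /phi -addnn -addn1 leq_add2l.
    by rewrite E s_half_G.
  rewrite (_ : a j = 0%N) ?eqxx //; apply: (G_inj bj) => //; first exact: ab.
    by rewrite double_gt0.
  by rewrite E mulr1.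
have odd1 : (2 %| \sum_(x in Sp) K x - 1)%Z.
  rewrite (big_imset _ flip_inj) /=.
  apply: (koszul_odd (al := al) (be := be) e_idem e_orth GE G0 GN Gu al_unit be_unit H0 HN).
    by move=> i iO; have := b_full Om i; rewrite iO.
  rewrite -[LHS]mulr1 -e_sum mulr_sumr [RHS]big_mkcond /=; apply: eq_bigr => i _.
  by have := b_full Om i; case: ifP.
have tot : g (b Om) *~ (\sum_(x in Sp) K x) \in L.
  have E : \sum_(x in Fl) g x *~ K x = - \sum_(x | x \notin Fl) g x *~ K x.
    by have /eqP := rel; rewrite (bigID (mem Fl)) /= addr_eq0 => /eqP.
  move: high; rewrite E => /LN; rewrite opprB opprK => h1.
  by have := LB h1 low; rewrite addrK.
case/dvdzP: odd1 => c cE.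
have {}cE : \sum_(x in Sp) K x = c * 2 + 1 by rewrite -cE subrK.
move: tot; rewrite cE mulrzDr mulr1z mulrC mulrzA => h1.
rewrite -f0 in h1 *; have h2 : f (fun=> 0%N) *~ 2 *~ c \in L by apply: Lz; apply: f2.
by have := LB h1 h2; rewrite addrC addrA addNr add0r.
Qed.

End GoldKimSpan.

(** * Cyclotomic fields *)

Section CyclotomicFields.
Variable R : realType.
Local Notation z := (zeta R).

Lemma Cyclotomic_root (F : fieldType) n (w : F) : (0 < n)%N -> n.-primitive_root w ->
  root (map_poly intr 'Phi_n) w.
Proof.
move=> n0 pw.
have ev d : (0 < d)%N -> \prod_(k <- divisors d) (map_poly intr 'Phi_k).[w] = w ^+ d - 1.
  move=> d0; rewrite -horner_prod -rmorph_prod prod_Cyclotomic //=.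
  by rewrite rmorphB rmorph1 /= map_polyXn !hornerE.
have := ev n n0; rewrite (prim_expr_order pw) subrr => /eqP; rewrite prodf_seq_eq0.
case/hasP=> d; rewrite -dvdn_divisors // => dn /= /eqP dw.
have d0 : (0 < d)%N := dvdn_gt0 n0 dn.
have := ev d d0; rewrite (bigD1_seq d) ?divisors_uniq -?dvdn_divisors //= dw mul0r.
move/esym/eqP; rewrite subr_eq0 -(prim_order_dvd pw) => nd.
by rewrite (_ : n = d) /root ?dw //; apply/eqP; rewrite eqn_dvd nd dn.
Qed.

Definition PhiQ n : {poly rat} := map_poly intr 'Phi_n.

Lemma ratr_PhiQ (F : numFieldType) n : map_poly (ratr : rat -> F) (PhiQ n) = map_poly intr 'Phi_n.
Proof. by rewrite -map_poly_comp; apply: eq_map_poly => x /=; rewrite ratr_int. Qed.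

Definition ev (w : R[i]) (p : {poly rat}) : R[i] := (map_poly ratr p).[w].

Lemma evD w p1 p2 : ev w (p1 + p2) = ev w p1 + ev w p2.
Proof. by rewrite /ev rmorphD hornerD. Qed.
Lemma evB w p1 p2 : ev w (p1 - p2) = ev w p1 - ev w p2.
Proof. by rewrite /ev rmorphB hornerD hornerN. Qed.
Lemma evM w p1 p2 : ev w (p1 * p2) = ev w p1 * ev w p2.
Proof. by rewrite /ev rmorphM hornerM. Qed.
Lemma ev1 w : ev w 1 = 1. Proof. by rewrite /ev rmorph1 hornerC. Qed.
Lemma ev0 w : ev w 0 = 0. Proof. by rewrite /ev rmorph0 horner0. Qed.
Lemma evXn w k : ev w 'X^k = w ^+ k. Proof. by rewrite /ev map_polyXn hornerXn. Qed.

Lemma PhiQ_monic n : PhiQ n \is monic.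
Proof. by apply: monic_map; apply: Cyclotomic_monic. Qed.

(* Irreducibility of the cyclotomic polynomial, read off from minimal polynomials in algC. *)
Lemma PhiQ_dvd_or_coprime n p : (0 < n)%N -> PhiQ n %| p \/ coprimep p (PhiQ n).
Proof.
move=> n0; have [v pv] := C_prim_root_exists n0.
have rootv q : root (map_poly (ratr : rat -> algC) q) v = (PhiQ n %| q).
  have [m [mE _] ->] := minCpolyP v; suff -> : m = PhiQ n by [].
  apply: (@map_poly_inj _ algC ratr); rewrite -mE (minCpoly_cyclotomic pv).
  by rewrite -Cintr_Cyclotomic // ratr_PhiQ.
have /dvdpP[e eE] := dvdp_gcdr p (PhiQ n).
have : root (map_poly (ratr : rat -> algC) (PhiQ n)) v by rewrite rootv.
rewrite {1}eE rmorphM rootM !rootv => /orP[|]; last first.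
  by move=> h; left; apply: dvdp_trans h (dvdp_gcdl _ _).
move=> Pe; right; have Phi0 := monic_neq0 (PhiQ_monic n).
have e0 : e != 0 by apply: contra_neq Phi0 => e0; rewrite eE e0 mul0r.
have g0 : gcdp p (PhiQ n) != 0 by apply: contra_neq Phi0 => e1; rewrite eE e1 mulr0.
have := dvdp_leq e0 Pe; rewrite {1}eE size_mul // /coprimep => h.
have e1 : (0 < size e)%N by rewrite size_poly_gt0.
have g1 : (0 < size (gcdp p (PhiQ n)))%N by rewrite size_poly_gt0.
move: h e1 g1; move: (size e) (size (gcdp p (PhiQ n))) => x y; clear => h e1 g1; apply/eqP; lia.
Qed.

Lemma PhiQ_root n (w : R[i]) : (0 < n)%N -> n.-primitive_root w -> ev w (PhiQ n) = 0.
Proof. by move=> n0 pw; have /eqP := Cyclotomic_root n0 pw; rewrite /ev ratr_PhiQ. Qed.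

Lemma ev_inv n (w : R[i]) p : (0 < n)%N -> n.-primitive_root w ->
  PhiQ n %| p \/ exists q, ev w q * ev w p = 1.
Proof.
move=> n0 pw; case: (PhiQ_dvd_or_coprime p n0); [by left|move=> co; right].
have /Bezout_eq1_coprimepP[[a b] /= /(congr1 (ev w))] := co.
by rewrite evD !evM PhiQ_root // mulr0 addr0 ev1 => h; exists a.
Qed.

(** A polynomial killing zeta_n cannot be coprime to the cyclotomic polynomial, so it is divisible
    by it and kills every primitive root. *)
Lemma ev_conj n u p : (0 < n)%N -> coprime u n -> ev (z n) p = 0 -> ev (z n ^+ u) p = 0.
Proof.
move=> n0 co p0; have pz := zeta_prim R n0.
case: (ev_inv p n0 pz) => [/dvdpP[e ->]|[q /eqP]]; last first.
  by rewrite p0 mulr0 eq_sym oner_eq0.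
by rewrite evM PhiQ_root ?mulr0 // prim_root_exp_coprime.
Qed.

Lemma ev_conj_eq n u p1 p2 : (0 < n)%N -> coprime u n ->
  ev (z n) p1 = ev (z n) p2 -> ev (z n ^+ u) p1 = ev (z n ^+ u) p2.
Proof.
move=> n0 co /eqP; rewrite -subr_eq0 -evB => /eqP /(ev_conj n0 co) /eqP.
by rewrite evB subr_eq0 => /eqP.
Qed.

Local Notation K := (cyclotomic_field R).

Lemma cyclotomic_fieldP n x : (0 < n)%N -> K n x <-> exists p, x = ev (z n) p.
Proof.
move=> n0; split=> [Kx|[p ->] A [A1 AB AV] Az].
  pose A : {pred R[i]} := fun x => `[< exists p, x = ev (z n) p >].
  have AP y : reflect (exists p, y = ev (z n) p) (y \in A) by apply: asboolP.
  apply/AP; apply: Kx; last by apply/AP; exists 'X; rewrite -['X]expr1 evXn.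
  split.
  - by apply/AP; exists 1; rewrite ev1.
  - by move=> a b /AP[p ->] /AP[q ->]; apply/AP; exists (p - q); rewrite evB.
  move=> a b /AP[p ->] /AP[q ->]; apply/AP.
  case: (ev_inv q n0 (zeta_prim R n0)) => [/dvdpP[e ->]|[q' h]].
    by exists 0; rewrite evM PhiQ_root ?zeta_prim // mulr0 invr0 mulr0 ev0.
  exists (p * q'); rewrite evM; congr (_ * _).
  have q0 : ev (z n) q != 0 by apply: contra_eq_neq h => ->; rewrite mulr0 eq_sym oner_neq0.
  by apply: (mulIf q0); rewrite h mulVf.
have A0 : 0 \in A by rewrite -(subrr 1) AB.
have AN a : a \in A -> - a \in A by move=> aA; rewrite -sub0r AB.
have AD a b : a \in A -> b \in A -> a + b \in A.
  by move=> aA bA; rewrite -[b]opprK AB // AN.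
have AM a b : a \in A -> b \in A -> a * b \in A.
  move=> aA bA; have bV : b^-1 \in A by rewrite -[b^-1]mul1r AV.
  by rewrite -[b]invrK AV.
have An (k : nat) : k%:R \in A by elim: k => // k IH; rewrite -natr1 AD.
have Ai (k : int) : k%:~R \in A by case: k => k; [exact: An|rewrite NegzE mulrNz AN //; exact: An].
rewrite /ev horner_coef; elim/big_ind: _ => // i _; apply: (AM).
  by rewrite coef_map /= /ratr AV.
by elim: (nat_of_ord i) => // k IH; rewrite exprS AM.
Qed.

Lemma K_zeta n : (0 < n)%N -> K n (z n).
Proof. by move=> n0; apply/cyclotomic_fieldP => //; exists 'X; rewrite -['X]expr1 evXn. Qed.

Lemma K_1 n : K n 1. Proof. by move=> A [A1 _ _] _. Qed.
Lemma K_B n x y : K n x -> K n y -> K n (x - y).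
Proof. by move=> hx hy A cA zA; case: (cA) => _ AB _; apply: AB; [exact: hx|exact: hy]. Qed.
Lemma K_div n x y : K n x -> K n y -> K n (x / y).
Proof. by move=> hx hy A cA zA; case: (cA) => _ _ AV; apply: AV; [exact: hx|exact: hy]. Qed.
Lemma K_0 n : K n 0. Proof. by rewrite -(subrr 1); apply: K_B; apply: K_1. Qed.
Lemma K_N n x : K n x -> K n (- x).
Proof. by move=> hx; rewrite -sub0r; apply: K_B => //; apply: K_0. Qed.
Lemma K_V n x : K n x -> K n x^-1.
Proof. by move=> hx; rewrite -div1r; apply: K_div => //; apply: K_1. Qed.
Lemma K_M n x y : K n x -> K n y -> K n (x * y).
Proof. by move=> hx hy; rewrite -[y]invrK; apply: K_div => //; apply: K_V. Qed.
Lemma K_X n x k : K n x -> K n (x ^+ k).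
Proof. by move=> hx; elim: k => [|k IH]; [exact: K_1|rewrite exprS; apply: K_M]. Qed.
Lemma K_Xz n x (k : int) : K n x -> K n (x ^ k).
Proof. by move=> hx; case: k => k; [exact: K_X|apply: K_V; exact: K_X]. Qed.
Lemma K_prod n (I : Type) (l : seq I) (P : pred I) (F : I -> R[i]) :
  (forall i, P i -> K n (F i)) -> K n (\prod_(i <- l | P i) F i).
Proof. by move=> h; elim/big_ind: _ => //; [exact: K_1|exact: K_M]. Qed.

Lemma zeta_dvd m N : (0 < N)%N -> (m %| N)%N -> z N ^+ (N %/ m) = z m.
Proof.
move=> N0 mN; rewrite zetaX; have m0 : (0 < m)%N := dvdn_gt0 N0 mN.
have -> : (N %/ m)%:R * (2 * pi / N%:R) = 2 * pi / m%:R :> R.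
  rewrite -{2}(divnK mN) natrM; field.
  by rewrite !pnatr_eq0 -!lt0n m0 divn_gt0 // dvdn_leq.
by [].
Qed.

Lemma ev_comp w p k : ev w (p \Po 'X^k) = ev (w ^+ k) p.
Proof. by rewrite /ev map_comp_poly /= map_polyXn horner_comp hornerXn. Qed.

Lemma aut_pow n s k x : is_field_aut (K n) s -> K n x -> s (x ^+ k) = s x ^+ k.
Proof.
case=> _ s1 _ sM Kx; elim: k => [|k IH]; first by rewrite !expr0.
by rewrite !exprS sM ?IH //; apply: K_X.
Qed.

Lemma aut_one_sub n s x : is_field_aut (K n) s -> K n x -> s (1 - x) = 1 - s x.
Proof.
case=> _ s1 sD _ Kx; have := sD (1 - x) x (K_B (@K_1 n) Kx) Kx.
by rewrite subrK s1 => E; rewrite [in RHS]E addrK.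
Qed.

Lemma field_aut_zeta n s : (0 < n)%N -> is_field_aut (K n) s ->
  exists2 u, coprime u n & s (z n) = z n ^+ u.
Proof.
move=> n0 as_; have pz := zeta_prim R n0; have Kz := K_zeta n0.
have [[_ sinj _] s1 _ _] := as_.
have /(prim_rootP pz)[u uE] : s (z n) ^+ n = 1.
  by rewrite -(aut_pow n as_ Kz) prim_expr_order // s1.
exists u => //; set d := gcdn u n; have d0 : (0 < d)%N by rewrite gcdn_gt0 n0 orbT.
have : z n ^+ (n %/ d) = 1.
  apply: sinj; rewrite ?inE; [exact: K_X|exact: K_1|].
  rewrite (aut_pow _ as_ Kz) uE s1 -exprM.
  by rewrite muln_divCA_gcd exprM (prim_expr_order pz) expr1n.
move/eqP; rewrite -(prim_order_dvd pz) => /dvdn_leq.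
rewrite divn_gt0 // dvdn_leq ?dvdn_gcdr // => /(_ isT) h.
rewrite /coprime -/d eqn_leq d0 andbT leqNgt; apply/negP => d1.
by have := ltn_Pdiv d1 n0; rewrite ltnNge h.
Qed.

Lemma gal_exists n u : (1 < n)%N -> coprime u n ->
  exists2 s, is_field_aut (K n) s & s (z n) = z n ^+ u.
Proof.
move=> n1 co; have n0 := ltnW n1; have Kz := K_zeta n0.
(* The automorphism is evaluation at zeta_n^u of any polynomial that represents x at zeta_n;
   [ev_conj_eq] makes the choice by [xget] irrelevant. *)
pose s x := ev (z n ^+ u) (xget 0 [set p | x = ev (z n) p]).
have sE p : s (ev (z n) p) = ev (z n ^+ u) p.
  apply: ev_conj_eq => //; rewrite /s; case: xgetP => [q _ -> //|h].
  by case: (h p).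
have KP x := cyclotomic_fieldP x n0.
have [u' cu' uu'] := coprime_inverse n1 co.
have zuu : z n ^+ (u * u') = z n by rewrite -(zeta_mod _ _ n0) uu' zeta_mod.
exists s; last by have := sE 'X; rewrite -['X]expr1 !evXn !expr1.
split.
- split.
  + by move=> _ /KP[p ->]; rewrite /= sE; apply/KP; exists (p \Po 'X^u); rewrite ev_comp.
  + move=> x y; rewrite !inE => /KP[p ->] /KP[q ->]; rewrite !sE -!ev_comp.
    by move/(ev_conj_eq n0 cu'); rewrite !ev_comp -!exprM mulnC zuu.
  move=> _ /KP[p ->]; exists (ev (z n) (p \Po 'X^u')); first by apply/KP; eexists.
  by rewrite sE ev_comp -exprM zuu.
- by have := sE 1; rewrite !ev1.
- by move=> x y /KP[p ->] /KP[q ->]; rewrite -evD !sE evD.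
- by move=> x y /KP[p ->] /KP[q ->]; rewrite -evM !sE evM.
Qed.

(** Replacing zeta_N by zeta_N^a in an expression of zeta_m as a polynomial in zeta_k fixes zeta_k
    but moves zeta_m. *)
Lemma zeta_notin k m N a : (0 < N)%N -> (k %| N)%N -> (m %| N)%N -> coprime a N ->
  (a = 1 %[mod k])%N -> (a != 1 %[mod m])%N -> ~ K k (z m).
Proof.
move=> N0 kN mN co a1 am; have k0 := dvdn_gt0 N0 kN; have m0 := dvdn_gt0 N0 mN.
case/(cyclotomic_fieldP _ k0) => p zE; have := zE.
rewrite -(zeta_dvd N0 kN) -ev_comp -(zeta_dvd N0 mN) -evXn.
move/(ev_conj_eq N0 co); rewrite evXn ev_comp -!exprM mulnC [X in ev (_ ^+ X)]mulnC.
rewrite !exprM !zeta_dvd // -[z k ^+ a](zeta_mod _ _ k0) a1 zeta_mod // expr1 -zE.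
by move/eqP; rewrite -{2}[z m]expr1 (eq_prim_root_expr (zeta_prim R m0)) (negPf am).
Qed.

Lemma zeta4 : z 4 = 'i%C.
Proof.
rewrite /zeta; have -> : 2 * pi / 4%:R = pi / 2 :> R by field.
by rewrite cos_pihalf sin_pihalf.
Qed.

Lemma imaginary_notin n : odd n -> ~ K n 'i%C.
Proof.
move=> on; have n0 : (0 < n)%N by case: n on.
have co : coprime n 4 by rewrite (@coprime_pexpr 2 n 2) // coprimen2.
rewrite -zeta4; apply: (@zeta_notin _ _ (n * 4) (chinese n 4 1 3)).
- by rewrite muln_gt0 n0.
- exact: dvdn_mulr.
- exact: dvdn_mull.
- rewrite coprimeMr -coprime_modl chinese_modl // coprime_modl coprime1n.
  by rewrite -coprime_modl chinese_modr.
- exact: chinese_modl.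
- by rewrite chinese_modr.
Qed.

(** If p^v divides n exactly and k = p^w k' with w < v, the residue [a] which is 1 + p^w modulo p^v
    and 1 modulo k' fixes zeta_k and moves zeta_(p^v). For w = 0 this residue is 2 modulo p^v,
    invertible because n is odd. *)
Lemma conductor_le n k : odd n -> (0 < k)%N -> K n `<=` K k -> (n <= k)%N.
Proof.
move=> on k0 sub; have n0 : (0 < n)%N by case: n on {sub}.
case: (boolP (n %| k)%N) => [/dvdn_leq -> //|].
move/(elimN (dvdn_partP _ n0)) => h; exfalso; apply: h => p pn.
have pp : prime p by move: pn; rewrite mem_primes; case/and3P.
have pdn : (p %| n)%N by move: pn; rewrite mem_primes; case/and3P.
have op : odd p := dvdn_odd pdn on.
rewrite p_part; set v := logn p n; apply/idPn => h.
have [k' cok' kE] := pfactor_coprime pp k0; set w := logn p k in kE.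
have wv : (w < v)%N by rewrite ltnNge; apply: contra h => h; rewrite pfactor_dvdn.
have pvk : coprime (p ^ v) k' by rewrite coprimeXl.
have k'0 : (0 < k')%N by rewrite lt0n; apply: contraTneq k0 => k'0; rewrite kE k'0.
pose a := chinese (p ^ v) k' (1 + p ^ w) 1.
have a1 : (a = 1 + p ^ w %[mod p ^ v])%N by apply: chinese_modl.
have a2 : (a = 1 %[mod k'])%N by apply: chinese_modr.
have cop : coprime (1 + p ^ w) p.
  case: (w) => [|w']; last by rewrite expnS /coprime gcdnC addnC mulnC gcdnMDl gcdn1.
  by rewrite expn0 addn1 coprime2n.
apply: (@zeta_notin k (p ^ v) (p ^ v * k') a).
- by rewrite muln_gt0 expn_gt0 prime_gt0.
- by rewrite {1}kE mulnC dvdn_mul // dvdn_exp2l // ltnW.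
- exact: dvdn_mulr.
- by rewrite coprimeMr -coprime_modl a1 coprime_modl coprimeXr // -coprime_modl a2 coprime_modl coprime1n.
- have pw : (a = 1 %[mod p ^ w])%N.
    have d : (p ^ w %| p ^ v)%N by rewrite dvdn_exp2l // ltnW.
    by rewrite -(modn_dvdm a d) a1 modn_dvdm // -modnDmr modnn addn0.
  have kE' : k = (p ^ w * k')%N by rewrite mulnC.
  have cwk : coprime (p ^ w) k' by rewrite coprimeXl.
  by apply/eqP; rewrite [X in (_ == _ %[mod X])%N]kE' (chinese_remainder cwk) a2 pw !eqxx.
- rewrite a1 -{2}[1%N]addn0 eqn_modDl mod0n -/(dvdn _ _).
  by apply/negP => /dvdn_leq; rewrite expn_gt0 prime_gt0 // leq_exp2l ?prime_gt1 // leqNgt wv => /(_ isT).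
apply: sub; rewrite -(zeta_dvd n0 (m := p ^ v)) ?pfactor_dvdnn //.
by apply: K_X; apply: K_zeta.
Qed.

Lemma cyclotomic_conductor n m : odd n -> is_conductor (K n) m <-> m = n.
Proof.
move=> on; have n0 : (0 < n)%N by case: n on.
split=> [[m0 sub mini]|->]; last by split=> // k k0; apply: conductor_le.
by apply/eqP; rewrite eqn_leq mini // (conductor_le on m0 sub).
Qed.

(** The monic integer polynomial is transported to [algC], where rational algebraic integers are
    known to be integers. *)
Lemma integral_ratr (c : rat) : integralOver (intr : int -> R[i]) (ratr c) -> c \is a Num.int.
Proof.
case=> f mf; have E (F : numFieldType) : map_poly (intr : int -> F) f = map_poly ratr (map_poly intr f : {poly rat}).
  by rewrite -map_poly_comp; apply: eq_map_poly => x /=; rewrite ratr_int.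
rewrite E /root horner_map fmorph_eq0 => fc.
have : (ratr c : algC) \in Aint.
  apply: (@root_monic_Aint (map_poly intr f)).
  - by rewrite E /root horner_map (eqP fc) rmorph0.
  - exact: monic_map.
  by apply/polyOverP => i; rewrite coef_map /= intr_int.
move/(Cint_rat_Aint (Crat_rat c)) => /intrP[m mE].
have -> : c = m%:~R by apply: (fmorph_inj (ratr : {rmorphism rat -> algC})); rewrite /= mE ratr_int.
exact: intr_int.
Qed.

Lemma prime_prod_unit (r : nat) (p : 'I_r -> nat) (m : 'I_r -> int) :
  (forall j, prime (p j)) -> injective p ->
  let c := \prod_j (p j)%:R ^ m j : R[i] in
  integralOver (intr : int -> R[i]) c -> integralOver (intr : int -> R[i]) c^-1 ->
  forall j, m j = 0.
Proof.
move=> hp hpinj; set c := \prod_j _ => /= ic icV.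
pose d : rat := \prod_j (p j)%:R ^ m j.
have cE : c = ratr d.
  by rewrite rmorph_prod; apply: eq_bigr => j _; rewrite fmorphXz rmorph_nat.
have dp : 0 < d by apply: prodr_gt0 => j _; rewrite exprz_gt0 // ltr0n prime_gt0.
have di : d \is a Num.int by apply: integral_ratr; rewrite -cE.
have dVi : d^-1 \is a Num.int.
  by apply: integral_ratr; move: icV; rewrite cE -fmorphV.
have d1 : d = 1.
  have h1 := norm_intr_ge1 di (lt0r_neq0 dp).
  have := norm_intr_ge1 dVi; rewrite invr_eq0 lt0r_neq0 // => /(_ isT).
  rewrite !gtr0_norm ?invr_gt0 // in h1 *; rewrite invf_ge1 // => h2.
  by apply/eqP; rewrite eq_le h1 h2.
pose A := (\prod_(j | (0 <= m j)%R) p j ^ `|m j|)%N.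
pose B := (\prod_(j | ~~ (0 <= m j)%R) p j ^ `|m j|)%N.
have AB : A = B.
  apply/eqP; rewrite -(eqr_nat rat); apply/eqP.
  have B0 : B%:R != 0 :> rat.
    rewrite natr_prod; apply/prodf_neq0 => j _.
    by rewrite pnatr_eq0 -lt0n expn_gt0 prime_gt0.
  apply: (mulIf (invr_neq0 B0)); rewrite mulfV // -[RHS]d1 /d (bigID (fun j => 0 <= m j)) /=.
  rewrite /A /B !natr_prod -prodfV; congr (_ * _); apply: eq_bigr => j mj.
    by rewrite natrX -{2}(gez0_abs mj).
  by case: (m j) mj => // k _; rewrite natrX.
have co (P : pred 'I_r) j : ~~ P j -> coprime (p j) (\prod_(k | P k) p k ^ `|m k|)%N.
  move=> Pj; elim/big_ind: _ => [|x y hx hy|k Pk]; rewrite ?coprimen1 ?coprimeMr ?hx //.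
  rewrite coprimeXr // prime_coprime // dvdn_prime2 //.
  by apply: contraNneq Pj => /hpinj ->.
move=> j; apply/eqP; apply: contraT => mj.
have dv (P : pred 'I_r) : P j -> (p j %| \prod_(k | P k) p k ^ `|m k|)%N.
  by move=> Pj; rewrite (bigD1 j) //= dvdn_mulr // dvdn_exp // absz_gt0.
have p1 X : coprime (p j) X -> (p j %| X)%N -> false.
  by rewrite prime_coprime // => /negP h /h.
have [mj0|mj0] := boolP (0 <= m j).
  by apply: (p1 B); [apply: co; rewrite negbK|rewrite -AB; apply: dv].
by apply: (p1 A); [exact: co|rewrite AB; apply: dv].
Qed.

End CyclotomicFields.

(** * Residues modulo n *)

Lemma even_totient m : odd m -> (2 < m)%N -> ~~ odd (totient m).
Proof.
move=> om m2; have [k mk]: exists k, (0 < k)%N /\ prime (pdiv m) /\ (pdiv m %| m)%N.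
  by exists 1%N; rewrite pdiv_prime ?pdiv_dvd //; apply: ltn_trans m2.
case: mk => _ [pp pm].
have [l col mE] := pfactor_coprime pp (ltnW (ltnW m2)).
have lg0 : (0 < logn (pdiv m) m)%N by rewrite -pfactor_dvdn // ?expn1 // ltnW // ltnW.
rewrite mE totient_coprime; last by rewrite coprime_sym coprimeXl.
rewrite totient_pfactor // !oddM /=.
have op : odd (pdiv m) by apply: dvdn_odd om.
by rewrite -subn1 oddB ?prime_gt0 // op /= andbF.
Qed.

Section PrimePowerCoordinates.
Variables (r : nat) (p ex q : 'I_r -> nat) (n : nat).
Hypothesis hp : forall j, prime (p j).
Hypothesis hpinj : injective p.
Hypothesis he : forall j, (0 < ex j)%N.
Hypothesis hq : forall j, q j = (p j ^ ex j)%N.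
Hypothesis hn : n = (\prod_j q j)%N.
Hypothesis hodd : odd n.
Hypothesis n1 : (1 < n)%N.
Local Notation S := 'Z_n.

Lemma q_gt1 j : (1 < q j)%N.
Proof. by rewrite hq; apply: leq_trans (prime_gt1 (hp j)) _; rewrite -{1}[p j]expn1 leq_exp2l ?prime_gt1. Qed.

Lemma q_coprime i j : i != j -> coprime (q i) (q j).
Proof.
move=> ij; rewrite !hq coprime_pexpl // coprime_pexpr // prime_coprime //.
rewrite dvdn_prime2 //; apply: contra ij => /eqP /hpinj ->; exact: eqxx.
Qed.

Lemma prod_q_coprime (P : pred 'I_r) j : ~~ P j -> coprime (q j) (\prod_(k | P k) q k)%N.
Proof.
move=> Pj; elim/big_ind: _ => [|x y hx hy|k Pk]; rewrite ?coprimen1 ?coprimeMr ?hx //.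
by apply: q_coprime; apply: contraNneq Pj => ->.
Qed.

Lemma prod_q_dvd (P : pred 'I_r) x : (forall j, P j -> q j %| x)%N ->
  (\prod_(j | P j) q j %| x)%N.
Proof.
move=> hx; have := index_enum_uniq 'I_r; elim: (index_enum _) => [|j s IH] /=.
  by rewrite big_nil dvd1n.
case/andP=> js us; rewrite big_cons; case: ifP => Pj; last exact: IH.
rewrite Gauss_dvd ?hx ?IH // big_seq_cond.
elim/big_ind: _ => [|y z hy hz|k /andP[ks _]]; rewrite ?coprimen1 ?coprimeMr ?hy //.
by apply: q_coprime; apply: contraNneq js => ->.
Qed.

Lemma n_dvd x : (forall j, q j %| x)%N -> (n %| x)%N.
Proof. by move=> h; rewrite hn; apply: prod_q_dvd. Qed.

Lemma nq_prod j : (n %/ q j = \prod_(k | k != j) q k)%N.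
Proof. by rewrite hn (bigD1 j) //= mulKn // ltnW // q_gt1. Qed.

Lemma q_dvd j : (q j %| n)%N.
Proof. by rewrite hn (bigD1 j) //= dvdn_mulr. Qed.

Lemma nqK j : (n %/ q j * q j = n)%N.
Proof. by rewrite divnK // q_dvd. Qed.

Lemma q_odd j : odd (q j). Proof. exact: dvdn_odd (q_dvd j) hodd. Qed.

Lemma q_gt2 j : (2 < q j)%N.
Proof. by move: (q_gt1 j) (q_odd j); case: (q j) => [|[|[|]]]. Qed.

Lemma p_dvd j : (p j %| q j)%N. Proof. by rewrite hq dvdn_exp. Qed.

Lemma q_coprimeE j a : coprime a (q j) = ~~ (p j %| a)%N.
Proof. by rewrite hq coprime_pexpr // coprime_sym prime_coprime. Qed.

Lemma q_coprime_nq j : coprime (q j) (n %/ q j).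
Proof. by rewrite nq_prod prod_q_coprime ?eqxx. Qed.

Lemma q_dvd_nq j k : k != j -> (q k %| n %/ q j)%N.
Proof. by move=> kj; rewrite nq_prod (bigD1 k) //= dvdn_mulr. Qed.

Lemma eqZ a b : ((a%:R : S) == b%:R) = (a == b %[mod n])%N.
Proof. by rewrite -val_eqE /= !val_Zp_nat. Qed.

Lemma eqZ0 a : ((a%:R : S) == 0) = (n %| a)%N.
Proof. by rewrite (eqZ a 0) mod0n. Qed.

Lemma valZ (t : S) : (val t)%:R = t. Proof. exact: natr_Zp. Qed.

(** The idempotent of the factor Z/q_j in the decomposition of Z/n by the Chinese remainder
    theorem. *)
Definition idem j : S := (chinese (q j) (n %/ q j) 1 0)%:R.

Lemma idem_eq0 j a : (a%:R * idem j == 0) = (q j %| a)%N.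
Proof.
rewrite -natrM eqZ0; set E := chinese _ _ _ _.
have E1 : (E = 1 %[mod q j])%N by apply: chinese_modl; apply: q_coprime_nq.
have E0 : (n %/ q j %| E)%N.
  by rewrite /dvdn (chinese_modr (q_coprime_nq j)) mod0n.
apply/idP/idP => [h|qa]; last by rewrite -(nqK j) mulnC dvdn_mul.
have : (q j %| a * E)%N by apply: dvdn_trans h; apply: q_dvd.
by rewrite Gauss_dvdl // /coprime -gcdn_modr E1 gcdn_modr gcdn1.
Qed.

Lemma idem_eq j a b : (a%:R * idem j == b%:R * idem j) = (a == b %[mod q j])%N.
Proof.
wlog ab : a b / (a <= b)%N.
  by move=> W; case: (leqP a b) => [/W //|/ltnW /W]; rewrite eq_sym => ->; rewrite eq_sym.
by rewrite eq_sym -subr_eq0 -mulrBl -natrB // idem_eq0 eq_sym eqn_mod_dvd.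
Qed.

Lemma idem_mod j : (chinese (q j) (n %/ q j) 1 0 = 1 %[mod q j])%N.
Proof. exact: (chinese_modl (q_coprime_nq j)). Qed.

Lemma idem_idem j : idem j * idem j = idem j.
Proof. by apply/eqP; rewrite {1}/idem -[eqbRHS]mul1r (idem_eq j _ 1) idem_mod. Qed.

Lemma idem_orth i j : i != j -> idem i * idem j = 0.
Proof.
move=> ij; apply/eqP; rewrite idem_eq0.
apply: dvdn_trans (q_dvd_nq (k := j) (j := i) _) _; first by rewrite eq_sym.
by rewrite /dvdn (chinese_modr (q_coprime_nq i)) mod0n.
Qed.

Lemma idem_inj (x y : S) : (forall j, x * idem j = y * idem j) -> x = y.
Proof.
move=> h; apply/eqP; rewrite -subr_eq0 -[x - y]valZ eqZ0; apply: n_dvd => j.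
by rewrite -idem_eq0 valZ mulrBl h subrr.
Qed.

Lemma idem_sum : \sum_j idem j = 1.
Proof.
apply: idem_inj => j; rewrite mul1r mulr_suml (bigD1 j) //= idem_idem.
by rewrite big1 ?addr0 // => i ij; rewrite idem_orth.
Qed.

(** The units of the factor Z/q_j inside Z/n: the residues x for which zeta_n^x is a primitive
    q_j-th root of unity. *)
Definition Gset j : {set S} := [set x | (x * idem j == x) && [exists y, x * y == idem j]]%SET.

Lemma GsetP j (x : S) : reflect (x * idem j = x /\ exists y, x * y = idem j) (x \in Gset j).
Proof.
rewrite inE; apply: (iffP andP) => [[/eqP h /existsP[y /eqP hy]]|[h [y hy]]]; split=> //.
- by exists y.
- exact/eqP.
by apply/existsP; exists y; apply/eqP.
Qed.

Lemma idem_neq0 j : idem j != 0.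
Proof. by rewrite -[idem j]mul1r (idem_eq0 j 1) dvdn1 neq_ltn q_gt1 orbT. Qed.

Lemma Gset_idem j x : x \in Gset j -> x * idem j = x.
Proof. by case/GsetP. Qed.

Lemma Gset0 j : 0 \notin Gset j.
Proof. by apply/GsetP => -[_ [y]]; rewrite mul0r => /esym/eqP; rewrite (negPf (idem_neq0 j)). Qed.

Lemma GsetN j x : x \in Gset j -> - x \in Gset j.
Proof.
case/GsetP => h [y hy]; apply/GsetP; rewrite mulNr h; split=> //.
by exists (- y); rewrite mulrNN.
Qed.

Lemma Gset_unit j x u : is_unit u -> x \in Gset j -> u * x \in Gset j.
Proof.
case=> v uv /GsetP[h [y hy]]; apply/GsetP; rewrite -mulrA h; split=> //.
by exists (v * y); rewrite mulrACA uv hy mul1r.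
Qed.

Lemma Gset_nat j a : (a%:R * idem j \in Gset j) = coprime a (q j).
Proof.
apply/GsetP/idP => [[_ [y]]|co].
  rewrite mulrAC -[y]valZ -natrM => /eqP; rewrite -[eqbRHS]mul1r (idem_eq j _ 1) => /eqP E.
  have : coprime (a * val y) (q j) by rewrite -coprime_modl E coprime_modl coprime1n.
  by rewrite coprimeMl => /andP[].
rewrite -mulrA idem_idem; split=> //; have [b _ ab] := coprime_inverse (q_gt1 j) co.
exists b%:R; apply/eqP; rewrite mulrAC -natrM -[eqbRHS]mul1r (idem_eq j _ 1).
by rewrite ab.
Qed.

Lemma GsetE j x : x * idem j = x -> (x \in Gset j) = coprime (val x) (q j).
Proof. by move=> xj; rewrite -Gset_nat valZ xj. Qed.

Definition half_system : {set S} := [set x : S | (0 < val x)%N && ((val x).*2 < n)%N]%SET.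

Lemma half0 : 0 \notin half_system. Proof. by rewrite inE. Qed.

Lemma val_lt (x : S) : (val x < n)%N.
Proof. by have := ltn_ord x; rewrite /=; move: (nat_of_ord x) => v; rewrite Zp_cast. Qed.

Lemma val_gt0 (x : S) : (0 < val x)%N = (x != 0).
Proof. by rewrite lt0n. Qed.

Lemma valN (x : S) : x != 0 -> val (- x) = (n - val x)%N.
Proof.
rewrite -val_gt0 /=; move: (val_lt x); rewrite /=; move: (nat_of_ord x) => v vn v0.
by rewrite Zp_cast // modn_small // ltn_subrL v0 (ltnW n1).
Qed.

Lemma halfN x : x != 0 -> (x \in half_system) (+) (- x \in half_system).
Proof.
move=> x0; rewrite !inE valN // val_gt0 x0 subn_gt0 val_lt /=.
have := val_lt x; have no : (val x).*2 != n by apply: contraTneq hodd => <-; rewrite odd_double.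
move: no; rewrite /=; move: (nat_of_ord x) => v; clear.
by case: (ltnP v.*2 n); case: (ltnP (n - v).*2 n) => //=; lia.
Qed.

(** The exponent n / n_Omega, for which zeta_n^(n / n_Omega) is zeta_Omega. *)
Definition base_pt (Om : {set 'I_r}) : S := (\prod_(j | j \notin Om) q j)%:R.

Lemma base_full Om : full idem Gset Om (base_pt Om).
Proof.
move=> i; case: ifP => iO; last first.
  by apply/eqP; rewrite idem_eq0 (bigD1 i) ?iO //= dvdn_mulr.
by rewrite Gset_nat coprime_sym prod_q_coprime // iO.
Qed.

(** On residues without i-th coordinate, [al i] and [be i] invert the multiplications by q_i and q_i
    / p_i. The added [idem i] puts 1 in the i-th coordinate and makes them units of Z/n. *)
Definition al i : S := ((q i)%:R * (1 - idem i) + idem i)^-1.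
Definition be i : S := ((q i %/ p i)%:R * (1 - idem i) + idem i)^-1.

Lemma shifted_unit i a : (forall k, k != i -> coprime a (q k)) ->
  a%:R * (1 - idem i) + idem i \is a GRing.unit.
Proof.
move=> co.
have inv k : exists y : S, k != i -> a%:R * y * idem k = idem k.
  case: (eqVneq k i) => [->|ki]; first by exists 0.
  have [b _ ab] := coprime_inverse (q_gt1 k) (co k ki); exists b%:R => _.
  by apply/eqP; rewrite -natrM -[eqbRHS]mul1r (idem_eq k _ 1) ab.
case: (choice inv) => y hy.
have : (a%:R * (1 - idem i) + idem i) * (\sum_(k | k != i) y k * idem k + idem i) = 1.
  apply: idem_inj => k; rewrite mul1r -mulrA; have [->|ki] := eqVneq k i.
    rewrite !mulrDl mulr_suml big1 => [|j ji]; last by rewrite -mulrA idem_orth ?mulr0.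
    by rewrite add0r !idem_idem -mulrA mulrBl mul1r idem_idem subrr mulr0 add0r.
  rewrite [_ * idem k]mulrDl mulr_suml (bigD1 k) //= big1 => [|j /andP[_ jk]]; last first.
    by rewrite -mulrA idem_orth ?mulr0.
  rewrite (idem_orth (i := i)) 1?eq_sym // !addr0 -mulrA idem_idem mulrCA mulrDl -mulrA mulrBl mul1r.
  by rewrite (idem_orth (i := i)) 1?eq_sym // subr0 addr0 mulrCA mulrA hy.
by move=> h; apply/unitrP; eexists; split; [rewrite mulrC; exact: h|exact: h].
Qed.

Lemma al_unit i : is_unit (al i).
Proof.
exists (al i)^-1; apply: divrr; rewrite /al unitrV; apply: shifted_unit => k ki.
by apply: q_coprime; rewrite eq_sym.
Qed.

Lemma qp_coprime i k : k != i -> coprime (q i %/ p i) (q k).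
Proof.
move=> ki; apply: coprime_dvdl (q_coprime (i := i) (j := k) _); last by rewrite eq_sym.
by rewrite -[X in (_ %| X)%N](divnK (p_dvd i)) dvdn_mulr.
Qed.

Lemma be_unit i : is_unit (be i).
Proof.
exists (be i)^-1; apply: divrr; rewrite /be unitrV; apply: shifted_unit => k ki.
exact: qp_coprime.
Qed.

(** * Norm relations derived from distribution relations *)

Section Distribution.
Variables (V : zmodType) (g : S -> V).
Hypothesis g_dist : forall d t, (d %| n)%N -> t * d%:R != 0 ->
  \sum_(k < d) g (t + (k * (n %/ d))%:R) = g (t * d%:R).

Lemma unit_neq0 (u t : S) : u \is a GRing.unit -> t != 0 -> u * t != 0.
Proof.
by move=> uu; apply: contra => /eqP h; rewrite -[t](mulKr uu) h mulr0.
Qed.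

(** The norm relation is the difference of the distribution relations of degrees q_i and q_i / p_i:
    the second sum consists of the terms of the first whose index is divisible by p_i, and the other
    indices run through G i. *)
Lemma dist_norm i t : t != 0 -> t * idem i = 0 ->
  forall u v, u * al i = 1 -> v * be i = 1 ->
  \sum_(x in Gset i) g (t + x) = g (u * t) - g (v * t).
Proof.
move=> t0 ti u v ua vb.
have unA : (q i)%:R * (1 - idem i) + idem i \is a GRing.unit.
  by apply: shifted_unit => k ki; apply: q_coprime; rewrite eq_sym.
have unB := shifted_unit (fun k => qp_coprime (i := i) (k := k)).
have tE a (w : S) : w * (a%:R * (1 - idem i) + idem i)^-1 = 1 ->
    a%:R * (1 - idem i) + idem i \is a GRing.unit -> w * t = t * a%:R.
  move=> h un; have -> : w = a%:R * (1 - idem i) + idem i.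
    by rewrite -[LHS](divrK un) h mul1r.
  by rewrite mulrDl -mulrA mulrBl mul1r mulrC [idem i * t]mulrC ti subr0 addr0.
rewrite (tE _ _ ua unA) (tE _ _ vb unB).
have tq : t * (q i)%:R != 0 by rewrite -(tE _ _ ua unA) unit_neq0 //; apply/unitrP; exists (al i); split; rewrite // mulrC.
have tqp : t * (q i %/ p i)%:R != 0 by rewrite -(tE _ _ vb unB) unit_neq0 //; apply/unitrP; exists (be i); split; rewrite // mulrC.
have qp_dvd : (q i %/ p i %| n)%N.
  by apply: dvdn_trans (q_dvd i); rewrite -[X in (_ %| X)%N](divnK (p_dvd i)) dvdn_mulr.
rewrite -(g_dist (q_dvd i) tq) -(g_dist qp_dvd tqp).
pose F k := g (t + (k * (n %/ q i))%:R).
have qipi : (q i = q i %/ p i * p i)%N by rewrite divnK // p_dvd.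
have -> : \sum_(k < q i %/ p i) g (t + (k * (n %/ (q i %/ p i)))%:R) = \sum_(k < q i | (p i %| k)%N) F k.
  have -> : (n %/ (q i %/ p i) = p i * (n %/ q i))%N.
    have E : (n = p i * (n %/ q i) * (q i %/ p i))%N by rewrite -mulnA mulnC -mulnA -qipi nqK.
    by rewrite {1}E mulnK // divn_gt0 ?prime_gt0 // dvdn_leq ?p_dvd // ltnW // q_gt1.
  have lt (k : 'I_(q i %/ p i)) : (k * p i < q i)%N.
    by rewrite {2}qipi ltn_pmul2r ?prime_gt0.
  have lt2 (k : 'I_(q i)) : (k %/ p i < q i %/ p i)%N.
    by rewrite ltn_divLR ?prime_gt0 // -qipi.
  rewrite (reindex_onto (fun k => Ordinal (lt k)) (fun k => Ordinal (lt2 k))) /=; last first.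
    by move=> k pk; apply/val_inj; rewrite /= divnK.
  apply: eq_big => [k|k _]; last by rewrite /F /= mulnA.
  rewrite dvdn_mull // andTb; apply/esym/eqP/val_inj.
  by rewrite /= mulnK ?prime_gt0.
rewrite (bigID (fun k : 'I_(q i) => (p i %| k)%N)) /= addrC addrK.
have nm := nqK i; set m := (n %/ q i)%N in nm *.
have m0 : (0 < m)%N by rewrite lt0n; apply: contraTneq n1 => m0; rewrite -nm m0.
have inj : {in [pred k : 'I_(q i) | ~~ (p i %| k)%N] &, injective (fun k : 'I_(q i) => ((k * m)%:R : S))}.
  have lt (k : 'I_(q i)) : (k * m < n)%N by rewrite -nm mulnC ltn_pmul2l.
  by move=> k l _ _ /eqP; rewrite eqZ !modn_small // eqn_pmul2r // => /eqP/val_inj.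
rewrite -(big_imset (fun x => g (t + x)) inj) /=; apply: eq_bigl => x.
apply/idP/imsetP => [xG|[k]].
  have dv : (m %| val x)%N.
    rewrite /m nq_prod; apply: prod_q_dvd => k ki.
    by rewrite -idem_eq0 valZ -(Gset_idem xG) -mulrA idem_orth ?mulr0 // eq_sym.
  have xn := val_lt x.
  have lt : (val x %/ m < q i)%N.
    by rewrite ltn_divLR // mulnC nm.
  exists (Ordinal lt); last by rewrite /= divnK ?valZ.
  rewrite inE /=; have := xG; rewrite GsetE ?Gset_idem // q_coprimeE; apply: contra => h.
  by rewrite -(divnK dv) dvdn_mulr.
rewrite inE => pk ->.
have E : (k * m)%:R * idem i = (k * m)%:R.
  apply: idem_inj => j; rewrite -mulrA; have [->|ji] := eqVneq j i; first by rewrite idem_idem.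
  rewrite (idem_orth (i := i)) 1?eq_sym // mulr0; apply/esym/eqP; rewrite idem_eq0.
  by rewrite dvdn_mull // q_dvd_nq.
by rewrite -E Gset_nat coprimeMl q_coprimeE pk coprime_sym q_coprime_nq.
Qed.

Definition supp (t : S) : {set 'I_r} := [set i | t * idem i != 0]%SET.

(** If p_j divides a nonzero j-th coordinate, the relation of degree p_j replaces t by its
    p_j-division points. They have the same support and generate strictly larger ideals, so the
    process stops. *)
Lemma norm_down t : t != 0 ->
  exists2 l : seq S, (forall x, x \in l -> full idem Gset (supp t) x) &
    g t = \sum_(x <- l) g x.
Proof.
pose I (t : S) : {set S} := [set t * z | z in predT]%SET.
have [m] := ubnP (#|S| - #|I t|)%N; elim: m => // m IH in t *; rewrite ltnS => tm t0.
have [gt|] := boolP [forall i, (i \in supp t) ==> (t * idem i \in Gset i)].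
  exists [:: t]; last by rewrite big_seq1.
  move=> x; rewrite inE => /eqP -> i; have /forallP/(_ i) := gt.
  by rewrite inE; case: eqP => //=.
rewrite negb_forall; move/existsP; case=> j; rewrite negb_imply inE => /andP[tj0 tjG].
have pt : (p j %| val t)%N.
  by apply: contraR tjG; rewrite -q_coprimeE -Gset_nat valZ.
pose a : S := (val t %/ p j)%:R.
have aE : a * (p j)%:R = t by rewrite -natrM divnK // valZ.
pose x (k : 'I_(p j)) : S := a + (k * (n %/ p j))%:R.
have pn : (p j %| n)%N := dvdn_trans (p_dvd j) (q_dvd j).
have xE k : x k * (p j)%:R = t.
  rewrite mulrDl aE -natrM -mulnA divnK // natrM; have -> : (n%:R : S) = 0 by apply/eqP; rewrite eqZ0.
  by rewrite mulr0 addr0.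
have x0 k : x k != 0 by apply: contra_neq t0 => h; rewrite -(xE k) h mul0r.
have suppx k : supp (x k) = supp t.
  apply/setP => i; rewrite !inE -(xE k); have [->|ij] := eqVneq i j.
    have h1 : x k * (p j)%:R * idem j != 0 by rewrite xE.
    by rewrite h1; apply: contra_neq h1; rewrite mulrAC => ->; rewrite mul0r.
  rewrite -[x k]valZ -natrM !idem_eq0 Gauss_dvdl // coprime_sym q_coprimeE dvdn_prime2 //.
  by apply: contra ij => /eqP/hpinj ->.
have Ix k : (#|S| - #|I (x k)| < m)%N.
  apply: leq_trans tm; apply: ltn_sub2l; last first.
    apply: proper_card; apply/fintype.properP; split.
      apply/fintype.subsetP => y /imsetP[z _ ->]; apply/imsetP; exists ((p j)%:R * z) => //.
      by rewrite mulrA xE.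
    exists (x k); first by apply/imsetP; exists 1; rewrite ?mulr1.
    apply/imsetP => -[z _ xz].
    (* If [x k] were a multiple t z, multiplication by [p j * z] would fix it, although its
       [ex j]-th power kills the coordinate j. *)
    have iter i : x k = x k * ((p j)%:R * z) ^+ i.
      elim: i => [|i IHi]; first by rewrite mulr1.
      by rewrite exprS mulrA [x k * _]mulrA xE -xz.
    move/negP: tj0; apply; rewrite -(xE k) (iter (ex j)) exprMn -natrX -hq.
    have -> : x k * ((q j)%:R * z ^+ ex j) * (p j)%:R * idem j =
      (q j)%:R * idem j * (x k * z ^+ ex j * (p j)%:R) by ring.
    by have /eqP -> : (q j)%:R * idem j == 0; rewrite ?mul0r ?idem_eq0.
  rewrite -cardsT; apply: proper_card.
  rewrite finset.properT; apply/eqP => h.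
  have : 1 \in I t by rewrite h inE.
  case/imsetP => z _ /esym tz1; case/negP: tjG; apply/GsetP; rewrite -mulrA idem_idem; split=> //.
  by exists z; rewrite mulrAC tz1 mul1r.
have /choice[l hl] k : exists l : seq S, (forall y, y \in l -> full idem Gset (supp t) y) /\
    g (x k) = \sum_(y <- l) g y.
  by have [l h1 h2] := IH (x k) (Ix k) (x0 k); exists l; rewrite -(suppx k).
exists (flatten [seq l k | k <- enum 'I_(p j)]).
  by move=> y /flattenP[s /mapP[k _ ->]]; apply: (hl k).1.
rewrite big_flatten /= big_map big_enum /= -{1}aE -g_dist ?aE //.
by apply: eq_bigr => k _; rewrite -(hl k).2.
Qed.

End Distribution.

Variable s : 'I_r -> nat.
Hypothesis s_one : forall j, (s j = 1 %[mod n %/ q j])%N.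
Hypothesis s_co : forall j, coprime (s j) (q j).
Hypothesis s_gen : forall j t, coprime t (q j) -> exists k, (t = s j ^ k %[mod q j])%N.

Definition hphi j := (totient (q j))./2.

Lemma hphi_double j : (hphi j).*2 = totient (q j).
Proof.
rewrite -[RHS]odd_double_half; have := even_totient (q_odd j) (q_gt2 j).
by move/negPf => ->.
Qed.

Lemma hphi_gt0 j : (0 < hphi j)%N.
Proof. by rewrite -double_gt0 hphi_double totient_gt0 ltnW // q_gt1. Qed.

Lemma s_pow_mod j k : (s j ^ (k %% totient (q j)) = s j ^ k %[mod q j])%N.
Proof.
rewrite {2}(divn_eq k (totient (q j))) expnD mulnC expnM.
by rewrite -modnMmr Euler_exp_totient ?coprimeXl // modnMmr muln1.
Qed.

Lemma s_pow_inj j a b : (a < totient (q j))%N -> (b < totient (q j))%N ->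
  (s j ^ a = s j ^ b %[mod q j])%N -> a = b.
Proof.
move=> la lb E.
have q0 : (0 < q j)%N by rewrite ltnW // q_gt1.
pose f (k : 'I_(totient (q j))) : 'I_(q j) := Ordinal (ltn_pmod (s j ^ k) q0).
have surj : [set x : 'I_(q j) | coprime (q j) x]%SET \subset [set f k | k in predT]%SET.
  apply/fintype.subsetP => x; rewrite inE coprime_sym => /s_gen[k hk].
  have kl : (k %% totient (q j) < totient (q j))%N by rewrite ltn_mod totient_gt0.
  apply/imsetP; exists (Ordinal kl) => //; apply/val_inj.
  by rewrite /= s_pow_mod -hk modn_small.
have card : #|[set x : 'I_(q j) | coprime (q j) x]%SET| = totient (q j).
  rewrite totient_count_coprime big_mkord -sum1_card big_mkcond /=.
  by apply: eq_bigr => x _; rewrite inE; case: coprime.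
have : #|[set f k | k in predT]%SET| == #|(predT : pred 'I_(totient (q j)))|.
  rewrite eqn_leq leq_imset_card /=; have := subset_leq_card surj.
  by rewrite card cardT size_enum_ord.
move/imset_injP => inj.
suff : Ordinal la = Ordinal lb by case.
by apply: inj => //; apply/val_inj.
Qed.

(** -1 is a power s^m with 0 < m < phi, and 2 m is a multiple of phi, which leaves m = phi / 2. *)
Lemma s_half_mod j : (q j %| s j ^ hphi j + 1)%N.
Proof.
have co1 : coprime (q j).-1 (q j) by rewrite -{2}(prednK (ltnW (q_gt1 j))) coprimenS.
have [k hk] := s_gen co1; set m := (k %% totient (q j))%N.
have mE : (s j ^ m + 1 = 0 %[mod q j])%N.
  rewrite -modnDml s_pow_mod -hk modnDml addn1 prednK ?modnn ?mod0n //.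
  by rewrite ltnW // q_gt1.
have mt : (m < totient (q j))%N by rewrite ltn_mod totient_gt0 ltnW // q_gt1.
suff -> : hphi j = m by rewrite /dvdn mE mod0n.
have sq : (s j ^ (m + m) = 1 %[mod q j])%N.
  rewrite expnD; apply/eqP; rewrite -(eqn_modDr (s j ^ m)).
  have -> : (s j ^ m * s j ^ m + s j ^ m = s j ^ m * (s j ^ m + 1))%N by rewrite mulnDr muln1.
  by rewrite -modnMmr mE modnMmr muln0 addnC mE.
have m0 : (0 < m)%N.
  rewrite lt0n; apply/eqP => m0; have : (q j %| 2)%N by rewrite /dvdn; move: mE; rewrite m0 expn0 mod0n => ->.
  by move/dvdn_leq => /(_ isT); rewrite leqNgt q_gt2.
have : ((m + m) %% totient (q j))%N = 0%N.
  apply: (@s_pow_inj j); rewrite ?ltn_mod ?totient_gt0 ?(ltnW (q_gt1 _)) //.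
  by rewrite s_pow_mod sq expn0.
move/eqP; rewrite -/(dvdn _ _) => /dvdnP[c cE].
have c1 : c = 1%N.
  have h1 : (c * totient (q j) < 2 * totient (q j))%N by rewrite -cE mul2n -addnn -addSn leq_add // ltnW.
  have h2 : (0 < c * totient (q j))%N by rewrite -cE addn_gt0 m0.
  move: h1 h2; rewrite ltn_pmul2r ?totient_gt0 ?(ltnW (q_gt1 _)) //; case: (c) => [|[|]] //.
by rewrite /hphi -[totient _]mul1n -c1 -cE addnn doubleK.
Qed.

Definition sZ j : S := (s j)%:R.

Lemma sZ_fix i k : k != i -> sZ i * idem k = idem k.
Proof.
move=> ki; apply/eqP; rewrite -[eqbRHS]mul1r (idem_eq k _ 1).
by rewrite -(modn_dvdm (s i) (q_dvd_nq ki)) s_one (modn_dvdm _ (q_dvd_nq ki)).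
Qed.

Lemma sZ_half j : sZ j ^+ hphi j * idem j = - idem j.
Proof.
apply/eqP; rewrite -addr_eq0 -[X in _ + X]mul1r -mulrDl /sZ -natrX -(natrD _ _ 1%N) idem_eq0.
exact: s_half_mod.
Qed.

Lemma Gset_pow i x a : x \in Gset i -> x * sZ i ^+ a = (val x * s i ^ a)%:R * idem i.
Proof. by move=> xG; rewrite natrM natrX valZ mulrAC Gset_idem. Qed.

Lemma Gset_gen i x y : x \in Gset i -> y \in Gset i ->
  exists2 a, (a < (hphi i).*2)%N & y = x * sZ i ^+ a.
Proof.
move=> xG yG; have cx : coprime (val x) (q i) by rewrite -GsetE // Gset_idem.
have cy : coprime (val y) (q i) by rewrite -GsetE // Gset_idem.
have [b cb xb] := coprime_inverse (q_gt1 i) cx.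
have cyb : coprime (val y * b) (q i) by rewrite coprimeMl cy.
have [k hk] := s_gen cyb; exists (k %% totient (q i))%N.
  by rewrite hphi_double ltn_mod totient_gt0 ltnW // q_gt1.
apply/eqP; rewrite Gset_pow // -(Gset_idem yG) -{1}[y]valZ idem_eq.
rewrite -[eqbRHS]modnMmr s_pow_mod -hk modnMmr mulnCA -modnMmr xb modnMmr muln1.
by [].
Qed.

Lemma Gset_inj i x a c : x \in Gset i -> (a < (hphi i).*2)%N -> (c < (hphi i).*2)%N ->
  x * sZ i ^+ a = x * sZ i ^+ c -> a = c.
Proof.
move=> xG; rewrite hphi_double => la lc; rewrite !Gset_pow // => /eqP.
have cx : coprime (val x) (q i) by rewrite -GsetE // Gset_idem.
have [b cb xb] := coprime_inverse (q_gt1 i) cx.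
rewrite idem_eq => /eqP E.
apply: (s_pow_inj la lc).
have := congr1 (fun z => (b * z) %% q i)%N E; rewrite !modnMmr !mulnA [(b * _)%N]mulnC.
by rewrite -modnMml xb modnMml mul1n -[in RHS]modnMml xb modnMml mul1n.
Qed.

Lemma word_full Om a : full idem Gset Om (gk_word sZ base_pt Om a).
Proof.
exact: (gk_word_full idem_sum Gset_unit hphi_gt0 sZ_fix sZ_half base_full).
Qed.

Section Span.
Variables (V : zmodType) (g : S -> V) (L : {pred V}).
Hypothesis LZ : GRing.zmod_closed L.
Hypothesis V2 : forall v : V, v *+ 2 = 0 -> v = 0.
Hypothesis g_even : forall t, g (- t) = g t.
Hypothesis g_dist : forall d t, (d %| n)%N -> t * d%:R != 0 ->
  \sum_(k < d) g (t + (k * (n %/ d))%:R) = g (t * d%:R).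
Hypothesis gX : forall (Om : {set 'I_r}) i a, (1 < #|Om|)%N -> i \in Om ->
  (forall j, j \in Om -> [/\ (j < i)%N -> (0 < a j < totient (q j))%N,
     j = i -> (0 < a j < hphi j)%N & (i < j)%N -> a j = 0%N]) ->
  g (gk_word sZ base_pt Om a) \in L.
Hypothesis g_base : forall Om : {set 'I_r}, (1 < #|Om|)%N -> ~~ odd #|Om| -> g (base_pt Om) \in L.
Hypothesis g_single : forall i a, (0 < a < hphi i)%N ->
  g (base_pt [set i]%SET * sZ i ^+ a) - g (base_pt [set i]%SET) \in L.

Lemma full_in_span (Om : {set 'I_r}) t : (1 < #|Om|)%N -> full idem Gset Om t -> g t \in L.
Proof.
apply: (gold_kim_span idem_idem idem_orth idem_sum Gset_idem Gset0 GsetN Gset_unit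
  al_unit be_unit half0 halfN hphi_gt0 sZ_fix sZ_half Gset_gen Gset_inj base_full
  LZ V2 g_even (dist_norm g_dist)) => // O i a O1 iO h.
by apply: (gX O1 iO) => j jO; rewrite -hphi_double; apply: h.
Qed.

Lemma single_diff_in_span i x y : x \in Gset i -> y \in Gset i -> g x - g y \in L.
Proof.
exact: (gold_kim_single idem_idem idem_orth idem_sum Gset_idem sZ_half Gset_gen
  base_full LZ g_even g_single).
Qed.

End Span.

(* Both kinds of Gold-Kim words are encoded by one tuple b of exponents, bounded
   by the orders of the s j.  A coordinate equal to 0 or to half the order is
   special; the exponents after the last non-special coordinate are 0 and there
   b j = 0 or b j = hphi j only records whether j lies in Omega.  If every
   coordinate is special, b stands for the base point of a set Omega of even
   cardinality. *)
Section Words.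
Local Notation T := {ffun 'I_r -> S}.
Implicit Types (b : T) (j k : 'I_r).

Definition wsupp b : {set 'I_r} := [set j | b j != 0]%SET.
Definition special b j := (val (b j) == 0%N) || (val (b j) == hphi j).
Definition wexp b j : nat :=
  if [exists k : 'I_r, (j <= k)%N && ~~ special b k] then val (b j) else 0%N.
Definition wbounded b := [forall j, (val (b j) < totient (q j))%N].
Definition wcond b :=
  if [exists k, ~~ special b k] then
    [exists k : 'I_r, [&& ~~ special b k, (val (b k) < hphi k)%N &
      [forall k' : 'I_r, (k < k')%N ==> special b k']]]
  else ~~ odd #|wsupp b|.
Definition is_word b := [&& wbounded b, wcond b & wsupp b != finset.set0].

Lemma hphi_lt j : (hphi j < totient (q j))%N.
Proof. by rewrite -hphi_double -addnn -addn1 leq_add2l hphi_gt0. Qed.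

Lemma totient_lt m : (1 < m)%N -> (totient m < m)%N.
Proof.
move=> m1; rewrite totient_count_coprime big_ltn ?(ltnW m1) // /coprime gcdn0.
rewrite gtn_eqF // add0n; apply: (@leq_ltn_trans (\sum_(1 <= i < m) 1)%N).
  by apply: leq_sum => i _; case: (_ == _).
by rewrite sum_nat_const_nat muln1 subn1 ltn_predL ltnW.
Qed.

Lemma totient_q_lt j : (totient (q j) < n)%N.
Proof. by apply: leq_trans (totient_lt (q_gt1 j)) _; rewrite dvdn_leq ?q_dvd // ltnW. Qed.

Lemma specialE b v j : val (b j) = v -> special b j = (v == 0%N) || (v == hphi j).
Proof. by rewrite /special => ->. Qed.

Definition of_values (v : 'I_r -> nat) : T := [ffun j => (v j)%:R].

Lemma of_valuesE v j : (v j < totient (q j))%N -> val (of_values v j) = v j.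
Proof.
move=> h; rewrite ffunE /= val_Zp_nat // modn_small //.
exact: ltn_trans h (totient_q_lt j).
Qed.

Lemma word_pivot (Om : {set 'I_r}) i (a : 'I_r -> nat) : i \in Om ->
  (forall j, j \in Om -> [/\ (j < i)%N -> (0 < a j < totient (q j))%N,
     j = i -> (0 < a j < hphi j)%N & (i < j)%N -> a j = 0%N]) ->
  exists b, [/\ is_word b, wsupp b = Om & forall j, j \in Om -> wexp b j = a j].
Proof.
move=> iO ha; pose v j := if j \in Om then if (j <= i)%N then a j else hphi j else 0%N.
have vlt j : (v j < totient (q j))%N.
  rewrite /v; case: ifP => jO; last by rewrite totient_gt0 ltnW // q_gt1.
  have [h1 h2 _] := ha j jO; case: (ltngtP j i) => [ji|ji|/ord_inj ji].
  - by case/andP: (h1 ji).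
  - exact: hphi_lt.
  by have /andP[_ h] := h2 ji; apply: ltn_trans h (hphi_lt j).
have vE j : val (of_values v j) = v j := of_valuesE (vlt j).
have v0 j : (v j == 0%N) = (j \notin Om).
  rewrite /v; case: ifP => //= jO; apply/negbTE; rewrite -lt0n.
  have [h1 h2 _] := ha j jO; case: (ltngtP j i) => [ji|ji|/ord_inj ji].
  - by case/andP: (h1 ji).
  - exact: hphi_gt0.
  by case/andP: (h2 ji).
have vi : (0 < v i < hphi i)%N by have [_ h _] := ha i iO; rewrite /v iO leqnn; apply: h.
have nsi : ~~ special (of_values v) i.
  by rewrite (specialE (vE i)) negb_or -lt0n; case/andP: vi => -> h; rewrite neq_ltn h.
have sp k : (i < k)%N -> special (of_values v) k.
  move=> ik; rewrite (specialE (vE k)) v0 /v; case: ifP => //= _.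
  by rewrite leqNgt ik eqxx.
have suppE : wsupp (of_values v) = Om.
  by apply/setP => j; rewrite !inE -val_eqE vE /= v0 negbK.
exists (of_values v); split=> //.
  apply/and3P; split.
  - by apply/forallP => j; rewrite vE.
  - rewrite /wcond; case: ifP => [_|/negbT/negP nex]; last by case: nex; apply/existsP; exists i.
    apply/existsP; exists i; rewrite nsi vE /=; case/andP: vi => _ ->.
    by apply/forallP => k; apply/implyP => /sp.
  by rewrite suppE; apply/set0Pn; exists i.
move=> j jO; rewrite /wexp; have [ji|ij] := leqP j i.
  by case: ifP => [_|/negbT/negP nex]; [rewrite vE /v jO ji|case: nex; apply/existsP; exists i; rewrite ji].
case: ifP => [/existsP[k /andP[jk]]|_]; first by rewrite sp // (leq_trans ij).
by have [_ _ ->] := ha j jO.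
Qed.

Lemma word_even (Om : {set 'I_r}) : Om != finset.set0 -> ~~ odd #|Om| ->
  exists b, [/\ is_word b, wsupp b = Om & forall j, wexp b j = 0%N].
Proof.
move=> O0 eO; pose v j := if j \in Om then hphi j else 0%N.
have vlt j : (v j < totient (q j))%N.
  by rewrite /v; case: ifP => _; [exact: hphi_lt|rewrite totient_gt0 ltnW // q_gt1].
have vE j : val (of_values v j) = v j := of_valuesE (vlt j).
have sp k : special (of_values v) k.
  by rewrite (specialE (vE k)) /v; case: ifP; rewrite eqxx ?orbT.
have suppE : wsupp (of_values v) = Om.
  apply/setP => j; rewrite !inE -val_eqE vE /= /v; case: ifP => // _.
  by rewrite -lt0n hphi_gt0.
exists (of_values v); split=> //.
  apply/and3P; split; rewrite ?suppE //; first by apply/forallP => j; rewrite vE.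
  by rewrite /wcond suppE; case: ifP => // /existsP[k]; rewrite sp.
by move=> j; rewrite /wexp; case: ifP => // /existsP[k]; rewrite sp andbF.
Qed.

Lemma word_cases b : is_word b ->
  (exists2 i, i \in wsupp b & forall j, j \in wsupp b ->
     [/\ (j < i)%N -> (0 < wexp b j < totient (q j))%N,
         j = i -> (0 < wexp b j < hphi j)%N & (i < j)%N -> wexp b j = 0%N])
  \/ (~~ odd #|wsupp b| /\ forall j, wexp b j = 0%N).
Proof.
case/and3P=> /forallP bb; rewrite /wcond; case: ifP => [_|ns] h _; last first.
  right; split=> // j; rewrite /wexp; case: ifP => // /existsP[k /andP[_ nk]].
  by have /negP := negbT ns; case; apply/existsP; exists k.
case/existsP: h => i /and3P[ni ilt /forallP sp]; left; exists i.
  by move: ni; rewrite inE /special negb_or; case/andP.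
move=> j; rewrite inE -val_eqE /= -lt0n => bj; split=> [ji|->|ij].
- rewrite /wexp; case: ifP => [_|/negbT/negP nex]; last by case: nex; apply/existsP; exists i; rewrite (ltnW ji).
  by rewrite bj bb.
- rewrite /wexp; case: ifP => [_|/negbT/negP nex]; last by case: nex; apply/existsP; exists i; rewrite leqnn.
  by rewrite ilt andbT lt0n; move: ni; rewrite /special negb_or; case/andP.
rewrite /wexp; case: ifP => // /existsP[k /andP[jk]].
by have := sp k; rewrite (leq_trans ij jk) /= => ->.
Qed.

Variable j0 : 'I_r.

(* This involution maps the words and the zero tuple to bounded tuples which are
   neither, whence 2 (#words + 1) <= phi(n). *)
Definition flipv b j : nat :=
  if [exists k, ~~ special b k] then (if val (b j) == 0%N then 0 else totient (q j) - val (b j))%N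
  else if j == j0 then (if val (b j) == 0 then hphi j else 0)%N else val (b j).
Definition flipw b : T := of_values (flipv b).

Lemma flipv_lt b j : wbounded b -> (flipv b j < totient (q j))%N.
Proof.
move=> /forallP bb; have t0 : (0 < totient (q j))%N by rewrite totient_gt0 ltnW // q_gt1.
rewrite /flipv; case: ifP => _.
  by case: ifP => // /negbT; rewrite -lt0n => bj; rewrite ltn_subrL bj t0.
case: ifP => _; last by have := bb j.
by case: ifP => _ //; apply: hphi_lt.
Qed.

Lemma flipwE b j : wbounded b -> val (flipw b j) = flipv b j.
Proof. by move=> bb; rewrite of_valuesE // flipv_lt. Qed.

Lemma flipw_bounded b : wbounded b -> wbounded (flipw b).
Proof. by move=> bb; apply/forallP => j; rewrite flipwE // flipv_lt. Qed.

Lemma special_flipw b j : wbounded b -> special (flipw b) j = special b j.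
Proof.
move=> bb; have /forallP/(_ j) bj := bb; rewrite /special flipwE // /flipv.
case: (boolP [exists k, ~~ special b k]) => ns.
  have [//|bj0] := eqVneq (val (b j)) 0%N; rewrite /= -hphi_double -addnn in bj *.
  have h0 := hphi_gt0 j; move: bj bj0 h0; move: (nat_of_ord (b j)) (hphi j) => x y h1 h2 h3.
  have -> : (y + y - x == 0)%N = false by apply/negbTE; rewrite subn_eq0 -ltnNge.
  by apply/eqP/eqP; clear -h1; lia.
have sb k : special b k by apply: contraNT ns => h; apply/existsP; exists k.
have [->|//] := eqVneq j j0; have := sb j0; rewrite /special.
by case: (eqVneq (val (b j0)) 0%N) => [_ _|_ /= ->]; rewrite ?eqxx ?orbT.
Qed.

Lemma flipw_exists b : wbounded b ->
  [exists k, ~~ special (flipw b) k] = [exists k, ~~ special b k].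
Proof. by move=> bb; apply: eq_existsb => k; rewrite special_flipw. Qed.

Lemma flipwK b : wbounded b -> flipw (flipw b) = b.
Proof.
move=> bb; apply/ffunP => j; apply/val_inj; have fb := flipw_bounded bb.
rewrite flipwE // /flipv flipw_exists // !flipwE // /flipv.
case: (boolP [exists k, ~~ special b k]) => ns.
  have [-> //|bj0] := eqVneq (val (b j)) 0%N; have /forallP/(_ j) bj := bb.
  by rewrite subn_eq0 leqNgt bj /= subKn // ltnW.
have [->|//] := eqVneq j j0.
have : special b j0 by apply: contraNT ns => h; apply/existsP; exists j0.
rewrite /special; have [->|_] /= := eqVneq (val (b j0)) 0%N; last by move/eqP.
by rewrite gtn_eqF ?hphi_gt0.
Qed.

(** If some coordinate is not special, the value v at the last such place goes to phi - v, from the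
    lower half to the upper one. Otherwise toggling j0 changes the parity of the support. *)
Lemma flipw_cond b : wbounded b -> wcond b -> ~~ wcond (flipw b).
Proof.
move=> bb; rewrite /wcond flipw_exists //; case: ifP => ns.
  case/existsP=> k /and3P[nk klt /forallP sk]; apply/negP => /existsP[l /and3P[nl llt /forallP sl]].
  have lk : l = k.
    apply/val_inj; case: (ltngtP l k) => // h.
      by have := sl k; rewrite h special_flipw // (negPf nk).
    by have := sk l; rewrite h -special_flipw // (negPf nl).
  move: llt; rewrite lk flipwE // /flipv ns; have kn0 : val (b k) != 0%N by move: nk; rewrite /special negb_or; case/andP.
  rewrite (negPf kn0) -hphi_double -addnn; move: klt; move: (val (b k)) (hphi k) => x y; clear; lia.
rewrite negbK => eS.
have mem : forall j, j != j0 -> (j \in wsupp (flipw b)) = (j \in wsupp b).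
  by move=> j jj0; rewrite !inE -!val_eqE flipwE // /flipv ns (negPf jj0).
have mem0 : (j0 \in wsupp (flipw b)) = (j0 \notin wsupp b).
  rewrite !inE -!val_eqE flipwE // /flipv ns eqxx /= negbK.
  by case: (nat_of_ord (b j0) == 0%N) => //=; rewrite -lt0n hphi_gt0.
have DE : wsupp (flipw b) :\ j0 = wsupp b :\ j0.
  by apply/setP => j; rewrite !inE; have [//|jj0] := eqVneq j j0; have := mem j jj0; rewrite !inE.
move: eS; rewrite (cardsD1 j0 (wsupp b)) (cardsD1 j0 (wsupp (flipw b))) mem0 DE !oddD.
by case: (j0 \in wsupp b) => /=; case: (odd #|_|).
Qed.

Lemma card_bounded : #|[set b : T | wbounded b]%SET| = totient n.
Proof.
have -> : totient n = (\prod_j totient (q j))%N.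
  rewrite hn; have := index_enum_uniq 'I_r; elim: (index_enum _) => [|j l IH] /=.
    by rewrite !big_nil.
  case/andP=> jl ul; rewrite !big_cons totient_coprime ?IH // big_seq.
  elim/big_ind: _ => [|x y hx hy|k kl]; rewrite ?coprimen1 ?coprimeMr ?hx //.
  by apply: q_coprime; apply: contraNneq jl => ->.
transitivity #|family (fun j => [pred x : S | (val x < totient (q j))%N])|.
  apply: eq_card => b; rewrite inE; apply/forallP/familyP => h j; have := h j; by rewrite inE.
rewrite card_family foldrE big_map big_enum /=; apply: eq_bigr => j _.
rewrite -sum1_card (eq_bigl (fun x : 'I_(Zp_trunc n).+2 => (x < totient (q j))%N)) //.
have le : (totient (q j) <= (Zp_trunc n).+2)%N by rewrite Zp_cast // ltnW // totient_q_lt.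
by rewrite (big_ord_narrow le) /= sum1_card card_ord.
Qed.

Lemma card_words : ((#|[set b : T | is_word b]%SET|.+1).*2 <= totient n)%N.
Proof.
pose W0 := [set b : T | wbounded b && wcond b]%SET.
have -> : #|[set b : T | is_word b]%SET|.+1 = #|W0|.
  pose zz : T := [ffun=> 0].
  have z0 : zz \in W0.
    have sp k : special zz k by rewrite /special ffunE.
    rewrite inE; apply/andP; split.
      by apply/forallP => j; rewrite ffunE totient_gt0 ltnW // q_gt1.
    rewrite /wcond; case: ifP => [/existsP[k]|_]; first by rewrite sp.
    have -> : wsupp zz = finset.set0 by apply/setP => j; rewrite !inE ffunE eqxx.
    by rewrite cards0.
  rewrite (cardsD1 zz W0) z0 add1n; congr (_.+1); apply: eq_card => b; rewrite !inE.
  rewrite /is_word andbA andbC; congr (_ && _); apply: negb_inj; rewrite !negbK.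
  apply/eqP/eqP => [/setP h|->]; last by apply/setP => j; rewrite !inE ffunE eqxx.
  by apply/ffunP => j; have := h j; rewrite !inE ffunE => /negbFE/eqP.
rewrite -card_bounded -addnn -{2}(card_in_imset (f := flipw) (D := W0)); last first.
  move=> b b'; rewrite !inE => /andP[bb _] /andP[bb' _] E.
  by rewrite -(flipwK bb) E flipwK.
rewrite -cardsUI [X in (_ + X)%N](_ : _ = 0%N) ?addn0.
  apply: subset_leq_card; apply/fintype.subsetP => b; rewrite !inE => /orP[/andP[]//|].
  by case/imsetP=> b'; rewrite !inE => /andP[bb _] ->; apply: flipw_bounded.
apply/eqP; rewrite cards_eq0; apply/eqP/setP => b; rewrite !inE; apply/negP.
case/andP=> /andP[bb cb] /imsetP[b']; rewrite inE => /andP[bb' cb'] E.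
by have := flipw_cond bb' cb'; rewrite -E cb.
Qed.

Definition half_units : {set S} := [set u | (coprime (val u) n) && (u \in half_system)]%SET.

Lemma coprime_sub_self a m : (a <= m)%N -> coprime (m - a) m = coprime a m.
Proof.
move=> am; have h d : coprime d (d + a) = coprime a (d + a).
  by rewrite /coprime gcdnDl addnC gcdnDl gcdnC.
by have := h (m - a)%N; rewrite subnK.
Qed.

Lemma card_half_units : #|half_units|.*2 = totient n.
Proof.
pose U := [set u : S | coprime (val u) n]%SET.
have UE u : (u \in U) = coprime (val u) n by rewrite inE.
have -> : totient n = #|U|.
  rewrite totient_count_coprime big_mkord -sum1_card.
  transitivity (\sum_(x < (Zp_trunc n).+2) coprime n x)%N; first by rewrite Zp_cast.
  by rewrite [RHS]big_mkcond /=; apply: eq_bigr => x _; rewrite UE coprime_sym; case: coprime.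
have U0 u : u \in U -> u != 0.
  rewrite UE; apply: contraTneq => ->; rewrite /coprime gcd0n; apply/eqP => h.
  by move: n1; rewrite h.
have UN u : u \in U -> - u \in U.
  move=> uU; have u0 := U0 u uU; move: uU; rewrite !UE valN // coprime_sub_self //.
  exact: ltnW (val_lt u).
have hE u : (u \in half_units) = (u \in U) && (u \in half_system) by rewrite inE UE.
have UH : U :&: half_units = half_units.
  by apply/finset.setIidPr/fintype.subsetP => u; rewrite hE => /andP[].
rewrite -(cardsID half_units U) UH -addnn; congr (_ + _)%N.
rewrite -(card_imset (mem half_units) (@oppr_inj S)); congr (#|pred_of_set _|).
apply/setP => u; rewrite finset.in_setD hE negb_and; apply/imsetP/andP => [[v]|[h uU]].
  rewrite hE => /andP[vU vH] ->; rewrite UN //= ; split=> //.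
  by have := halfN (U0 v vU); rewrite vH.
exists (- u); rewrite ?opprK // hE UN //=.
by have := halfN (U0 u uU); move: h; rewrite uU /= => /negPf ->.
Qed.

Lemma val_one : val (1 : S) = 1%N.
Proof. by have := val_Zp_nat n1 1; rewrite modn_small. Qed.

Lemma one_half : (1 : S) \in half_system.
Proof. by rewrite !inE val_one /=; move: n1 hodd; case: (n) => [|[|[|]]]. Qed.

Lemma card_words_le : (#|[set b : T | is_word b]%SET| <= #|half_units :\ (1%R : S)|)%N.
Proof.
have one : (1 : S) \in half_units.
  by rewrite inE val_one coprime1n one_half.
have := card_words; rewrite -card_half_units leq_double (cardsD1 1 half_units) one add1n.
by rewrite ltnS.
Qed.

End Words.

(** * Circular units *)

Lemma ln_prodr (R : realType) (I : Type) (l : seq I) (P : pred I) (F : I -> R) :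
  (forall i, P i -> 0 < F i) -> ln (\prod_(i <- l | P i) F i) = \sum_(i <- l | P i) ln (F i).
Proof.
move=> F0; suff [] : 0 < \prod_(i <- l | P i) F i /\
  ln (\prod_(i <- l | P i) F i) = \sum_(i <- l | P i) ln (F i) by [].
elim/big_rec2: _ => [|i x y Pi [x0 <-]]; first by rewrite ln1.
by rewrite mulr_gt0 ?F0 // lnM ?posrE ?F0.
Qed.

Lemma ln_exprz (R : realType) (x : R) (k : int) : 0 < x -> ln (x ^ k) = ln x *~ k.
Proof.
move=> x0; case: k => k; first by rewrite -exprnP lnXn // pmulrn.
by rewrite NegzE mulrNz -exprnN lnV ?posrE ?exprn_gt0 // lnXn // pmulrn.
Qed.

(** * Logarithms of circular numbers and of algebraic units *)

Section RealLogarithms.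
Variable R : realType.
Local Notation z := (zeta R n).
Local Notation integral := (integralOver (intr : int -> R[i])).

Let n0 : (0 < n)%N := ltnW n1.

Definition zt (t : S) : R[i] := z ^+ val t.
Definition om t : R[i] := 1 - zt t.
Definition lz t : R := ln (modc (om t)).

Lemma ztE a : zt a%:R = z ^+ a.
Proof. by rewrite /zt /= val_Zp_nat // zeta_mod. Qed.

Lemma ztD x y : zt (x + y) = zt x * zt y.
Proof. by rewrite -{1}[x]valZ -{1}[y]valZ -natrD ztE exprD. Qed.

Lemma ztM x a : zt (x * a%:R) = zt x ^+ a.
Proof. by rewrite -{1}[x]valZ -natrM ztE exprM. Qed.

Lemma zt_eq1 t : (zt t == 1) = (t == 0).
Proof. by rewrite -[t]valZ ztE zeta_eq1 // eqZ0. Qed.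

Lemma zt0 : zt 0 = 1. Proof. by apply/eqP; rewrite zt_eq1. Qed.

Lemma zt_pow t : zt t ^+ n = 1.
Proof. by rewrite -ztM; have /eqP -> : (n%:R : S) == 0; rewrite ?mulr0 ?zt0 // eqZ0. Qed.

Lemma zt_neq0 t : zt t != 0. Proof. by rewrite expf_neq0 // zeta_neq0. Qed.

Lemma ztN t : zt (- t) = (zt t)^-1.
Proof. by apply: (mulIf (zt_neq0 t)); rewrite -ztD addNr zt0 mulVf ?zt_neq0. Qed.

Lemma ztJ t : ((zt t)^*)%C = zt (- t).
Proof. by rewrite ztN /zt -exprVn -zetaJ rmorphXn. Qed.

Lemma omJ t : ((om t)^*)%C = om (- t).
Proof. by rewrite /om rmorphB rmorph1 /= ztJ. Qed.

Lemma om_eq0 t : (om t == 0) = (t == 0).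
Proof. by rewrite subr_eq0 eq_sym zt_eq1. Qed.

Lemma modc_om_gt0 t : t != 0 -> 0 < modc (om t).
Proof. by move=> t0; rewrite modc_gt0 om_eq0. Qed.

Lemma lz_even t : lz (- t) = lz t.
Proof. by rewrite /lz -omJ modcJ. Qed.

Lemma lz0 : lz 0 = 0.
Proof. by rewrite /lz /om zt0 subrr modc0 ln0. Qed.

Lemma prod_one_sub (F : fieldType) (w y : F) d : (0 < d)%N -> d.-primitive_root w ->
  \prod_(k < d) (1 - y * w ^+ k) = 1 - y ^+ d.
Proof.
move=> d0 pw; have [->|y0] := eqVneq y 0.
  by rewrite expr0n gtn_eqF // subr0 big1 // => k _; rewrite mul0r subr0.
have := congr1 (fun f => f.[y^-1]) (factor_Xn_sub_1 pw); rewrite /= big_mkord horner_prod !hornerE => h.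
have -> : 1 - y ^+ d = y ^+ d * (y^-1 ^+ d - 1).
  by rewrite mulrBr mulr1 -exprMn divff // expr1n.
have Yd : y ^+ d = \prod_(k < d) y by rewrite prodr_const card_ord.
rewrite -h Yd -big_split /=.
by apply: eq_bigr => k _; rewrite !hornerE mulrBr divff.
Qed.

Lemma prod_one_sub_root (F : fieldType) (w : F) d : (0 < d)%N -> d.-primitive_root w ->
  \prod_(1 <= k < d) (1 - w ^+ k) = d%:R.
Proof.
move=> d0 pw; have := factor_Xn_sub_1 pw; rewrite big_ltn // expr0.
rewrite -['X^d - 1]/('X^d - 1) -[X in _ = _ - X](expr1n _ d) subrXX => h.
have {h}/(congr1 (fun f => f.[1])) : \prod_(1 <= k < d) ('X - (w ^+ k)%:P) = \sum_(i < d) 'X^(d.-1 - i) * 1 ^+ i.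
  have X1 : 'X - 1%:P != 0 :> {poly F} by rewrite polyXsubC_eq0.
  by apply: (mulfI X1); rewrite h.
rewrite horner_prod => h; have {h} : \prod_(1 <= k < d) (1 - w ^+ k) = (\sum_(i < d) 'X^(d.-1 - i) * 1 ^+ i : {poly F}).[1].
  by rewrite -h; apply: eq_bigr => k _; rewrite !hornerE.
move=> ->; rewrite horner_sum (eq_bigr (fun=> 1)) => [|i _]; last by rewrite expr1n mulr1 hornerXn expr1n.
by rewrite sumr_const card_ord.
Qed.

Lemma om_dist d t : (d %| n)%N -> \prod_(k < d) om (t + (k * (n %/ d))%:R) = om (t * d%:R).
Proof.
move=> dn; have d0 := dvdn_gt0 n0 dn.
rewrite /om ztM -(prod_one_sub (zt t) d0 (zeta_prim R d0)); apply: eq_bigr => k _.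
by rewrite ztD ztE mulnC exprM (zeta_dvd R n0 dn).
Qed.

Lemma lz_dist d t : (d %| n)%N -> t * d%:R != 0 ->
  \sum_(k < d) lz (t + (k * (n %/ d))%:R) = lz (t * d%:R).
Proof.
move=> dn td; rewrite /lz -om_dist // modc_prod ln_prodr // => k _.
have : om (t * d%:R) != 0 by rewrite om_eq0.
by rewrite -om_dist // modc_gt0 (bigD1 k) //= mulf_eq0 negb_or => /andP[].
Qed.

Lemma lz_prime j : \sum_(1 <= k < p j) lz (k * (n %/ p j))%:R = ln (p j)%:R.
Proof.
have p0 := prime_gt0 (hp j); have pn : (p j %| n)%N := dvdn_trans (p_dvd j) (q_dvd j).
have omE k : om (k * (n %/ p j))%:R = 1 - zeta R (p j) ^+ k.
  by rewrite /om ztE mulnC exprM (zeta_dvd R n0 pn).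
have E : \prod_(1 <= k < p j) modc (om (k * (n %/ p j))%:R) = (p j)%:R.
  rewrite -modc_prod (eq_bigr _ (fun k _ => omE k)) (prod_one_sub_root p0 (zeta_prim R p0)).
  have -> : (p j)%:R = ((p j)%:R%:C)%C :> R[i] by rewrite rmorph_nat.
  by rewrite modc_real ger0_norm // ler0n.
rewrite -E /lz big_seq_cond [in RHS]big_seq_cond ln_prodr // => k; rewrite andbT mem_index_iota => /andP[k0 kp].
apply: modc_om_gt0; rewrite eqZ0; apply/negP => h.
have m0 : (0 < n %/ p j)%N by rewrite divn_gt0 // dvdn_leq.
have : (n %/ p j * p j %| n %/ p j * k)%N by rewrite divnK // mulnC.
by rewrite dvdn_pmul2l // => /dvdn_leq => /(_ k0); rewrite leqNgt kp.
Qed.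

Lemma integral_zt t : integral (zt t).
Proof.
apply: (@integral_root_monic _ _ _ _ ('X^n - 1)).
- by rewrite monicXnsubC.
- by rewrite /root !hornerE zt_pow subrr.
apply/integral_poly => i; rewrite coefB coefXn coef1.
by apply: integral_sub; apply: integral_nat.
Qed.

Lemma integral_X x k : integral x -> integral (x ^+ k).
Proof.
by move=> ix; elim: k => [|k IH]; [exact: integral1|rewrite exprS; apply: integral_mul].
Qed.

Lemma integral_sum (I : Type) (l : seq I) (P : pred I) (F : I -> R[i]) :
  (forall i, P i -> integral (F i)) -> integral (\sum_(i <- l | P i) F i).
Proof.
move=> h; elim/big_rec: _ => [|i x Pi ix]; first exact: (integral_nat (intr : {rmorphism int -> R[i]}) 0).
by apply: integral_add => //; apply: h.
Qed.

Lemma integral_om t : integral (om t).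
Proof. by apply: integral_sub; [exact: integral1|exact: integral_zt]. Qed.

Lemma one_sub_pow (w : R[i]) k : 1 - w ^+ k = (1 - w) * \sum_(i < k) w ^+ i.
Proof. by rewrite -opprB subrX1 -mulNr opprB. Qed.

Lemma om_quotient_integral t a : t != 0 -> integral (om (t * a%:R) / om t).
Proof.
move=> t0; rewrite /om ztM one_sub_pow mulrC mulKf -/(om t) ?om_eq0 //.
by apply: integral_sum => i _; apply: integral_X; apply: integral_zt.
Qed.

(** The powers of w from 0 to m - 1 have sum 0, so m is the sum of the 1 - w^k, all divisible by 1 -
    w. *)
Lemma root_of_unity_dvd (w : R[i]) m : w != 1 -> w ^+ m = 1 -> integral w ->
  exists2 A, integral A & (1 - w) * A = m%:R.
Proof.
move=> w1 wm iw; exists (\sum_(k < m) \sum_(i < k) w ^+ i).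
  by apply: integral_sum => k _; apply: integral_sum => i _; apply: integral_X.
rewrite mulr_sumr (eq_bigr (fun k : 'I_m => 1 - w ^+ k)) => [|k _]; last by rewrite -one_sub_pow.
rewrite sumrB sumr_const card_ord; have -> : \sum_(k < m) w ^+ k = 0; last by rewrite subr0.
have w10 : 1 - w != 0 by rewrite subr_eq0 eq_sym.
by apply: (mulfI w10); rewrite -one_sub_pow wm subrr mulr0.
Qed.

Lemma om_dvd_q t i : t * idem i != 0 -> exists2 A, integral A & om t * A = (q i)%:R.
Proof.
move=> ti; set m := (n %/ q i)%N; have t0 : t != 0 by apply: contra_neq ti => ->; rewrite mul0r.
have [||A iA AE] := @root_of_unity_dvd (zt (t * m%:R)) (q i) _ _ (integral_zt _).
- rewrite zt_eq1; apply: contra ti => /eqP h.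
  have : t * m%:R * idem i == 0 by rewrite h mul0r.
  by rewrite -{1}[t]valZ -natrM idem_eq0 Gauss_dvdl ?q_coprime_nq // -idem_eq0 valZ.
- by rewrite -!ztM -mulrA -natrM nqK ztM zt_pow.
exists (om (t * m%:R) / om t * A); last by rewrite mulrA mulrCA divff ?om_eq0 // mulr1.
by apply: integral_mul => //; apply: om_quotient_integral.
Qed.

(** 1 - zeta_n^t divides both q_i and q_j, which are coprime, so a Bezout identity exhibits its
    inverse as an algebraic integer. *)
Lemma om_unit t : (1 < #|supp t|)%N -> integral (om t)^-1.
Proof.
move=> /card_gt1P[i [j [iS jS ij]]]; rewrite !inE in iS jS.
have t0 : t != 0 by apply: contra_neq iS => ->; rewrite mul0r.
have [A iA AE] := om_dvd_q iS; have [B iB BE] := om_dvd_q jS.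
have [[u v] uv] : exists uv : int * int, uv.1%:~R * (q i)%:R + uv.2%:~R * (q j)%:R = 1 :> R[i].
  have /coprimezP[[u v] /= uv] : coprimez (q i) (q j) by rewrite /coprimez /gcdz /= (eqP (q_coprime ij)).
  exists (u, v) => /=; have := congr1 (fun x : int => x%:~R : R[i]) uv.
  by rewrite rmorphD !rmorphM /= -!pmulrn.
have -> : (om t)^-1 = u%:~R * A + v%:~R * B.
  apply: (mulfI (x := om t)); first by rewrite om_eq0.
  move: uv => /= uv; rewrite divff ?om_eq0 // [RHS]mulrDr [om t * (u%:~R * A)]mulrCA AE.
  by rewrite [om t * (v%:~R * B)]mulrCA BE uv.
by apply: integral_add; apply: integral_mul => //; apply: integral_id.
Qed.

Lemma om_single_unit j a : coprime a (q j) -> forall x, x \in Gset j ->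
  integral (om (x * a%:R) / om x) /\ integral (om (x * a%:R) / om x)^-1.
Proof.
move=> co x xG; have x0 : x != 0 by apply: contraTneq xG => ->; rewrite Gset0.
split; first exact: om_quotient_integral.
have [b _ ab] := coprime_inverse (q_gt1 j) co.
have xab : x * a%:R * b%:R = x.
  rewrite -(Gset_idem xG) -!mulrA [idem j * _]mulrC -!mulrA; congr (_ * _).
  rewrite mulrA -natrM -[RHS]mul1r; apply/eqP.
  by rewrite (idem_eq j _ 1) ab.
have xa0 : x * a%:R != 0 by apply: contra_neq x0 => h; rewrite -xab h mul0r.
by rewrite invf_div -{1}xab; apply: om_quotient_integral.
Qed.

(** Logarithms of the units of the ring of all algebraic integers; no field is fixed, so that v and
    its conjugate can be multiplied freely. *)
Definition unit_log : {pred R} := fun y => `[< exists v, [/\ v != 0, integral v,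
  integral v^-1 & y = ln (modc v)] >].

Lemma unit_logP y : reflect (exists v, [/\ v != 0, integral v, integral v^-1 & y = ln (modc v)])
  (y \in unit_log).
Proof. exact: asboolP. Qed.

Lemma unit_log_closed : GRing.zmod_closed unit_log.
Proof.
split.
  by apply/unit_logP; exists 1; rewrite oner_neq0 invr1 modc1 ln1; split=> //; apply: integral1.
move=> x y /unit_logP[v [v0 iv ivV ->]] /unit_logP[w [w0 iw iwV ->]]; apply/unit_logP.
exists (v / w); split.
- by rewrite mulf_neq0 ?invr_neq0.
- exact: integral_mul.
- by rewrite invf_div; apply: integral_mul.
by rewrite modcM modcV lnM ?lnV ?posrE ?invr_gt0 ?modc_gt0.
Qed.

Lemma integralJ x : integral x -> integral (x^*)%C.
Proof.
move=> ix; have [f mf fx] := integral_rmorph (@conjc R : {rmorphism R[i] -> R[i]}) ix.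
exists f => //; move: fx; congr (root _ _).
by apply: eq_map_poly => k /=; rewrite rmorph_int.
Qed.

(** If |v| is a product of powers of the p_j, then v times its conjugate is rational, and as a unit
    it must be 1. The exponents are doubled because |v| itself occurs only through its square. *)
Lemma ln_primes_unit (m : 'I_r -> int) :
  \sum_j ln (p j)%:R *~ m j \in unit_log -> forall j, m j = 0.
Proof.
case/unit_logP=> v [v0 iv ivV E].
pose c : R[i] := \prod_j (p j)%:R ^ (m j *+ 2).
have p0 j : 0 < (p j)%:R :> R by rewrite ltr0n prime_gt0.
have mv : modc v = \prod_j (p j)%:R ^ m j.
  have pp : 0 < \prod_j (p j)%:R ^ m j :> R by apply: prodr_gt0 => j _; apply: exprz_gt0.
  apply: ln_inj; rewrite ?posrE ?modc_gt0 //.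
  by rewrite -E ln_prodr => [|j _]; [apply: eq_bigr => j _; rewrite ln_exprz|exact: exprz_gt0].
have cE : c = v * (v^*)%C.
  rewrite mulcJ mv -prodrXl rmorph_prod; apply: eq_bigr => j _.
  rewrite rmorphXn /= fmorphXz rmorph_nat mulr2n expfzDr ?expr2 //.
  by rewrite pnatr_eq0 -lt0n prime_gt0.
have iv2 : integral c by rewrite cE; apply: integral_mul => //; apply: integralJ.
have iv2V : integral c^-1.
  by rewrite cE invfM -fmorphV; apply: integral_mul => //; apply: integralJ.
move=> j; have := prime_prod_unit hp hpinj iv2 iv2V j.
by move/eqP; rewrite mulrn_eq0 => /eqP.
Qed.

Definition wbase b := base_pt (wsupp b).
Definition wpt b := gk_word sZ base_pt (wsupp b) (wexp b).
(** A single-prime word enters as a quotient by its base point, since 1 - zeta_(q_j) is not a unit;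
    this quotient has the absolute value of xi. *)
Definition ell (g : S -> R) b : R :=
  if #|wsupp b| == 1%N then g (wpt b) - g (wbase b) else g (wpt b).

Lemma wpt_full b : full idem Gset (wsupp b) (wpt b). Proof. exact: word_full. Qed.

Lemma full_supp Om t : full idem Gset Om t -> supp t = Om.
Proof.
move=> ft; apply/setP => i; rewrite inE; have := ft i; case: ifP => _.
  by move=> h; apply: contraTneq h => ->; rewrite Gset0.
by move=> ->; rewrite eqxx.
Qed.

Lemma full_single j t : full idem Gset [set j]%SET t -> t \in Gset j.
Proof.
move=> ft; suff -> : t = t * idem j by have := ft j; rewrite inE eqxx.
apply: idem_inj => k; rewrite -mulrA; have [->|kj] := eqVneq k j; first by rewrite idem_idem.
by rewrite idem_orth 1?eq_sym // mulr0; have := ft k; rewrite inE (negPf kj).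
Qed.

Lemma R2 (v : R) : v *+ 2 = 0 -> v = 0.
Proof. by move/eqP; rewrite mulrn_eq0 => /eqP. Qed.

Section WordSpan.
Variables (g : S -> R) (L : {pred R}).
Hypothesis LZ : GRing.zmod_closed L.
Hypothesis g_even : forall t, g (- t) = g t.
Hypothesis g_dist : forall d t, (d %| n)%N -> t * d%:R != 0 ->
  \sum_(k < d) g (t + (k * (n %/ d))%:R) = g (t * d%:R).
Hypothesis gL : forall b, is_word b -> ell g b \in L.

Let gword (Om : {set 'I_r}) a b : (forall j, j \in Om -> wexp b j = a j) -> wsupp b = Om ->
  gk_word sZ base_pt Om a = wpt b.
Proof.
by move=> h sb; rewrite /wpt sb /gk_word; congr (_ * _); apply: eq_bigr => j jb; rewrite h.
Qed.

Lemma word_span_pivot (Om : {set 'I_r}) i a : (1 < #|Om|)%N -> i \in Om ->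
  (forall j, j \in Om -> [/\ (j < i)%N -> (0 < a j < totient (q j))%N,
     j = i -> (0 < a j < hphi j)%N & (i < j)%N -> a j = 0%N]) ->
  g (gk_word sZ base_pt Om a) \in L.
Proof.
move=> O1 iO /(word_pivot iO)[b [wb sb ab]]; have := gL wb.
by rewrite /ell sb gtn_eqF // (gword ab sb).
Qed.

Lemma word_span_base (Om : {set 'I_r}) : (1 < #|Om|)%N -> ~~ odd #|Om| -> g (base_pt Om) \in L.
Proof.
move=> O1 eO; have O0 : Om != finset.set0 by rewrite -card_gt0 ltnW.
have [b [wb sb ab]] := word_even O0 eO; have := gL wb.
rewrite /ell sb gtn_eqF // -(gword (fun j _ => ab j) sb) /gk_word big1 ?mulr1 // => j _.
Qed.

Lemma word_span_single i a : (0 < a < hphi i)%N ->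
  g (base_pt [set i]%SET * sZ i ^+ a) - g (base_pt [set i]%SET) \in L.
Proof.
move=> ai; have [|b [wb sb ab]] := @word_pivot [set i]%SET i (fun=> a) (finset.set11 i).
  by move=> j; rewrite inE => /eqP ->; rewrite ltnn.
have := gL wb; rewrite /ell sb cards1 eqxx -(gword ab sb) /wbase sb /gk_word.
by rewrite big_set1.
Qed.

Lemma span_full (Om : {set 'I_r}) t : (1 < #|Om|)%N -> full idem Gset Om t -> g t \in L.
Proof.
exact: (full_in_span LZ R2 g_even g_dist word_span_pivot word_span_base word_span_single).
Qed.

Lemma span_single i x y : x \in Gset i -> y \in Gset i -> g x - g y \in L.
Proof. exact: (single_diff_in_span LZ g_even word_span_single). Qed.

Lemma span_supp t : (1 < #|supp t|)%N -> g t \in L.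
Proof.
move=> S1; have t0 : t != 0.
  by case/card_gt0P: (ltnW S1) => i; rewrite inE; apply: contra_neq => ->; rewrite mul0r.
have [l fl ->] := norm_down g_dist t0.
have L0 : 0 \in L by case: LZ.
have LD x y : x \in L -> y \in L -> x + y \in L.
  by case: LZ => _ LB xL yL; rewrite -[y]opprK LB // -sub0r LB.
rewrite big_seq; elim/big_ind: _ => // x xl; apply: (span_full S1); exact: fl.
Qed.

Lemma span_supp1 j t : supp t = [set j]%SET ->
  exists m : nat, g t - g (base_pt [set j]%SET) *+ m \in L.
Proof.
move=> St; have t0 : t != 0.
  apply/eqP => t0; have : j \in supp t by rewrite St finset.set11.
  by rewrite inE t0 mul0r eqxx.
have [l fl ->] := norm_down g_dist t0; exists (size l).
have L0 : 0 \in L by case: LZ.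
have LD x y : x \in L -> y \in L -> x + y \in L.
  by case: LZ => _ LB xL yL; rewrite -[y]opprK LB // -sub0r LB.
have -> : g (base_pt [set j]%SET) *+ size l = \sum_(x <- l) g (base_pt [set j]%SET).
  by rewrite big_const_seq count_predT iter_addr_0.
rewrite -sumrB big_seq; elim/big_ind: _ => // x xl; apply: (@span_single j).
  by apply: full_single; rewrite -St; apply: fl.
by apply: full_single; apply: base_full.
Qed.

End WordSpan.

Definition word_span : {pred R} := fun v => `[< exists k : {ffun 'I_r -> S} -> int,
  v = \sum_(b | is_word b) ell lz b *~ k b >].

Lemma word_spanP v : reflect (exists k : {ffun 'I_r -> S} -> int,
  v = \sum_(b | is_word b) ell lz b *~ k b) (v \in word_span).
Proof. exact: asboolP. Qed.

Lemma word_span_closed : GRing.zmod_closed word_span.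
Proof.
split; first by apply/word_spanP; exists (fun=> 0); rewrite big1 // => b _; rewrite mulr0z.
move=> x y /word_spanP[k ->] /word_spanP[k' ->]; apply/word_spanP.
by exists (fun b => k b - k' b); rewrite -sumrB; apply: eq_bigr => b _; rewrite mulrzBr.
Qed.

Lemma word_in_span b : is_word b -> ell lz b \in word_span.
Proof.
move=> wb; apply/word_spanP; exists (fun b' => (b' == b)%:R).
by rewrite (bigD1 b) //= eqxx mulr1z big1 ?addr0 // => b' /andP[_ /negPf ->]; rewrite mulr0z.
Qed.

Section Closed.
Variable L : {pred R}.
Hypothesis LZ : GRing.zmod_closed L.
Lemma zclosed0 : 0 \in L. Proof. by case: LZ. Qed.
Lemma zclosedB x y : x \in L -> y \in L -> x - y \in L. Proof. by case: LZ => _; apply. Qed.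
Lemma zclosedN x : x \in L -> - x \in L.
Proof. by move=> xL; rewrite -sub0r zclosedB // zclosed0. Qed.
Lemma zclosedD x y : x \in L -> y \in L -> x + y \in L.
Proof. by move=> xL yL; rewrite -[y]opprK zclosedB // zclosedN. Qed.
Lemma zclosed_sum (I : Type) (l : seq I) (P : pred I) (F : I -> R) :
  (forall i, P i -> F i \in L) -> \sum_(i <- l | P i) F i \in L.
Proof. by move=> h; elim/big_ind: _ => //; [exact: zclosed0|exact: zclosedD]. Qed.
Lemma zclosedZ x (k : int) : x \in L -> x *~ k \in L.
Proof.
move=> xL; have nk (m : nat) : x *+ m \in L.
  by elim: m => [|m IH]; rewrite ?mulr0n ?zclosed0 // mulrS zclosedD.
by case: k => m; [exact: nk|rewrite NegzE mulrNz zclosedN //; exact: nk].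
Qed.
End Closed.

Lemma coprime_s_pow j a : coprime (s j ^ a) (q j). Proof. by rewrite coprimeXl. Qed.

Lemma wpt_single b j : wsupp b = [set j]%SET -> wpt b = wbase b * (s j ^ wexp b j)%:R.
Proof. by move=> h; rewrite /wpt /wbase /gk_word h big_set1 /sZ natrX. Qed.

Lemma wpt_neq0 b : is_word b -> wpt b != 0.
Proof.
case/and3P=> _ _ /set0Pn[j jb]; apply/eqP => w0; have := wpt_full b j.
by rewrite jb w0 mul0r (negPf (Gset0 j)).
Qed.

Lemma word_unit_log b : is_word b -> ell lz b \in unit_log.
Proof.
move=> wb; have w0 := wpt_neq0 wb; apply/unit_logP; rewrite /ell.
case: (eqVneq #|wsupp b| 1%N) => [/eqP/cards1P[j sb]|s1].
  have bG : wbase b \in Gset j by apply: full_single; rewrite /wbase sb; apply: base_full.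
  have b0 : wbase b != 0 by apply: contraTneq bG => ->; rewrite Gset0.
  have [i1 i2] := om_single_unit (coprime_s_pow j (wexp b j)) bG.
  exists (om (wpt b) / om (wbase b)); rewrite {1 2 3}(wpt_single sb); split=> //.
    by rewrite -(wpt_single sb) mulf_neq0 ?invr_neq0 ?om_eq0.
  by rewrite modcM modcV lnM ?lnV ?posrE ?invr_gt0 ?modc_om_gt0.
exists (om (wpt b)); split=> //; first by rewrite om_eq0.
  exact: integral_om.
apply: om_unit; rewrite (full_supp (wpt_full b)) ltn_neqAle eq_sym s1 card_gt0.
by case/and3P: wb.
Qed.

Lemma word_span_unit v : v \in word_span -> v \in unit_log.
Proof.
case/word_spanP=> k ->; apply: (zclosed_sum unit_log_closed) => b wb.
by apply: (zclosedZ unit_log_closed); apply: word_unit_log.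
Qed.

Lemma lz_mod_span t : t != 0 -> exists m : 'I_r -> nat,
  lz t - \sum_j lz (base_pt [set j]%SET) *+ m j \in word_span.
Proof.
move=> t0; have [S1|] := ltnP 1 #|supp t|.
  exists (fun=> 0%N); rewrite big1 ?subr0 //.
  exact: (span_supp word_span_closed lz_even lz_dist word_in_span S1).
rewrite leq_eqVlt ltnS leqn0 => /orP[/cards1P[j sj]|].
  have [m hm] := span_supp1 word_span_closed lz_even lz_dist word_in_span sj.
  exists (fun i => if i == j then m else 0%N); rewrite (bigD1 j) //= eqxx big1 ?addr0 //.
  by move=> i /negPf ->.
rewrite cards_eq0 => /eqP s0; case/eqP: t0; apply: idem_inj => i; rewrite mul0r.
have : i \notin supp t by rewrite s0 finset.in_set0.
by rewrite finset.inE negbK => /eqP.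
Qed.

(** p_j is the product of the 1 - zeta_(p_j)^k, each a power of the base value modulo words. If D
    were 0, ln p_j would be the logarithm of a unit. *)
Lemma ln_prime_mod_span j : exists2 D : nat, (0 < D)%N &
  ln (p j)%:R - lz (base_pt [set j]%SET) *+ D \in word_span.
Proof.
have pn : (p j %| n)%N := dvdn_trans (p_dvd j) (q_dvd j).
have m0 : (0 < n %/ p j)%N by rewrite divn_gt0 ?prime_gt0 // dvdn_leq // ltnW.
have nE : (n %/ p j = (q j %/ p j) * (n %/ q j))%N.
  have E : (n = (q j %/ p j) * (n %/ q j) * p j)%N by rewrite mulnAC divnK ?p_dvd // mulnC nqK.
  by rewrite {1}E mulnK ?prime_gt0.
have sE k : (0 < k < p j)%N -> supp (k * (n %/ p j))%:R = [set j]%SET.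
  move=> /andP[k0 kp]; apply/setP => i; rewrite !inE idem_eq0.
  have [->|ij] := eqVneq i j.
    rewrite nE mulnA Gauss_dvdl ?q_coprime_nq //; apply/negP => h.
    have q0 : (0 < q j %/ p j)%N by rewrite divn_gt0 ?prime_gt0 // dvdn_leq ?p_dvd // ltnW // q_gt1.
    have : (p j * (q j %/ p j) %| k * (q j %/ p j))%N by rewrite mulnC divnK // p_dvd.
    by rewrite dvdn_pmul2r // => /dvdn_leq => /(_ k0); rewrite leqNgt kp.
  apply/negbTE; rewrite negbK; apply: dvdn_mull.
  by rewrite nE; apply: dvdn_mull; apply: q_dvd_nq.
have /choice[m hm] k : exists m : nat, (0 < k < p j)%N ->
    lz (k * (n %/ p j))%:R - lz (base_pt [set j]%SET) *+ m \in word_span.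
  have [kp|kp] := boolP (0 < k < p j)%N; last by exists 0%N.
  have [m hm] := span_supp1 word_span_closed lz_even lz_dist word_in_span (sE k kp).
  by exists m.
have h : ln (p j)%:R - lz (base_pt [set j]%SET) *+ (\sum_(1 <= k < p j) m k)%N \in word_span.
  rewrite -lz_prime -sumrMnr -sumrB big_seq; apply: (zclosed_sum word_span_closed) => k.
  by rewrite mem_index_iota => /hm.
exists (\sum_(1 <= k < p j) m k)%N => //; rewrite lt0n; apply/eqP => D0.
move: h; rewrite D0 mulr0n subr0 => /word_span_unit h.
have := ln_primes_unit (m := fun i => (i == j)%:R) _ j; rewrite eqxx; apply/not_implyP; split=> //.
rewrite (bigD1 j) //= eqxx mulr1z big1 ?addr0 // => i /negPf ->; exact: mulr0z.
Qed.

(* The coefficients of the logarithms of the 1 - zeta_(q_j) vanish: a multiple of their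
   combination is a combination of logarithms of the p_j. *)
Lemma unit_in_word_span (k : S -> int) : let v := \sum_(a | a != 0) lz a *~ k a in
  v \in unit_log -> v \in word_span.
Proof.
set v := \sum_(a | _) _ => /= vU.
have /choice[m hm] a : exists m : 'I_r -> nat, a != 0 ->
    lz a - \sum_j lz (base_pt [set j]%SET) *+ m j \in word_span.
  by have [a0|a0] := boolP (a != 0); [have [m] := lz_mod_span a0; exists m|exists (fun=> 0%N)].
pose M j : int := \sum_(a | a != 0) (m a j)%:Z * k a.
pose be' j := lz (base_pt [set j]%SET).
have vM : v - \sum_j be' j *~ M j \in word_span.
  have -> : \sum_j be' j *~ M j = \sum_(a | a != 0) (\sum_j be' j *+ m a j) *~ k a.
    under eq_bigr do rewrite mulrz_sumr; rewrite exchange_big /=; apply: eq_bigr => a _.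
    by rewrite mulrz_suml; apply: eq_bigr => j _; rewrite mulrzA.
  rewrite -sumrB; apply: (zclosed_sum word_span_closed) => a a0.
  by rewrite -mulrzBl; apply: (zclosedZ word_span_closed); apply: hm.
have /choice[D hD] j : exists D : nat, (0 < D)%N /\ ln (p j)%:R - be' j *+ D \in word_span.
  by have [D D0 h] := ln_prime_mod_span j; exists D.
suff M0 j : M j = 0.
  by move: vM; rewrite big1 ?subr0 // => j _; rewrite M0 mulr0z.
(* Multiplication by [C j] gives all the D i the common multiple [P], so that P times the
   combination of base values becomes one of the ln p_i. *)
pose C j : int := (\prod_(i | i != j) D i)%N.
suff : M j * C j = 0.
  move/eqP; rewrite mulf_eq0 => /orP[/eqP //|].
  rewrite eqz_nat; apply: contraTeq => _; rewrite -lt0n prodn_cond_gt0 // => i _; exact: (hD i).1.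
apply: (ln_primes_unit (m := fun j => M j * C j)).
pose P : int := (\prod_i D i)%N.
have PE i : P = (D i)%:Z * C i by rewrite /P (bigD1 i) //= PoszM.
have -> : \sum_i ln (p i)%:R *~ (M i * C i) =
    v *~ P - (v - \sum_i be' i *~ M i) *~ P + \sum_i (ln (p i)%:R - be' i *+ D i) *~ (M i * C i).
  have -> : v *~ P - (v - \sum_i be' i *~ M i) *~ P = (\sum_i be' i *~ M i) *~ P.
    by rewrite -mulrzBl opprB addrC subrK.
  rewrite mulrz_suml -big_split /=; apply: eq_bigr => i _.
  by rewrite mulrzBl (PE i) -mulrzA -[_ *+ D i]/(_ *~ (D i)%:Z) -mulrzA mulrCA addrC subrK.
apply: (zclosedD unit_log_closed); last first.
  apply: word_span_unit; apply: (zclosed_sum word_span_closed) => i _.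
  by apply: (zclosedZ word_span_closed); exact: (hD i).2.
apply: (zclosedB unit_log_closed); first exact: zclosedZ unit_log_closed _ _ vU.
by apply: word_span_unit; apply: (zclosedZ word_span_closed).
Qed.

Lemma lz_dist_unit (u : S) d t : coprime (val u) n -> (d %| n)%N -> t * d%:R != 0 ->
  \sum_(k < d) lz (u * (t + (k * (n %/ d))%:R)) = lz (u * (t * d%:R)).
Proof.
move=> co dn td; have d0 := dvdn_gt0 n0 dn; set m := (n %/ d)%N.
have uu : u \is a GRing.unit by rewrite -[u]valZ unitZpE // coprime_sym.
have nE : (n = d * m)%N by rewrite mulnC divnK.
pose F k := lz (u * t + (k * m)%:R).
have Fmod a : F (a %% d)%N = F a.
  rewrite /F; congr (lz (_ + _)); apply/eqP.
  by rewrite eqZ muln_modl nE modn_mod.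
have cod : coprime (val u) d := coprime_dvdr dn co.
have := sum_residues_mul d0 cod Fmod; rewrite !big_mkord /F.
have td' : u * t * d%:R != 0 by rewrite -mulrA unit_neq0.
rewrite lz_dist // mulrA => <-; apply: eq_bigr => k _.
by rewrite mulrDr -{2}[u]valZ -natrM mulnA.
Qed.

(** * Combinations of unit translates of the logarithm *)

Section Kernel.
Variable c : S -> R.
Hypothesis c_unit : forall u, ~~ coprime (val u) n -> c u = 0.
Hypothesis c_sum : \sum_u c u = 0.

Definition log_comb t : R := \sum_u c u * lz (u * t).

Lemma log_comb_even t : log_comb (- t) = log_comb t.
Proof. by apply: eq_bigr => u _; rewrite mulrN lz_even. Qed.

Lemma log_comb_dist d t : (d %| n)%N -> t * d%:R != 0 ->
  \sum_(k < d) log_comb (t + (k * (n %/ d))%:R) = log_comb (t * d%:R).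
Proof.
move=> dn td; rewrite exchange_big /=; apply: eq_bigr => u _; rewrite -mulr_sumr.
have [co|/c_unit ->] := boolP (coprime (val u) n); last by rewrite !mul0r.
by rewrite lz_dist_unit.
Qed.

Hypothesis c_words : forall b, is_word b -> ell log_comb b = 0.

Let Z : {pred R} := pred1 0.

Let ZZ : GRing.zmod_closed Z.
Proof. by split=> [|x y]; rewrite ?inE // => /eqP -> /eqP ->; rewrite subrr. Qed.

Let Zw b : is_word b -> ell log_comb b \in Z.
Proof. by move=> wb; rewrite inE c_words. Qed.

(** The vanishing on the words makes [log_comb] constant on Gset j. Units permute Gset j, so the
    total over it is the sum of the c u times the total of [lz], hence 0; this is the purpose of
    [c_sum]. *)
Lemma log_comb_single j x : x \in Gset j -> log_comb x = 0.
Proof.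
move=> xG; have const y : y \in Gset j -> log_comb y = log_comb x.
  move=> yG; apply/eqP; rewrite -subr_eq0.
  exact: (span_single ZZ log_comb_even Zw yG xG).
have tot : \sum_(y in Gset j) log_comb y = 0.
  rewrite exchange_big /= (eq_bigr (fun u => c u * \sum_(y in Gset j) lz y)).
    by rewrite -mulr_suml c_sum mul0r.
  move=> u _; rewrite -mulr_sumr; have [co|/c_unit ->] := boolP (coprime (val u) n); last by rewrite !mul0r.
  have uu : u \is a GRing.unit by rewrite -[u]valZ unitZpE // coprime_sym.
  congr (_ * _); rewrite [RHS](reindex_inj (mulrI uu)) /=; apply: eq_bigl => y.
  apply/idP/idP; first by apply: Gset_unit; exists u^-1; rewrite divrr.
  move=> h; rewrite -[y](mulKr uu); apply: Gset_unit => //; exists u; exact: mulVr.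
have := tot; rewrite (eq_bigr (fun=> log_comb x)) => [|y yG]; last exact: const.
rewrite sumr_const => /eqP; rewrite mulrn_eq0 cards_eq0 => /orP[/eqP G0|/eqP //].
by move: xG; rewrite G0 finset.in_set0.
Qed.

Lemma log_comb0 t : t != 0 -> log_comb t = 0.
Proof.
move=> t0; have [S1|] := ltnP 1 #|supp t|.
  by apply/eqP; apply: (span_supp ZZ log_comb_even log_comb_dist Zw S1).
rewrite leq_eqVlt ltnS leqn0 => /orP[/cards1P[j sj]|].
  have [m] := span_supp1 ZZ log_comb_even log_comb_dist Zw sj.
  rewrite (@log_comb_single j (base_pt _)) ?mul0rn ?subr0; first by move/eqP.
  by apply: full_single; apply: base_full.
rewrite cards_eq0 => /eqP s0; case/eqP: t0; apply: idem_inj => i; rewrite mul0r.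
have : i \notin supp t by rewrite s0 finset.in_set0.
by rewrite finset.inE negbK => /eqP.
Qed.

Lemma sumS (F : nat -> R) : \sum_(0 <= a < n) F a = \sum_(u : S) F (val u).
Proof.
rewrite big_mkord; transitivity (\sum_(u < (Zp_trunc n).+2) F u); last by [].
by rewrite Zp_cast.
Qed.

Lemma log_comb_trivial u : c u + c (- u) = 0.
Proof.
pose c' (a : nat) := c a%:R.
have c'v (x : S) : c' (val x) = c x by rewrite /c' valZ.
have h1 a : c' (a %% n)%N = c' a by congr c; apply/eqP; rewrite eqZ modn_mod.
have h2 a : ~~ coprime a n -> c' a = 0.
  move=> co; apply: c_unit; rewrite /= val_Zp_nat // coprime_modl //.
have h3 : \sum_(0 <= a < n) c' a = 0 by rewrite sumS -[RHS]c_sum; apply: eq_bigr => x _; rewrite c'v.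
have h4 t : ~~ (n %| t)%N -> \sum_(0 <= a < n) c' a * lg R n (a * t) = 0.
  rewrite -eqZ0 => h; rewrite -[RHS](log_comb0 h) sumS; apply: eq_bigr => x _; rewrite c'v; congr (_ * _).
  rewrite /lz /om /zt -{2}[x]valZ -natrM /= val_Zp_nat // /lg; congr (ln (modc (1 - _))).
  by rewrite zeta_mod.
have := log_relations_even n1 h1 h2 h3 h4 (val u); rewrite c'v.
have -> // : c' (n.-1 * val u)%N = c (- u).
congr c; apply/eqP; rewrite -addr_eq0 -[X in _ + X]valZ -natrD eqZ0.
by rewrite -mulSnr prednK // dvdn_mulr.
Qed.

End Kernel.

Variable j0 : 'I_r.

Lemma ell_sum (I : Type) (l : seq I) (P : pred I) (w : I -> R) (G : I -> S -> R) b :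
  ell (fun t => \sum_(i <- l | P i) w i * G i t) b = \sum_(i <- l | P i) w i * ell (G i) b.
Proof.
rewrite /ell; case: ifP => // _; rewrite -sumrB; apply: eq_bigr => i _.
by rewrite mulrBr.
Qed.

Lemma words_independent (k : {ffun 'I_r -> S} -> int) :
  (forall u : S, coprime (val u) n -> \sum_(b | is_word b) ell (fun t => lz (u * t)) b *~ k b = 0) ->
  forall b, is_word b -> k b = 0.
Proof.
move=> rel; pose W := [set b | is_word b]%SET; pose C := half_units :\ (1 : S).
pose M : 'M[R]_(#|W|, #|C|) :=
  \matrix_(i, j) (ell (fun t => lz (enum_val j * t)) (enum_val i) - ell lz (enum_val i)).
have inW (i : 'I_#|W|) : is_word (enum_val i) by have := enum_valP i; rewrite inE.
have inC u : (u \in C) = [&& u != 1, coprime (val u) n & u \in half_system] by rewrite !inE.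
have v1 : val (1 : S) = 1%N by have := val_Zp_nat n1 1; rewrite modn_small.
have kerM (v : 'rV[R]_#|C|) : v *m M^T = 0 -> v = 0.
  move=> vM; pose cC (u : S) := \sum_(j < #|C|) (enum_val j == u)%:R * v 0 j.
  have cCE j : cC (enum_val j) = v 0 j.
    rewrite /cC (bigD1 j) //= eqxx mul1r big1 ?addr0 // => i ij.
    by rewrite (inj_eq enum_val_inj) (negPf ij) mul0r.
  have cC0 u : u \notin C -> cC u = 0.
    move=> uC; rewrite /cC big1 // => j _; case: eqP => [E|_]; last by rewrite mul0r.
    by move: uC; rewrite -E enum_valP.
  (* The weight at 1 makes the total 0 and turns the pairing with F into the differences F u - F 1,
     which are the entries of M. *)
  pose c u := cC u - (u == 1)%:R * \sum_w cC w.
  have sumC (F : S -> R) : \sum_u cC u * F u = \sum_(j < #|C|) v 0 j * F (enum_val j).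
    under eq_bigr do rewrite mulr_suml; rewrite exchange_big /=; apply: eq_bigr => j _.
    rewrite (bigD1 (enum_val j)) //= eqxx mul1r big1 ?addr0 // => u.
    by rewrite eq_sym => /negPf ->; rewrite !mul0r.
  have sumc (F : S -> R) : \sum_u c u * F u = \sum_(j < #|C|) v 0 j * (F (enum_val j) - F 1).
    have -> : \sum_u c u * F u = \sum_u cC u * F u - (\sum_w cC w) * F 1.
      rewrite [X in _ - X](_ : _ = \sum_u (u == 1)%:R * (\sum_w cC w) * F u).
        by rewrite -sumrB; apply: eq_bigr => u _; rewrite mulrBl.
      rewrite [RHS](bigD1 1) //= ?eqxx mul1r [X in _ + X]big1 ?addr0 // => u /negPf ->.
      by rewrite !mul0r.
    have -> : \sum_w cC w = \sum_(j < #|C|) v 0 j.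
      have := sumC (fun=> 1); under eq_bigr do rewrite mulr1; move=> ->.
      by apply: eq_bigr => j _; rewrite mulr1.
    by rewrite sumC mulr_suml -sumrB; apply: eq_bigr => j _; rewrite mulrBr.
  have c_unit u : ~~ coprime (val u) n -> c u = 0.
    move=> co; rewrite /c cC0 ?inC ?(negPf co) ?andbF // sub0r.
    case: eqP co => [->|]; last by rewrite mul0r oppr0.
    by rewrite v1 coprime1n.
  have c_sum : \sum_u c u = 0.
    have := sumc (fun=> 1); under eq_bigr do rewrite mulr1; move=> ->.
    by rewrite big1 // => j _; rewrite subrr mulr0.
  have c_words b : is_word b -> ell (log_comb c) b = 0.
    move=> wb; rewrite /log_comb ell_sum sumc.
    have bW : b \in W by rewrite inE.
    have := congr1 (fun A : 'rV_#|W| => A 0 (enum_rank_in bW b)) vM.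
    rewrite !mxE => E; rewrite -[RHS]E; apply: eq_bigr => j _; rewrite !mxE enum_rankK_in //.
    congr (_ * (_ - _)); rewrite /ell; case: ifP => _; by rewrite !mul1r.
  apply/rowP => j; rewrite mxE -cCE.
  have uC := enum_valP j; set u := enum_val j in uC *.
  have := uC; rewrite inC => /and3P[u1 uco uH].
  have u0 : u != 0 by apply: contraTneq uH => ->; apply: half0.
  have nH : - u \notin half_system by have := halfN u0; rewrite uH.
  (* Evenness gives c u = - c (- u), and - u lies outside the half system, where c is 0. *)
  have := log_comb_trivial c_unit c_sum c_words u; rewrite /c (negPf u1) mul0r subr0.
  rewrite (cC0 (- u)); last by rewrite inC (negPf nH) !andbF.
  case: eqP => [E|_]; last by rewrite mul0r subrr addr0.
  by move: nH; rewrite E one_half.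
have rC : \rank M = #|C|.
  by rewrite -mxrank_tr; apply/eqP; apply: inj_row_free.
have fM : row_free M.
  by rewrite /row_free eqn_leq rank_leq_row rC card_words_le.
pose kv : 'rV[R]_#|W| := \row_i (k (enum_val i))%:~R.
have kM : kv *m M = 0.
  apply/rowP => j; rewrite !mxE.
  have uC := enum_valP j; have := uC; rewrite inC => /and3P[_ co _].
  have sumW (F : {ffun 'I_r -> S} -> R) :
      \sum_(i < #|W|) (k (enum_val i))%:~R * F (enum_val i) = \sum_(b | is_word b) F b *~ k b.
    rewrite [RHS](eq_bigl (fun b => b \in W)) => [|b]; last by rewrite inE.
    rewrite [RHS]big_enum_val /=; apply: eq_bigr => i _.
    by rewrite mulrzl.
  transitivity (\sum_(i < #|W|) (k (enum_val i))%:~R * (ell (fun t => lz (enum_val j * t)) (enum_val i)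
      - ell lz (enum_val i))); first by apply: eq_bigr => i _; rewrite !mxE.
  rewrite (sumW (fun b => ell (fun t => lz (enum_val j * t)) b - ell lz b)).
  under eq_bigr do rewrite mulrzBl; rewrite sumrB rel // sub0r.
  have := rel 1; rewrite v1 coprime1n => /(_ isT) h.
  have -> : \sum_(b | is_word b) ell lz b *~ k b = 0; last by rewrite oppr0.
  by rewrite -[RHS]h; apply: eq_bigr => b _; congr (_ *~ _); rewrite /ell; case: ifP => _; rewrite !mul1r.
move/eqP: kM; rewrite mulmx_free_eq0 // => /eqP kv0 b wb.
have bW : b \in W by rewrite inE.
have := congr1 (fun A : 'rV_#|W| => A 0 (enum_rank_in bW b)) kv0.
by rewrite !mxE enum_rankK_in // => /eqP; rewrite intr_eq0 => /eqP.
Qed.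

(** The absolute values need not lie in the field, but their squares y t = om t * om (- t) do, and
    the automorphism of u maps y t to y (u t). The exponentiated relation is squared and conjugated;
    positivity then recovers the absolute values. *)
Lemma galois_lz (k : S -> int) (u : S) : coprime (val u) n ->
  \sum_a lz a *~ k a = 0 -> \sum_a lz (u * a) *~ k a = 0.
Proof.
move=> co rel; have [f fa fz] := gal_exists R n1 co.
have uu : u \is a GRing.unit by rewrite -[u]valZ unitZpE // coprime_sym.
have [[_ _ _] f1 fD fM] := fa.
have Kz t : cyclotomic_field R n (zt t) by apply: K_X; apply: K_zeta.
have Kom t : cyclotomic_field R n (om t) by apply: K_B; [exact: K_1|exact: Kz].
have fom t : f (om t) = om (u * t).
  rewrite /om (aut_one_sub fa (Kz t)) /zt (aut_pow _ fa (K_zeta n0)) fz -exprM.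
  by congr (1 - _); rewrite -ztE natrM !valZ.
pose y t := om t * om (- t).
have yE t : y t = ((modc (om t) ^+ 2)%:C)%C by rewrite -mulcJ omJ.
have Ky t : cyclotomic_field R n (y t) by apply: K_M; exact: Kom.
have fy t : f (y t) = y (u * t) by rewrite /y fM // !fom mulrN.
pose P g := \prod_(a : S | a != 0) modc (om (g a)) ^ k a.
have Ppos g : (forall a, a != 0 -> g a != 0) -> 0 < P g.
  by move=> g0; apply: prodr_gt0 => a /g0 ga; apply: exprz_gt0; apply: modc_om_gt0.
have lnP g : (forall a, (g a == 0) = (a == 0)) -> ln (P g) = \sum_a lz (g a) *~ k a.
  move=> g0; rewrite ln_prodr => [|a a0]; last by apply: exprz_gt0; rewrite modc_om_gt0 // g0.
  rewrite [RHS](bigD1 0) //= (eqP (_ : g 0 == 0)) ?g0 // lz0 mul0rz add0r.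
  by apply: eq_bigr => a a0; rewrite ln_exprz // modc_om_gt0 // g0.
have yP g : (forall a, (g a == 0) = (a == 0)) ->
    \prod_(a : S | a != 0) y (g a) ^ k a = ((P g ^+ 2)%:C)%C.
  move=> g0; rewrite -prodrXl rmorph_prod; apply: eq_bigr => a a0.
  rewrite yE -fmorphXz; congr (_%:C)%C; rewrite !exprnP !exprz_exp mulrC //.
have u0 a : (u * a == 0) = (a == 0).
  by apply/eqP/eqP => [h|->]; [rewrite -[a](mulKr uu) h mulr0|rewrite mulr0].
have fV x : cyclotomic_field R n x -> f x^-1 = (f x)^-1.
  move=> Kx; have [->|x0] := eqVneq x 0.
    have := fD 0 0 (@K_0 R n) (@K_0 R n); rewrite addr0 => /eqP.
    by rewrite -subr_eq0 opprD addrA subrr sub0r oppr_eq0 invr0 => /eqP ->; rewrite invr0.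
  have fx : f x^-1 * f x = 1 by rewrite -fM ?mulVf //; apply: K_V.
  have fx0 : f x != 0 by apply: contra_eq_neq fx => ->; rewrite mulr0 eq_sym oner_neq0.
  by apply: (mulIf fx0); rewrite fx mulVf.
have fXz x (m : int) : cyclotomic_field R n x -> f (x ^ m) = f x ^ m.
  move=> Kx; case: m => m; first by rewrite -!exprnP (aut_pow _ fa Kx).
  by rewrite NegzE -!exprnN fV ?(aut_pow _ fa Kx) //; apply: K_X.
have fprod : f (\prod_(a : S | a != 0) y a ^ k a) = \prod_(a : S | a != 0) y (u * a) ^ k a.
  suff [] : cyclotomic_field R n (\prod_(a : S | a != 0) y a ^ k a) /\
    f (\prod_(a : S | a != 0) y a ^ k a) = \prod_(a : S | a != 0) y (u * a) ^ k a by [].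
  elim/big_rec2: _ => [|a x x' a0 [Kx fx]]; first by split; [exact: K_1|].
  have Kya : cyclotomic_field R n (y a ^ k a) by apply: K_Xz.
  by split; [exact: K_M|rewrite fM // fXz // fx fy].
have P1 : P id = 1.
  apply: ln_inj; rewrite ?posrE ?ltr01 ?Ppos // lnP // ln1; exact: rel.
move: fprod; rewrite (yP id) // P1 expr1n rmorph1 f1 (yP (fun a => u * a)) // => /esym.
move/(congr1 (@complex.Re R)) => /= /eqP; rewrite sqrf_eq1 => /orP[/eqP Pu|/eqP Pu]; last first.
  have := Ppos (fun a => u * a); rewrite Pu ltr0N1 => h.
  by have : false by apply: h => a; rewrite u0.
by rewrite -(lnP (fun a => u * a)) // Pu ln1.
Qed.

(** The coefficients K do not depend on [g], so a relation for [lz] and its conjugates by units have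
    the same coefficients. *)
Lemma ell_combination (k : {ffun 'I_r -> S} -> int) : exists K : S -> int,
  forall g : S -> R, \sum_(b | is_word b) ell g b *~ k b = \sum_a g a *~ K a.
Proof.
pose e b a : int := (wpt b == a)%:R - ((#|wsupp b| == 1%N) && (wbase b == a))%:R.
exists (fun a => \sum_(b | is_word b) e b a * k b) => g.
under [RHS]eq_bigr do rewrite mulrz_sumr; rewrite exchange_big /=; apply: eq_bigr => b _.
under eq_bigr do rewrite mulrzA; rewrite -mulrz_suml; congr (_ *~ _).
have delta x : \sum_a g a *~ (x == a)%:R = g x.
  rewrite (bigD1 x) //= eqxx mulr1z big1 ?addr0 // => a; rewrite eq_sym => /negPf ->.
  exact: mulr0z.
under eq_bigr do rewrite mulrzBr; rewrite sumrB delta /ell; case: eqP => _ /=.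
  by rewrite delta.
by rewrite [X in _ - X]big1 ?subr0 // => a _; rewrite mulr0z.
Qed.

Lemma word_logs_independent (k : {ffun 'I_r -> S} -> int) :
  \sum_(b | is_word b) ell lz b *~ k b = 0 -> forall b, is_word b -> k b = 0.
Proof.
move=> rel; have [K KE] := ell_combination k; apply: words_independent => u co.
by rewrite KE galois_lz // -KE.
Qed.

Local Notation K := (cyclotomic_field R n).

(** * Words as Galois conjugates, and the basis of real units *)

Section GaloisWords.
Variable sigma : 'I_r -> R[i] -> R[i].
Hypothesis sigma_aut : forall j, is_field_aut K (sigma j).
Hypothesis sigma_zeta : forall j, sigma j z = z ^+ s j.

Lemma K_zt t : K (zt t). Proof. by apply: K_X; apply: K_zeta. Qed.

Lemma sigma_om j t : sigma j (om t) = om (t * sZ j).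
Proof.
rewrite /om (aut_one_sub (sigma_aut j) (K_zt t)) /zt (aut_pow _ (sigma_aut j) (K_zeta n0)).
by rewrite sigma_zeta -exprM mulnC -ztE natrM valZ.
Qed.

Lemma iter_sigma_om j a t : iter a (sigma j) (om t) = om (t * sZ j ^+ a).
Proof.
elim: a => [|a IH]; first by rewrite mulr1.
by rewrite iterS IH sigma_om exprSr mulrA.
Qed.

Lemma zt_base Om : zt (base_pt Om) = zeta R (n_of q Om).
Proof.
have nE : n = (n_of q Om * \prod_(j | j \notin Om) q j)%N by rewrite hn (bigID (mem Om)).
have m0 : (0 < n_of q Om)%N by rewrite lt0n; apply: contraTneq n1 => h; rewrite nE h.
rewrite /base_pt ztE -(zeta_dvd R n0 (m := n_of q Om)); last by rewrite [X in (_ %| X)%N]nE dvdn_mulr.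
by congr (_ ^+ _); rewrite [in RHS]nE mulKn.
Qed.

Lemma gal_word_om (Om : {set 'I_r}) (a : {ffun 'I_#|Om| -> nat}) (a' : 'I_r -> nat) :
  (forall i, a' (enum_val i) = a i) ->
  gal_word sigma a (1 - zeta R (n_of q Om)) = om (gk_word sZ base_pt Om a').
Proof.
move=> aE; rewrite -zt_base -/(om _) /gal_word /gk_word big_enum_val /=.
rewrite (eq_bigr (fun i => sZ (enum_val i) ^+ a i)) => [|i _]; last by rewrite aE.
elim: (index_enum _) (base_pt Om) => [|i l IH] t; first by rewrite !big_nil mulr1.
by rewrite !big_cons /= IH iter_sigma_om -mulrA [_ * sZ _ ^+ _]mulrC.
Qed.

(** [X_Omega] compares positions in the enumeration of Omega, the words compare the indices
    themselves. *)
Lemma enum_val_lt (Om : {set 'I_r}) (i i' : 'I_#|Om|) :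
  (enum_val i < enum_val i')%N = (i < i')%N.
Proof.
have srt : sorted ltn (map val (enum Om)).
  have sub : subseq (map val (enum Om)) (map val (enum 'I_r)).
    by apply: map_subseq; rewrite [enum 'I_r]enumT /enum_mem; apply: filter_subseq.
  apply: (subseq_sorted ltn_trans sub); rewrite val_enum_ord; exact: iota_ltn_sorted.
have nthE (k : 'I_#|Om|) : val (enum_val k) = nth 0%N (map val (enum Om)) k.
  by rewrite (nth_map (enum_val k)) -?cardE // -enum_val_nth.
have szE : size (map val (enum Om)) = #|Om| by rewrite size_map -cardE.
have mono (k l : 'I_#|Om|) : (k < l)%N -> (enum_val k < enum_val l)%N.
  move=> kl; rewrite -[X in (X < _)%N]/(val _) -[X in (_ < X)%N]/(val _) !nthE.
  by apply: (sorted_ltn_nth ltn_trans 0%N srt); rewrite ?inE ?szE.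
apply/idP/idP => [h|]; last exact: mono.
rewrite ltnNge; apply/negP; rewrite leq_eqVlt => /orP[/eqP/val_inj E|/mono].
  by move: h; rewrite E ltnn.
by rewrite ltnNge (ltnW h).
Qed.

Definition word_index b : basis_index R r :=
  if [pick j | wsupp b == [set j]%SET] is Some j then inl (j, wexp b j)
  else inr (wsupp b, om (wpt b)).

Lemma word_index1 b j : wsupp b = [set j]%SET -> word_index b = inl (j, wexp b j).
Proof.
move=> sb; rewrite /word_index; case: pickP => [k /eqP|/(_ j)]; last by rewrite sb eqxx.
by rewrite sb => /finset.set1_inj ->.
Qed.

Lemma word_index2 b : #|wsupp b| != 1%N -> word_index b = inr (wsupp b, om (wpt b)).
Proof.
move=> s1; rewrite /word_index; case: pickP => [k /eqP sb|//].
by move: s1; rewrite sb cards1.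
Qed.

Lemma basis_dom_word i : basis_dom R r q sigma i -> exists2 b, is_word b & i = word_index b.
Proof.
case: i => i; case: i => j a.
  rewrite /basis_dom /= => /andP[a0 ah].
  have [|b [wb sb ab]] := @word_pivot [set j]%SET j (fun=> a) (finset.set11 j).
    by move=> i; rewrite inE => /eqP ->; rewrite ltnn; split=> // _; rewrite a0.
  by exists b => //; rewrite (word_index1 sb) ab ?finset.set11.
rewrite /basis_dom /=; move: j a => Om x; case=> O2; case=> k; case=> a; case=> kO ok Xa ->.
have [j1 j1O] : exists j, j \in Om by apply/card_gt0P; apply: ltnW.
pose a' j := if j \in Om then a (enum_rank_in j1O j) else 0%N.
have aE i : a' (enum_val i) = a i by rewrite /a' enum_valP enum_valK_in.
have rk j : j \in Om -> exists i : 'I_#|Om|, j = enum_val i.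
  by move=> jO; exists (enum_rank_in j1O j); rewrite enum_rankK_in.
have conc b : is_word b -> wsupp b = Om -> (forall j, j \in Om -> wexp b j = a' j) ->
    exists2 b, is_word b & inr (Om, gal_word sigma a (1 - zeta R (n_of q Om))) = word_index b.
  move=> wb sb ab; exists b => //; rewrite word_index2 sb ?gtn_eqF // (gal_word_om aE).
  congr (inr (_, om _)); rewrite /wpt sb /gk_word; congr (_ * _).
  by apply: eq_bigr => j jO; rewrite ab.
case: k kO ok Xa => [|k] kO ok Xa.
  have [b [wb sb ab]] : exists b, [/\ is_word b, wsupp b = Om & forall j, wexp b j = 0%N].
    apply: word_even; first by apply/set0Pn; exists j1.
    by apply/negP => /ok.
  apply: (conc b wb sb) => j /rk[i ->]; rewrite ab aE.
  by have [_ _ ->] := Xa i.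
have [|b [wb sb ab]] := @word_pivot Om (enum_val (Ordinal kO)) a' (enum_valP _).
  move=> j /rk[i ->]; rewrite !enum_val_lt aE /=; have [X1 X2 X3] := Xa i.
  by split=> [ik|/enum_val_inj E|ki]; [apply: X1|apply: X2; rewrite E|apply: X3].
exact: (conc b wb sb ab).
Qed.

Lemma word_card b : is_word b -> (0 < #|wsupp b|)%N.
Proof. by case/and3P=> _ _; rewrite card_gt0. Qed.

Lemma word_basis_dom b : is_word b -> basis_dom R r q sigma (word_index b).
Proof.
move=> wb; have [/eqP/cards1P[j sb]|s1] := eqVneq #|wsupp b| 1%N.
  rewrite (word_index1 sb) /=; case: (word_cases wb) => [[i iS h]|[]]; last by rewrite sb cards1.
  have ij : j = i by move: iS; rewrite sb inE => /eqP.
  by have [|_ h2 _] := h j; [rewrite sb finset.set11|exact: h2].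
have s2 : (2 <= #|wsupp b|)%N by rewrite ltn_neqAle eq_sym s1 word_card.
rewrite (word_index2 s1) /=; split=> //.
pose a : {ffun 'I_#|wsupp b| -> nat} := [ffun i => wexp b (enum_val i)].
have xE : om (wpt b) = gal_word sigma a (1 - zeta R (n_of q (wsupp b))).
  by rewrite (gal_word_om (a' := wexp b)) // => i; rewrite ffunE.
case: (word_cases wb) => [[i iS h]|[eO h]].
  pose i0 := enum_rank_in iS i; have iE : i = enum_val i0 by rewrite enum_rankK_in.
  exists i0.+1, a; split; [exact: (ltn_ord i0)|by []| |exact: xE].
  move=> l; have [h1 h2 h3] := h (enum_val l) (enum_valP l); rewrite ffunE.
  rewrite iE !enum_val_lt in h1 h2 h3; split=> [|[E]|//]; first exact: h1.
  by apply: h2; congr enum_val; apply/val_inj.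
exists 0%N, a; split=> //; first by rewrite (negPf eO).
by move=> l; split=> // _; rewrite ffunE h.
Qed.

Variables (c : 'I_r -> nat -> int).
Hypothesis hc : forall j a, iter a (sigma j) (zeta R (q j)) = zeta R (q j) ^ c j a.

Definition basis_elt (i : basis_index R r) : R[i] :=
  match i with
  | inl (j, a) => `|xi R (q j) (c j a)|
  | inr (Omega, x) => `|sigma j0 (1 - zeta R n)| * `|x|
  end.

Definition multi b : bool := #|wsupp b| != 1%N.
Definition word_abs b : R :=
  if multi b then modc (om (sZ j0)) * modc (om (wpt b))
  else modc (om (wpt b)) / modc (om (wbase b)).

Lemma om_one : 1 - z = om 1.
Proof. by rewrite /om /zt val_one expr1. Qed.

Lemma iter_sub j a x : K x -> iter a (sigma j) (1 - x) = 1 - iter a (sigma j) x /\ K (iter a (sigma j) x).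
Proof.
move=> Kx; elim: a => [|a [IH KI]] //=; rewrite IH (aut_one_sub (sigma_aut j) KI).
by split=> //; have [[fK _ _] _ _ _] := sigma_aut j; apply: fK.
Qed.

Lemma xi_single b j : wsupp b = [set j]%SET ->
  `|xi R (q j) (c j (wexp b j))| = ((modc (om (wpt b)) / modc (om (wbase b)))%:C)%C.
Proof.
move=> sb; rewrite modcE /xi modcM modcXz -[zeta R (q j)]expr1 modc_zetaX exp1rz mul1r expr1.
rewrite -[zeta R (q j)](_ : zt (wbase b) = _); last first.
  by rewrite /wbase sb zt_base /n_of big_set1.
have ztq : zt (wbase b) = zeta R (q j) by rewrite /wbase sb zt_base /n_of big_set1.
have -> : 1 - zt (wbase b) ^ c j (wexp b j) = om (wpt b).
  rewrite ztq -hc -ztq -(iter_sub j (wexp b j) (K_zt (wbase b))).1 iter_sigma_om.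
  by congr om; rewrite /wpt /wbase /gk_word sb big_set1.
by rewrite -/(om (wbase b)) modcM modcV.
Qed.

Lemma basis_elt_word b : basis_elt (word_index b) = ((word_abs b)%:C)%C.
Proof.
rewrite /word_abs /multi; case: (eqVneq #|wsupp b| 1%N) => [/eqP/cards1P[j sb]|s1] /=.
  by rewrite (word_index1 sb) /= xi_single.
by rewrite (word_index2 s1) /= om_one sigma_om mul1r !modcE -rmorphM.
Qed.

Lemma real_complexE (x : R[i]) : (x^*)%C = x -> x = ((complex.Re x)%:C)%C.
Proof.
case: x => a b /eqP; rewrite eq_complex /= => /andP[_ /eqP h].
by apply/eqP; rewrite eq_complex /= eqxx; apply/eqP; lra.
Qed.

Lemma modc_real_sign (x : R[i]) : (x^*)%C = x ->
  ((modc x)%:C)%C = x \/ ((modc x)%:C)%C = - x.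
Proof.
move=> xr; rewrite {1 3}(real_complexE xr) modc_real.
have [h|h] := lerP 0 (complex.Re x); first by left; rewrite ger0_norm // -(real_complexE xr).
right; rewrite ltr0_norm //; have -> : ((- complex.Re x)%:C)%C = - ((complex.Re x)%:C)%C :> R[i] by exact: rmorphN.
by rewrite -(real_complexE xr).
Qed.

Definition half : S := (n.+1)./2%:R.

Lemma halfE t : t * half + t * half = t.
Proof.
rewrite -mulrDr -natrD addnn.
have -> : ((n.+1)./2.*2 = n.+1)%N by rewrite -[RHS]odd_double_half /= hodd.
by rewrite -addn1 natrD; have /eqP -> : (n%:R : S) == 0; rewrite ?eqZ0 // add0r mulr1.
Qed.

(* zeta^(t/2) - zeta^(-t/2) is purely imaginary and differs from 1 - zeta^t by a root of unity. *)
Definition imag t : R[i] := zt (t * half) - zt (- (t * half)).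

Lemma om_imag t : om t = - zt (t * half) * imag t.
Proof.
rewrite /om -{1}(halfE t) ztD /imag ztN mulrBr !mulNr mulfV ?zt_neq0 //.
by rewrite opprK addrC.
Qed.

Lemma imag_om t : imag t = - zt (- (t * half)) * om t.
Proof. by rewrite om_imag ztN mulrA mulrNN mulVf ?mul1r // zt_neq0. Qed.

Lemma K_imag t : K (imag t). Proof. by apply: K_B; apply: K_zt. Qed.

Lemma iC2 : 'i%C * 'i%C = -1 :> R[i].
Proof. by apply/eqP; rewrite eq_complex /=; apply/andP; split; apply/eqP; ring. Qed.

Lemma abs_om t : exists2 e : R[i], e = 1 \/ e = -1 & ((modc (om t))%:C)%C = e * ('i%C * imag t).
Proof.
have mE : modc (om t) = modc ('i%C * imag t).
  rewrite om_imag !modcM modcN modc_zetaX mul1r.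
  have -> : modc ('i%C : R[i]) = 1; last by rewrite mul1r.
  by rewrite /modc normc_def /= expr0n /= add0r expr1n sqrtr1.
have rl : (('i%C * imag t)^*)%C = 'i%C * imag t.
  have iJ : (('i%C : R[i])^*)%C = - 'i%C by apply/eqP; rewrite eq_complex /= oppr0 !eqxx.
  have vJ : ((imag t)^*)%C = - imag t by rewrite /imag rmorphB /= !ztJ opprK opprB.
  have mJ (x y : R[i]) : ((x * y)^*)%C = (x^*)%C * (y^*)%C := rmorphM (@conjc R) x y.
  by rewrite mJ iJ vJ mulrNN.
rewrite mE; case: (modc_real_sign rl) => ->; [exists 1|exists (-1)]; rewrite ?mul1r ?mulN1r //.
  by left.
by right.
Qed.

Local Notation circ := (circular_numbers R n).

Lemma circ_div x y : circ x -> circ y -> circ (x / y).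
Proof. by move=> hx hy H HH Hg; case: (HH) => _ Hd; apply: Hd; [exact: hx|exact: hy]. Qed.
Lemma circ1 : circ 1. Proof. by move=> H [H1 _]. Qed.
Lemma circV x : circ x -> circ x^-1.
Proof. by move=> h; rewrite -div1r; apply: circ_div => //; exact: circ1. Qed.
Lemma circM x y : circ x -> circ y -> circ (x * y).
Proof. by move=> hx hy; rewrite -[y]invrK; apply: circ_div => //; apply: circV. Qed.
Lemma circ_root x m : K x -> (0 < m)%N -> x ^+ m = 1 -> circ x.
Proof. by move=> Kx m0 xm H _ Hg; apply: Hg; left; split=> //; exists m. Qed.
Lemma circN x : circ x -> circ (- x).
Proof.
move=> h; rewrite -mulN1r; apply: circM => //; apply: (@circ_root _ 2) => //; last by rewrite sqrrN expr1n.
by apply: K_N; exact: K_1.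
Qed.
Lemma circ_zt t : circ (zt t).
Proof. by apply: (circ_root (K_zt t) n0); rewrite zt_pow. Qed.

Lemma coprime_s j : coprime (s j) n.
Proof.
rewrite -(nqK j) coprimeMr s_co andbT -coprime_modl s_one coprime_modl; exact: coprime1n.
Qed.

Lemma gk_word_nat (Om : {set 'I_r}) a : exists2 u, coprime u n & gk_word sZ base_pt Om a = base_pt Om * u%:R.
Proof.
exists (\prod_(i in Om) s i ^ a i)%N.
  elim/big_ind: _ => [|x y hx hy|i _]; rewrite ?coprime1n ?coprimeMl ?hx //.
  by rewrite coprimeXl // coprime_s.
by rewrite natr_prod; congr (_ * _); apply: eq_bigr => i _; rewrite natrX.
Qed.

Lemma n_of_gt1 (Om : {set 'I_r}) : Om != finset.set0 -> (1 < n_of q Om)%N.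
Proof.
case/set0Pn=> j jO; rewrite /n_of (bigD1 j) //=; apply: leq_trans (q_gt1 j) _.
by rewrite leq_pmulr // prodn_cond_gt0 // => i _; rewrite ltnW // q_gt1.
Qed.

Lemma circ_word (Om : {set 'I_r}) a : Om != finset.set0 -> circ (om (gk_word sZ base_pt Om a)).
Proof.
move=> O0; have [u co ->] := gk_word_nat Om a; have [f fa fz] := gal_exists R n1 co.
have -> : om (base_pt Om * u%:R) = f (1 - zeta R (n_of q Om)).
  rewrite -zt_base (aut_one_sub fa (K_zt _)) /zt (aut_pow _ fa (K_zeta n0)) fz -exprM mulnC.
  by rewrite -ztE natrM valZ.
move=> H _ Hg; apply: Hg; right; exists (n_of q Om), f; split=> //; last exact: n_of_gt1.
by rewrite hn [X in (_ %| X)%N](bigID (mem Om)) dvdn_mulr.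
Qed.

Definition word_num b : R[i] :=
  if multi b then om (sZ j0) * om (wpt b) else om (wpt b) / om (wbase b).

Lemma word_absE b : word_abs b = modc (word_num b).
Proof. by rewrite /word_abs /word_num; case: ifP => _; rewrite modcM ?modcV. Qed.

Lemma sZ_idem_neq0 j i : sZ j * idem i != 0.
Proof.
rewrite idem_eq0; apply/negP => h; have := coprime_dvdl h (coprime_dvdr (q_dvd i) (coprime_s j)).
by rewrite /coprime gcdnn => /eqP h1; have := q_gt1 i; rewrite h1.
Qed.

Lemma supp_sZ j : supp (sZ j) = [set: 'I_r]%SET.
Proof. by apply/setP => i; rewrite finset.in_setT finset.inE sZ_idem_neq0. Qed.

Lemma wbase_neq0 b : is_word b -> wbase b != 0.
Proof.
case/and3P=> _ _ /set0Pn[j jb]; apply/eqP => w0; have := base_full (wsupp b) j.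
by rewrite jb -/(wbase b) w0 mul0r (negPf (Gset0 j)).
Qed.

Lemma sZ_neq0 j : sZ j != 0.
Proof. by apply: contra_neq (sZ_idem_neq0 j j) => ->; rewrite mul0r. Qed.

Lemma word_num_unit b : is_word b ->
  [/\ word_num b != 0, integral (word_num b) & integral (word_num b)^-1].
Proof.
move=> wb; rewrite /word_num /multi; have [/eqP/cards1P[j sb]|s1] /= := eqVneq #|wsupp b| 1%N.
  have bG : wbase b \in Gset j by apply: full_single; rewrite /wbase sb; apply: base_full.
  have [i1 i2] := om_single_unit (coprime_s_pow j (wexp b j)) bG.
  rewrite (wpt_single sb); split=> //.
  by rewrite -(wpt_single sb) mulf_neq0 ?invr_neq0 ?om_eq0 ?wpt_neq0 ?wbase_neq0.
have s2 : (1 < #|wsupp b|)%N by rewrite ltn_neqAle eq_sym s1 word_card.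
split; first by rewrite mulf_neq0 // om_eq0 ?sZ_neq0 ?wpt_neq0.
  by apply: integral_mul; apply: integral_om.
rewrite invfM; apply: integral_mul; apply: om_unit; last by rewrite (full_supp (wpt_full b)).
by rewrite supp_sZ (leq_trans s2) // subset_leq_card //; apply/fintype.subsetP => i; rewrite finset.in_setT.
Qed.

Lemma integral_modc v : integral v -> integral ((modc v)%:C)%C.
Proof.
move=> iv; apply: (@integral_root_monic _ _ _ _ ('X^2 - ((modc v ^+ 2)%:C)%C%:P)).
- by rewrite monicXnsubC.
- by rewrite /root !hornerE -rmorphXn subrr.
apply/integral_poly => i; rewrite coefB coefXn coefC.
apply: integral_sub; first exact: integral_nat.
case: ifP => _; last exact: (integral_nat (intr : {rmorphism int -> R[i]}) 0).
by rewrite -mulcJ; apply: integral_mul => //; apply: integralJ.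
Qed.

Lemma K_sign (e : R[i]) : e = 1 \/ e = -1 -> K e.
Proof. by case=> ->; [exact: K_1|apply: K_N; exact: K_1]. Qed.
Lemma circ_sign (e : R[i]) : e = 1 \/ e = -1 -> circ e.
Proof. by case=> ->; [exact: circ1|apply: circN; exact: circ1]. Qed.

Lemma circ_imag_word (Om : {set 'I_r}) a : Om != finset.set0 -> circ (imag (gk_word sZ base_pt Om a)).
Proof.
move=> O0; rewrite imag_om mulNr; apply: circN; apply: circM; first exact: circ_zt.
exact: circ_word.
Qed.

Lemma base_word Om : base_pt Om = gk_word sZ base_pt Om (fun=> 0%N).
Proof. by rewrite /gk_word big1 ?mulr1. Qed.

Lemma base_setT : base_pt [set: 'I_r]%SET = 1.
Proof. by rewrite /base_pt big1 // => i; rewrite finset.in_setT. Qed.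

Lemma sZ_word j : sZ j = gk_word sZ base_pt [set: 'I_r]%SET (fun i => nat_of_bool (i == j)).
Proof.
rewrite /gk_word base_setT mul1r (bigD1 j) ?finset.in_setT //= eqxx expr1 big1 ?mulr1 // => i /andP[_ /negPf ->].
by rewrite expr0.
Qed.

Lemma word_Was b : is_word b -> Was_plus K (basis_elt (word_index b)).
Proof.
move=> wb; rewrite basis_elt_word; have [w0 iw iwV] := word_num_unit wb.
have S0 : wsupp b != finset.set0 by case/and3P: wb.
have T0 : [set: 'I_r]%SET != finset.set0 by apply/set0Pn; exists j0; rewrite finset.in_setT.
have KC : K ((word_abs b)%:C)%C /\ circ ((word_abs b)%:C)%C.
  rewrite /word_abs; case: ifP => mb.
    rewrite rmorphM /=; have [e eE ->] := abs_om (sZ j0); have [e' eE' ->] := abs_om (wpt b).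
    (* The two factors i multiply to -1; in the single-prime case below they cancel in the quotient.
       Either way the absolute value lies in K. *)
    have -> : e * ('i%C * imag (sZ j0)) * (e' * ('i%C * imag (wpt b))) =
      'i%C * 'i%C * (e * imag (sZ j0) * (e' * imag (wpt b))) by ring.
    rewrite iC2 mulN1r; split.
      by apply: K_N; apply: K_M; apply: K_M; [exact: K_sign|exact: K_imag|exact: K_sign|exact: K_imag].
    apply: circN; apply: circM; apply: circM; [exact: circ_sign| |exact: circ_sign|].
      by rewrite sZ_word; apply: circ_imag_word.
    exact: circ_imag_word.
  rewrite rmorphM fmorphV /=; have [e eE ->] := abs_om (wpt b); have [e' eE' ->] := abs_om (wbase b).
  have i0 : 'i%C != 0 :> R[i].
    by apply/eqP => h; have := iC2; rewrite h mul0r => /eqP; rewrite eq_sym oppr_eq0 oner_eq0.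
  have -> : e * ('i%C * imag (wpt b)) / (e' * ('i%C * imag (wbase b))) =
      e * imag (wpt b) / (e' * imag (wbase b)).
    by rewrite mulrCA [e' * _]mulrCA -mulf_div divff // mul1r.
  split.
    by apply: K_div; apply: K_M; [exact: K_sign|exact: K_imag|exact: K_sign|exact: K_imag].
  apply: circ_div; apply: circM; [exact: circ_sign| |exact: circ_sign|].
    exact: circ_imag_word.
  by rewrite /wbase base_word; apply: circ_imag_word.
case: KC => Kx cx; split; last by apply/eqP; rewrite eq_complex /= oppr0 !eqxx.
split; last by exists n => //; apply/cyclotomic_conductor.
rewrite /unit_group /= word_absE; split.
- by rewrite -word_absE.
- by rewrite fmorph_eq0 gt_eqF // modc_gt0.
- exact: integral_modc.
by rewrite -fmorphV -modcV; apply: integral_modc.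
Qed.

Lemma word_abs_gt0 b : is_word b -> 0 < word_abs b.
Proof. by move=> wb; rewrite word_absE modc_gt0; case: (word_num_unit wb). Qed.

Definition beta : R := lz (sZ j0).

Lemma ln_word_abs b : is_word b -> ln (word_abs b) = ell lz b + (if multi b then beta else 0).
Proof.
move=> wb; have w0 := modc_om_gt0 (wpt_neq0 wb).
rewrite /word_abs /ell /multi; case: (eqVneq #|wsupp b| 1%N) => _ /=.
  have b0 := modc_om_gt0 (wbase_neq0 wb).
  by rewrite [RHS]addr0 lnM ?posrE ?invr_gt0 // lnV ?posrE.
have b0 := modc_om_gt0 (sZ_neq0 j0).
by rewrite lnM ?posrE // [LHS]addrC.
Qed.

Hypothesis j0_first : forall j : 'I_r, (j0 <= j)%N.
Hypothesis q0_neq3 : (1 < r)%N -> q j0 <> 3%N.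

(** sigma_1(1 - zeta_n) has exponents 1, 0, ..., 0 and full support, so its pivot 1 at the first
    index must lie below phi(q_1)/2. Among odd prime powers only 3 has totient 2. With a single
    prime there is no word with several primes to consider. *)
Lemma beta_word : exists w0, forall b, is_word b -> multi b ->
  [/\ is_word w0, multi w0 & ell lz w0 = beta].
Proof.
have [r1|r1] := ltnP 1 r; last first.
  exists [ffun=> 0] => b wb; rewrite /multi => /negP[]; rewrite eqn_leq word_card // andbT.
  by apply: leq_trans (max_card _) _; rewrite card_ord.
have h1 : (1 < hphi j0)%N.
  have q3 := q0_neq3 r1; have q5 : (3 < q j0)%N.
    by move: (q_gt2 j0) q3; case: (q j0) => [|[|[|[|]]]].
  rewrite ltnNge; apply/negP => h; have t2 : totient (q j0) = 2%N.
    rewrite -hphi_double; have := hphi_gt0 j0; move: h; case: (hphi j0) => [|[|]] //.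
  have p3 : (2 < p j0)%N.
    by move: (prime_gt1 (hp j0)) (dvdn_odd (p_dvd j0) (q_odd j0)); case: (p j0) => [|[|[|]]].
  move: t2; rewrite hq totient_pfactor //.
  case E : (ex j0) (he j0) => [//|[|e]] _ /= t2; last first.
    have : (3 <= p j0 ^ e.+1)%N by rewrite expnS; apply: leq_trans p3 _; rewrite leq_pmulr // expn_gt0 prime_gt0.
    move: t2 p3; clear; move: (p j0) (p j0 ^ e.+1)%N => x y; nia.
  apply: q3; rewrite hq E expn1; move: t2 p3; rewrite expn0 muln1; clear; lia.
have [|w0 [ww sw aw]] := @word_pivot [set: 'I_r]%SET j0 (fun i => nat_of_bool (i == j0)) (finset.in_setT _).
  move=> j _; split=> [|->|jj]; first by rewrite ltnNge j0_first.
    by rewrite eqxx.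
  by rewrite -val_eqE /= gtn_eqF.
exists w0 => b _ _; have mw : multi w0 by rewrite /multi sw cardsT card_ord neq_ltn r1 orbT.
split=> //; rewrite /ell (negPf mw) /beta; congr lz.
rewrite sZ_word /wpt sw /gk_word; congr (_ * _); apply: eq_bigr => i iT; rewrite aw //.
Qed.

Lemma prodz (I : Type) (l : seq I) (P : pred I) (F : I -> int) (x : R[i]) : x != 0 ->
  \prod_(i <- l | P i) x ^ F i = x ^ (\sum_(i <- l | P i) F i).
Proof.
move=> x0; elim/big_rec2: _ => [|i y v Pi ->]; first by rewrite expr0z.
by rewrite expfzDr.
Qed.

Lemma circ_modc x : circ x -> exists k : S -> int, modc x = \prod_(a | a != 0) modc (om a) ^ k a.
Proof.
pose H : {pred R[i]} := fun x => `[< exists k : S -> int, modc x = \prod_(a | a != 0) modc (om a) ^ k a >].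
have HP y : reflect (exists k : S -> int, modc y = \prod_(a | a != 0) modc (om a) ^ k a) (y \in H).
  exact: asboolP.
have H1 y : modc y = 1 -> y \in H by move=> h; apply/HP; exists (fun=> 0); rewrite h big1.
move=> cx; apply/HP; apply: cx.
  split=> [|a b /HP[k hk] /HP[l hl]]; first by apply: H1; rewrite modc1.
  apply/HP; exists (fun a => k a - l a); rewrite modcM modcV hk hl -prodfV -big_split /=.
  apply: eq_bigr => t t0; rewrite expfzDr; last by rewrite gt_eqF // modc_om_gt0.
  by rewrite -invr_expz.
move=> y [[_ [k k0 yk]]|[d [f [dn d1 fa ->]]]].
  apply: H1; have : modc y ^+ k = 1 by rewrite -modcX yk modc1.
  by move/eqP; rewrite pexprn_eq1 ?modc_ge0 // => /orP[/eqP k00|/eqP //]; rewrite k00 in k0.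
have [u co fz] := field_aut_zeta n0 fa.
have -> : f (1 - zeta R d) = om (u * (n %/ d))%:R.
  rewrite -(zeta_dvd R n0 dn) (aut_one_sub fa); last by apply: K_X; apply: K_zeta.
  by rewrite (aut_pow _ fa (K_zeta n0)) fz -exprM -ztE.
have a0 : (u * (n %/ d))%:R != 0 :> S.
  rewrite eqZ0 Gauss_dvdr; last by rewrite coprime_sym.
  apply/negP => /dvdn_leq; rewrite divn_gt0 ?(ltnW d1) // dvdn_leq // => /(_ isT).
  by rewrite leqNgt ltn_Pdiv.
apply/HP; exists (fun a => (a == (u * (n %/ d))%:R)%:R); rewrite (bigD1 ((u * (n %/ d))%:R : S)) //= eqxx expr1z.
by rewrite big1 ?mulr1 // => t /andP[_ /negPf ->].
Qed.

(** [word_abs b] without the factor |sigma_1(1 - zeta_n)|; its logarithm is [ell lz b]. *)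
Definition core b : R := if multi b then modc (om (wpt b)) else modc (om (wpt b)) / modc (om (wbase b)).

Lemma core_gt0 b : is_word b -> 0 < core b.
Proof.
move=> wb; have h1 := modc_om_gt0 (wpt_neq0 wb); have h2 := modc_om_gt0 (wbase_neq0 wb).
by rewrite /core; case: ifP => _ //; rewrite divr_gt0.
Qed.

Lemma ln_core b : is_word b -> ln (core b) = ell lz b.
Proof.
move=> wb; have h1 := modc_om_gt0 (wpt_neq0 wb); have h2 := modc_om_gt0 (wbase_neq0 wb).
rewrite /core /ell /multi; case: eqP => _ //=.
by rewrite lnM ?posrE ?invr_gt0 // lnV ?posrE.
Qed.

Lemma i_neq0 : 'i%C != 0 :> R[i].
Proof. by apply/eqP => h; have := iC2; rewrite h mul0r => /eqP; rewrite eq_sym oppr_eq0 oner_eq0. Qed.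

Lemma K_core b : K ((if multi b then 'i%C else 1) * ((core b)%:C)%C).
Proof.
rewrite /core; case: ifP => mb.
  have [e eE ->] := abs_om (wpt b).
  have -> : 'i%C * (e * ('i%C * imag (wpt b))) = 'i%C * 'i%C * (e * imag (wpt b)) by ring.
  by rewrite iC2 mulN1r; apply: K_N; apply: K_M; [exact: K_sign|exact: K_imag].
rewrite mul1r rmorphM fmorphV /=; have [e eE ->] := abs_om (wpt b); have [e' eE' ->] := abs_om (wbase b).
have -> : e * ('i%C * imag (wpt b)) / (e' * ('i%C * imag (wbase b))) =
    e * imag (wpt b) / (e' * imag (wbase b)).
  by rewrite mulrCA [e' * _]mulrCA -mulf_div divff ?i_neq0 // mul1r.
by apply: K_div; apply: K_M; [exact: K_sign|exact: K_imag|exact: K_sign|exact: K_imag].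
Qed.

(** Multiplying each core of a word with several primes by i brings it into K, as |x| already is; so
    i^D lies in K, where D is the sum of the exponents of those words, and an odd D would bring i
    itself into K. *)
Lemma core_parity (k : {ffun 'I_r -> S} -> int) (x : R[i]) : K x -> x != 0 -> (x^*)%C = x ->
  modc x = \prod_(b | is_word b) core b ^ k b ->
  exists m : int, \sum_(b | is_word b && multi b) k b = m + m.
Proof.
move=> Kx x0 xr mx; set D := \sum_(b | _) _.
pose th b : R[i] := if multi b then 'i%C else 1.
have KP : K (\prod_(b | is_word b) (th b * ((core b)%:C)%C) ^ k b).
  by apply: K_prod => b _; apply: K_Xz; apply: K_core.
have KD : K ('i%C ^ D).
  move: KP; under eq_bigr do rewrite expfzMl; rewrite big_split /=.
  have -> : \prod_(b | is_word b) ((core b)%:C)%C ^ k b = ((modc x)%:C)%C.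
    by rewrite mx rmorph_prod; apply: eq_bigr => b _; rewrite fmorphXz.
  have -> : \prod_(b | is_word b) th b ^ k b = 'i%C ^ D.
    rewrite -prodz ?i_neq0 // [RHS]big_mkcondr; apply: eq_bigr => b _.
    by rewrite /th; case: ifP => _ //; rewrite exp1rz.
  have Kmx : K ((modc x)%:C)%C by case: (modc_real_sign xr) => -> //; apply: K_N.
  have mx0 : ((modc x)%:C)%C != 0 :> R[i] by rewrite fmorph_eq0 gt_eqF // modc_gt0.
  by move=> h; have := K_div h Kmx; rewrite mulfK.
have DE := divz_eq D 2; have D0 := modz_ge0 D (d := 2) isT; have D1 := ltz_pmod D (d := 2) isT.
move: DE D0 D1; move: (D %/ 2)%Z (D %% 2)%Z => d rm DE D0 D1; exists d.
have [rm0|rm1] : rm = 0 \/ rm = 1 by lia.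
  by lia.
exfalso; apply: (imaginary_notin (R := R) hodd); move: KD.
have -> : D = d + d + 1 by lia.
rewrite !expfzDr ?i_neq0 // -expfzMl iC2 expr1z.
move=> h; have KN1 : K (-1) by apply: K_N; exact: K_1.
have := K_div h (K_Xz d KN1).
by rewrite mulrC mulrA mulVf ?mul1r // expfz_neq0 // oppr_eq0 oner_eq0.
Qed.

(** The family is indexed by pairs (Omega, x) and not by exponents; collecting the exponents over
    each fibre of [word_index] makes the list of indices duplicate-free. *)
Lemma word_index_inj_aux (k : {ffun 'I_r -> S} -> int) :
  let s0 := undup [seq word_index b | b <- enum [pred b | is_word b]] in
  \prod_(i <- s0) basis_elt i ^ (\sum_(b | is_word b && (word_index b == i)) k b) =
  \prod_(b | is_word b) basis_elt (word_index b) ^ k b.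
Proof.
move=> s0; have us : uniq s0 := undup_uniq _.
have ms b : is_word b -> word_index b \in s0.
  by move=> wb; rewrite mem_undup; apply/mapP; exists b => //; rewrite mem_enum.
have ne b : is_word b -> basis_elt (word_index b) != 0.
  by move=> wb; rewrite basis_elt_word fmorph_eq0 gt_eqF // word_abs_gt0.
transitivity (\prod_(i <- s0) \prod_(b | is_word b && (word_index b == i)) basis_elt (word_index b) ^ k b).
  rewrite big_seq [RHS]big_seq; apply: eq_bigr => i; rewrite mem_undup => /mapP[b0].
  rewrite mem_enum => wb0 iE; rewrite -prodz; last by rewrite iE ne.
  by apply: eq_bigr => b /andP[_ /eqP ->].
rewrite (exchange_big_dep is_word) /= => [|i b _ /andP[] //]; apply: eq_bigr => b wb.
rewrite (eq_bigl (pred1 (word_index b))) => [|i]; last by rewrite wb /= eq_sym.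
by rewrite -big_filter filter_pred1_uniq ?ms // big_seq1.
Qed.

Lemma Was_generated w : Was_plus K w -> exists (k : {ffun 'I_r -> S} -> int) (e : R[i]),
  (e = 1 \/ e = -1) /\ w = e * \prod_(b | is_word b) basis_elt (word_index b) ^ k b.
Proof.
case=> [[[Kw w0 iw iwV] [m mK cw]] wr].
have mn := (@cyclotomic_conductor R n m hodd).1 mK; rewrite {}mn in cw.
have [l hl] := circ_modc cw.
have lw : ln (modc w) = \sum_(a | a != 0) lz a *~ l a.
  rewrite hl ln_prodr => [|a a0]; last by rewrite exprz_gt0 // modc_om_gt0.
  by apply: eq_bigr => a a0; rewrite ln_exprz // modc_om_gt0.
have : ln (modc w) \in word_span.
  by rewrite lw; apply: unit_in_word_span; rewrite -lw; apply/unit_logP; exists w.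
case/word_spanP=> k hk; have mw0 : 0 < modc w by rewrite modc_gt0.
have lnprod (F : {ffun 'I_r -> S} -> R) (k' : {ffun 'I_r -> S} -> int) :
    (forall b, is_word b -> 0 < F b) -> 0 < \prod_(b | is_word b) F b ^ k' b /\
    ln (\prod_(b | is_word b) F b ^ k' b) = \sum_(b | is_word b) ln (F b) *~ k' b.
  move=> F0; split; first by apply: prodr_gt0 => b wb; rewrite exprz_gt0 ?F0.
  rewrite ln_prodr => [|b wb]; last by rewrite exprz_gt0 ?F0.
  by apply: eq_bigr => b wb; rewrite ln_exprz ?F0.
have mc : modc w = \prod_(b | is_word b) core b ^ k b.
  have [h1 h2] := lnprod core k core_gt0.
  apply: ln_inj; rewrite ?posrE // h2 hk; apply: eq_bigr => b wb; by rewrite ln_core.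
have [d dE] := core_parity Kw w0 wr mc.
have [w1 hw1] := beta_word.
(* Using [word_abs] instead of [core] adds 2 d times [beta] to the logarithm. The element of [w1]
   has logarithm 2 beta, so lowering its exponent by d compensates. *)
pose k' b := k b - (if b == w1 then d else 0).
have key : \sum_(b | is_word b) ln (word_abs b) *~ k' b = ln (modc w).
  have -> : \sum_(b | is_word b) ln (word_abs b) *~ k' b =
    \sum_(b | is_word b) ell lz b *~ k b + beta *~ (d + d) -
    \sum_(b | is_word b) ln (word_abs b) *~ (if b == w1 then d else 0).
    have -> : beta *~ (d + d) = \sum_(b | is_word b) (if multi b then beta *~ k b else 0).
      by rewrite -dE mulrz_sumr big_mkcondr.
    rewrite -big_split -sumrB /=; apply: eq_bigr => b wb.
    rewrite /k' mulrzBr; congr (_ - _); rewrite ln_word_abs // mulrzDl; congr (_ + _).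
    by case: ifP => _ //; rewrite mul0rz.
  rewrite -hk; have [/existsP[b1 /andP[wb1 mb1]]|no] := boolP [exists b, is_word b && multi b].
    have [ww mw lw1] := hw1 b1 wb1 mb1.
    rewrite [X in _ - X](bigD1 w1) //= eqxx [X in _ - (_ + X)]big1 => [|b /andP[_ /negPf ->]]; last exact: mulr0z.
    by rewrite ln_word_abs // mw lw1 mulrzDl mulrzDr addr0 addrK.
  have d0 : d = 0.
    move: dE; rewrite big1 => [|b h]; last by move: no; rewrite negb_exists => /forallP/(_ b); rewrite h.
    by move=> h; apply/eqP; move/esym/eqP: h; rewrite -mulr2n mulrn_eq0.
  have -> : beta *~ (d + d) = 0 by rewrite d0.
  by rewrite addr0 [X in _ - X]big1 ?subr0 // => b _; rewrite d0 if_same.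
have mw : modc w = \prod_(b | is_word b) word_abs b ^ k' b.
  have [h1 h2] := lnprod word_abs k' word_abs_gt0.
  by apply: ln_inj; rewrite ?posrE // h2 key.
have PE : \prod_(b | is_word b) basis_elt (word_index b) ^ k' b = ((modc w)%:C)%C.
  by rewrite mw rmorph_prod; apply: eq_bigr => b _; rewrite basis_elt_word fmorphXz.
exists k'; rewrite PE; case: (modc_real_sign wr) => ->; [exists 1|exists (-1)].
  by rewrite mul1r; split=> //; left.
by rewrite mulrNN mul1r; split=> //; right.
Qed.

Lemma Was_independent (s0 : seq (basis_index R r)) (k : basis_index R r -> int) :
  uniq s0 -> (forall i, i \in s0 -> basis_dom R r q sigma i) ->
  modc (\prod_(i <- s0) basis_elt i ^ k i) = 1 -> forall i, i \in s0 -> k i = 0.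
Proof.
move=> us sD m1.
have /choice[bw hbw] i : exists b, i \in s0 -> is_word b /\ i = word_index b.
  have [/sD/basis_dom_word[b wb ->]|is0] := boolP (i \in s0); first by exists b.
  by exists [ffun=> 0].
pose kk b : int := \sum_(i <- s0) (bw i == b)%:R * k i.
have conv (F : {ffun 'I_r -> S} -> R) :
    \sum_(b | is_word b) F b *~ kk b = \sum_(i <- s0) F (bw i) *~ k i.
  under eq_bigr do rewrite mulrz_sumr; rewrite exchange_big /= big_seq [RHS]big_seq.
  apply: eq_bigr => i /hbw[wb _]; rewrite (bigD1 (bw i)) //= eqxx mul1r big1 ?addr0 // => b.
  by case/andP=> _; rewrite eq_sym => /negPf ->; rewrite mul0r mulr0z.
have rel : \sum_(b | is_word b) ln (word_abs b) *~ kk b = 0.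
  have bE i : i \in s0 -> modc (basis_elt i ^ k i) = word_abs (bw i) ^ k i.
    move=> /hbw[wb iE]; have -> : basis_elt i = ((word_abs (bw i))%:C)%C by rewrite {1}iE basis_elt_word.
    by rewrite modcXz modc_real gtr0_norm // word_abs_gt0.
  rewrite conv -[RHS](ln1 R) -m1 modc_prod big_seq [X in _ = ln X]big_seq ln_prodr => [|i is0].
    by apply: eq_bigr => i is0; have [wb _] := hbw i is0; rewrite bE // ln_exprz ?word_abs_gt0.
  by have [wb _] := hbw i is0; rewrite bE // exprz_gt0 // word_abs_gt0.
set D := \sum_(b | is_word b && multi b) kk b.
have relD : \sum_(b | is_word b) ell lz b *~ kk b + beta *~ D = 0.
  have -> : beta *~ D = \sum_(b | is_word b) (if multi b then beta *~ kk b else 0).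
    by rewrite /D mulrz_sumr big_mkcondr.
  rewrite -[RHS]rel -big_split /=; apply: eq_bigr => b wb.
  by rewrite ln_word_abs // mulrzDl; congr (_ + _); case: ifP => _ //; rewrite mul0rz.
have kk0 b : is_word b -> kk b = 0.
  have [w1 hw1] := beta_word.
  have [/existsP[b1 /andP[wb1 mb1]]|no] := boolP [exists b, is_word b && multi b]; last first.
    have D0 : D = 0.
      rewrite /D big1 // => b' h.
      by move: no; rewrite negb_exists => /forallP/(_ b'); rewrite h.
    by apply: word_logs_independent; rewrite -[RHS]relD D0 mulr0z addr0.
  have [ww mw lw1] := hw1 b1 wb1 mb1.
  (* Since [beta] is the logarithm of the word [w1], the relation has coefficient kk w1 + D at w1
     and kk b elsewhere. Thus kk vanishes off w1, which makes D equal to kk w1, and 2 kk w1 = 0. *)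
  have := @word_logs_independent (fun b => kk b + (if b == w1 then D else 0)).
  have -> : \sum_(b | is_word b) ell lz b *~ (kk b + (if b == w1 then D else 0)) = 0.
    rewrite -[RHS]relD; under eq_bigr do rewrite mulrzDr; rewrite big_split /=; congr (_ + _).
    rewrite (bigD1 w1) //= eqxx lw1 big1 ?addr0 // => b' /andP[_ /negPf ->]; exact: mulr0z.
  move=> /(_ erefl) h; have ne b' : is_word b' -> b' != w1 -> kk b' = 0.
    by move=> wb' b'w; have := h b' wb'; rewrite (negPf b'w) addr0.
  have DE : D = kk w1.
    rewrite /D (bigD1 w1) ?ww //= big1 ?addr0 // => b' /andP[/andP[wb' _] b'w]; exact: ne.
  have [-> _|b'w wb] := eqVneq b w1; last exact: ne.
  by have := h w1 ww; rewrite eqxx DE => /eqP; rewrite -mulr2n mulrn_eq0 => /eqP.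
move=> i iS; have [wb iE] := hbw i iS; have := kk0 _ wb.
rewrite /kk (bigD1_seq i) //= eqxx mul1r big_seq_cond big1 ?addr0 // => i' /andP[i's i'i].
case: eqP => [E|_]; last by rewrite mul0r.
by move: i'i; rewrite (hbw i' i's).2 E -iE eqxx.
Qed.

Lemma basis_of_Was : is_basis_mod (Was_plus K) [set 1; -1] (basis_dom R r q sigma) basis_elt.
Proof.
split.
- by move=> i /basis_dom_word[b wb ->]; apply: word_Was.
- move=> w /Was_generated[k [e [he1 ->]]].
  exists (undup [seq word_index b | b <- enum [pred b | is_word b]]).
  exists (fun i => \sum_(b | is_word b && (word_index b == i)) k b), e; split.
  + exact: undup_uniq.
  + move=> i; rewrite mem_undup => /mapP[b]; rewrite mem_enum => wb ->; exact: word_basis_dom.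
  + by [].
  by rewrite word_index_inj_aux.
move=> s0 k us sD zs; apply: Was_independent => //.
by case: zs => ->; rewrite ?modcN modc1.
Qed.

End GaloisWords.

End RealLogarithms.

End PrimePowerCoordinates.

Theorem theorem3p2 (R : realType) (n : nat) (hn3 : (3 <= n)%N) (hodd : odd n)
  (r : nat) (p e q : 'I_r.+1 -> nat)
  (hp : forall j, prime (p j)) (hpinj : injective p)
  (he : forall j, (0 < e j)%N) (hq : forall j, q j = (p j ^ e j)%N)
  (hn : n = (\prod_j q j)%N)
  (* If q_1 = 3 then sigma_1 is complex conjugation on Q(zeta_3) and
     |1 - zeta_n^sigma_1| |1 - zeta_n| is a norm: for n = 15 it lies in the
     group generated by -1 and the family (i), so the labelling of the primes
     has to start with some q_1 <> 3 as soon as there are two of them. *)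
  (hlab : (0 < r)%N -> q ord0 <> 3%N)
  (sigma : 'I_r.+1 -> R[i] -> R[i])
  (hsigma : forall j, is_field_aut (cyclotomic_field R n) (sigma j))
  (hgen : forall j, generates_gal (cyclotomic_field R (q j)) (sigma j))
  (htriv : forall j x, cyclotomic_field R (n %/ q j)%N x -> sigma j x = x)
  (c : 'I_r.+1 -> nat -> int)
  (hc : forall j a, iter a (sigma j) (zeta R (q j)) = zeta R (q j) ^ c j a) :
  is_basis_mod (Was_plus (cyclotomic_field R n)) [set 1; -1]
    (basis_dom R r.+1 q sigma)
    (fun i => match i with
              | inl (j, a) => `|xi R (q j) (c j a)|
              | inr (Omega, x) => `|sigma ord0 (1 - zeta R n)| * `|x|
              end).
Proof.
have n1 : (1 < n)%N := ltnW hn3; have n0 := ltnW n1; have pz := zeta_prim R n0.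
have qn j : (q j %| n)%N := q_dvd hn j.
have q0 j : (0 < q j)%N := dvdn_gt0 n0 (qn j).
have nq0 j : (0 < n %/ q j)%N by rewrite divn_gt0 // dvdn_leq.
have zq j : zeta R (q j) = zeta R n ^+ (n %/ q j) by rewrite (zeta_dvd R n0 (qn j)).
(* sigma_j raises zeta_n to the power [s j], which will be 1 modulo n / q_j and a primitive root
   modulo q_j. *)
have /choice[s hs] j : exists u, coprime u n /\ sigma j (zeta R n) = zeta R n ^+ u.
  by have [u] := field_aut_zeta n0 (hsigma j); exists u.
have sX j k : sigma j (zeta R n ^+ k) = zeta R n ^+ (k * s j).
  by rewrite (aut_pow _ (hsigma j) (K_zeta (R := R) n0)) (hs j).2 -exprM mulnC.
have s_one j : s j = 1 %[mod n %/ q j].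
  have := htriv j _ (K_zeta (R := R) (nq0 j)).
  rewrite -(zeta_dvd R n0 (dvdn_div (qn j))) sX => /eqP; rewrite (eq_prim_root_expr pz).
  have nnq : (n %/ (n %/ q j) = q j)%N by rewrite -{1}(divnK (qn j)) mulKn.
  rewrite nnq mulnC -{2}[q j]mul1n -(divnK (qn j)) -!muln_modl.
  by rewrite eqn_pmul2r // => /eqP; rewrite mulnK.
have s_co j : coprime (s j) (q j) := coprime_dvdr (qn j) (hs j).1.
(* Every residue t prime to q_j gives an automorphism of Q(zeta_(q_j)), which is a power of sigma_j
   by [hgen]; comparison at zeta_(q_j) gives the congruence. *)
have s_gen j t : coprime t (q j) -> exists k, t = s j ^ k %[mod q j].
  move=> co; have q1 : (1 < q j)%N := q_gt1 hp he hq j.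
  have [f af fz] := gal_exists R q1 co.
  have [k hk] := (hgen j).2 f af; exists k.
  have itz m : iter m (sigma j) (zeta R (q j)) = zeta R (q j) ^+ (s j ^ m).
    elim: m => [|m IH]; first by rewrite expn0 expr1.
    by rewrite iterS IH zq -!exprM sX expnSr mulnA.
  have := hk _ (K_zeta (R := R) (q0 j)); rewrite fz itz => /eqP.
  by rewrite (eq_prim_root_expr (zeta_prim R (q0 j))) => /eqP.
exact: (basis_of_Was hp hpinj he hq hn hodd n1 s_one s_co s_gen (j0 := ord0) hsigma
  (fun j => (hs j).2) hc (fun j => leq0n j) hlab).
Qed.
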